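(* There exists $\epsilon>0$ such that for every fixed $G\in(-\epsilon,\epsilon)$ there exists a continuous curve of solutions of the infinite-depth water wave problem $$\Delta\psi=-\Omega \ \text{ in } D,\qquad \psi=0\ \text{ on } S,\qquad \tfrac12|\nabla\psi|^2+Gy=B\ \text{ on } S,$$ $$\nabla\psi-(0,-\Omega y-1)\to(0,0)\quad\text{as } y\to-\infty,$$ which starts at a laminar flow and ends at a touching wave (with $G$ the same along the whole curve, while $\Omega$, $B$, $D$, $S$, $\psi$ vary along it).
   Context: Here $G,\Omega,B$ are real constants (dimensionless gravity, constant vorticity, Bernoulli constant). Solutions. Let $\mathbb S_\infty=\{\alpha+i\beta\in\mathbb C:\beta<0\}$ and identify $\mathbb R^2$ with $\mathbb C$. A solution consists of $\Omega,B\in\mathbb R$, a domain $D\subset\mathbb R^2$ which is $2\pi$-periodic in $x$, unbounded below and bounded above by a free surface $S$, and a stream function $\psi$ on $D\cup S$, such that the displayed equations hold. $D$ and $\psi$ are $2\pi$-periodic in $x$ and symmetric under reflection in the vertical lines beneath the crest and the trough. The domain is described by a conformal bijection $z=x+iy:\mathbb S_\infty\to D$ that extends in a $C^1$ fashion to $\{\beta=0\}$ with $z_\alpha\neq0$ there, such that $x-\alpha$ and $y$ are $2\pi$-periodic in $\alpha$, $x-\alpha$ and $y-\beta$ are bounded, and $S$ is the curve $\alpha\mapsto z(\alpha+i0)$. $S$ need not be a graph over the $x$-axis. The curve $\alpha\mapsto z(\alpha+i0)$ is injective, except for touching waves as defined below. Values of $\nabla\psi$ on $S$ are limits from inside $D$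 along the corresponding part of $S$. Laminar flow: a solution for which $S$ is a horizontal line and $\psi$ depends only on $y$. Touching wave: a solution whose profile touches itself tangentially: modulo the period, there is exactly one pair $\alpha_1<\alpha_2$ with $z(\alpha_1+i0)=z(\alpha_2+i0)$, the tangent lines of $S$ there coincide, and the closed loop $z([\alpha_1,\alpha_2])$ encloses a bounded region (a bubble of air) not belonging to $D$. Continuous curve of solutions: a family of solutions indexed by $t\in[0,1]$ such that $t\mapsto\Omega_t$ and $t\mapsto B_t$ are continuous and the boundary trace $\alpha\mapsto y_t(\alpha+i0)$ of the conformal map depends continuously on $t$ in the Hölder space $C^{3+\theta}(\mathbb R/2\pi\mathbb Z)$ for a fixed $\theta\in(0,1)$. *)

(* Defs.v *)
(* Stdlib reals with Coquelicot.  Coquelicot's complex type [C] is [R * R], so the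
   plane and the complex numbers are literally the same type: [fst p] and [snd p]
   are the coordinates x and y of a point [p], and the real and imaginary parts
   alpha and beta of a parameter. *)
From Stdlib Require Import Reals.
From Coquelicot Require Import Coquelicot.
Open Scope R_scope.

Definition frontier (A : C -> Prop) (p : C) : Prop :=
  forall eps : posreal,
    (exists q : C, ball p eps q /\ A q) /\ (exists q : C, ball p eps q /\ ~ A q).

Definition connected (A : C -> Prop) : Prop :=
  forall U V : C -> Prop,
    open U -> open V ->
    (forall p, A p -> U p \/ V p) ->
    (exists p, A p /\ U p) -> (exists p, A p /\ V p) ->
    exists p, A p /\ U p /\ V p.

Definition domain (A : C -> Prop) : Prop :=
  open A /\ connected A /\ exists p, A p.

Definition bounded (A : C -> Prop) : Prop :=
  exists M : R, forall p, A p -> Cmod p <= M.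

Definition dx (f : C -> R) (p : C) : R := Derive (fun x => f (x, snd p)) (fst p).
Definition dy (f : C -> R) (p : C) : R := Derive (fun y => f (fst p, y)) (snd p).
Definition grad (f : C -> R) (p : C) : C := (dx f p, dy f p).
Definition laplacian (f : C -> R) (p : C) : R := dx (dx f) p + dy (dy f) p.

Definition C1_on (A : C -> Prop) (f : C -> R) : Prop :=
  forall p : C, A p ->
    ex_derive (fun x => f (x, snd p)) (fst p) /\
    ex_derive (fun y => f (fst p, y)) (snd p) /\
    continuous (dx f) p /\ continuous (dy f) p.

Definition C2_on (A : C -> Prop) (f : C -> R) : Prop :=
  C1_on A f /\ C1_on A (dx f) /\ C1_on A (dy f).

(* [real] sends an infinite supremum to 0; the norms below are only meaningful
   for members of [holder_space], whose suprema are all finite. *)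
Definition sup_norm (f : R -> R) : R :=
  real (Lub_Rbar (fun r => exists x, r = Rabs (f x))).

Definition holder_quotient (theta : R) (f : R -> R) (r : R) : Prop :=
  exists x y, x <> y /\ r = Rabs (f x - f y) / Rpower (Rabs (x - y)) theta.

(* The space C^{k+theta}(R / 2 pi Z). For a 2 pi-periodic function the Hölder
   quotients over R and over R / 2 pi Z have the same supremum. *)
Definition holder_space (k : nat) (theta : R) (f : R -> R) : Prop :=
  (forall x, f (x + 2 * PI) = f x) /\
  (forall j x, (j <= k)%nat -> ex_derive_n f j x) /\
  (exists M, forall r, holder_quotient theta (Derive_n f k) r -> r <= M).

Definition holder_norm (k : nat) (theta : R) (f : R -> R) : R :=
  sum_n (fun j => sup_norm (Derive_n f j)) k
  + real (Lub_Rbar (holder_quotient theta (Derive_n f k))).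

(* The values of [psi] outside [fluid] together with [surface], and of [zmap]
   outside the closed lower half-plane, are irrelevant. *)
Record wave := Wave {
  vorticity : R;
  bernoulli : R;
  fluid : C -> Prop;
  psi : C -> R;
  zmap : C -> C
}.

Definition lower_half (zeta : C) : Prop := snd zeta < 0.
Definition closed_lower_half (zeta : C) : Prop := snd zeta <= 0.

Definition trace (w : wave) (a : R) : C := zmap w (a, 0).

Definition surface (w : wave) (p : C) : Prop := exists a : R, p = trace w a.

Definition fluid_or_surface (w : wave) (p : C) : Prop := fluid w p \/ surface w p.

(* [dz] is both the complex derivative z' = z_alpha inside the half-plane and its
   continuous extension, the tangent z_alpha of the trace, on the boundary. *)
Definition conformal_C1 (w : wave) : Prop :=
  (forall p, fluid w p <-> exists zeta, lower_half zeta /\ zmap w zeta = p) /\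
  (forall zeta1 zeta2, lower_half zeta1 -> lower_half zeta2 ->
     zmap w zeta1 = zmap w zeta2 -> zeta1 = zeta2) /\
  exists dz : C -> C,
    (forall zeta, lower_half zeta ->
       is_derive (K := C_AbsRing) (V := C_NormedModule) (zmap w) zeta (dz zeta)) /\
    (forall a, is_derive (K := R_AbsRing) (V := C_R_NormedModule)
                 (trace w) a (dz (a, 0))) /\
    continuous_on closed_lower_half (zmap w) /\
    continuous_on closed_lower_half dz /\
    (forall zeta, closed_lower_half zeta -> dz zeta <> (0, 0)).

Definition periodic_param (w : wave) : Prop :=
  (forall zeta, closed_lower_half zeta ->
     zmap w (fst zeta + 2 * PI, snd zeta)
     = (fst (zmap w zeta) + 2 * PI, snd (zmap w zeta))) /\
  (exists M, forall zeta, closed_lower_half zeta ->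
     Rabs (fst (zmap w zeta) - fst zeta) <= M /\
     Rabs (snd (zmap w zeta) - snd zeta) <= M).

Definition fluid_domain (w : wave) : Prop :=
  domain (fluid w) /\
  (forall p, fluid w (fst p + 2 * PI, snd p) <-> fluid w p) /\
  (forall M, exists p, fluid w p /\ snd p < M) /\
  (forall p, surface w p <-> (frontier (fluid w) p /\ ~ fluid w p)).

Definition crest (w : wave) (c : C) : Prop :=
  surface w c /\ forall p, surface w p -> snd p <= snd c.

Definition trough (w : wave) (c : C) : Prop :=
  surface w c /\ forall p, surface w p -> snd c <= snd p.

Definition reflect (c p : C) : C := (2 * fst c - fst p, snd p).

Definition symmetric_about (w : wave) (c : C) : Prop :=
  (forall p, fluid w (reflect c p) <-> fluid w p) /\
  (forall p, fluid_or_surface w p -> psi w (reflect c p) = psi w p).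

(* Crests and troughs exist, since the height of the surface is a continuous
   periodic function of alpha; every vertical line is one for a flat surface. *)
Definition symmetric_wave (w : wave) : Prop :=
  forall c, crest w c \/ trough w c -> symmetric_about w c.

(* The dynamic condition is stated at each parameter [a], with the gradient being
   a limit along the parametrisation: where the surface touches itself the two
   sides of the fluid have separate limits. *)
Definition water_wave_equations (G : R) (w : wave) : Prop :=
  C2_on (fluid w) (psi w) /\
  continuous_on (fluid_or_surface w) (psi w) /\
  (forall p, fluid_or_surface w p -> psi w (fst p + 2 * PI, snd p) = psi w p) /\
  (forall p, fluid w p -> laplacian (psi w) p = - vorticity w) /\
  (forall p, surface w p -> psi w p = 0) /\
  (forall a : R, exists g : C,
     filterlim (fun zeta : C => grad (psi w) (zmap w zeta))
       (within lower_half (locally ((a, 0) : C))) (locally g) /\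
     / 2 * (fst g ^ 2 + snd g ^ 2) + G * snd (trace w a) = bernoulli w) /\
  (forall eps : R, 0 < eps -> exists M : R, forall p, fluid w p -> snd p < M ->
     Cmod (Cminus (grad (psi w) p) (0, - vorticity w * snd p - 1)) < eps).

Definition tangent_line (w : wave) (a : R) (p : C) : Prop :=
  exists (v : C) (s : R),
    is_derive (K := R_AbsRing) (V := C_R_NormedModule) (trace w) a v /\
    p = (fst (trace w a) + s * fst v, snd (trace w a) + s * snd v).

(* A region is bounded by the loop exactly when it is its interior component;
   no part of the fluid may lie there. *)
Definition encloses_bubble (w : wave) (a1 a2 : R) : Prop :=
  exists U : C -> Prop,
    domain U /\ bounded U /\
    (forall p, (frontier U p /\ ~ U p) <-> exists a, a1 <= a <= a2 /\ p = trace w a) /\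
    (forall p, U p -> ~ fluid w p).

Definition touching (w : wave) : Prop :=
  exists a1 a2 : R,
    a1 < a2 /\ trace w a1 = trace w a2 /\
    (forall b1 b2, b1 < b2 -> trace w b1 = trace w b2 ->
       exists k : Z, b1 = a1 + 2 * PI * IZR k /\ b2 = a2 + 2 * PI * IZR k) /\
    (forall p, tangent_line w a1 p <-> tangent_line w a2 p) /\
    encloses_bubble w a1 a2.

Definition injective_trace (w : wave) : Prop :=
  forall a b, trace w a = trace w b -> a = b.

Definition is_solution (G : R) (w : wave) : Prop :=
  fluid_domain w /\ conformal_C1 w /\ periodic_param w /\
  (injective_trace w \/ touching w) /\
  symmetric_wave w /\ water_wave_equations G w.

Definition laminar (w : wave) : Prop :=
  (exists h : R, forall p, surface w p <-> snd p = h) /\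
  (exists f : R -> R, forall p, fluid_or_surface w p -> psi w p = f (snd p)).

Definition unit_interval (t : R) : Prop := 0 <= t <= 1.

Definition height (w : wave) (a : R) : R := snd (trace w a).

Definition continuous_curve_of_solutions (theta G : R) (w : R -> wave) : Prop :=
  (forall t, unit_interval t -> is_solution G (w t)) /\
  continuous_on unit_interval (fun t => vorticity (w t)) /\
  continuous_on unit_interval (fun t => bernoulli (w t)) /\
  (forall t, unit_interval t -> holder_space 3 theta (height (w t))) /\
  (forall t0, unit_interval t0 ->
     filterlim (fun t => holder_norm 3 theta (fun a => height (w t) a - height (w t0) a))
       (within unit_interval (locally t0)) (locally 0)).

(* Main.v *)
(* Fix the vorticity 1. For G = 0 there is an explicit family of waves: put C = 2a / (1 - a^2) and
   mu = (1 + a^2) / (1 - a^2), and let v be the disc automorphism (u - a) / (1 - a u) of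
   u = exp (- i zeta). Then y + 1 is the real part of mu + 2 C v, and z' = (mu + C v)^2. The wave is flat at
   a = 0, and for decreasing a it becomes steeper until it overhangs and intersects itself. For small G
   we look for the solution as a power series in v close to mu + 2 C v. Bernoulli's equation divided by C
   has a linear part that is explicitly invertible up to a contraction in a weighted l1 space, with bounds that are uniform in
   -11/24 <= a <= 0, so that the contraction principle gives a Lipschitz family of solutions.
   The inequality Im z' > 0 in the half-strip 0 < alpha < pi survives the perturbation: a curve can only
   meet itself where the right half of a period crosses the axis of symmetry through the trough alpha = 0.
   At the first parameter for which the minimum of x over 0 < alpha < pi is 0, the surface touches itself
   tangentially at one point, and the profile encloses a bubble. *)

From Stdlib Require Import Reals ZArith Lra Lia Psatz.
From Stdlib Require Import Classical ClassicalEpsilon FunctionalExtensionality.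
From Coquelicot Require Import Coquelicot.
Require Import Defs.
Open Scope R_scope.

(** The linearised equation is explicitly invertible because everything is built from g = mu + C v.
    On |v| = 1 the unperturbed map satisfies z' = g^2 = 1 + 2 C J v with J = mu + C Re v, and |g|^2
    = 2 mu J - 1. If C D is the increment of the power series, the linear terms in D collapse to -2
    mu Re (conj (g^2) (D + mu J (v D' - 2 D))). Since D starts at v^2 and the multiplier n - 2
    vanishes there, multiplication by J creates no power below v^2. After division by |g|^4 the
    equation is the real part of an identity between power series: its coefficients 0 and 1 fix the
    Bernoulli constant and the mean height, the others fix D. The remaining operator is diagonal up
    to neighbour couplings of relative size at most (|C| / mu) (rho + 1 / rho) / 2, with |C| / mu =
    2 |a| / (1 + a^2). The interval of parameters has to reach beyond the first contact and keep
    this number below 1; the endpoint -11/24 and the weight rho = 6/5 give about 0.77. All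
    coefficients are real, so symmetry of the waves is invariance under complex conjugation of v. *)

Lemma functional_choice (A B : Type) (Q : A -> B -> Prop) :
  (forall x, exists y, Q x y) -> exists f, forall x, Q x (f x).
Proof.
  intros H. exists (fun x => proj1_sig (constructive_indefinite_description _ (H x))).
  intros x. apply proj2_sig.
Qed.

(** * Series of reals: dominated convergence and interchange of sums *)

Lemma sum_n_nonneg (a : nat -> R) (N : nat) :
  (forall n, 0 <= a n) -> 0 <= sum_n a N.
Proof.
  intros H; induction N as [|N IH].
  - rewrite sum_O; auto.
  - rewrite sum_Sn; unfold plus; simpl; specialize (H (S N)); lra.
Qed.

Lemma ex_series_bounded (a : nat -> R) (M : R) :
  (forall n, 0 <= a n) -> (forall N, sum_n a N <= M) ->
  ex_series a /\ Series a <= M.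
Proof.
  intros Ha Hb.
  assert (Hex : ex_series a).
  { apply ex_finite_lim_seq_incr with M; [|exact Hb].
    intros n; rewrite sum_Sn; unfold plus; simpl; specialize (Ha (S n)); lra. }
  split; [exact Hex|].
  apply (is_lim_seq_le (sum_n a) (fun _ => M) (Series a) M); auto.
  - apply Series_correct; exact Hex.
  - apply is_lim_seq_const.
Qed.

Lemma sum_n_le_Series (a : nat -> R) (N : nat) :
  (forall n, 0 <= a n) -> ex_series a -> sum_n a N <= Series a.
Proof.
  intros Ha Hex.
  apply (is_lim_seq_incr_compare (sum_n a)).
  - apply Series_correct; exact Hex.
  - intros n; rewrite sum_Sn; unfold plus; simpl; specialize (Ha (S n)); lra.
Qed.

Lemma Series_nonneg (a : nat -> R) : (forall n, 0 <= a n) -> 0 <= Series a.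
Proof.
  intros H. destruct (ex_series_dec a) as [Hex|Hn].
  - apply Rle_trans with (sum_n a 0); [apply sum_n_nonneg; auto|].
    apply sum_n_le_Series; auto.
  - unfold Series, Lim_seq.
    destruct (ex_lim_seq_dec (sum_n a)) as [Hl|Hl].
    + apply Lim_seq_correct in Hl. unfold Lim_seq in Hl.
      assert (H0 : Rbar_le 0 (Lim_seq (sum_n a))).
      { replace (Finite 0) with (Lim_seq (fun _ => 0)) by apply Lim_seq_const.
        apply Lim_seq_le_loc. exists 0%nat; intros; apply sum_n_nonneg; auto. }
      unfold Lim_seq in H0. destruct Rbar_div_pos; simpl in *; lra.
    + assert (H0 : Rbar_le 0 (Lim_seq (sum_n a))).
      { replace (Finite 0) with (Lim_seq (fun _ => 0)) by apply Lim_seq_const.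
        apply Lim_seq_le_loc. exists 0%nat; intros; apply sum_n_nonneg; auto. }
      unfold Lim_seq in H0. destruct Rbar_div_pos; simpl in *; lra.
Qed.

Lemma term_le_Series (a : nat -> R) (k : nat) :
  (forall n, 0 <= a n) -> ex_series a -> a k <= Series a.
Proof.
  intros Ha Hex. apply Rle_trans with (sum_n a k); [|apply sum_n_le_Series; auto].
  destruct k; [rewrite sum_O; lra|].
  rewrite sum_Sn; unfold plus; simpl. pose proof (sum_n_nonneg a k Ha); lra.
Qed.

Lemma ex_series_le_R (a b : nat -> R) :
  (forall n, Rabs (a n) <= b n) -> ex_series b -> ex_series a.
Proof. intros H Hb. apply (ex_series_le (V := R_CompleteNormedModule) a b); auto. Qed.

Lemma ex_series_abs (a b : nat -> R) :
  (forall n, Rabs (a n) <= b n) -> ex_series b -> ex_series (fun n => Rabs (a n)).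
Proof.
  intros H Hb. apply ex_series_le_R with b; auto.
  intros n; rewrite Rabs_Rabsolu; auto.
Qed.

Lemma Series_abs_le (a b : nat -> R) :
  (forall n, Rabs (a n) <= b n) -> ex_series b -> Rabs (Series a) <= Series b.
Proof.
  intros H Hb. apply Rle_trans with (Series (fun n => Rabs (a n))).
  - apply Series_Rabs. apply ex_series_abs with b; auto.
  - apply Series_le; auto. intros n; split; auto using Rabs_pos.
Qed.

Lemma sum_n_Series_swap (a : nat -> nat -> R) (K : nat) :
  (forall k, ex_series (fun n => a n k)) ->
  ex_series (fun n => sum_n (a n) K) /\
  Series (fun n => sum_n (a n) K) = sum_n (fun k => Series (fun n => a n k)) K.
Proof.
  intros H; induction K as [|K [IH1 IH2]].
  - split.
    + apply ex_series_ext with (fun n => a n 0%nat); auto.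
      intros n; now rewrite sum_O.
    + rewrite sum_O. apply Series_ext; intros n; now rewrite sum_O.
  - assert (He : forall n, sum_n (a n) K + a n (S K) = sum_n (a n) (S K))
      by (intros n; now rewrite sum_Sn).
    split.
    + eapply ex_series_ext; [exact He|].
      apply (ex_series_plus (V := R_NormedModule)); auto.
    + rewrite sum_Sn, <- IH2. unfold plus; simpl.
      rewrite <- Series_plus; auto.
      apply Series_ext; intros n; now rewrite He.
Qed.

(** Dominated convergence for series: beyond a suitable N all tails are bounded by the tail of [A],
    uniformly in K, and finitely many terms remain. *)
Lemma Tannery (r : nat -> nat -> R) (A : nat -> R) :
  (forall n K, Rabs (r n K) <= A n) -> ex_series A ->
  (forall n, is_lim_seq (r n) 0) ->
  is_lim_seq (fun K => Series (fun n => r n K)) 0.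
Proof.
  intros Hb HA Hl.
  assert (HA0 : forall n, 0 <= A n)
    by (intros n; apply Rle_trans with (Rabs (r n 0%nat)); auto using Rabs_pos).
  apply is_lim_seq_spec; intros eps.
  assert (He2 : 0 < eps / 3) by (destruct eps; simpl; lra).
  assert (Htail : exists N, Series A - sum_n A N < eps / 3).
  { pose proof (Series_correct A HA) as Hc.
    change (is_lim_seq (sum_n A) (Series A)) in Hc.
    apply is_lim_seq_spec in Hc.
    destruct (Hc (mkposreal _ He2)) as [N HN]. exists N.
    specialize (HN N (le_n N)). simpl in HN. apply Rabs_def2 in HN. lra. }
  destruct Htail as [N HN].
  assert (Hfin : eventually (fun K => Rabs (sum_n (fun n => r n K) N) < eps / 3)).
  { assert (Hs : is_lim_seq (fun K => sum_n (fun n => r n K) N) 0).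
    { clear HN. induction N as [|N IH].
      - apply is_lim_seq_ext with (r 0%nat); [intros; now rewrite sum_O|auto].
      - apply is_lim_seq_ext with (fun K => sum_n (fun n => r n K) N + r (S N) K);
          [intros; now rewrite sum_Sn|].
        replace (Finite 0) with (Finite (0 + 0)) by (f_equal; ring).
        apply is_lim_seq_plus'; auto. }
    apply is_lim_seq_spec in Hs. destruct (Hs (mkposreal _ He2)) as [M HM].
    exists M; intros K HK; specialize (HM K HK); simpl in HM.
    now rewrite Rminus_0_r in HM. }
  destruct Hfin as [M HM]. exists M; intros K HK. specialize (HM K HK).
  rewrite Rminus_0_r.
  assert (Hex : ex_series (fun n => r n K)) by (apply ex_series_le_R with A; auto).
  rewrite (Series_incr_n _ (S N)); [|lia|exact Hex].
  rewrite <- sum_n_Reals. simpl pred.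
  assert (HT : Rabs (Series (fun k => r (S N + k)%nat K)) <= Series A - sum_n A N).
  { apply Rle_trans with (Series (fun k => A (S N + k)%nat)).
    - apply Series_abs_le; auto. apply ex_series_incr_n; auto.
    - rewrite (Series_incr_n A (S N)); [|lia|auto].
      rewrite <- sum_n_Reals. simpl pred. lra. }
  eapply Rle_lt_trans; [apply Rabs_triang|]. lra.
Qed.

(** [Tannery] applies to the errors of the rows truncated at column K, which are dominated by 2 A
    n. *)
Lemma Series_swap (a : nat -> nat -> R) (A : nat -> R) :
  (forall n, ex_series (fun k => Rabs (a n k))) ->
  (forall n, Series (fun k => Rabs (a n k)) <= A n) -> ex_series A ->
  is_series (fun k => Series (fun n => a n k)) (Series (fun n => Series (a n))).
Proof.
  intros Hex Hle HA.
  assert (Hcol : forall n k, Rabs (a n k) <= A n).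
  { intros n k. eapply Rle_trans; [|apply Hle].
    apply (term_le_Series (fun k => Rabs (a n k))); auto using Rabs_pos. }
  assert (Hcole : forall k, ex_series (fun n => a n k))
    by (intros k; apply ex_series_le_R with A; auto).
  assert (Hrow : forall n, ex_series (a n)) by (intros n; apply ex_series_Rabs; auto).
  assert (Hrs : ex_series (fun n => Series (a n))).
  { apply ex_series_le_R with A; auto. intros n.
    eapply Rle_trans; [apply Series_Rabs; auto|auto]. }
  assert (Hps : forall n K, Rabs (sum_n (a n) K) <= A n).
  { intros n K. apply Rle_trans with (sum_n (fun k => Rabs (a n k)) K).
    - clear. induction K as [|K IH].
      + rewrite !sum_O; lra.
      + rewrite !sum_Sn; unfold plus; simpl.
        eapply Rle_trans; [apply Rabs_triang|]; lra.
    - eapply Rle_trans; [|apply Hle]. apply sum_n_le_Series; auto using Rabs_pos. }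
  assert (HL : is_lim_seq (fun K => Series (fun n => sum_n (a n) K - Series (a n))) 0).
  { apply Tannery with (fun n => 2 * A n).
    - intros n K. unfold Rminus. eapply Rle_trans; [apply Rabs_triang|].
      rewrite Rabs_Ropp. pose proof (Hps n K).
      assert (Rabs (Series (a n)) <= A n)
        by (eapply Rle_trans; [apply Series_Rabs; auto|auto]). lra.
    - apply (ex_series_scal_l (V := R_NormedModule) 2); auto.
    - intros n. replace (Finite 0) with (Finite (Series (a n) - Series (a n))) by (f_equal; ring).
      apply is_lim_seq_minus'; [apply Series_correct; auto|apply is_lim_seq_const]. }
  unfold is_series. change (is_lim_seq (sum_n (fun k => Series (fun n => a n k)))
     (Series (fun n => Series (a n)))).
  apply is_lim_seq_ext with
    (fun K => Series (fun n => sum_n (a n) K - Series (a n)) + Series (fun n => Series (a n))).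
  - intros K. destruct (sum_n_Series_swap a K Hcole) as [H1 H2].
    rewrite Series_minus; auto. rewrite H2. ring.
  - replace (Finite (Series (fun n => Series (a n))))
      with (Finite (0 + Series (fun n => Series (a n)))) by (f_equal; ring).
    apply is_lim_seq_plus'; [exact HL|apply is_lim_seq_const].
Qed.

Lemma ex_series_ext_R (a b : nat -> R) :
  (forall n, a n = b n) -> ex_series a -> ex_series b.
Proof. apply ex_series_ext. Qed.

Lemma sum_Sn_R (a : nat -> R) (n : nat) : sum_n a (S n) = sum_n a n + a (S n).
Proof. rewrite sum_Sn; reflexivity. Qed.

Lemma Series_of_lim (a : nat -> R) (l : R) : is_lim_seq (sum_n a) l -> Series a = l.
Proof. apply is_series_unique. Qed.

(** * A weighted l1 space of cosine series *)

(** A weight above 1 makes the series converge beyond the unit circle, so all derivatives are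
    bounded there; it is close enough to 1 that the factor (rho + 1 / rho) / 2 = 61/60 hardly spoils
    the contraction constant. *)
Definition rho : R := 6 / 5.

Lemma rho_pow_ge1 (n : nat) : 1 <= rho ^ n.
Proof. apply pow_R1_Rle; unfold rho; lra. Qed.

Lemma rho_pow_pos (n : nat) : 0 < rho ^ n.
Proof. pose proof (rho_pow_ge1 n); lra. Qed.

Definition l1 (w : nat -> R) : Prop := ex_series (fun n => Rabs (w n) * rho ^ n).

Record W := mkW { co :> nat -> R; co_l1 : l1 co }.

Definition nrm (w : W) : R := Series (fun n => Rabs (w n) * rho ^ n).

Lemma term_pos (w : nat -> R) (n : nat) : 0 <= Rabs (w n) * rho ^ n.
Proof. pose proof (rho_pow_pos n); pose proof (Rabs_pos (w n)); nra. Qed.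

Lemma nrm_pos (w : W) : 0 <= nrm w.
Proof. apply Series_nonneg; intros n; apply term_pos. Qed.

Lemma co_le_nrm (w : W) (n : nat) : Rabs (w n) * rho ^ n <= nrm w.
Proof.
  apply (term_le_Series (fun n => Rabs (w n) * rho ^ n)); [apply term_pos|apply co_l1].
Qed.

Lemma nrm_le_series (w : W) (b : nat -> R) :
  (forall n, Rabs (w n) * rho ^ n <= b n) -> ex_series b -> nrm w <= Series b.
Proof. intros H Hb; apply Series_le; auto. intros n; split; auto using term_pos. Qed.

Lemma nrm_ext (x y : W) : (forall n, x n = y n) -> nrm x = nrm y.
Proof. intros H; apply Series_ext; intros n; now rewrite H. Qed.

Lemma l1_add (x y : W) : l1 (fun n => x n + y n).
Proof.
  apply ex_series_le_R with (fun n => Rabs (x n) * rho ^ n + Rabs (y n) * rho ^ n).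
  - intros n. rewrite Rabs_mult, Rabs_Rabsolu, (Rabs_pos_eq (rho ^ n));
      [|left; apply rho_pow_pos].
    pose proof (Rabs_triang (x n) (y n)); pose proof (rho_pow_pos n); nra.
  - apply (ex_series_plus (V := R_NormedModule)); apply co_l1.
Qed.
Definition wadd (x y : W) : W := mkW _ (l1_add x y).

Lemma l1_scal (c : R) (x : W) : l1 (fun n => c * x n).
Proof.
  apply ex_series_ext_R with (fun n => Rabs c * (Rabs (x n) * rho ^ n)).
  - intros n; rewrite Rabs_mult; ring.
  - apply (ex_series_scal_l (V := R_NormedModule) (Rabs c)); apply co_l1.
Qed.
Definition wscal (c : R) (x : W) : W := mkW _ (l1_scal c x).

Definition wsub (x y : W) : W := wadd x (wscal (-1) y).

Lemma wsub_co (x y : W) (n : nat) : wsub x y n = x n - y n.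
Proof. unfold wsub; simpl; ring. Qed.

Lemma nrm_add (x y : W) : nrm (wadd x y) <= nrm x + nrm y.
Proof.
  unfold nrm. rewrite <- Series_plus; try apply co_l1.
  apply Series_le.
  - intros n; split; [apply term_pos|]. simpl.
    pose proof (Rabs_triang (x n) (y n)); pose proof (rho_pow_pos n); nra.
  - apply (ex_series_plus (V := R_NormedModule)); apply co_l1.
Qed.

Lemma nrm_scal (c : R) (x : W) : nrm (wscal c x) = Rabs c * nrm x.
Proof.
  unfold nrm. rewrite <- Series_scal_l. apply Series_ext; intros n; simpl.
  rewrite Rabs_mult; ring.
Qed.

Lemma nrm_sub_triang (x y z : W) : nrm (wsub x z) <= nrm (wsub x y) + nrm (wsub y z).
Proof.
  eapply Rle_trans; [|apply nrm_add]. right; apply nrm_ext; intros n.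
  simpl; ring.
Qed.

Lemma nrm_sub_sym (x y : W) : nrm (wsub x y) = nrm (wsub y x).
Proof.
  apply Series_ext; intros n. rewrite !wsub_co, Rabs_minus_sym; reflexivity.
Qed.

Lemma l1_delta (i : nat) : l1 (fun n => if Nat.eqb n i then 1 else 0).
Proof.
  apply (ex_series_bounded _ (rho ^ i)).
  - intros n; apply (term_pos (fun n => if Nat.eqb n i then 1 else 0)).
  - intros N.
    assert (H : sum_n (fun n => Rabs (if Nat.eqb n i then 1 else 0) * rho ^ n) N
             = (if Nat.leb i N then rho ^ i else 0)%R).
    { induction N as [|N IH].
      - rewrite sum_O. destruct i; simpl; rewrite ?Rabs_R1, ?Rabs_R0; lra.
      - rewrite sum_Sn_R, IH.
        destruct (Nat.eqb_spec (S N) i) as [E|E].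
        + subst i. rewrite (proj2 (Nat.leb_gt (S N) N)), Nat.leb_refl; [|lia].
          rewrite Rabs_R1; lra.
        + rewrite Rabs_R0. destruct (Nat.leb_spec i N), (Nat.leb_spec i (S N)); try lia; simpl; lra. }
    rewrite H. pose proof (rho_pow_pos i). destruct (Nat.leb i N); lra.
Qed.
Definition delta (i : nat) : W := mkW _ (l1_delta i).

(** The continuous linear functionals on the weighted space. Coordinates, real and imaginary parts
    at points of the closed unit disc, and their versions weighted by the index are all of this
    kind. *)
Definition bnd (phi : nat -> R) : Prop := exists M, forall k, Rabs (phi k) <= M * rho ^ k.

Definition ap (phi : nat -> R) (w : W) : R := Series (fun k => w k * phi k).

Lemma ap_abs (phi : nat -> R) (M : R) (w : W) :
  (forall k, Rabs (phi k) <= M * rho ^ k) ->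
  ex_series (fun k => Rabs (w k * phi k)) /\
  Series (fun k => Rabs (w k * phi k)) <= M * nrm w.
Proof.
  intros H.
  assert (Hle : forall k, Rabs (w k * phi k) <= M * (Rabs (w k) * rho ^ k)).
  { intros k. rewrite Rabs_mult. pose proof (Rabs_pos (w k)). specialize (H k). nra. }
  assert (Hex : ex_series (fun k => M * (Rabs (w k) * rho ^ k)))
    by (apply (ex_series_scal_l (V := R_NormedModule) M), co_l1).
  split.
  - apply ex_series_abs with (1 := Hle); auto.
  - unfold nrm; rewrite <- Series_scal_l. apply Series_le; auto.
    intros k; split; auto using Rabs_pos.
Qed.

Lemma ap_ex (phi : nat -> R) (w : W) : bnd phi -> ex_series (fun k => w k * phi k).
Proof. intros [M H]. apply ex_series_Rabs, (ap_abs phi M w H). Qed.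

Lemma ap_bound (phi : nat -> R) (M : R) (w : W) :
  (forall k, Rabs (phi k) <= M * rho ^ k) -> Rabs (ap phi w) <= M * nrm w.
Proof.
  intros H. destruct (ap_abs phi M w H) as [H1 H2].
  eapply Rle_trans; [apply Series_Rabs; exact H1|exact H2].
Qed.

Lemma ap_add (phi : nat -> R) (x y : W) : bnd phi -> ap phi (wadd x y) = ap phi x + ap phi y.
Proof.
  intros H. unfold ap. rewrite <- Series_plus; auto using ap_ex.
  apply Series_ext; intros n; simpl; ring.
Qed.

Lemma ap_scal (phi : nat -> R) (c : R) (x : W) : ap phi (wscal c x) = c * ap phi x.
Proof.
  unfold ap. rewrite <- Series_scal_l. apply Series_ext; intros n; simpl; ring.
Qed.

Lemma ap_ext (phi : nat -> R) (x y : W) : (forall n, x n = y n) -> ap phi x = ap phi y.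
Proof. intros H; apply Series_ext; intros n; now rewrite H. Qed.

Lemma Series_single (a : nat -> R) (i : nat) :
  (forall n, n <> i -> a n = 0) -> Series a = a i.
Proof.
  intros H. destruct i as [|i].
  - apply Series_of_lim, is_lim_seq_ext with (fun _ => a 0%nat); [|apply is_lim_seq_const].
    intros n; induction n as [|n IH]; [now rewrite sum_O|].
    rewrite sum_Sn_R, <- IH, (H (S n)); [ring|lia].
  - rewrite (Series_incr_n_aux a (S i)); [|intros k Hk; apply H; lia].
    apply Series_of_lim, is_lim_seq_ext with (fun _ => a (S i)); [|apply is_lim_seq_const].
    intros n; induction n as [|n IH]; [rewrite sum_O; f_equal; lia|].
    rewrite sum_Sn_R, <- IH, (H (S i + S n)%nat); [ring|lia].
Qed.

Lemma ap_delta (phi : nat -> R) (i : nat) : ap phi (delta i) = phi i.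
Proof.
  unfold ap. rewrite (Series_single _ i).
  - simpl. rewrite Nat.eqb_refl; ring.
  - intros n Hn; simpl. rewrite (proj2 (Nat.eqb_neq n i) Hn); ring.
Qed.

Lemma nrm_delta (i : nat) : nrm (delta i) = rho ^ i.
Proof.
  unfold nrm. rewrite (Series_single _ i).
  - simpl. rewrite Nat.eqb_refl, Rabs_R1; ring.
  - intros n Hn; simpl. rewrite (proj2 (Nat.eqb_neq n i) Hn), Rabs_R0; ring.
Qed.

(** [tau n] will be the image of the basis vector n, whose norm is rho^n, so K bounds the operator
    norm. *)
Definition wbnd (tau : nat -> W) : Prop := exists K, forall n, nrm (tau n) <= K * rho ^ n.

Section Lin.
Variables (tau : nat -> W) (K : R) (w : W).
Hypothesis HK : forall n, nrm (tau n) <= K * rho ^ n.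

Lemma lin_weights : forall n, Rabs (w n) * nrm (tau n) <= K * (Rabs (w n) * rho ^ n).
Proof. intros n. pose proof (Rabs_pos (w n)); specialize (HK n); nra. Qed.

Lemma lin_weights_ex : ex_series (fun n => Rabs (w n) * nrm (tau n)).
Proof.
  apply ex_series_le_R with (fun n => K * (Rabs (w n) * rho ^ n)).
  - intros n. rewrite Rabs_pos_eq; [apply lin_weights|].
    pose proof (Rabs_pos (w n)); pose proof (nrm_pos (tau n)); nra.
  - apply (ex_series_scal_l (V := R_NormedModule) K), co_l1.
Qed.

Lemma lin_coord_abs (n k : nat) :
  Rabs (w n * tau n k) * rho ^ k <= Rabs (w n) * nrm (tau n).
Proof.
  rewrite Rabs_mult, Rmult_assoc. pose proof (Rabs_pos (w n)).
  pose proof (co_le_nrm (tau n) k). nra.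
Qed.

Lemma lin_coord_ex (k : nat) : ex_series (fun n => Rabs (w n * tau n k)).
Proof.
  apply ex_series_abs with (fun n => Rabs (w n) * nrm (tau n)); [|apply lin_weights_ex].
  intros n. pose proof (lin_coord_abs n k). pose proof (rho_pow_ge1 k).
  pose proof (Rabs_pos (w n * tau n k)). nra.
Qed.

(** The norm of the image is estimated on finitely many coordinates, where the sum over coordinates
    and the series over n may be interchanged; the bound does not depend on their number. *)
Lemma lin_bound :
  l1 (fun k => Series (fun n => w n * tau n k)) /\
  Series (fun k => Rabs (Series (fun n => w n * tau n k)) * rho ^ k) <= K * nrm w.
Proof.
  apply ex_series_bounded.
  - intros n; apply (term_pos (fun k => Series (fun n => w n * tau n k))).
  - intros N.
    apply Rle_trans with (sum_n (fun k => Series (fun n => Rabs (w n * tau n k) * rho ^ k)) N).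
    { assert (Hk : forall k, Rabs (Series (fun n => w n * tau n k)) * rho ^ k
                     <= Series (fun n => Rabs (w n * tau n k) * rho ^ k)).
      { intros k. rewrite Series_scal_r. apply Rmult_le_compat_r; [left; apply rho_pow_pos|].
        apply Series_Rabs, lin_coord_ex. }
      induction N as [|N IH]; [rewrite !sum_O; auto|].
      rewrite !sum_Sn_R. apply Rplus_le_compat; auto. }
    destruct (sum_n_Series_swap (fun n k => Rabs (w n * tau n k) * rho ^ k) N) as [He Heq].
    { intros k. apply ex_series_scal_r, lin_coord_ex. }
    rewrite <- Heq.
    unfold nrm; rewrite <- Series_scal_l. apply Series_le.
    + intros n; split; [apply sum_n_nonneg; intros k; apply (term_pos (fun k => w n * tau n k))|].
      apply Rle_trans with (Rabs (w n) * nrm (tau n)); [|apply lin_weights].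
      unfold nrm; rewrite <- Series_scal_l.
      eapply Rle_trans; [apply sum_n_le_Series|right; apply Series_ext].
      * intros k; apply (term_pos (fun k => w n * tau n k)).
      * apply ex_series_ext_R with (fun k => Rabs (w n) * (Rabs (tau n k) * rho ^ k)).
        { intros k; rewrite Rabs_mult; ring. }
        apply (ex_series_scal_l (V := R_NormedModule)), co_l1.
      * intros k; simpl; rewrite Rabs_mult; ring.
    + apply (ex_series_scal_l (V := R_NormedModule) K), co_l1.
Qed.

Lemma ap_lin_aux (phi : nat -> R) : bnd phi ->
  Series (fun k => Series (fun n => w n * tau n k) * phi k)
  = Series (fun n => w n * ap phi (tau n)).
Proof.
  intros [M HM].
  assert (Hr : forall n, ex_series (fun k => Rabs (w n * tau n k * phi k)) /\
     Series (fun k => Rabs (w n * tau n k * phi k)) <= Rabs (w n) * (M * nrm (tau n))).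
  { intros n. destruct (ap_abs phi M (tau n) HM) as [H1 H2].
    assert (He : forall k, Rabs (w n) * Rabs (tau n k * phi k) = Rabs (w n * tau n k * phi k))
      by (intros k; rewrite <- Rabs_mult; f_equal; ring).
    split.
    - apply ex_series_ext_R with (1 := He).
      apply (ex_series_scal_l (V := R_NormedModule)); auto.
    - rewrite <- (Series_ext _ _ He), Series_scal_l.
      apply Rmult_le_compat_l; auto using Rabs_pos. }
  transitivity (Series (fun k => Series (fun n => w n * tau n k * phi k))).
  { apply Series_ext; intros k. now rewrite Series_scal_r. }
  transitivity (Series (fun n => Series (fun k => w n * tau n k * phi k))).
  { apply is_series_unique.
    apply (Series_swap (fun n k => w n * tau n k * phi k)
             (fun n => Rabs (w n) * (M * nrm (tau n)))); try apply Hr.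
    apply ex_series_ext_R with (fun n => M * (Rabs (w n) * nrm (tau n))).
    { intros n; ring. }
    apply (ex_series_scal_l (V := R_NormedModule)), lin_weights_ex. }
  apply Series_ext; intros n. unfold ap. rewrite <- Series_scal_l.
  apply Series_ext; intros k; ring.
Qed.
End Lin.

Lemma lin_l1 (tau : nat -> W) (w : W) : wbnd tau -> l1 (fun k => Series (fun n => w n * tau n k)).
Proof. intros [K HK]. apply (lin_bound tau K w HK). Qed.

Definition lin (tau : nat -> W) (H : wbnd tau) (w : W) : W := mkW _ (lin_l1 tau w H).

Lemma nrm_lin (tau : nat -> W) (H : wbnd tau) (K : R) (w : W) :
  (forall n, nrm (tau n) <= K * rho ^ n) -> nrm (lin tau H w) <= K * nrm w.
Proof. intros HK. apply (lin_bound tau K w HK). Qed.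

Lemma ap_lin (tau : nat -> W) (H : wbnd tau) (phi : nat -> R) (w : W) :
  bnd phi -> ap phi (lin tau H w) = Series (fun n => w n * ap phi (tau n)).
Proof. intros Hp. destruct H as [K HK] eqn:E. apply (ap_lin_aux tau K w HK phi Hp). Qed.

Definition dist (n m : nat) : nat := ((n - m) + (m - n))%nat.

(* A kernel describes the bilinear map sending the pair of basis vectors (n, m)
   to [k1 n m] times the basis vector n + m plus [k2 n m] times the basis vector |n - m|. *)
Record ker := mkker {
  k1 : nat -> nat -> R; k2 : nat -> nat -> R; kK : R;
  ker_bound : forall n m, Rabs (k1 n m) * rho ^ (n + m) + Rabs (k2 n m) * rho ^ (dist n m)
              <= kK * (rho ^ n * rho ^ m) }.

Definition kbasis (k : ker) (n m : nat) : W :=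
  wadd (wscal (k1 k n m) (delta (n + m))) (wscal (k2 k n m) (delta (dist n m))).

Lemma nrm_kbasis (k : ker) (n m : nat) : nrm (kbasis k n m) <= kK k * rho ^ n * rho ^ m.
Proof.
  eapply Rle_trans; [apply nrm_add|]. rewrite !nrm_scal, !nrm_delta, Rmult_assoc.
  apply ker_bound.
Qed.

Lemma kK_nonneg (k : ker) : 0 <= kK k.
Proof.
  pose proof (nrm_kbasis k 0 0). pose proof (nrm_pos (kbasis k 0 0)). simpl in *; lra.
Qed.

Lemma kbasis_wbnd (k : ker) (n : nat) : wbnd (kbasis k n).
Proof. exists (kK k * rho ^ n); apply nrm_kbasis. Qed.

Definition bil1 (k : ker) (q : W) (n : nat) : W := lin (kbasis k n) (kbasis_wbnd k n) q.

Lemma nrm_bil1 (k : ker) (q : W) (n : nat) : nrm (bil1 k q n) <= kK k * nrm q * rho ^ n.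
Proof.
  eapply Rle_trans; [apply nrm_lin, nrm_kbasis|]. right; ring.
Qed.

Lemma bil1_wbnd (k : ker) (q : W) : wbnd (bil1 k q).
Proof. exists (kK k * nrm q); apply nrm_bil1. Qed.

Definition bil (k : ker) (p q : W) : W := lin (bil1 k q) (bil1_wbnd k q) p.

Lemma nrm_bil (k : ker) (p q : W) : nrm (bil k p q) <= kK k * nrm p * nrm q.
Proof.
  eapply Rle_trans; [apply nrm_lin, nrm_bil1|]. right; ring.
Qed.

Lemma ap_bil (k : ker) (p q : W) (phi : nat -> R) : bnd phi ->
  ap phi (bil k p q) = Series (fun n => p n * Series (fun m => q m *
     (k1 k n m * phi (n + m)%nat + k2 k n m * phi (dist n m)))).
Proof.
  intros H. unfold bil. rewrite ap_lin; auto. apply Series_ext; intros n. f_equal.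
  unfold bil1. rewrite ap_lin; auto. apply Series_ext; intros m. f_equal.
  unfold kbasis. rewrite ap_add, !ap_scal, !ap_delta; auto.
Qed.

Lemma bnd_coord (i : nat) : bnd (fun k => if Nat.eqb k i then 1 else 0).
Proof.
  exists 1. intros k. pose proof (rho_pow_ge1 k).
  destruct (Nat.eqb k i); rewrite ?Rabs_R1, ?Rabs_R0; lra.
Qed.

Lemma lin_coord (tau : nat -> W) (H : wbnd tau) (w : W) (k : nat) :
  ex_series (fun n => w n * tau n k).
Proof. destruct H as [K HK]. apply ex_series_Rabs, (lin_coord_ex tau K w HK). Qed.

Lemma bil_sub_l (k : ker) (p p' q : W) (i : nat) :
  bil k (wsub p p') q i = bil k p q i - bil k p' q i.
Proof.
  simpl. rewrite <- Series_minus; try apply (lin_coord (bil1 k q) (bil1_wbnd k q)).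
  apply Series_ext; intros n. ring.
Qed.

Lemma bil1_sub (k : ker) (q q' : W) (n i : nat) :
  bil1 k (wsub q q') n i = bil1 k q n i - bil1 k q' n i.
Proof.
  simpl. rewrite <- Series_minus; try apply (lin_coord (kbasis k n) (kbasis_wbnd k n)).
  apply Series_ext; intros m. simpl; ring.
Qed.

Lemma bil_sub_r (k : ker) (p q q' : W) (i : nat) :
  bil k p (wsub q q') i = bil k p q i - bil k p q' i.
Proof.
  change (Series (fun n => p n * bil1 k (wsub q q') n i) =
    Series (fun n => p n * bil1 k q n i) - Series (fun n => p n * bil1 k q' n i)).
  rewrite <- Series_minus.
  - apply Series_ext; intros n. rewrite bil1_sub; ring.
  - apply (lin_coord (bil1 k q) (bil1_wbnd k q)).
  - apply (lin_coord (bil1 k q') (bil1_wbnd k q')).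
Qed.

Lemma nrm_bil_sub (k : ker) (p q p' q' : W) :
  nrm (wsub (bil k p q) (bil k p' q'))
  <= kK k * (nrm (wsub p p') * nrm q + nrm p' * nrm (wsub q q')).
Proof.
  apply Rle_trans with (nrm (wadd (bil k (wsub p p') q) (bil k p' (wsub q q')))).
  - right; apply nrm_ext; intros n. change (wadd (bil k (wsub p p') q) (bil k p' (wsub q q')) n)
      with (bil k (wsub p p') q n + bil k p' (wsub q q') n).
    rewrite bil_sub_l, bil_sub_r, wsub_co; ring.
  - eapply Rle_trans; [apply nrm_add|].
    pose proof (nrm_bil k (wsub p p') q). pose proof (nrm_bil k p' (wsub q q')). lra.
Qed.

Definition up_fun (x : nat -> R) (n : nat) : R := match n with O => 0 | S k => x k end.

Lemma up_l1 (x : W) : l1 (up_fun x).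
Proof.
  apply ex_series_incr_1. simpl.
  apply ex_series_ext_R with (fun n => rho * (Rabs (x n) * rho ^ n)).
  - intros n; simpl; ring.
  - apply (ex_series_scal_l (V := R_NormedModule) rho), co_l1.
Qed.
Definition up (x : W) : W := mkW _ (up_l1 x).

Lemma nrm_up (x : W) : nrm (up x) = rho * nrm x.
Proof.
  unfold nrm. rewrite Series_incr_1_aux; [|simpl; rewrite Rabs_R0; ring].
  rewrite <- Series_scal_l. apply Series_ext; intros n; simpl; ring.
Qed.

Lemma dn_l1 (x : W) : l1 (fun n => x (S n)).
Proof.
  apply ex_series_le_R with (fun n => Rabs (x (S n)) * rho ^ S n).
  - intros n. rewrite Rabs_mult, Rabs_Rabsolu, (Rabs_pos_eq (rho ^ n)); [|left; apply rho_pow_pos].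
    simpl. pose proof (Rabs_pos (x (S n))). pose proof (rho_pow_pos n).
    assert (rho ^ n <= rho * rho ^ n) by (unfold rho in *; nra). nra.
  - apply (ex_series_incr_1 (fun n => Rabs (x n) * rho ^ n)), co_l1.
Qed.
Definition dn (x : W) : W := mkW _ (dn_l1 x).

Lemma nrm_dn (x : W) : nrm (dn x) <= nrm x / rho.
Proof.
  unfold nrm at 2. rewrite (Series_incr_1 _ (co_l1 x)).
  assert (E : Series (fun k => Rabs (x (S k)) * rho ^ S k) = rho * nrm (dn x)).
  { unfold nrm; rewrite <- Series_scal_l. apply Series_ext; intros n; simpl; ring. }
  rewrite E. pose proof (Rabs_pos (x 0%nat)). simpl. unfold rho in *. lra.
Qed.

Definition sbnd (m : nat -> R) : Prop := exists K, forall n, Rabs (m n) <= K.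

Lemma dg_le (m : nat -> R) (K : R) (x : W) (n : nat) : (forall n, Rabs (m n) <= K) ->
  Rabs (m n * x n) * rho ^ n <= K * (Rabs (x n) * rho ^ n).
Proof.
  intros HK. rewrite Rabs_mult. pose proof (term_pos x n). specialize (HK n). nra.
Qed.

Lemma dg_l1 (m : nat -> R) (x : W) : sbnd m -> l1 (fun n => m n * x n).
Proof.
  intros [K HK]. apply ex_series_le_R with (fun n => K * (Rabs (x n) * rho ^ n)).
  - intros n. rewrite (Rabs_pos_eq (_ * _)); [now apply dg_le|].
    apply (term_pos (fun n => m n * x n)).
  - apply (ex_series_scal_l (V := R_NormedModule) K), co_l1.
Qed.
Definition dg (m : nat -> R) (H : sbnd m) (x : W) : W := mkW _ (dg_l1 m x H).

Lemma nrm_dg (m : nat -> R) (H : sbnd m) (K : R) (x : W) :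
  (forall n, Rabs (m n) <= K) -> nrm (dg m H x) <= K * nrm x.
Proof.
  intros HK. unfold nrm. rewrite <- Series_scal_l. apply Series_le.
  - intros n; split; [apply term_pos|]. simpl. now apply dg_le.
  - apply (ex_series_scal_l (V := R_NormedModule) K), co_l1.
Qed.

(** * The contraction principle in the weighted space *)

Section FixedPoint.
Variables (T : W -> W) (t q : R).
Hypothesis Hq : 0 < q < 1.
Hypothesis Ht : 0 < t.
Hypothesis Hball : forall x, nrm x <= t -> nrm (T x) <= t.
Hypothesis Hlip : forall x y, nrm x <= t -> nrm y <= t ->
  nrm (wsub (T x) (T y)) <= q * nrm (wsub x y).

Fixpoint picard (n : nat) : W := match n with O => wscal 0 (delta 0) | S k => T (picard k) end.

Lemma picard_ball (n : nat) : nrm (picard n) <= t.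
Proof.
  induction n as [|n IH]; simpl; auto. rewrite nrm_scal, Rabs_R0; lra.
Qed.

Lemma picard_step (n : nat) : nrm (wsub (picard (S n)) (picard n)) <= 2 * t * q ^ n.
Proof.
  induction n as [|n IH].
  - eapply Rle_trans; [apply nrm_add|]. rewrite nrm_scal.
    pose proof (picard_ball 0); pose proof (picard_ball 1).
    replace (Rabs (-1)) with 1 by (rewrite Rabs_left; lra). simpl in *; lra.
  - apply Rle_trans with (q * nrm (wsub (picard (S n)) (picard n)));
      [apply (Hlip (picard (S n)) (picard n)); apply picard_ball|].
    apply Rle_trans with (q * (2 * t * q ^ n)); [|right; simpl; ring].
    apply Rmult_le_compat_l; [lra|exact IH].
Qed.

Lemma qr_l1 : l1 (fun n => (q / rho) ^ n).
Proof.
  apply ex_series_ext_R with (fun n => q ^ n).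
  - intros n. rewrite Rabs_pos_eq.
    + rewrite <- Rpow_mult_distr. f_equal. unfold rho; field.
    + apply pow_le. unfold rho; lra.
  - apply ex_series_geom. rewrite Rabs_pos_eq; lra.
Qed.

(** Completeness is obtained from [lin]: the telescoping series of the iterates is [lin] applied to
    the sequence (q / rho)^n, which belongs to the space, and the rescaled differences satisfy
    exactly the bound that [wbnd] asks for. *)
Definition pic_tau (n : nat) : W := wscal ((rho / q) ^ n) (wsub (picard (S n)) (picard n)).

Lemma pic_tau_bound (n : nat) : nrm (pic_tau n) <= 2 * t * rho ^ n.
Proof.
  unfold pic_tau. rewrite nrm_scal, Rabs_pos_eq.
  - unfold Rdiv. rewrite Rpow_mult_distr, pow_inv.
    assert (Hp : 0 < q ^ n) by (apply pow_lt; lra).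
    pose proof (picard_step n). pose proof (rho_pow_pos n).
    apply Rle_trans with (rho ^ n * / q ^ n * (2 * t * q ^ n)).
    + apply Rmult_le_compat_l; auto. apply Rmult_le_pos; [lra|].
      left; apply Rinv_0_lt_compat; lra.
    + right; field; lra.
  - apply pow_le. unfold rho. apply Rmult_le_pos; [lra|]. left; apply Rinv_0_lt_compat; lra.
Qed.

Lemma pic_tau_wbnd : wbnd pic_tau.
Proof. exists (2 * t); apply pic_tau_bound. Qed.

Definition pic_lim : W := lin pic_tau pic_tau_wbnd (mkW _ qr_l1).

Lemma pic_term (n k : nat) : (q / rho) ^ n * pic_tau n k = picard (S n) k - picard n k.
Proof.
  unfold pic_tau. change (wscal ((rho / q) ^ n) (wsub (picard (S n)) (picard n)) k)
    with ((rho / q) ^ n * wsub (picard (S n)) (picard n) k).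
  rewrite wsub_co, <- Rmult_assoc, <- Rpow_mult_distr.
  replace (q / rho * (rho / q)) with 1 by (unfold rho; field; lra).
  rewrite pow1; ring.
Qed.

Lemma pic_partial (N k : nat) :
  sum_n (fun n => (q / rho) ^ n * pic_tau n k) N = picard (S N) k.
Proof.
  induction N as [|N IH].
  - rewrite sum_O, pic_term. change (picard 0 k) with (0 * delta 0 k). lra.
  - rewrite sum_Sn_R, IH, pic_term. lra.
Qed.

Lemma pic_lim_coord (k : nat) : is_lim_seq (fun n => picard (S n) k) (pic_lim k).
Proof.
  apply is_lim_seq_ext with (sum_n (fun n => (q / rho) ^ n * pic_tau n k)).
  - intros n; apply pic_partial.
  - apply Series_correct. apply (lin_coord pic_tau pic_tau_wbnd (mkW _ qr_l1)).
Qed.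

(** Lower semicontinuity of the norm, as in Fatou's lemma: every partial sum of the norm passes to
    the limit. *)
Lemma nrm_lim (y : nat -> W) (x : W) (b : R) :
  (forall k, is_lim_seq (fun n => y n k) (x k)) -> (forall n, nrm (y n) <= b) -> nrm x <= b.
Proof.
  intros Hl Hb. apply ex_series_bounded.
  - intros n; apply term_pos.
  - intros N.
    apply (is_lim_seq_le (fun n => sum_n (fun k => Rabs (y n k) * rho ^ k) N) (fun _ => b)
             (sum_n (fun k => Rabs (x k) * rho ^ k) N) b).
    + intros n. eapply Rle_trans; [|apply (Hb n)]. apply sum_n_le_Series.
      * intros k; apply term_pos.
      * apply co_l1.
    + induction N as [|N IH].
      * rewrite sum_O. apply is_lim_seq_ext with (fun n => Rabs (y n 0%nat) * rho ^ 0);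
          [intros; now rewrite sum_O|].
        apply (is_lim_seq_scal_r _ _ (Rabs (x 0%nat))). apply (is_lim_seq_abs _ (x 0%nat)); auto.
      * rewrite sum_Sn_R. apply is_lim_seq_ext with
          (fun n => sum_n (fun k => Rabs (y n k) * rho ^ k) N + Rabs (y n (S N)) * rho ^ S N);
          [intros; now rewrite sum_Sn_R|].
        apply is_lim_seq_plus'; auto.
        apply (is_lim_seq_scal_r _ _ (Rabs (x (S N)))).
        apply (is_lim_seq_abs _ (x (S N))); auto.
    + apply is_lim_seq_const.
Qed.

Lemma pic_ball : nrm pic_lim <= t.
Proof.
  apply (nrm_lim (fun n => picard (S n))); [apply pic_lim_coord|intros; apply picard_ball].
Qed.

Lemma pic_far (n p : nat) :
  nrm (wsub (picard (n + p)) (picard n)) <= 2 * t * q ^ n * / (1 - q).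
Proof.
  assert (Hqn : 0 < q ^ n) by (apply pow_lt; lra).
  assert (H : nrm (wsub (picard (n + p)) (picard n)) <= 2 * t * q ^ n * ((1 - q ^ p) / (1 - q))).
  { induction p as [|p IH].
    - rewrite Nat.add_0_r. right. replace (nrm (wsub (picard n) (picard n))) with 0.
      + simpl; field; lra.
      + symmetry. transitivity (nrm (wscal 0 (picard n))).
        * apply nrm_ext; intros k; simpl; ring.
        * rewrite nrm_scal, Rabs_R0; ring.
    - eapply Rle_trans; [apply (nrm_sub_triang _ (picard (n + p)))|].
      rewrite Nat.add_succ_r. pose proof (picard_step (n + p)) as Hs.
      rewrite pow_add in Hs.
      apply Rle_trans with (2 * t * (q ^ n * q ^ p) + 2 * t * q ^ n * ((1 - q ^ p) / (1 - q))); [lra|].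
      right. simpl; field; lra. }
  eapply Rle_trans; [exact H|].
  apply Rmult_le_compat_l; [nra|].
  assert (0 < q ^ p) by (apply pow_lt; lra).
  unfold Rdiv. assert (0 < / (1 - q)) by (apply Rinv_0_lt_compat; lra). nra.
Qed.

Lemma pic_close (n : nat) : nrm (wsub pic_lim (picard n)) <= 2 * t * q ^ n * / (1 - q).
Proof.
  apply (nrm_lim (fun p => wsub (picard (n + S p)) (picard n))).
  - intros k. rewrite wsub_co.
    apply is_lim_seq_ext with (fun p => picard (S (p + n)) k - picard n k).
    + intros p. rewrite wsub_co. do 3 f_equal. lia.
    + apply is_lim_seq_minus'; [|apply is_lim_seq_const].
      apply (is_lim_seq_incr_n (fun p => picard (S p) k) n), pic_lim_coord.
  - intros p; apply pic_far.
Qed.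

Lemma fixed_point : exists x, nrm x <= t /\ forall k, x k = T x k.
Proof.
  exists pic_lim. split; [apply pic_ball|]. intros k.
  assert (H0 : nrm (wsub pic_lim (T pic_lim)) = 0).
  { apply Rle_antisym; [|apply nrm_pos].
    apply (is_lim_seq_le (fun _ => nrm (wsub pic_lim (T pic_lim)))
             (fun n => 4 * t * / (1 - q) * q ^ n)
             (nrm (wsub pic_lim (T pic_lim))) 0).
    - intros n. eapply Rle_trans; [apply (nrm_sub_triang _ (picard (S n)))|].
      pose proof (pic_close (S n)) as H1. pose proof (pic_close n) as H2.
      assert (H3 : nrm (wsub (picard (S n)) (T pic_lim)) <= q * nrm (wsub pic_lim (picard n))).
      { rewrite (nrm_sub_sym pic_lim). apply Hlip; [apply picard_ball|apply pic_ball]. }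
      simpl in H1. assert (Hqn : 0 < q ^ n) by (apply pow_lt; lra).
      assert (Hi : 0 < / (1 - q)) by (apply Rinv_0_lt_compat; lra).
      assert (q * nrm (wsub pic_lim (picard n)) <= 2 * t * q ^ n * / (1 - q)).
      { pose proof (nrm_pos (wsub pic_lim (picard n))). apply Rle_trans with (1 * nrm (wsub pic_lim (picard n))); [|lra]. apply Rmult_le_compat_r; lra. }
      assert (2 * t * (q * q ^ n) * / (1 - q) <= 2 * t * q ^ n * / (1 - q)).
      { apply Rmult_le_compat_r; [lra|]. assert (0 < t * q ^ n) by nra. nra. }
      change (T (picard n)) with (picard (S n)) in *. lra.
    - apply is_lim_seq_const.
    - replace (Finite 0) with (Rbar_mult (4 * t * / (1 - q)) 0) by (simpl; f_equal; ring).
      apply is_lim_seq_scal_l, is_lim_seq_geom. rewrite Rabs_pos_eq; lra. }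
  pose proof (co_le_nrm (wsub pic_lim (T pic_lim)) k) as H. rewrite H0, wsub_co in H.
  pose proof (rho_pow_pos k). pose proof (Rabs_pos (pic_lim k - T pic_lim k)).
  assert (Hz : Rabs (pic_lim k - T pic_lim k) = 0) by nra.
  apply Rabs_eq_0 in Hz. lra.
Qed.
End FixedPoint.

(** * Bilinear maps evaluated on the unit circle *)

Definition dbnd (B : nat -> nat -> R) : Prop :=
  exists M, 0 <= M /\ forall n m, Rabs (B n m) <= M * rho ^ n * rho ^ m.

Definition dser (p q : W) (B : nat -> nat -> R) : R := ap (fun n => ap (B n) q) p.

Lemma dbnd_row (B : nat -> nat -> R) (n : nat) : dbnd B -> bnd (B n).
Proof. intros (M & HM & H). exists (M * rho ^ n). apply H. Qed.

Lemma dbnd_col (B : nat -> nat -> R) (q : W) : dbnd B -> bnd (fun n => ap (B n) q).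
Proof.
  intros (M & HM & H). exists (M * nrm q). intros n.
  replace (M * nrm q * rho ^ n) with (M * rho ^ n * nrm q) by ring.
  apply ap_bound, H.
Qed.

Lemma dser_ext (p q : W) (B B' : nat -> nat -> R) :
  (forall n m, B n m = B' n m) -> dser p q B = dser p q B'.
Proof.
  intros H. apply Series_ext; intros n. f_equal. apply Series_ext; intros m. now rewrite H.
Qed.

Lemma dser_add (p q : W) (B B' : nat -> nat -> R) : dbnd B -> dbnd B' ->
  dser p q (fun n m => B n m + B' n m) = dser p q B + dser p q B'.
Proof.
  intros H H'. unfold dser at 2 3. unfold ap at 1 3.
  rewrite <- Series_plus; try (apply ap_ex; now apply dbnd_col).
  apply Series_ext; intros n. rewrite <- Rmult_plus_distr_l. f_equal.
  unfold ap. rewrite <- Series_plus; try (apply ap_ex; now apply dbnd_row).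
  apply Series_ext; intros m; ring.
Qed.

Lemma dser_scal (p q : W) (c : R) (B : nat -> nat -> R) :
  dser p q (fun n m => c * B n m) = c * dser p q B.
Proof.
  unfold dser, ap. rewrite <- Series_scal_l. apply Series_ext; intros n.
  rewrite <- Rmult_assoc, (Rmult_comm c (p n)), Rmult_assoc. f_equal.
  rewrite <- Series_scal_l. apply Series_ext; intros m. ring.
Qed.

Lemma dbnd_add (B B' : nat -> nat -> R) : dbnd B -> dbnd B' -> dbnd (fun n m => B n m + B' n m).
Proof.
  intros (M & HM & H) (M' & HM' & H'). exists (M + M'); split; [lra|]. intros n m.
  eapply Rle_trans; [apply Rabs_triang|]. specialize (H n m); specialize (H' n m). lra.
Qed.

Lemma dbnd_scal (c : R) (B : nat -> nat -> R) : dbnd B -> dbnd (fun n m => c * B n m).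
Proof.
  intros (M & HM & H). exists (Rabs c * M). pose proof (Rabs_pos c). split; [nra|].
  intros n m. rewrite Rabs_mult. specialize (H n m). nra.
Qed.

Lemma bnd_pos (phi : nat -> R) : bnd phi -> exists M, 0 <= M /\ forall k, Rabs (phi k) <= M * rho ^ k.
Proof.
  intros [M HM]. exists M; split; auto. specialize (HM 0%nat). simpl in HM.
  pose proof (Rabs_pos (phi 0%nat)). lra.
Qed.

Lemma dbnd_prod (phi psi : nat -> R) : bnd phi -> bnd psi -> dbnd (fun n m => phi n * psi m).
Proof.
  intros H H'. destruct (bnd_pos _ H) as (M & HM & HB). destruct (bnd_pos _ H') as (M' & HM' & HB').
  exists (M * M'); split; [nra|]. intros n m. rewrite Rabs_mult.
  specialize (HB n); specialize (HB' m).
  apply Rle_trans with ((M * rho ^ n) * (M' * rho ^ m)); [|right; ring].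
  apply Rmult_le_compat; auto using Rabs_pos.
Qed.

Lemma dser_prod (p q : W) (phi psi : nat -> R) :
  dser p q (fun n m => phi n * psi m) = ap phi p * ap psi q.
Proof.
  unfold dser, ap. rewrite <- Series_scal_r. apply Series_ext; intros n.
  rewrite Rmult_assoc. f_equal. rewrite <- Series_scal_l. apply Series_ext; intros m; ring.
Qed.

Lemma ap_bil_dser (k : ker) (p q : W) (phi : nat -> R) : bnd phi ->
  ap phi (bil k p q) = dser p q (fun n m => k1 k n m * phi (n + m)%nat + k2 k n m * phi (dist n m)).
Proof. apply ap_bil. Qed.

Lemma dbnd_ker (k : ker) (phi : nat -> R) : bnd phi ->
  dbnd (fun n m => k1 k n m * phi (n + m)%nat + k2 k n m * phi (dist n m)).
Proof.
  intros H. destruct (bnd_pos _ H) as (M & HM & HB).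
  exists (M * kK k). pose proof (kK_nonneg k). split; [nra|]. intros n m.
  eapply Rle_trans; [apply Rabs_triang|]. rewrite !Rabs_mult.
  pose proof (ker_bound k n m). pose proof (HB (n + m)%nat). pose proof (HB (dist n m)).
  pose proof (Rabs_pos (k1 k n m)). pose proof (Rabs_pos (k2 k n m)).
  apply Rle_trans with (M * (Rabs (k1 k n m) * rho ^ (n + m) + Rabs (k2 k n m) * rho ^ dist n m)).
  - assert (Rabs (k1 k n m) * Rabs (phi (n + m)%nat) <= Rabs (k1 k n m) * (M * rho ^ (n + m)))
      by (apply Rmult_le_compat_l; auto).
    assert (Rabs (k2 k n m) * Rabs (phi (dist n m)) <= Rabs (k2 k n m) * (M * rho ^ dist n m))
      by (apply Rmult_le_compat_l; auto). lra.
  - rewrite !Rmult_assoc. apply Rmult_le_compat_l; auto.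
Qed.

Lemma dist_le (n m : nat) : rho ^ dist n m <= rho ^ n * rho ^ m.
Proof.
  rewrite <- pow_add. apply Rle_pow; [unfold rho; lra|unfold dist; lia].
Qed.

Lemma kmul_bound (n m : nat) :
  Rabs (/ 2) * rho ^ (n + m) + Rabs (/ 2) * rho ^ (dist n m) <= 1 * (rho ^ n * rho ^ m).
Proof.
  rewrite Rabs_pos_eq, pow_add by lra. pose proof (dist_le n m). lra.
Qed.

Lemma kcor_bound (n m : nat) :
  Rabs 0 * rho ^ (n + m) + Rabs 1 * rho ^ (dist n m) <= 1 * (rho ^ n * rho ^ m).
Proof. rewrite Rabs_R0, Rabs_R1. pose proof (dist_le n m). lra. Qed.

(** The factor min (n, m) comes from a derivative, but the output sits at |n - m| = n + m - 2 min
    (n, m), where the weight is smaller by rho^(2 min). This gain absorbs the factor, so the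
    quadratic form loses no derivative. *)
Lemma kqf_bound (n m : nat) :
  Rabs 0 * rho ^ (n + m) + Rabs (/ 2 * INR (Nat.min n m)) * rho ^ (dist n m)
  <= 2 * (rho ^ n * rho ^ m).
Proof.
  rewrite Rabs_R0, Rabs_pos_eq by (pose proof (pos_INR (Nat.min n m)); lra).
  rewrite <- pow_add.
  replace (n + m)%nat with (dist n m + (Nat.min n m + Nat.min n m))%nat at 2 by (unfold dist; lia).
  rewrite !pow_add. set (k := Nat.min n m).
  assert (H : INR k <= 4 * (rho ^ k * rho ^ k)).
  { assert (Hb : 1 + INR k * (rho * rho - 1) <= (rho * rho) ^ k).
    { replace (rho * rho) with (1 + (rho * rho - 1)) at 2 by ring.
      apply poly. unfold rho; lra. }
    rewrite Rpow_mult_distr in Hb. unfold rho in *. pose proof (pos_INR k). lra. }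
  pose proof (rho_pow_pos (dist n m)). nra.
Qed.

Lemma min_sum_dist (n m : nat) : INR (n + m) - INR (dist n m) = 2 * INR (Nat.min n m).
Proof.
  replace (n + m)%nat with (dist n m + (Nat.min n m + Nat.min n m))%nat by (unfold dist; lia).
  rewrite !plus_INR; ring.
Qed.

(* On the circle [|v| = 1] the real parts of power series are cosine series: [kmul] is
   their product, [kcor] is Re (p conj q), and [kqf] is the quadratic form
   (1/2) (y |D| y - (1/2) |D| y^2) of the water wave problem. *)
Definition kmul : ker := mkker (fun _ _ => / 2) (fun _ _ => / 2) 1 kmul_bound.
Definition kcor : ker := mkker (fun _ _ => 0) (fun _ _ => 1) 1 kcor_bound.
Definition kqf : ker :=
  mkker (fun _ _ => 0) (fun n m => / 2 * INR (Nat.min n m)) 2 kqf_bound.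

Definition pre (v : C) (n : nat) : R := fst (Cpow v n).
Definition pim (v : C) (n : nat) : R := snd (Cpow v n).

Lemma pre_S (v : C) (n : nat) : pre v (S n) = fst v * pre v n - snd v * pim v n.
Proof. reflexivity. Qed.
Lemma pim_S (v : C) (n : nat) : pim v (S n) = fst v * pim v n + snd v * pre v n.
Proof. reflexivity. Qed.

Lemma pre_add (v : C) (n m : nat) : pre v (n + m) = pre v n * pre v m - pim v n * pim v m.
Proof. unfold pre, pim. rewrite Cpow_add_r. reflexivity. Qed.
Lemma pim_add (v : C) (n m : nat) : pim v (n + m) = pre v n * pim v m + pim v n * pre v m.
Proof. unfold pre, pim. rewrite Cpow_add_r. reflexivity. Qed.

Definition sqmod (v : C) : R := fst v * fst v + snd v * snd v.

Lemma sqmod_pow (v : C) (n : nat) : pre v n * pre v n + pim v n * pim v n = sqmod v ^ n.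
Proof.
  induction n as [|n IH].
  - unfold pre, pim; simpl; ring.
  - rewrite pre_S, pim_S. simpl. rewrite <- IH. unfold sqmod; ring.
Qed.

Lemma pow_le1_bounds (v : C) (n : nat) : sqmod v <= 1 -> Rabs (pre v n) <= 1 /\ Rabs (pim v n) <= 1.
Proof.
  intros H. pose proof (sqmod_pow v n) as E.
  assert (H0 : 0 <= sqmod v) by (unfold sqmod; nra).
  assert (H1 : sqmod v ^ n <= 1).
  { clear E. induction n as [|n IH]; simpl; [lra|].
    assert (0 <= sqmod v ^ n) by (apply pow_le; auto). nra. }
  split; apply Rabs_le; nra.
Qed.

Lemma bnd_pre (v : C) : sqmod v <= 1 -> bnd (pre v).
Proof.
  intros H; exists 1; intros n. pose proof (rho_pow_ge1 n).
  destruct (pow_le1_bounds v n H); lra.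
Qed.
Lemma bnd_pim (v : C) : sqmod v <= 1 -> bnd (pim v).
Proof.
  intros H; exists 1; intros n. pose proof (rho_pow_ge1 n).
  destruct (pow_le1_bounds v n H); lra.
Qed.

Lemma INR_le_rho (n : nat) : INR n <= 5 * rho ^ n.
Proof.
  assert (Hb : 1 + INR n * (rho - 1) <= rho ^ n).
  { replace rho with (1 + (rho - 1)) at 2 by ring. apply poly. unfold rho; lra. }
  unfold rho in *. lra.
Qed.

Lemma bnd_INR (phi : nat -> R) : (forall n, Rabs (phi n) <= 1) -> bnd (fun n => INR n * phi n).
Proof.
  intros H. exists 5. intros n. rewrite Rabs_mult, Rabs_pos_eq by apply pos_INR.
  pose proof (INR_le_rho n). pose proof (pos_INR n). specialize (H n).
  pose proof (Rabs_pos (phi n)). nra.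
Qed.

Section Circle.
Variable v : C.
Hypothesis Hv : sqmod v = 1.

Lemma circle_pow (n : nat) : pre v n * pre v n + pim v n * pim v n = 1.
Proof. rewrite sqmod_pow, Hv, pow1; reflexivity. Qed.

Let bpre : bnd (pre v). Proof. apply bnd_pre; lra. Qed.
Let bpim : bnd (pim v). Proof. apply bnd_pim; lra. Qed.
Let bpre1 : bnd (fun n => INR n * pre v n).
Proof. apply bnd_INR; intros n; apply pow_le1_bounds; lra. Qed.
Let bpim1 : bnd (fun n => INR n * pim v n).
Proof. apply bnd_INR; intros n; apply pow_le1_bounds; lra. Qed.

Lemma pre_dist (n m : nat) : pre v (dist n m) = pre v n * pre v m + pim v n * pim v m.
Proof.
  assert (H : forall m k, pre v k = pre v (m + k) * pre v m + pim v (m + k) * pim v m).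
  { clear n m. intros m k. rewrite pre_add, pim_add.
    transitivity (pre v k * (pre v m * pre v m + pim v m * pim v m)); [rewrite circle_pow|]; ring. }
  unfold dist. destruct (Nat.le_ge_cases m n) as [L|L].
  - replace (n - m + (m - n))%nat with (n - m)%nat by lia.
    rewrite (H m (n - m)%nat). replace (m + (n - m))%nat with n by lia. ring.
  - replace (n - m + (m - n))%nat with (m - n)%nat by lia.
    rewrite (H n (m - n)%nat). replace (n + (m - n))%nat with m by lia. ring.
Qed.

(** The imaginary part of v^k is odd in k on the circle; the factor k makes the product even, so
    that the absolute value in [dist] does no harm. *)
Lemma pim_dist (n m : nat) :
  INR (dist n m) * pim v (dist n m) = (INR n - INR m) * (pim v n * pre v m - pre v n * pim v m).
Proof.
  assert (H : forall m k, pim v k = pim v (m + k) * pre v m - pre v (m + k) * pim v m).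
  { clear n m. intros m k. rewrite pre_add, pim_add.
    transitivity (pim v k * (pre v m * pre v m + pim v m * pim v m)); [rewrite circle_pow|]; ring. }
  unfold dist. destruct (Nat.le_ge_cases m n) as [L|L].
  - replace (n - m + (m - n))%nat with (n - m)%nat by lia.
    rewrite (H m (n - m)%nat). replace (m + (n - m))%nat with n by lia. rewrite minus_INR; auto.
  - replace (n - m + (m - n))%nat with (m - n)%nat by lia.
    rewrite (H n (m - n)%nat). replace (n + (m - n))%nat with m by lia. rewrite minus_INR; auto. ring.
Qed.

Lemma ap_mul (p q : W) : ap (pre v) (bil kmul p q) = ap (pre v) p * ap (pre v) q.
Proof.
  rewrite ap_bil_dser; auto. rewrite <- dser_prod. apply dser_ext; intros n m; simpl.
  rewrite pre_dist, pre_add. field.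
Qed.

Lemma ap_cor (p q : W) :
  ap (pre v) (bil kcor p q) = ap (pre v) p * ap (pre v) q + ap (pim v) p * ap (pim v) q.
Proof.
  rewrite ap_bil_dser; auto. rewrite <- !dser_prod, <- dser_add; try (apply dbnd_prod; auto).
  apply dser_ext; intros n m; simpl. rewrite pre_dist. ring.
Qed.

Lemma ap_qf_delta0_l (q : W) : ap (pre v) (bil kqf (delta 0) q) = 0.
Proof.
  rewrite ap_bil_dser; auto. unfold dser. rewrite ap_delta. unfold ap.
  rewrite (Series_single _ 0); [simpl; ring|intros n Hn; simpl; ring].
Qed.

Lemma ap_qf_delta0_r (p : W) : ap (pre v) (bil kqf p (delta 0)) = 0.
Proof.
  rewrite ap_bil_dser; auto. unfold dser, ap. rewrite (Series_single _ 0).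
  - fold (ap (fun m => k1 kqf 0 m * pre v (0 + m) + k2 kqf 0 m * pre v (dist 0 m)) (delta 0)).
    rewrite ap_delta; simpl; ring.
  - intros n Hn.
    fold (ap (fun m => k1 kqf n m * pre v (n + m) + k2 kqf n m * pre v (dist n m)) (delta 0)).
    rewrite ap_delta. simpl. rewrite Nat.min_0_r; simpl; ring.
Qed.

Lemma ap_qf_delta1_l (q : W) : ap (pre v) (bil kqf (delta 1) q) = / 2 * ap (pre v) (dn q).
Proof.
  rewrite ap_bil_dser; auto. unfold dser. rewrite ap_delta. unfold ap.
  rewrite Series_incr_1_aux; [|simpl; ring].
  rewrite <- Series_scal_l. apply Series_ext; intros n. simpl.
  replace (dist 1 (S n)) with n by (unfold dist; lia). field.
Qed.

Lemma ap_qf_sym (p q : W) : (exists i, forall n, n <> i -> p n = 0) ->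
  ap (pre v) (bil kqf q p) = ap (pre v) (bil kqf p q).
Proof.
  intros [i Hi]. rewrite !ap_bil_dser; auto. unfold dser.
  unfold ap at 3. rewrite (Series_single _ i); [|intros n Hn; rewrite Hi; auto; ring].
  unfold ap; rewrite <- Series_scal_l. apply Series_ext; intros n.
  rewrite (Series_single _ i); [|intros m Hm; rewrite Hi; auto; ring].
  simpl. rewrite (Nat.min_comm n i). replace (dist n i) with (dist i n) by (unfold dist; lia). ring.
Qed.

(** After symmetrisation in n and m all terms are double series and can be compared entry by entry.
    The first identity rests on (n + m) - |n - m| = 2 min (n, m); the second is the derivative of
    Y^2 / 2 along the circle. *)
Lemma qf_identity (f : W) :
  ap (pre v) f * ap (fun n => INR n * pre v n) f
    - / 2 * ap (fun n => INR n * pre v n) (bil kmul f f) = ap (pre v) (bil kqf f f) /\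
  ap (pre v) f * ap (fun n => INR n * pim v n) f
    - / 2 * ap (fun n => INR n * pim v n) (bil kmul f f) = 0.
Proof.
  assert (sym : forall phi, bnd phi -> ap (pre v) f * ap phi f =
    dser f f (fun n m => / 2 * (pre v n * phi m + phi n * pre v m))).
  { intros phi Hp. rewrite dser_scal, dser_add; try (apply dbnd_prod; auto).
    rewrite !dser_prod. field. }
  assert (step : forall phi B, bnd phi ->
    (forall n m, B n m = / 2 * (pre v n * phi m + phi n * pre v m)
        + (- / 2) * (/ 2 * phi (n + m)%nat + / 2 * phi (dist n m))) ->
    ap (pre v) f * ap phi f - / 2 * ap phi (bil kmul f f) = dser f f B).
  { intros phi B Hp HB. rewrite (sym phi Hp), (ap_bil_dser kmul f f phi Hp).
    rewrite (dser_ext f f B _ HB),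
      (dser_add f f (fun n m => / 2 * (pre v n * phi m + phi n * pre v m))
        (fun n m => - / 2 * (/ 2 * phi (n + m)%nat + / 2 * phi (dist n m)))).
    - rewrite (dser_scal f f (- / 2)). simpl. ring.
    - apply dbnd_scal, dbnd_add; apply dbnd_prod; auto.
    - apply dbnd_scal. apply (dbnd_ker kmul); auto. }
  split.
  - rewrite (ap_bil_dser kqf); auto. apply step; auto. intros n m.
    rewrite pre_add, pre_dist. simpl. rewrite plus_INR.
    pose proof (min_sum_dist n m) as E. rewrite plus_INR in E.
    replace (INR (Nat.min n m)) with ((INR n + INR m - INR (dist n m)) / 2) by lra. field.
  - rewrite (step _ (fun _ _ => 0)); auto.
    + unfold dser, ap. rewrite (Series_single _ 0%nat).
      * rewrite (Series_single _ 0%nat); intros; ring.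
      * intros n _. rewrite (Series_single _ 0%nat); intros; ring.
    + intros n m. rewrite pim_dist, plus_INR, pim_add. field.
Qed.
End Circle.

(** * Lipschitz dependence on the parameter *)

Record par := mkpar { pa :> R; pa_range : - (11 / 24) <= pa <= 0 }.

Definition slip (f : par -> R) : Prop :=
  exists K, 0 <= K /\ forall a b : par, Rabs (f a) <= K /\ Rabs (f a - f b) <= K * Rabs (a - b).

Lemma slip_const (c : R) : slip (fun _ => c).
Proof.
  exists (Rabs c). split; [apply Rabs_pos|]. intros a b. split; [lra|].
  replace (c - c) with 0 by ring. rewrite Rabs_R0.
  apply Rmult_le_pos; apply Rabs_pos.
Qed.

Lemma slip_id : slip (fun a => a).
Proof.
  exists 1. split; [lra|]. intros a b. split; [|lra].
  destruct a as [a Ha]; simpl. apply Rabs_le; lra.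
Qed.

Lemma slip_add (f g : par -> R) : slip f -> slip g -> slip (fun a => f a + g a).
Proof.
  intros (K & HK & H) (K' & HK' & H'). exists (K + K'). split; [lra|]. intros a b.
  destruct (H a b) as [H1 H2], (H' a b) as [H1' H2']. split.
  - eapply Rle_trans; [apply Rabs_triang|]; lra.
  - replace (f a + g a - (f b + g b)) with ((f a - f b) + (g a - g b)) by ring.
    eapply Rle_trans; [apply Rabs_triang|]; lra.
Qed.

Lemma slip_mul (f g : par -> R) : slip f -> slip g -> slip (fun a => f a * g a).
Proof.
  intros (K & HK & H) (K' & HK' & H'). exists (2 * K * K' + K * K').
  assert (0 <= K * K') by nra. split; [lra|]. intros a b.
  destruct (H a b) as [H1 H2], (H' a b) as [H1' H2']. destruct (H b a) as [H3 _].
  pose proof (Rabs_pos (f a)); pose proof (Rabs_pos (g a)); pose proof (Rabs_pos (a - b)). split.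
  - rewrite Rabs_mult.
    assert (Rabs (f a) * Rabs (g a) <= K * K') by (apply Rmult_le_compat; auto). lra.
  - replace (f a * g a - f b * g b) with ((f a - f b) * g a + f b * (g a - g b)) by ring.
    eapply Rle_trans; [apply Rabs_triang|]. rewrite !Rabs_mult.
    assert (Rabs (f a - f b) * Rabs (g a) <= K * Rabs (a - b) * K')
      by (apply Rmult_le_compat; auto using Rabs_pos).
    assert (Rabs (f b) * Rabs (g a - g b) <= K * (K' * Rabs (a - b)))
      by (apply Rmult_le_compat; auto using Rabs_pos).
    nra.
Qed.

Lemma slip_inv (f : par -> R) (c : R) : 0 < c -> (forall a, c <= f a) -> slip f -> slip (fun a => / f a).
Proof.
  intros Hc Hf (K & HK & H).
  assert (Hi : 0 < / c) by (apply Rinv_0_lt_compat; auto).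
  assert (Hb : forall a, 0 < / f a <= / c).
  { intros a. specialize (Hf a). split; [apply Rinv_0_lt_compat; lra|].
    apply Rinv_le_contravar; auto. }
  exists (/ c + K * / c * / c).
  assert (0 <= K * / c * / c) by (repeat apply Rmult_le_pos; lra).
  split; [lra|]. intros a b. pose proof (Hb a); pose proof (Hb b). split.
  - rewrite Rabs_pos_eq; lra.
  - pose proof (Hf a); pose proof (Hf b).
    replace (/ f a - / f b) with ((f b - f a) * / f a * / f b) by (field; lra).
    rewrite !Rabs_mult, (Rabs_pos_eq (/ f a)), (Rabs_pos_eq (/ f b)) by lra.
    rewrite (Rabs_minus_sym (f b)). destruct (H a b) as [_ Hab].
    pose proof (Rabs_pos (a - b)).
    apply Rle_trans with (K * Rabs (a - b) * / c * / c).
    + apply Rmult_le_compat; try lra.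
      * apply Rmult_le_pos; [apply Rabs_pos|lra].
      * apply Rmult_le_compat; try lra. apply Rabs_pos.
    + nra.
Qed.

Definition smul (m : par -> nat -> R) : Prop :=
  exists K, 0 <= K /\ forall (a b : par) n,
    Rabs (m a n) <= K /\ Rabs (m a n - m b n) <= K * Rabs (a - b).

Lemma smul_sbnd (m : par -> nat -> R) (a : par) : smul m -> sbnd (m a).
Proof. intros (K & HK & H). exists K. intros n. apply (H a a n). Qed.

(* [F a] vanishes to order j at 0 and is Lipschitz in x and in the parameter. *)
Definition ord (j : nat) (F : par -> W -> W) : Prop :=
  exists K, 0 <= K /\ forall (a b : par) t x y, 0 <= t <= 1 -> nrm x <= t -> nrm y <= t ->
    nrm (F a x) <= K * t ^ j /\
    nrm (wsub (F a x) (F a y)) <= K * t ^ pred j * nrm (wsub x y) /\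
    nrm (wsub (F a x) (F b x)) <= K * Rabs (a - b).

Lemma pow_decr (t : R) (i j : nat) : 0 <= t <= 1 -> (i <= j)%nat -> t ^ j <= t ^ i.
Proof.
  intros Ht Hij. replace j with (i + (j - i))%nat by lia. rewrite pow_add.
  assert (0 <= t ^ i) by (apply pow_le; lra).
  assert (t ^ (j - i) <= 1).
  { generalize (j - i)%nat. intros k; induction k as [|k IH]; simpl; [lra|].
    assert (0 <= t ^ k) by (apply pow_le; lra). nra. }
  nra.
Qed.

Lemma ord_weaken (i j : nat) (F : par -> W -> W) : (j <= i)%nat -> ord i F -> ord j F.
Proof.
  intros Hij (K & HK & H). exists K; split; auto. intros a b t x y Ht Hx Hy.
  destruct (H a b t x y Ht Hx Hy) as (H1 & H2 & H3).
  assert (t ^ i <= t ^ j) by (apply pow_decr; auto).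
  assert (t ^ pred i <= t ^ pred j) by (apply pow_decr; auto; lia).
  pose proof (nrm_pos (wsub x y)). repeat split; auto.
  - nra.
  - apply Rle_trans with (1 := H2). apply Rmult_le_compat_r; auto. nra.
Qed.

Lemma ord_lift (j : nat) (F : par -> W -> W) (Phi : par -> W -> W) (M : R) : 0 <= M ->
  (forall a x, nrm (Phi a x) <= M * nrm x) ->
  (forall a x y, nrm (wsub (Phi a x) (Phi a y)) <= M * nrm (wsub x y)) ->
  (forall a b x, nrm (wsub (Phi a x) (Phi b x)) <= M * Rabs (a - b) * nrm x) ->
  ord j F -> ord j (fun a x => Phi a (F a x)).
Proof.
  intros HM P1 P2 P3 (K & HK & H). exists (2 * (M * K)).
  assert (HMK : 0 <= M * K) by nra. split; [lra|].
  intros a b t x y Ht Hx Hy. destruct (H a b t x y Ht Hx Hy) as (H1 & H2 & H3).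
  assert (Htj : 0 <= t ^ j) by (apply pow_le; lra).
  assert (Htj' : 0 <= t ^ pred j) by (apply pow_le; lra).
  pose proof (nrm_pos (wsub x y)). pose proof (Rabs_pos (a - b)). repeat split.
  - eapply Rle_trans; [apply P1|]. assert (M * nrm (F a x) <= M * (K * t ^ j))
      by (apply Rmult_le_compat_l; auto). nra.
  - eapply Rle_trans; [apply P2|].
    apply Rle_trans with (M * (K * t ^ pred j * nrm (wsub x y)));
      [apply Rmult_le_compat_l; auto|].
    replace (M * (K * t ^ pred j * nrm (wsub x y))) with ((M * K) * (t ^ pred j * nrm (wsub x y))) by ring.
    assert (0 <= t ^ pred j * nrm (wsub x y)) by nra. nra.
  - apply Rle_trans with (1 := nrm_sub_triang _ (Phi a (F b x)) _).
    apply Rle_trans with (M * (K * Rabs (a - b)) + M * Rabs (a - b) * K); [|right; ring].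
    apply Rplus_le_compat.
    + eapply Rle_trans; [apply P2|]. apply Rmult_le_compat_l; auto.
    + eapply Rle_trans; [apply P3|]. apply Rmult_le_compat_l; [nra|].
      destruct (H b b 1 x x) as (Hb1 & _); try lra. rewrite pow1 in Hb1. lra.
Qed.

Lemma nrm_sub_self (x : W) : nrm (wsub x x) = 0.
Proof.
  transitivity (nrm (wscal 0 x)); [apply nrm_ext; intros k; simpl; ring|].
  rewrite nrm_scal, Rabs_R0; ring.
Qed.

Lemma ord_id : ord 1 (fun _ x => x).
Proof.
  exists 1. split; [lra|]. intros a b t x y Ht Hx Hy. simpl. repeat split; try lra.
  rewrite nrm_sub_self. pose proof (Rabs_pos (a - b)); lra.
Qed.

Lemma ord_const (h : par -> W) (K : R) :
  (forall a, nrm (h a) <= K) -> (forall a b, nrm (wsub (h a) (h b)) <= K * Rabs (a - b)) ->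
  ord 0 (fun a _ => h a).
Proof.
  intros H1 H2.
  assert (HK : 0 <= K).
  { assert (Ha : - (11 / 24) <= 0 <= 0) by lra.
    pose proof (H1 (mkpar 0 Ha)). pose proof (nrm_pos (h (mkpar 0 Ha))). lra. }
  exists K. split; auto. intros a b t x y Ht Hx Hy. simpl. repeat split; auto.
  - rewrite Rmult_1_r; auto.
  - rewrite nrm_sub_self. pose proof (nrm_pos (wsub x y)). nra.
Qed.

Lemma ord_add (j : nat) (F G : par -> W -> W) :
  ord j F -> ord j G -> ord j (fun a x => wadd (F a x) (G a x)).
Proof.
  intros (K & HK & H) (K' & HK' & H'). exists (K + K'). split; [lra|].
  intros a b t x y Ht Hx Hy.
  destruct (H a b t x y Ht Hx Hy) as (H1 & H2 & H3), (H' a b t x y Ht Hx Hy) as (H1' & H2' & H3').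
  assert (S : forall p q p' q', nrm (wsub (wadd p q) (wadd p' q')) <= nrm (wsub p p') + nrm (wsub q q')).
  { intros. eapply Rle_trans; [|apply nrm_add]. right; apply nrm_ext; intros n; simpl; ring. }
  repeat split.
  - eapply Rle_trans; [apply nrm_add|]. lra.
  - eapply Rle_trans; [apply S|]. lra.
  - eapply Rle_trans; [apply S|]. lra.
Qed.

Lemma pow_pred_l (t : R) (i j : nat) : 0 <= t <= 1 -> t ^ pred i * t ^ j <= t ^ pred (i + j).
Proof. intros Ht. rewrite <- pow_add. apply pow_decr; auto. lia. Qed.

Lemma ord_bil (k : ker) (i j : nat) (F G : par -> W -> W) :
  ord i F -> ord j G -> ord (i + j) (fun a x => bil k (F a x) (G a x)).
Proof.
  intros (K & HK & H) (K' & HK' & H'). pose proof (kK_nonneg k) as Hk.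
  assert (HKK : 0 <= K * K') by nra.
  exists (2 * (kK k * (K * K'))). assert (0 <= kK k * (K * K')) by nra. split; [lra|].
  intros a b t x y Ht Hx Hy.
  destruct (H a b t x y Ht Hx Hy) as (H1 & H2 & H3), (H' a b t x y Ht Hx Hy) as (H1' & H2' & H3').
  destruct (H a b t y y Ht Hy Hy) as (H4 & _).
  assert (Hti : 0 <= t ^ i) by (apply pow_le; lra).
  assert (Htj : 0 <= t ^ j) by (apply pow_le; lra).
  assert (Hti' : 0 <= t ^ pred i) by (apply pow_le; lra).
  assert (Htj' : 0 <= t ^ pred j) by (apply pow_le; lra).
  assert (Htij : 0 <= t ^ pred (i + j)) by (apply pow_le; lra).
  pose proof (nrm_pos (wsub x y)) as Hd. pose proof (Rabs_pos (a - b)) as Hab.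
  repeat split.
  - eapply Rle_trans; [apply nrm_bil|]. rewrite Rmult_assoc.
    apply Rle_trans with (kK k * ((K * t ^ i) * (K' * t ^ j))).
    + apply Rmult_le_compat_l; auto. apply Rmult_le_compat; auto using nrm_pos.
    + rewrite pow_add. replace (kK k * (K * t ^ i * (K' * t ^ j)))
        with ((kK k * (K * K')) * (t ^ i * t ^ j)) by ring.
      assert (0 <= t ^ i * t ^ j) by nra. nra.
  - eapply Rle_trans; [apply nrm_bil_sub|].
    apply Rle_trans with (kK k * ((K * t ^ pred i * nrm (wsub x y)) * (K' * t ^ j)
      + (K * t ^ i) * (K' * t ^ pred j * nrm (wsub x y)))).
    + apply Rmult_le_compat_l; auto. apply Rplus_le_compat; apply Rmult_le_compat; auto using nrm_pos.
    + replace (kK k * (K * t ^ pred i * nrm (wsub x y) * (K' * t ^ j) +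
         K * t ^ i * (K' * t ^ pred j * nrm (wsub x y))))
        with ((kK k * (K * K')) * nrm (wsub x y) * (t ^ pred i * t ^ j + t ^ pred j * t ^ i)) by ring.
      pose proof (pow_pred_l t i j Ht). pose proof (pow_pred_l t j i Ht) as P.
      rewrite Nat.add_comm in P.
      replace (2 * (kK k * (K * K')) * t ^ pred (i + j) * nrm (wsub x y))
        with ((kK k * (K * K')) * nrm (wsub x y) * (t ^ pred (i + j) + t ^ pred (i + j))) by ring.
      apply Rmult_le_compat_l; [nra|lra].
  - assert (HFb : nrm (F b x) <= K).
    { destruct (H b b 1 x x) as (Hb1 & _); try lra. rewrite pow1 in Hb1. lra. }
    assert (HGa : nrm (G a x) <= K').
    { destruct (H' a a 1 x x) as (Ha1 & _); try lra. rewrite pow1 in Ha1. lra. }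
    eapply Rle_trans; [apply nrm_bil_sub|].
    apply Rle_trans with (kK k * ((K * Rabs (a - b)) * K' + K * (K' * Rabs (a - b)))).
    + apply Rmult_le_compat_l; auto. apply Rplus_le_compat; apply Rmult_le_compat; auto using nrm_pos.
    + right; ring.
Qed.

Lemma ord_scal (j : nat) (f : par -> R) (F : par -> W -> W) :
  slip f -> ord j F -> ord j (fun a x => wscal (f a) (F a x)).
Proof.
  intros (K & HK & H). apply (ord_lift j F (fun a x => wscal (f a) x) K HK).
  - intros a x. rewrite nrm_scal. pose proof (nrm_pos x). destruct (H a a). nra.
  - intros a x y. apply Rle_trans with (nrm (wscal (f a) (wsub x y))).
    + right; apply nrm_ext; intros n; simpl; ring.
    + rewrite nrm_scal. pose proof (nrm_pos (wsub x y)). destruct (H a a). nra.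
  - intros a b x. apply Rle_trans with (nrm (wscal (f a - f b) x)).
    + right; apply nrm_ext; intros n; simpl; ring.
    + rewrite nrm_scal. pose proof (nrm_pos x). destruct (H a b). nra.
Qed.

Lemma ord_dg (j : nat) (m : par -> nat -> R) (Hm : forall a, sbnd (m a)) (F : par -> W -> W) :
  smul m -> ord j F -> ord j (fun a x => dg (m a) (Hm a) (F a x)).
Proof.
  intros (K & HK & H). apply (ord_lift j F (fun a x => dg (m a) (Hm a) x) K HK).
  - intros a x. apply nrm_dg. intros n; apply (H a a n).
  - intros a x y. apply Rle_trans with (nrm (dg (m a) (Hm a) (wsub x y))).
    + right; apply nrm_ext; intros n; simpl; ring.
    + apply nrm_dg. intros n; apply (H a a n).
  - intros a b x.
    assert (Hs : forall n, Rabs (m a n - m b n) <= K * Rabs (a - b)) by (intros n; apply H).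
    apply Rle_trans with (nrm (dg (fun n => m a n - m b n) (ex_intro _ _ Hs) x)).
    + right; apply nrm_ext; intros n; simpl; ring.
    + apply nrm_dg; auto.
Qed.

Lemma ord_up (j : nat) (F : par -> W -> W) : ord j F -> ord j (fun a x => up (F a x)).
Proof.
  apply (ord_lift j F (fun _ x => up x) rho); unfold rho; try lra.
  - intros a x. rewrite nrm_up. unfold rho; lra.
  - intros a x y. right. transitivity (nrm (up (wsub x y))).
    + apply nrm_ext; intros [|n]; simpl; ring.
    + apply nrm_up.
  - intros a b x. rewrite nrm_sub_self. pose proof (nrm_pos x). pose proof (Rabs_pos (a - b)). nra.
Qed.

Lemma ord_dn (j : nat) (F : par -> W -> W) : ord j F -> ord j (fun a x => dn (F a x)).
Proof.
  assert (Hd : forall x, nrm (dn x) <= 1 * nrm x).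
  { intros x. pose proof (nrm_dn x). pose proof (nrm_pos x). unfold rho in *. lra. }
  apply (ord_lift j F (fun _ x => dn x) 1); try lra.
  - intros a x. apply Hd.
  - intros a x y. eapply Rle_trans; [|apply Hd]. right. apply nrm_ext; intros n; simpl; ring.
  - intros a b x. rewrite nrm_sub_self. pose proof (nrm_pos x). pose proof (Rabs_pos (a - b)). nra.
Qed.

Lemma ord_coord (i : nat) : ord 1 (fun _ x => wscal (x i) (delta 0)).
Proof.
  apply (ord_lift 1 (fun _ x => x) (fun _ x => wscal (x i) (delta 0)) 1); try lra.
  - intros a x. rewrite nrm_scal, nrm_delta. pose proof (co_le_nrm x i).
    pose proof (rho_pow_ge1 i). pose proof (Rabs_pos (x i)). simpl; nra.
  - intros a x y. apply Rle_trans with (nrm (wscal (wsub x y i) (delta 0))).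
    + right; apply nrm_ext; intros n; simpl; ring.
    + rewrite nrm_scal, nrm_delta. pose proof (co_le_nrm (wsub x y) i).
      pose proof (rho_pow_ge1 i). pose proof (Rabs_pos (wsub x y i)). simpl pow; nra.
  - intros a b x. rewrite nrm_sub_self. pose proof (nrm_pos x). pose proof (Rabs_pos (a - b)). nra.
  - apply ord_id.
Qed.

Lemma ord_sc_delta (f : par -> R) (i : nat) : slip f -> ord 0 (fun a _ => wscal (f a) (delta i)).
Proof.
  intros H. apply (ord_scal 0 f (fun _ _ => delta i)); auto.
  apply (ord_const (fun _ => delta i) (nrm (delta i))); [intros; lra|].
  intros a b. rewrite nrm_sub_self. pose proof (nrm_pos (delta i)). pose proof (Rabs_pos (a - b)). nra.
Qed.

(** The linear part [Off] contracts on the whole space; a small ball makes the quadratic part almost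
    constant, and a small G keeps [F0] from leaving the ball. The contraction constant is uniform in
    a, so comparing the equations at a and b gives a Lipschitz family. *)
Lemma parametric_fixed_point (Off F2 F0 : par -> W -> W) (q0 K0 : R) :
  0 <= q0 < 1 -> 0 <= K0 ->
  (forall a x, nrm (Off a x) <= q0 * nrm x) ->
  (forall a x y, nrm (wsub (Off a x) (Off a y)) <= q0 * nrm (wsub x y)) ->
  (forall a b x, nrm (wsub (Off a x) (Off b x)) <= K0 * Rabs (a - b) * nrm x) ->
  ord 2 F2 -> ord 0 F0 ->
  forall eta, 0 < eta -> exists eps, 0 < eps /\ forall G, Rabs G < eps ->
  exists (X : par -> W) (L : R), 0 <= L /\ forall a b,
    nrm (X a) <= eta /\
    (forall k, X a k = Off a (X a) k + F2 a (X a) k + G * F0 a (X a) k) /\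
    nrm (wsub (X a) (X b)) <= L * Rabs (a - b).
Proof.
  intros Hq HK0 O1 O2 O3 (K2 & HK2 & P2) (K1 & HK1 & P0) eta Heta.
  set (K := K1 + K2 + 1). set (del := 1 - q0).
  assert (Hdel : 0 < del <= 1) by (unfold del; lra).
  assert (HK : 1 <= K) by (unfold K; lra).
  (* With K t at most del / 4 the quadratic term has Lipschitz constant at most del / 4, and the
     bound on G gives the same for the last term; half of the gap del = 1 - q0 is left over. *)
  set (t := Rmin eta (del / (4 * K))).
  assert (Hdk : 0 < del / (4 * K)) by (apply Rdiv_lt_0_compat; lra).
  assert (Ht : 0 < t) by (unfold t; apply Rmin_glb_lt; auto).
  assert (HtK : K * t <= del / 4).
  { apply Rle_trans with (K * (del / (4 * K))).
    - apply Rmult_le_compat_l; [lra|apply Rmin_r].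
    - right; field; lra. }
  assert (Ht1 : t <= 1) by nra.
  exists (t * del / (4 * K)).
  assert (Heps : 0 < t * del / (4 * K)) by (apply Rdiv_lt_0_compat; nra).
  split; auto. intros G HG.
  assert (HGK : Rabs G * K <= t * del / 4).
  { apply Rle_trans with (t * del / (4 * K) * K); [apply Rmult_le_compat_r; lra|].
    right; field; lra. }
  set (q := q0 + del / 2).
  assert (Hq1 : 0 < q < 1) by (unfold q, del in *; lra).
  set (T := fun a x => wadd (wadd (Off a x) (F2 a x)) (wscal G (F0 a x))).
  assert (S : forall a b x y, nrm (wsub (T a x) (T b y)) <= nrm (wsub (Off a x) (Off b y))
     + nrm (wsub (F2 a x) (F2 b y)) + Rabs G * nrm (wsub (F0 a x) (F0 b y))).
  { intros a b x y. rewrite <- nrm_scal. eapply Rle_trans; [|apply Rplus_le_compat_r, nrm_add].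
    eapply Rle_trans; [|apply nrm_add]. right; apply nrm_ext; intros n; simpl; ring. }
  pose proof (Rabs_pos G) as HG0.
  assert (Hball : forall a x, nrm x <= t -> nrm (T a x) <= t).
  { intros a x Hx. unfold T. eapply Rle_trans; [apply nrm_add|]. rewrite nrm_scal.
    pose proof (nrm_add (Off a x) (F2 a x)). pose proof (O1 a x).
    destruct (P2 a a t x x) as (B2 & _); try lra. destruct (P0 a a t x x) as (B0 & _); try lra.
    simpl in B2, B0. assert (Rabs G * nrm (F0 a x) <= Rabs G * K).
    { apply Rmult_le_compat_l; auto. unfold K; lra. }
    assert (K2 * (t * (t * 1)) <= t * (K * t)) by (unfold K; nra).
    assert (t * (K * t) <= t * (del / 4)) by (apply Rmult_le_compat_l; lra).
    assert (q0 * nrm x <= q0 * t) by (apply Rmult_le_compat_l; lra).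
    unfold del in *. nra. }
  assert (Hlip : forall a x y, nrm x <= t -> nrm y <= t ->
    nrm (wsub (T a x) (T a y)) <= q * nrm (wsub x y)).
  { intros a x y Hx Hy. eapply Rle_trans; [apply S|]. pose proof (O2 a x y).
    destruct (P2 a a t x y) as (_ & B2 & _); try lra. destruct (P0 a a t x y) as (_ & B0 & _); try lra.
    simpl in B2, B0. pose proof (nrm_pos (wsub x y)) as Hn.
    assert (Rabs G * nrm (wsub (F0 a x) (F0 a y)) <= del / 4 * nrm (wsub x y)).
    { apply Rle_trans with (Rabs G * (K * nrm (wsub x y))).
      - apply Rmult_le_compat_l; auto. unfold K; nra.
      - rewrite <- Rmult_assoc. apply Rmult_le_compat_r; auto. nra. }
    assert (nrm (wsub (F2 a x) (F2 a y)) <= del / 4 * nrm (wsub x y)).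
    { eapply Rle_trans; [exact B2|]. apply Rmult_le_compat_r; auto. unfold K in HtK; nra. }
    unfold q; lra. }
  assert (HX : forall a, exists x, nrm x <= t /\ forall k, x k = T a x k).
  { intros a. apply (fixed_point (T a) t q Hq1 Ht (Hball a) (Hlip a)). }
  destruct (functional_choice _ _ _ HX) as [X HX']. clear HX. rename HX' into HX.
  exists X, ((K0 + K2 + Rabs G * K1) / (1 - q)).
  assert (Hc : 0 <= K0 + K2 + Rabs G * K1) by nra.
  split; [apply Rdiv_le_0_compat; lra|].
  intros a b. destruct (HX a) as [H1 H2], (HX b) as [H3 H4]. repeat split.
  - eapply Rle_trans; [exact H1|apply Rmin_l].
  - intros k; rewrite (H2 k) at 1. reflexivity.
  - pose proof (Rabs_pos (a - b)) as Hab.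
    assert (H5 : nrm (wsub (X a) (X b)) <= q * nrm (wsub (X a) (X b))
                   + (K0 + K2 + Rabs G * K1) * Rabs (a - b)).
    { apply Rle_trans with (nrm (wsub (T a (X a)) (T b (X b)))).
      { right; apply nrm_ext; intros k. rewrite !wsub_co, (H2 k), (H4 k) at 1. reflexivity. }
      apply Rle_trans with (1 := nrm_sub_triang _ (T a (X b)) _).
      apply Rplus_le_compat; [apply Hlip; auto|].
      eapply Rle_trans; [apply S|]. rewrite !Rmult_plus_distr_r.
      destruct (P2 a b t (X b) (X b)) as (_ & _ & H6); try lra.
      destruct (P0 a b t (X b) (X b)) as (_ & _ & H7); try lra.
      pose proof (O3 a b (X b)). apply Rplus_le_compat; [apply Rplus_le_compat; auto|].
      - assert (K0 * Rabs (a - b) * nrm (X b) <= K0 * Rabs (a - b) * 1)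
          by (apply Rmult_le_compat_l; [nra|lra]). lra.
      - rewrite Rmult_assoc. apply Rmult_le_compat_l; auto. }
    apply Rmult_le_reg_l with (1 - q); [lra|].
    apply Rle_trans with ((K0 + K2 + Rabs G * K1) * Rabs (a - b)); [lra|].
    right; field; lra.
Qed.

(** * The linearised equation and its remainders as operators *)

Definition Cc (a : R) : R := 2 * a / (1 - a * a).
Definition mu (a : R) : R := (1 + a * a) / (1 - a * a).

Lemma par_sq (a : par) : 1 - a * a >= 3 / 4.
Proof. destruct a as [a Ha]; simpl; nra. Qed.

Lemma mu_Cc (a : par) : mu a * mu a = 1 + Cc a * Cc a.
Proof. pose proof (par_sq a). unfold mu, Cc. field. lra. Qed.

Lemma mu_ge1 (a : par) : 1 <= mu a.
Proof.
  pose proof (par_sq a). unfold mu.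
  apply Rmult_le_reg_r with (1 - a * a); [lra|]. unfold Rdiv.
  rewrite Rmult_assoc, Rinv_l, Rmult_1_r by lra. nra.
Qed.

(** The quotient -C / mu equals 2 |a| / (1 + a^2), which increases with |a| and takes the value
    528/697 at |a| = 11/24. *)
Lemma Cc_mu (a : par) : 0 <= - Cc a <= 528 / 697 * mu a.
Proof.
  pose proof (par_sq a). unfold mu, Cc.
  destruct a as [a Ha]; simpl in *. split.
  - replace (- (2 * a / (1 - a * a))) with (2 * (- a) * / (1 - a * a)) by (unfold Rdiv; ring).
    apply Rmult_le_pos; [lra|]. left; apply Rinv_0_lt_compat; lra.
  - apply Rmult_le_reg_r with (1 - a * a); [lra|].
    replace (- (2 * a / (1 - a * a)) * (1 - a * a)) with (- 2 * a) by (field; lra).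
    replace (528 / 697 * ((1 + a * a) / (1 - a * a)) * (1 - a * a)) with (528 / 697 * (1 + a * a))
      by (field; lra). nra.
Qed.

Lemma slip_sq : slip (fun a => 1 - a * a).
Proof.
  apply (slip_add (fun _ => 1) (fun a => - (a * a))); [apply slip_const|].
  destruct (slip_mul (fun _ => -1) (fun a => a * a)) as (K & HK & H).
  - apply slip_const.
  - apply slip_mul; apply slip_id.
  - exists K; split; auto. intros a b. destruct (H a b).
    replace (- (a * a)) with (-1 * (a * a)) by ring.
    replace (- (b * b)) with (-1 * (b * b)) by ring. auto.
Qed.

Lemma slip_isq : slip (fun a => / (1 - a * a)).
Proof. apply slip_inv with (3 / 4); [lra| |apply slip_sq]. intros a. pose proof (par_sq a); lra. Qed.

Lemma slip_Cc : slip (fun a => Cc a).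
Proof.
  unfold Cc, Rdiv. apply slip_mul; [|apply slip_isq].
  apply slip_mul; [apply slip_const|apply slip_id].
Qed.

Lemma slip_mu : slip (fun a => mu a).
Proof.
  unfold mu, Rdiv. apply slip_mul; [|apply slip_isq].
  apply slip_add; [apply slip_const|]. apply slip_mul; apply slip_id.
Qed.

Ltac slip_tac :=
  repeat first [ apply slip_Cc | apply slip_mu | apply slip_const | apply slip_add | apply slip_mul ].

(** The symbol of v d/dv - 2. Truncated subtraction makes it vanish at 0 and 1 as well as at 2; the
    first two indices do not belong to the higher coefficients. *)
Definition kap (n : nat) : R := INR (n - 2).
(** The diagonal part of the linearised operator acts on coefficient n as 1 + mu^2 (n - 2). Dividing
    by it turns [x] into the coefficients of D; numerators of linear growth are still bounded
    multipliers. *)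
Definition frac (al : nat -> R) (a : par) (n : nat) : R := al n / (1 + mu a * mu a * kap n).

Lemma kap_pos (n : nat) : 0 <= kap n.
Proof. apply pos_INR. Qed.

Lemma frac_den (a : par) (n : nat) : 1 + kap n <= 1 + mu a * mu a * kap n.
Proof.
  pose proof (kap_pos n). pose proof (mu_ge1 a). assert (1 <= mu a * mu a) by nra. nra.
Qed.

Lemma frac_smul (al : nat -> R) (A : R) :
  (forall n, Rabs (al n) <= A * (1 + kap n)) -> smul (frac al).
Proof.
  intros H.
  assert (HA : 0 <= A).
  { specialize (H 0%nat). pose proof (Rabs_pos (al 0%nat)). unfold kap in H; simpl in H. lra. }
  destruct (slip_mul (fun a => mu a) (fun a => mu a) slip_mu slip_mu) as (K & HK & HS).
  exists (A + A * K). assert (0 <= A * K) by nra. split; [lra|]. intros a b n.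
  specialize (H n). pose proof (kap_pos n) as Hk.
  pose proof (frac_den a n) as Da. pose proof (frac_den b n) as Db.
  set (da := 1 + mu a * mu a * kap n) in *. set (db := 1 + mu b * mu b * kap n) in *.
  assert (Ia : Rabs (frac al a n) <= A).
  { unfold frac, Rdiv. fold da. rewrite Rabs_mult, (Rabs_pos_eq (/ da))
      by (left; apply Rinv_0_lt_compat; lra).
    apply Rmult_le_reg_r with da; [lra|]. rewrite Rmult_assoc, Rinv_l, Rmult_1_r by lra. nra. }
  split; [lra|].
  replace (frac al a n - frac al b n) with
    (frac al a n * ((mu b * mu b - mu a * mu a) * (kap n * / db))).
  2:{ replace ((mu b * mu b - mu a * mu a) * (kap n * / db)) with ((db - da) * / db)
        by (unfold da, db; ring).
      unfold frac. fold da db. field. lra. }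
  rewrite !Rabs_mult. destruct (HS b a) as [_ HS2]. rewrite (Rabs_minus_sym b a) in HS2.
  assert (Hkd : Rabs (kap n) * Rabs (/ db) <= 1).
  { rewrite (Rabs_pos_eq (kap n)), (Rabs_pos_eq (/ db)); auto; [|left; apply Rinv_0_lt_compat; lra].
    apply Rmult_le_reg_r with db; [lra|]. rewrite Rmult_assoc, Rinv_l by lra. lra. }
  pose proof (Rabs_pos (a - b)).
  apply Rle_trans with (A * (K * Rabs (a - b) * 1)); [|nra].
  repeat (apply Rmult_le_compat; auto using Rabs_pos).
  apply Rmult_le_pos; [apply Rabs_pos|]. apply Rmult_le_pos; apply Rabs_pos.
  apply Rmult_le_pos; apply Rabs_pos.
Qed.

Definition al_d (n : nat) : R := match n with O | 1%nat => 0 | _ => 1 end.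
Definition al_t (n : nat) : R := match n with O | 1%nat => 0 | _ => INR n end.

Lemma smul_d : smul (frac al_d).
Proof.
  apply frac_smul with 1. intros n. pose proof (kap_pos n).
  destruct n as [|[|n]]; simpl al_d; rewrite ?Rabs_R0, ?Rabs_R1; lra.
Qed.
Lemma smul_t : smul (frac al_t).
Proof.
  apply frac_smul with 2. intros n. pose proof (kap_pos n).
  destruct n as [|[|n]]; simpl al_t; rewrite ?Rabs_R0; try lra.
  change (match n with O => _ | S _ => _ end) with (INR (S (S n))) || idtac.
  rewrite Rabs_pos_eq; unfold kap in *; simpl Nat.sub in *; rewrite ?Nat.sub_0_r in *.
  - change (INR (S (S n)) <= 2 * (1 + INR n)). rewrite !S_INR. pose proof (pos_INR n). lra.
  - change (0 <= INR (S (S n))). apply pos_INR.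
Qed.
Lemma smul_y : smul (frac kap).
Proof. apply frac_smul with 1. intros n. pose proof (kap_pos n). rewrite Rabs_pos_eq; lra. Qed.

(* The unknown x encodes the perturbation of the explicit wave: [x 0] that of the Bernoulli constant,
   [x 1] that of the mean height, and [Dw a x] that of the higher coefficients, divided by [Cc a];
   [Tw a x] is its derivative n d_n and the smoothing divisor absorbs this loss. *)
Definition Dw (a : par) (x : W) : W := dg (frac al_d a) (smul_sbnd _ a smul_d) x.
Definition Tw (a : par) (x : W) : W := dg (frac al_t a) (smul_sbnd _ a smul_t) x.
Definition Yw (a : par) (x : W) : W := dg (frac kap a) (smul_sbnd _ a smul_y) x.

(** Multiplication by J = mu + C (v + 1/v) / 2 couples neighbouring coefficients; this is the
    coupling part of -mu J Y, taken to the other side of the equation. *)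
Definition Off (a : par) (x : W) : W :=
  wscal (- (mu a * Cc a / 2)) (wadd (dn (Yw a x)) (up (Yw a x))).

Lemma nrm_dn_up (x : W) : nrm (wadd (dn x) (up x)) <= 61 / 30 * nrm x.
Proof.
  eapply Rle_trans; [apply nrm_add|]. rewrite nrm_up. pose proof (nrm_dn x).
  unfold rho in *. lra.
Qed.

Lemma Yw_bound (a : par) (x : W) : nrm (Yw a x) <= / (mu a * mu a) * nrm x.
Proof.
  apply nrm_dg. intros n. pose proof (frac_den a n). pose proof (kap_pos n). pose proof (mu_ge1 a).
  unfold frac. rewrite Rabs_pos_eq.
  - apply Rmult_le_reg_r with (1 + mu a * mu a * kap n); [lra|].
    unfold Rdiv. rewrite (Rmult_assoc (kap n)), Rinv_l, Rmult_1_r by lra.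
    rewrite Rmult_plus_distr_l, <- Rmult_assoc, Rinv_l, Rmult_1_l by nra.
    assert (0 < / (mu a * mu a)) by (apply Rinv_0_lt_compat; nra). lra.
  - apply Rdiv_le_0_compat; lra.
Qed.

(** The shifts contribute rho + 1 / rho = 61/30 and [Yw] contributes 1 / mu^2, so the norm is at
    most (61/60) |C| / mu, and (61/60) (528/697) is below 4/5. *)
Lemma Off_bound (a : par) (x : W) : nrm (Off a x) <= 4 / 5 * nrm x.
Proof.
  unfold Off. rewrite nrm_scal. pose proof (Cc_mu a) as [H1 H2]. pose proof (mu_ge1 a).
  replace (- (mu a * Cc a / 2)) with (mu a * (- Cc a) / 2) by field.
  assert (H0 : 0 <= mu a * - Cc a / 2) by nra.
  rewrite Rabs_pos_eq; auto. pose proof (nrm_pos x).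
  apply Rle_trans with (mu a * - Cc a / 2 * (61 / 30 * (/ (mu a * mu a) * nrm x))).
  - apply Rmult_le_compat_l; auto. eapply Rle_trans; [apply nrm_dn_up|].
    apply Rmult_le_compat_l; [lra|apply Yw_bound].
  - replace (mu a * - Cc a / 2 * (61 / 30 * (/ (mu a * mu a) * nrm x)))
      with (61 / 60 * (- Cc a / mu a) * nrm x) by (field; lra).
    apply Rmult_le_compat_r; auto.
    assert (- Cc a / mu a <= 528 / 697).
    { apply Rmult_le_reg_r with (mu a); [lra|]. unfold Rdiv.
      rewrite Rmult_assoc, Rinv_l by lra. lra. }
    lra.
Qed.

Lemma Off_sub (a : par) (x y : W) : nrm (wsub (Off a x) (Off a y)) <= 4 / 5 * nrm (wsub x y).
Proof.
  eapply Rle_trans; [|apply (Off_bound a)]. right; apply nrm_ext.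
  intros [|n]; simpl; ring.
Qed.

Lemma Off_slip : exists K0, 0 <= K0 /\ forall (a b : par) x,
  nrm (wsub (Off a x) (Off b x)) <= K0 * Rabs (a - b) * nrm x.
Proof.
  destruct smul_y as (K & HK & H).
  assert (Hs : slip (fun a => -1 * (mu a * Cc a * / 2))) by slip_tac.
  destruct Hs as (M & HM & HS).
  exists (M * (61 / 30 * K) + M * (61 / 30)). assert (0 <= M * K) by nra. split; [lra|].
  intros a b x. pose proof (nrm_pos x). pose proof (Rabs_pos (a - b)).
  assert (Hd : forall n, Rabs (frac kap a n - frac kap b n) <= K * Rabs (a - b)) by (intros; apply H).
  set (fa := - (mu a * Cc a / 2)). set (fb := - (mu b * Cc b / 2)).
  destruct (HS a b) as [H3 H4].
  replace (-1 * (mu a * Cc a * / 2)) with fa in * by (unfold fa; field).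
  replace (-1 * (mu b * Cc b * / 2)) with fb in * by (unfold fb; field).
  set (z := dg _ (ex_intro _ _ Hd) x).
  assert (Hz : nrm z <= K * Rabs (a - b) * nrm x) by (apply nrm_dg; auto).
  assert (Hy : nrm (Yw b x) <= nrm x).
  { eapply Rle_trans; [apply Yw_bound|]. pose proof (mu_ge1 b).
    assert (/ (mu b * mu b) <= 1). { rewrite <- Rinv_1. apply Rinv_le_contravar; nra. } nra. }
  apply Rle_trans with (nrm (wadd (wscal fa (wadd (dn z) (up z)))
                                  (wscal (fa - fb) (wadd (dn (Yw b x)) (up (Yw b x)))))).
  { right; apply nrm_ext. intros [|n]; simpl; unfold fa, fb; ring. }
  eapply Rle_trans; [apply nrm_add|]. rewrite !nrm_scal.
  pose proof (nrm_dn_up z). pose proof (nrm_dn_up (Yw b x)).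
  pose proof (nrm_pos (wadd (dn z) (up z))). pose proof (nrm_pos (wadd (dn (Yw b x)) (up (Yw b x)))).
  assert (Rabs fa * nrm (wadd (dn z) (up z)) <= M * (61 / 30 * (K * Rabs (a - b) * nrm x)))
    by (apply Rmult_le_compat; auto using Rabs_pos; lra).
  assert (Rabs (fa - fb) * nrm (wadd (dn (Yw b x)) (up (Yw b x))) <= M * Rabs (a - b) * (61 / 30 * nrm x))
    by (apply Rmult_le_compat; auto using Rabs_pos; lra).
  lra.
Qed.

Definition mul : W -> W -> W := bil kmul.

Definition sd (c : R) (i : nat) : W := wscal c (delta i).
(* With Y = mu + s + C e the equation reads N^2 = (b - 2 G Y) |z'|^2, where N = mu + s + C N1 and
   |z'|^2 = 1 + C V1. Both sides agree at C = 0, so a factor C divides out, and the problem stays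
   regular down to the flat flow. At x = 0, G = 0 we have z' = g^2 with g = mu + C v: here [g2w] is
   |g|^2 and [N1w] is N1, while [lw] + [n2w] and [lvw] + [v2w] are the linear and quadratic increments
   of N1 and V1. *)
Definition Jw (a : par) : W := wadd (sd (mu a) 0) (sd (Cc a) 1).
Definition g2w (a : par) : W :=
  wadd (sd (2 * (mu a * mu a) + -1) 0) (sd (2 * (mu a * Cc a)) 1).
Definition N1w (a : par) : W :=
  wadd (sd (2 * (Cc a * mu a)) 0) (sd (2 + 2 * (Cc a * Cc a)) 1).
Definition Sw (x : W) : W := wscal (x 1%nat) (delta 0).
Definition Bw (x : W) : W := wscal (x 0%nat) (delta 0).
Definition ew (a : par) (x : W) : W := wadd (sd 2 1) (Dw a x).
Definition lw (a : par) (x : W) : W :=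
  wadd (Dw a x) (wscal (2 * Cc a) (mul (Jw a) (dn (Dw a x)))).
Definition n2w (a : par) (x : W) : W :=
  wscal (Cc a) (mul (Jw a) (bil kqf (Dw a x) (Dw a x))).
Definition lvw (a : par) (x : W) : W :=
  wadd (wscal 2 (mul (Jw a) (Tw a x)))
       (wscal (4 * Cc a) (mul (Jw a) (mul (Jw a) (dn (Tw a x))))).
Definition v2w (a : par) (x : W) : W :=
  wscal (Cc a) (mul (Jw a) (mul (Jw a) (bil kcor (Tw a x) (Tw a x)))).
Definition V1w (a : par) : W := wscal 2 (mul (Jw a) (N1w a)).
Definition Vow (a : par) : W := mul (g2w a) (g2w a).

(** The difference N^2 - (b - 2 G Y) |z'|^2, divided by C, is the linear part in x plus [rem2] plus
    G times [rem0]. The identity N = mu |g|^2 of the unperturbed wave explains the factor [g2w] in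
    the first term. *)
Definition rem2 (a : par) (x : W) : W :=
  wadd (wscal (2 * mu a) (mul (g2w a) (n2w a x)))
  (wadd (wscal 2 (mul (Sw x) (wadd (lw a x) (n2w a x))))
  (wadd (wscal (Cc a) (mul (wadd (lw a x) (n2w a x)) (wadd (lw a x) (n2w a x))))
  (wadd (wscal (-1 * (mu a * mu a)) (v2w a x))
  (wadd (wscal (-2 * mu a) (mul (Sw x) (wadd (lvw a x) (v2w a x))))
  (wadd (wscal (-1) (mul (mul (Sw x) (Sw x)) (wadd (V1w a) (wadd (lvw a x) (v2w a x)))))
        (wscal (-1 * Cc a) (mul (Bw x) (wadd (lvw a x) (v2w a x))))))))).

Definition rem0 (a : par) (x : W) : W :=
  wscal 2 (mul (ew a x) (wadd (Vow a) (wscal (Cc a) (wadd (lvw a x) (v2w a x))))).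

Lemma ord_D : ord 1 Dw. Proof. apply ord_dg; [apply smul_d|apply ord_id]. Qed.
Lemma ord_T : ord 1 Tw. Proof. apply ord_dg; [apply smul_t|apply ord_id]. Qed.
Lemma ord_J : ord 0 (fun a _ => Jw a).
Proof. apply ord_add; apply ord_sc_delta; slip_tac. Qed.
Lemma ord_g2 : ord 0 (fun a _ => g2w a).
Proof. apply ord_add; apply ord_sc_delta; slip_tac. Qed.
Lemma ord_N1 : ord 0 (fun a _ => N1w a).
Proof. apply ord_add; apply ord_sc_delta; slip_tac. Qed.
Lemma ord_mul (i j k : nat) (F G : par -> W -> W) : (k <= i + j)%nat ->
  ord i F -> ord j G -> ord k (fun a x => mul (F a x) (G a x)).
Proof. intros Hk HF HG. apply ord_weaken with (i + j)%nat; auto. apply ord_bil; auto. Qed.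
Lemma ord_e : ord 0 ew.
Proof.
  apply ord_add; [apply ord_sc_delta; slip_tac|]. apply ord_weaken with 1%nat; [lia|apply ord_D].
Qed.
Lemma ord_l : ord 1 lw.
Proof.
  apply ord_add; [apply ord_D|]. apply ord_scal; [slip_tac|].
  apply (ord_mul 0 1); [lia|apply ord_J|apply ord_dn, ord_D].
Qed.
Lemma ord_n2 : ord 2 n2w.
Proof.
  apply ord_scal; [slip_tac|]. apply (ord_mul 0 2); [lia|apply ord_J|].
  apply (ord_bil kqf 1 1); apply ord_D.
Qed.
Lemma ord_lv : ord 1 lvw.
Proof.
  apply ord_add; apply ord_scal; try slip_tac.
  - apply (ord_mul 0 1); [lia|apply ord_J|apply ord_T].
  - apply (ord_mul 0 1); [lia|apply ord_J|].
    apply (ord_mul 0 1); [lia|apply ord_J|]. apply ord_dn, ord_T.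
Qed.
Lemma ord_v2 : ord 2 v2w.
Proof.
  apply ord_scal; [slip_tac|]. apply (ord_mul 0 2); [lia|apply ord_J|].
  apply (ord_mul 0 2); [lia|apply ord_J|]. apply (ord_bil kcor 1 1); apply ord_T.
Qed.
Lemma ord_ln : ord 1 (fun a x => wadd (lw a x) (n2w a x)).
Proof. apply ord_add; [apply ord_l|]. apply ord_weaken with 2%nat; [lia|apply ord_n2]. Qed.
Lemma ord_lvv : ord 1 (fun a x => wadd (lvw a x) (v2w a x)).
Proof. apply ord_add; [apply ord_lv|]. apply ord_weaken with 2%nat; [lia|apply ord_v2]. Qed.
Lemma ord_V1 : ord 0 (fun a _ => V1w a).
Proof.
  apply (ord_scal 0 (fun _ => 2) (fun a _ => mul (Jw a) (N1w a))); [slip_tac|].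
  apply (ord_mul 0 0); [lia|apply ord_J|apply ord_N1].
Qed.
Lemma ord_Vo : ord 0 (fun a _ => Vow a).
Proof. apply (ord_mul 0 0); [lia|apply ord_g2|apply ord_g2]. Qed.

Lemma ord_rem2 : ord 2 rem2.
Proof.
  assert (HS : ord 1 (fun _ x => Sw x)) by apply ord_coord.
  assert (HB : ord 1 (fun _ x => Bw x)) by apply ord_coord.
  apply ord_add; [|apply ord_add; [|apply ord_add; [|apply ord_add; [|apply ord_add; [|apply ord_add]]]]];
    (apply ord_scal; [slip_tac|]).
  - apply (ord_mul 0 2); [lia|apply ord_g2|apply ord_n2].
  - apply (ord_mul 1 1); [lia|apply HS|apply ord_ln].
  - apply (ord_mul 1 1); [lia|apply ord_ln|apply ord_ln].
  - apply ord_v2.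
  - apply (ord_mul 1 1); [lia|apply HS|apply ord_lvv].
  - apply (ord_mul 2 0); [lia|apply (ord_mul 1 1); [lia|apply HS|apply HS]|].
    apply ord_add; [apply ord_V1|]. apply ord_weaken with 1%nat; [lia|apply ord_lvv].
  - apply (ord_mul 1 1); [lia|apply HB|apply ord_lvv].
Qed.

Lemma ord_rem0 : ord 0 rem0.
Proof.
  apply ord_scal; [slip_tac|]. apply (ord_mul 0 0); [lia|apply ord_e|].
  apply ord_add; [apply ord_Vo|]. apply ord_scal; [slip_tac|].
  apply ord_weaken with 1%nat; [lia|apply ord_lvv].
Qed.

(** The ratio in g = mu (1 - tau v), that is, C = - tau mu. *)
Definition tau (a : R) : R := - (2 * a / (1 + a * a)).

Lemma tau_bounds (a : par) : 0 <= tau a <= 19 / 24.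
Proof.
  unfold tau. destruct a as [a Ha]; simpl. split.
  - replace (- (2 * a / (1 + a * a))) with (2 * (- a) / (1 + a * a)) by (field; nra).
    apply Rdiv_le_0_compat; nra.
  - apply Rmult_le_reg_r with (1 + a * a); [nra|].
    replace (- (2 * a / (1 + a * a)) * (1 + a * a)) with (- 2 * a) by (field; nra). nra.
Qed.

Lemma slip_tau : slip (fun a => tau a).
Proof.
  destruct (slip_mul (fun a => -2 * a) (fun a => / (1 + a * a))) as (K & HK & H).
  - apply slip_mul; [apply slip_const|apply slip_id].
  - apply slip_inv with 1; [lra| |].
    + intros [a Ha]; simpl; nra.
    + apply slip_add; [apply slip_const|apply slip_mul; apply slip_id].
  - exists K; split; auto. intros a b. unfold tau.
    replace (- (2 * a / (1 + a * a))) with (-2 * a * / (1 + a * a)) by (unfold Rdiv; ring).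
    replace (- (2 * b / (1 + b * b))) with (-2 * b * / (1 + b * b)) by (unfold Rdiv; ring).
    apply H.
Qed.

Lemma geom_l1 (t : R) : 0 <= t <= 19 / 24 -> l1 (fun n => t ^ n).
Proof.
  intros Ht. apply ex_series_le_R with (fun n => (19 / 20) ^ n).
  - intros n. pose proof (rho_pow_pos n).
    assert (0 <= t ^ n) by (apply pow_le; lra).
    rewrite Rabs_pos_eq by (apply Rmult_le_pos; [apply Rabs_pos|lra]).
    rewrite Rabs_pos_eq, <- Rpow_mult_distr by auto. apply pow_incr.
    unfold rho; lra.
  - apply ex_series_geom. rewrite Rabs_pos_eq; lra.
Qed.

Definition geo (a : par) : W := mkW _ (geom_l1 (tau a) (tau_bounds a)).

Lemma ap_ex_geom (q : R) : 0 <= q < 1 -> ex_series (fun n => q ^ n).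
Proof. intros H. apply ex_series_geom. rewrite Rabs_pos_eq; lra. Qed.

Lemma pow_diff (s t M : R) (n : nat) : 0 <= s <= M -> 0 <= t <= M ->
  Rabs (s ^ n - t ^ n) * M <= INR n * M ^ n * Rabs (s - t).
Proof.
  intros Hs Ht. induction n as [|n IH].
  - simpl. rewrite Rminus_diag, Rabs_R0. lra.
  - simpl pow. replace (s * s ^ n - t * t ^ n) with (s * (s ^ n - t ^ n) + (s - t) * t ^ n) by ring.
    rewrite S_INR.
    assert (Htn : 0 <= t ^ n <= M ^ n) by (split; [apply pow_le; lra|apply pow_incr; lra]).
    pose proof (Rabs_triang (s * (s ^ n - t ^ n)) ((s - t) * t ^ n)) as Tr.
    rewrite !Rabs_mult, (Rabs_pos_eq s), (Rabs_pos_eq (t ^ n)) in Tr by lra.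
    pose proof (Rabs_pos (s - t)). pose proof (Rabs_pos (s ^ n - t ^ n)).
    apply Rle_trans with ((s * Rabs (s ^ n - t ^ n) + Rabs (s - t) * t ^ n) * M).
    + apply Rmult_le_compat_r; lra.
    + assert (s * (Rabs (s ^ n - t ^ n) * M) <= M * (INR n * M ^ n * Rabs (s - t))).
      { apply Rmult_le_compat; try lra. apply Rmult_le_pos; lra. }
      assert (Rabs (s - t) * t ^ n * M <= Rabs (s - t) * M ^ n * M).
      { apply Rmult_le_compat_r; [lra|]. apply Rmult_le_compat_l; lra. }
      lra.
Qed.

Lemma ord_geo : ord 0 (fun a _ => geo a).
Proof.
  destruct slip_tau as (K & HK & H).
  set (S1 := Series (fun n => (19 / 20) ^ n)).
  set (S2 := Series (fun n => 48 * (39 / 40) ^ n)).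
  assert (E1 : ex_series (fun n => (19 / 20) ^ n)) by (apply ap_ex_geom; lra).
  assert (E2 : ex_series (fun n => 48 * (39 / 40) ^ n))
    by (apply (ex_series_scal_l (V := R_NormedModule) 48), ap_ex_geom; lra).
  assert (P1 : 0 <= S1) by (apply Series_nonneg; intros n; apply pow_le; lra).
  assert (P2 : 0 <= S2) by (apply Series_nonneg; intros n;
    assert (0 <= (39 / 40) ^ n) by (apply pow_le; lra); lra).
  apply (ord_const geo (S1 + S2 * K)).
  - intros a. apply Rle_trans with S1; [|nra]. apply nrm_le_series; auto. intros n. simpl.
    destruct (tau_bounds a). assert (0 <= tau a ^ n) by (apply pow_le; lra).
    rewrite Rabs_pos_eq, <- Rpow_mult_distr by auto. apply pow_incr. unfold rho; lra.
  - intros a b. pose proof (Rabs_pos (a - b)). destruct (H a b) as [_ Hab].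
    apply Rle_trans with (S2 * Rabs (tau a - tau b)).
    + unfold S2. rewrite <- Series_scal_r. apply nrm_le_series; [|apply ex_series_scal_r; auto].
      intros n. rewrite wsub_co. simpl.
      pose proof (pow_diff _ _ (19 / 24) n (tau_bounds a) (tau_bounds b)) as Hp.
      pose proof (rho_pow_pos n) as Hr.
      (* Bernoulli's inequality for 1 + 1/38 absorbs the factor n, since (39/38) (19/20) = 39/40.
         The constant 48 is 38 times 24/19. *)
      assert (Hn : INR n * ((19 / 24) ^ n * rho ^ n) <= 38 * (39 / 40) ^ n).
      { rewrite <- Rpow_mult_distr. replace (19 / 24 * rho) with (19 / 20) by (unfold rho; field).
        assert (Hb : 1 + INR n * (1 / 38) <= (1 + 1 / 38) ^ n) by (apply poly; lra).
        assert (Hq0 : 0 < (19 / 20) ^ n) by (apply pow_lt; lra).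
        replace (39 / 40) with ((1 + 1 / 38) * (19 / 20)) by field. rewrite Rpow_mult_distr. nra. }
      pose proof (Rabs_pos (tau a - tau b)).
      apply Rle_trans with (24 / 19 * (INR n * (19 / 24) ^ n * Rabs (tau a - tau b)) * rho ^ n).
      * apply Rmult_le_compat_r; lra.
      * replace (24 / 19 * (INR n * (19 / 24) ^ n * Rabs (tau a - tau b)) * rho ^ n)
          with (24 / 19 * (INR n * ((19 / 24) ^ n * rho ^ n)) * Rabs (tau a - tau b)) by ring.
        apply Rmult_le_compat_r; auto. lra.
    + apply Rle_trans with (S2 * (K * Rabs (a - b))); [apply Rmult_le_compat_l; auto|].
      assert (0 <= S1 * Rabs (a - b)) by nra. lra.
Qed.

(* The cosine series of 1 / |g|^2, by summation of the geometric series of ratio [tau a] *)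
Definition hw (a : par) : W := wadd (sd (-1) 0) (wscal 2 (geo a)).

Lemma ord_h : ord 0 (fun a _ => hw a).
Proof.
  apply ord_add; [apply (ord_sc_delta (fun _ => -1)), slip_const|].
  apply (ord_scal 0 (fun _ => 2) (fun a _ => geo a)); [apply slip_const|apply ord_geo].
Qed.

(** The generic entries are the coefficients mu^2, 2 mu C and C^2 of g^2, times -mu. The exceptional
    ones come from forward substitution: coefficients 0 and 1 determine the Bernoulli constant and
    the mean height, whose contributions then cancel part of g^2 r in coefficients 1 and 2. *)
Definition al0 (n : nat) (a : par) : R :=
  match n with O => -2 * (mu a * mu a) | 1%nat => - / 2 * (mu a * mu a)
  | _ => -1 * (mu a * (mu a * mu a)) end.
Definition al1 (n : nat) (a : par) : R :=
  match n with O => 0 | 1%nat => -1 * (mu a * mu a * Cc a) | _ => -2 * (mu a * mu a * Cc a) end.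
Definition al2 (n : nat) (a : par) : R :=
  match n with O => 0 | _ => -1 * (mu a * (Cc a * Cc a)) end.

Lemma smul_three (al : nat -> par -> R) :
  slip (al 0%nat) -> slip (al 1%nat) -> slip (al 2%nat) -> (forall n, al (S (S n)) = al 2%nat) ->
  smul (fun a n => al n a).
Proof.
  intros (K0 & H0 & S0) (K1 & H1 & S1) (K2 & H2 & S2) E.
  exists (K0 + K1 + K2). split; [lra|]. intros a b n.
  pose proof (Rabs_pos (a - b)).
  assert (forall K, K <= K0 + K1 + K2 -> K * Rabs (a - b) <= (K0 + K1 + K2) * Rabs (a - b))
    by (intros; apply Rmult_le_compat_r; auto).
  assert (K0 <= K0 + K1 + K2) by lra. assert (K1 <= K0 + K1 + K2) by lra.
  assert (K2 <= K0 + K1 + K2) by lra.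
  destruct n as [|[|n]]; [destruct (S0 a b)|destruct (S1 a b)|rewrite E; destruct (S2 a b)];
    split; eauto using Rle_trans.
Qed.

Lemma smul_0 : smul (fun a n => al0 n a).
Proof. apply smul_three; try reflexivity; simpl; slip_tac. Qed.
Lemma smul_1 : smul (fun a n => al1 n a).
Proof. apply smul_three; try reflexivity; simpl; slip_tac. Qed.
Lemma smul_2 : smul (fun a n => al2 n a).
Proof. apply smul_three; try reflexivity; simpl; slip_tac. Qed.

(* Solves the linearised problem up to the off-diagonal part [Off] *)
Definition Aw (a : par) (r : W) : W :=
  wadd (dg (fun n => al0 n a) (smul_sbnd _ a smul_0) r)
  (wadd (up (dg (fun n => al1 n a) (smul_sbnd _ a smul_1) r))
        (up (up (dg (fun n => al2 n a) (smul_sbnd _ a smul_2) r)))).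

(** Division of a remainder by -2 mu^2 |g|^4 on the circle. The result, a cosine series, is read
    again as a power series with that real part. *)
Definition rw (a : par) (m : W) : W :=
  wscal (- / 2 * (/ mu a * / mu a)) (mul (hw a) (mul (hw a) m)).

Lemma ord_A (j : nat) (F : par -> W -> W) : ord j F -> ord j (fun a x => Aw a (F a x)).
Proof.
  intros H. apply ord_add; [|apply ord_add; [apply ord_up|apply ord_up, ord_up]].
  - apply (ord_dg j (fun a n => al0 n a)); auto using smul_0.
  - apply (ord_dg j (fun a n => al1 n a)); auto using smul_1.
  - apply (ord_dg j (fun a n => al2 n a)); auto using smul_2.
Qed.

Lemma ord_r (j : nat) (F : par -> W -> W) : ord j F -> ord j (fun a x => rw a (F a x)).
Proof.
  intros H. apply ord_scal.
  - assert (slip (fun a => / mu a)).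
    { apply slip_inv with 1; [lra|apply mu_ge1|apply slip_mu]. }
    repeat apply slip_mul; auto; apply slip_const.
  - apply (ord_mul 0 j); [lia|apply ord_h|]. apply (ord_mul 0 j); [lia|apply ord_h|auto].
Qed.

Lemma fixed_family (eta : R) : 0 < eta -> exists eps, 0 < eps /\ forall G, Rabs G < eps ->
  exists (X : par -> W) (L : R), 0 <= L /\ forall a b,
    nrm (X a) <= eta /\
    (forall k, X a k = Off a (X a) k + Aw a (rw a (rem2 a (X a))) k
                       + G * Aw a (rw a (rem0 a (X a))) k) /\
    nrm (wsub (X a) (X b)) <= L * Rabs (a - b).
Proof.
  destruct Off_slip as (K0 & HK0 & H0).
  apply (parametric_fixed_point Off (fun a x => Aw a (rw a (rem2 a x)))
           (fun a x => Aw a (rw a (rem0 a x))) (4 / 5) K0); auto; try lra.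
  - apply Off_bound.
  - apply Off_sub.
  - apply ord_A, ord_r, ord_rem2.
  - apply ord_A, ord_r, ord_rem0.
Qed.

(** * The fixed point solves Bernoulli's equation on the circle *)

Arguments frac : simpl never.
Arguments kap : simpl never.

Lemma frac_kap_small (a : par) (n : nat) : (n <= 2)%nat -> frac kap a n = 0.
Proof.
  intros H. unfold frac, kap. replace (n - 2)%nat with 0%nat by lia. simpl; unfold Rdiv; ring.
Qed.

Lemma frac_d_small (a : par) (n : nat) : (n <= 1)%nat -> frac al_d a n = 0.
Proof. intros H. unfold frac. destruct n as [|[|n]]; [| |lia]; simpl; unfold Rdiv; ring. Qed.

Lemma frac_split (a : par) (n : nat) : (2 <= n)%nat ->
  frac al_d a n + mu a * mu a * frac kap a n = 1.
Proof.
  intros H. unfold frac. pose proof (frac_den a n). pose proof (kap_pos n).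
  replace (al_d n) with 1 by (destruct n as [|[|n]]; [lia|lia|reflexivity]). field. lra.
Qed.

Lemma Off_0 (a : par) (x : W) : Off a x 0%nat = 0.
Proof. simpl. rewrite frac_kap_small by lia. ring. Qed.
Lemma Off_S (a : par) (x : W) (n : nat) : Off a x (S n)
  = - (mu a * Cc a / 2) * (frac kap a (S (S n)) * x (S (S n)) + frac kap a n * x n).
Proof. reflexivity. Qed.

(** The coefficients of the power series identity m g^2 r = -(D + m J Y) - 2 s v g - (bt / (2 m))
    g^2 with g = m + c v, where s is the coefficient 1 and bt the coefficient 0 of [x]. The product
    J Y contains no negative power because Y starts at v^3. *)
Lemma coef_identity_gen (a : par) (x r : W) :
  (forall k, x k = Off a x k + Aw a r k) -> let m := mu a in let c := Cc a in forall k,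
  wadd (wscal (m * m * m) r) (wadd (wscal (2 * m * m * c) (up r)) (wscal (m * c * c) (up (up r)))) k
  = wadd (wscal (-1) (wadd (Dw a x) (wadd (wscal (m * m) (Yw a x))
        (wscal (m * c / 2) (wadd (dn (Yw a x)) (up (Yw a x)))))))
     (wadd (wscal (-2 * x 1%nat) (wadd (sd m 1) (sd c 2)))
        (wscal (- x 0%nat / (2 * m)) (wadd (sd (m * m) 0) (wadd (sd (2 * m * c) 1) (sd (c * c) 2))))) k.
Proof.
  intros H m c k.
  assert (Hm : m <> 0) by (pose proof (mu_ge1 a); unfold m; lra).
  pose proof (H 0%nat) as E0. pose proof (H 1%nat) as E1.
  rewrite Off_0 in E0. rewrite Off_S, !frac_kap_small in E1 by lia.
  simpl in E0, E1. fold m c in E0, E1.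
  assert (R0 : x 0%nat = -2 * (m * m) * r 0%nat) by lra.
  assert (R1 : x 1%nat = - / 2 * (m * m) * r 1%nat) by lra. clear E0 E1.
  destruct k as [|[|[|k]]].
  - simpl. rewrite !frac_kap_small, !frac_d_small by lia. fold m c. rewrite R0.
    unfold Rdiv. field; auto.
  - simpl. rewrite !frac_kap_small, !frac_d_small by lia. fold m c. rewrite R0, R1.
    unfold Rdiv. field; auto.
  - pose proof (H 2%nat) as E2. pose proof (frac_split a 2 (le_n 2)) as Hs.
    rewrite Off_S in E2. rewrite (frac_kap_small a 1) in E2 by lia.
    simpl in E2. fold m c in E2. simpl. rewrite (frac_kap_small a 1), (frac_kap_small a 2) in * by lia.
    replace (frac al_d a 2) with 1 by lra.
    replace (1 * x 2%nat + (m * m * (0 * x 2%nat) + m * c / 2 * (frac kap a 3 * x 3%nat + 0 * x 1%nat)))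
      with (-1 * (m * (m * m)) * r 2%nat - m * m * c * r 1%nat) by lra.
    rewrite R0, R1. field; auto.
  - pose proof (H (S (S (S k)))) as E3. rewrite Off_S in E3.
    pose proof (frac_split a (S (S (S k)))) as Hs. simpl in E3. fold m c in E3, Hs.
    assert (ED : x (S (S (S k))) = frac al_d a (S (S (S k))) * x (S (S (S k)))
                   + m * m * (frac kap a (S (S (S k))) * x (S (S (S k))))).
    { transitivity ((frac al_d a (S (S (S k))) + m * m * frac kap a (S (S (S k)))) * x (S (S (S k))));
        [rewrite Hs by lia|]; ring. }
    simpl. lra.
Qed.

Section Pointwise.
Variable v : C.
Hypothesis Hv : sqmod v = 1.

Let bre : bnd (pre v). Proof. apply bnd_pre; lra. Qed.
Let bim : bnd (pim v). Proof. apply bnd_pim; lra. Qed.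

Lemma re_add (x y : W) : ap (pre v) (wadd x y) = ap (pre v) x + ap (pre v) y.
Proof. now apply ap_add. Qed.
Lemma re_mul (x y : W) : ap (pre v) (mul x y) = ap (pre v) x * ap (pre v) y.
Proof. now apply ap_mul. Qed.
Lemma re_sd (c : R) (i : nat) : ap (pre v) (sd c i) = c * pre v i.
Proof. unfold sd. now rewrite ap_scal, ap_delta. Qed.

Lemma ap_up_re (x : W) : ap (pre v) (up x) = fst v * ap (pre v) x - snd v * ap (pim v) x.
Proof.
  unfold ap. rewrite <- !Series_scal_l, <- Series_minus.
  - rewrite Series_incr_1_aux; [|simpl; ring]. apply Series_ext; intros n.
    rewrite pre_S; simpl; ring.
  - apply (ex_series_scal_l (V := R_NormedModule) (fst v)), ap_ex, bre.
  - apply (ex_series_scal_l (V := R_NormedModule) (snd v)), ap_ex, bim.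
Qed.
Lemma ap_up_im (x : W) : ap (pim v) (up x) = fst v * ap (pim v) x + snd v * ap (pre v) x.
Proof.
  unfold ap. rewrite <- !Series_scal_l, <- Series_plus.
  - rewrite Series_incr_1_aux; [|simpl; ring]. apply Series_ext; intros n.
    rewrite pim_S; simpl; ring.
  - apply (ex_series_scal_l (V := R_NormedModule) (fst v)), ap_ex, bim.
  - apply (ex_series_scal_l (V := R_NormedModule) (snd v)), ap_ex, bre.
Qed.

Lemma ap_dn (x : W) : x 0%nat = 0 ->
  ap (pre v) (dn x) = fst v * ap (pre v) x + snd v * ap (pim v) x /\
  ap (pim v) (dn x) = fst v * ap (pim v) x - snd v * ap (pre v) x.
Proof.
  intros H0.
  assert (E : forall phi, ap phi (up (dn x)) = ap phi x)
    by (intros phi; apply ap_ext; intros [|n]; simpl; auto).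
  pose proof (E (pre v)) as E1. pose proof (E (pim v)) as E2.
  rewrite ap_up_re in E1. rewrite ap_up_im in E2. unfold sqmod in Hv.
  set (p := ap (pre v) (dn x)) in *. set (q := ap (pim v) (dn x)) in *.
  rewrite <- E1, <- E2. split.
  - transitivity ((fst v * fst v + snd v * snd v) * p); [rewrite Hv|]; ring.
  - transitivity ((fst v * fst v + snd v * snd v) * q); [rewrite Hv|]; ring.
Qed.

Lemma pre0 : pre v 0 = 1. Proof. reflexivity. Qed.
Lemma pim0 : pim v 0 = 0. Proof. reflexivity. Qed.
Lemma pre1 : pre v 1 = fst v. Proof. rewrite pre_S, pre0, pim0; ring. Qed.
Lemma pim1 : pim v 1 = snd v. Proof. rewrite pim_S, pre0, pim0; ring. Qed.
Lemma pre2 : pre v 2 = fst v * fst v - snd v * snd v. Proof. rewrite pre_S, pre1, pim1; ring. Qed.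
Lemma pim2 : pim v 2 = 2 * (fst v * snd v). Proof. rewrite pim_S, pre1, pim1; ring. Qed.

Variable a : par.

Definition absg2 : R := 2 * (mu a * mu a) - 1 + 2 * (mu a * Cc a) * fst v.

(** The Poisson kernel: the real part of -1 + 2 / (1 - tau v) is (1 - tau^2) / |1 - tau v|^2, and
    |g|^2 = mu^2 |1 - tau v|^2 with mu^2 (1 - tau^2) = 1. *)
Lemma re_h : ap (pre v) (hw a) * absg2 = 1.
Proof.
  set (p := ap (pre v) (geo a)). set (q := ap (pim v) (geo a)).
  assert (E : forall k, geo a k = wadd (delta 0) (wscal (tau a) (up (geo a))) k).
  { intros [|k]; simpl; ring. }
  assert (Ep : p = 1 + tau a * (fst v * p - snd v * q)).
  { unfold p at 1. rewrite (ap_ext _ _ _ E), re_add, ap_scal, ap_delta, ap_up_re, pre0. reflexivity. }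
  assert (Eq : q = tau a * (fst v * q + snd v * p)).
  { unfold q at 1. rewrite (ap_ext _ _ _ E), ap_add, ap_scal, ap_delta, ap_up_im, pim0; auto.
    fold p q. ring. }
  unfold hw. rewrite re_add, re_sd, ap_scal, pre0. fold p.
  destruct (tau_bounds a) as [T0 T1]. set (t := tau a) in *.
  assert (Hd : p * (1 - 2 * t * fst v + t * t) = 1 - t * fst v).
  { unfold sqmod in Hv.
    replace (1 - 2 * t * fst v + t * t) with ((1 - t * fst v) * (1 - t * fst v) + t * t * (snd v * snd v)).
    2:{ replace (snd v * snd v) with (1 - fst v * fst v) by lra. ring. }
    assert (E1 : p * (1 - t * fst v) = 1 - t * snd v * q) by lra.
    assert (E2 : q * (1 - t * fst v) = t * snd v * p) by lra.
    replace (p * ((1 - t * fst v) * (1 - t * fst v) + t * t * (snd v * snd v)))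
      with (p * (1 - t * fst v) * (1 - t * fst v) + t * snd v * (t * snd v * p)) by ring.
    rewrite E1, <- E2. ring. }
  assert (HC : Cc a = - t * mu a).
  { unfold t, tau, Cc, mu. pose proof (par_sq a). field. split; nra. }
  pose proof (mu_Cc a) as HM. unfold absg2. rewrite HC in *.
  assert (HM' : mu a * mu a * (1 - t * t) = 1) by lra.
  replace (2 * (mu a * mu a) - 1 + 2 * (mu a * (- t * mu a)) * fst v)
    with (mu a * mu a * (1 - 2 * t * fst v + t * t)) by lra.
  transitivity (mu a * mu a * (2 * (p * (1 - 2 * t * fst v + t * t)) - (1 - 2 * t * fst v + t * t)));
    [ring|]. rewrite Hd. transitivity (mu a * mu a * (1 - t * t)); [ring|exact HM'].
Qed.

Variables (G : R) (X : W).
Hypothesis HX : forall k, X k = Off a X k + Aw a (rw a (rem2 a X)) k + G * Aw a (rw a (rem0 a X)) k.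

Let m := mu a.
Let c := Cc a.
Let r : W := wadd (rw a (rem2 a X)) (wscal G (rw a (rem0 a X))).
Let D := Dw a X.
Let T := Tw a X.
Let Y := Yw a X.
Let s := X 1%nat.
Let bt := X 0%nat.

Lemma HXr (k : nat) : X k = Off a X k + Aw a r k.
Proof.
  rewrite (HX k) at 1. unfold r. generalize (rw a (rem2 a X)) (rw a (rem0 a X)) (Off a X).
  intros r2 r0 o. destruct k as [|[|k]]; simpl; ring.
Qed.

Lemma complex_identity :
  let dd1 := ap (pre v) D in let dd2 := ap (pim v) D in
  let yy1 := ap (pre v) Y in let yy2 := ap (pim v) Y in
  let r1 := ap (pre v) r in let r2 := ap (pim v) r in
  let J := m + c * fst v in
  m * m * m * r1 + 2 * m * m * c * (fst v * r1 - snd v * r2)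
    + m * c * c * (fst v * (fst v * r1 - snd v * r2) - snd v * (fst v * r2 + snd v * r1))
  = - (dd1 + m * J * yy1) - 2 * s * (m * fst v + c * (fst v * fst v - snd v * snd v))
    - bt / (2 * m) * (m * m + 2 * m * c * fst v + c * c * (fst v * fst v - snd v * snd v)) /\
  m * m * m * r2 + 2 * m * m * c * (fst v * r2 + snd v * r1)
    + m * c * c * (fst v * (fst v * r2 + snd v * r1) + snd v * (fst v * r1 - snd v * r2))
  = - (dd2 + m * J * yy2) - 2 * s * (m * snd v + c * (2 * (fst v * snd v)))
    - bt / (2 * m) * (2 * m * c * snd v + c * c * (2 * (fst v * snd v))).
Proof.
  intros dd1 dd2 yy1 yy2 r1 r2 J.
  assert (Hm : m <> 0) by (pose proof (mu_ge1 a); unfold m; lra).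
  assert (Y0 : Y 0%nat = 0) by (simpl; unfold frac, kap; simpl; unfold Rdiv; ring).
  destruct (ap_dn Y Y0) as [Yd1 Yd2].
  pose proof (ap_ext (pre v) _ _ (coef_identity_gen a X r HXr)) as E1.
  pose proof (ap_ext (pim v) _ _ (coef_identity_gen a X r HXr)) as E2.
  unfold sd in E1, E2. fold D Y s bt m c in E1, E2.
  repeat (rewrite ap_add in E1 by auto). repeat (rewrite ap_add in E2 by auto).
  repeat rewrite ap_scal in E1. repeat rewrite ap_scal in E2.
  repeat (rewrite ap_add in E1 by auto). repeat (rewrite ap_add in E2 by auto).
  repeat rewrite ap_scal in E1. repeat rewrite ap_scal in E2.
  repeat (rewrite ap_add in E1 by auto). repeat (rewrite ap_add in E2 by auto).
  repeat rewrite ap_scal in E1. repeat rewrite ap_scal in E2.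
  rewrite Yd1 in E1. rewrite Yd2 in E2.
  repeat (rewrite ?ap_up_re, ?ap_up_im, ?ap_delta, ?pre0, ?pre1, ?pre2 in E1).
  repeat (rewrite ?ap_up_re, ?ap_up_im, ?ap_delta, ?pim0, ?pim1, ?pim2 in E2).
  fold dd1 dd2 yy1 yy2 r1 r2 in E1, E2.
  split; unfold J.
  - eapply eq_trans; [|eapply eq_trans; [exact E1|field; auto]]; ring.
  - eapply eq_trans; [|eapply eq_trans; [exact E2|field; auto]]; ring.
Qed.

Let d1 := ap (pre v) D.
Let d2 := ap (pim v) D.
Let t1 := ap (pre v) T.
Let t2 := ap (pim v) T.
Let J := m + c * fst v.
Let q := ap (pre v) (bil kqf D D).

Definition lval : R := d1 + 2 * c * (J * (fst v * d1 + snd v * d2)).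
Definition lvval : R := 2 * (J * t1) + 4 * c * (J * (J * (fst v * t1 + snd v * t2))).
Definition n2val : R := c * (J * q).
Definition v2val : R := c * (J * (J * (t1 * t1 + t2 * t2))).
Definition N1val : R := 2 * (c * m) + (2 + 2 * (c * c)) * fst v.
Definition e1val : R := 2 * fst v + d1.

Lemma D0 : D 0%nat = 0.
Proof. simpl; unfold frac; simpl; unfold Rdiv; ring. Qed.
Lemma T0 : T 0%nat = 0.
Proof. simpl; unfold frac; simpl; unfold Rdiv; ring. Qed.

Lemma re_J : ap (pre v) (Jw a) = J.
Proof. unfold Jw. rewrite re_add, !re_sd, pre0, pre1. fold m c. unfold J; ring. Qed.
Lemma re_g2 : ap (pre v) (g2w a) = absg2.
Proof. unfold g2w, absg2. rewrite re_add, !re_sd, pre0, pre1. ring. Qed.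
Lemma re_N1 : ap (pre v) (N1w a) = N1val.
Proof. unfold N1w, N1val. rewrite re_add, !re_sd, pre0, pre1. fold m c. ring. Qed.
Lemma re_S : ap (pre v) (Sw X) = s.
Proof. unfold Sw. rewrite ap_scal, ap_delta, pre0. fold s; ring. Qed.
Lemma re_B : ap (pre v) (Bw X) = bt.
Proof. unfold Bw. rewrite ap_scal, ap_delta, pre0. fold bt; ring. Qed.
Lemma re_l : ap (pre v) (lw a X) = lval.
Proof.
  unfold lw, lval. rewrite re_add, ap_scal, re_mul, re_J. fold D. rewrite (proj1 (ap_dn D D0)).
  reflexivity.
Qed.
Lemma re_lv : ap (pre v) (lvw a X) = lvval.
Proof.
  unfold lvw, lvval. rewrite re_add, !ap_scal, !re_mul, re_J. fold T. rewrite (proj1 (ap_dn T T0)).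
  reflexivity.
Qed.
Lemma re_n2 : ap (pre v) (n2w a X) = n2val.
Proof. unfold n2w, n2val. rewrite ap_scal, re_mul, re_J. reflexivity. Qed.
Lemma re_v2 : ap (pre v) (v2w a X) = v2val.
Proof. unfold v2w, v2val. rewrite ap_scal, !re_mul, re_J, ap_cor; auto. Qed.

Lemma re_rem2 : ap (pre v) (rem2 a X) =
  2 * m * (absg2 * n2val) + 2 * (s * (lval + n2val)) + c * ((lval + n2val) * (lval + n2val))
  - m * m * v2val - 2 * m * (s * (lvval + v2val))
  - s * s * (2 * (J * N1val) + (lvval + v2val)) - c * (bt * (lvval + v2val)).
Proof.
  unfold rem2, V1w.
  repeat (rewrite ?re_add, ?ap_scal, ?re_mul, ?re_J, ?re_g2, ?re_N1, ?re_S, ?re_B, ?re_l, ?re_lv, ?re_n2, ?re_v2).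
  fold m c. ring.
Qed.

Lemma re_rem0 : ap (pre v) (rem0 a X) =
  2 * (e1val * (absg2 * absg2 + c * (lvval + v2val))).
Proof.
  unfold rem0, Vow, ew.
  repeat (rewrite ?re_add, ?ap_scal, ?re_mul, ?re_g2, ?re_lv, ?re_v2, ?re_sd, ?pre1).
  fold m c. unfold e1val. reflexivity.
Qed.

Lemma re_r : 2 * (m * m) * (absg2 * absg2) * ap (pre v) r
  = - (ap (pre v) (rem2 a X) + G * ap (pre v) (rem0 a X)).
Proof.
  unfold r, rw. rewrite re_add. repeat rewrite ap_scal. rewrite !re_mul. fold m.
  pose proof re_h as Hh. set (h := ap (pre v) (hw a)) in *.
  assert (Hm : m <> 0) by (pose proof (mu_ge1 a); unfold m; lra).
  transitivity (- (h * absg2) * (h * absg2) * (ap (pre v) (rem2 a X) + G * ap (pre v) (rem0 a X))).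
  - field; auto.
  - rewrite Hh; ring.
Qed.

(** From n = (n - 2) + 2 for n >= 2; the indices 0 and 1 are empty on both sides. This is the origin
    of the multiplier [kap]. *)
Lemma T_split (phi : nat -> R) : bnd phi -> ap phi T = ap phi Y + 2 * ap phi D.
Proof.
  intros Hp. rewrite <- ap_scal, <- ap_add by auto. apply ap_ext. intros n.
  simpl. unfold frac. unfold Rdiv.
  destruct n as [|[|n]]; unfold kap; simpl; try ring.
  rewrite Nat.sub_0_r. change (match n with O => 1 | S _ => INR n + 1 end) with (INR (S n)).
  rewrite !S_INR. ring.
Qed.

(** Since |g|^2 = 2 m J - 1 and T = Y + 2 D, most D terms cancel and the left side is -2 m Re (conj
    (g^2) Q) with Q = D + m J Y + 2 s v g + (bt / (2 m)) g^2. By the power series identity Q = - m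
    g^2 r, and conj (g^2) g^2 = |g|^4. *)
Lemma linear_part :
  2 * (m * absg2) * lval - m * m * lvval - 2 * s * (N1val * absg2) - bt * (absg2 * absg2)
  = 2 * (m * m) * (absg2 * absg2) * ap (pre v) r.
Proof.
  assert (Hm : m <> 0) by (pose proof (mu_ge1 a); unfold m; lra).
  destruct complex_identity as [E1 E2].
  pose proof (T_split (pre v) bre) as T1. pose proof (T_split (pim v) bim) as T2.
  fold t1 d1 in T1. fold t2 d2 in T2. fold d1 in E1. fold d2 in E2. fold J in E1, E2.
  set (y1 := ap (pre v) Y) in *. set (y2 := ap (pim v) Y) in *.
  set (r1 := ap (pre v) r) in *. set (r2 := ap (pim v) r) in *.
  pose proof (mu_Cc a) as HM. fold m c in HM. unfold sqmod in Hv.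
  unfold lval, lvval, N1val, absg2. fold m c. rewrite T1, T2.
  set (p := fst v) in *. set (w := snd v) in *.
  set (k := bt / (2 * m)) in *.
  replace bt with (2 * m * k) by (unfold k; field; auto).
  assert (HJ : J = m + c * p) by reflexivity.
  assert (Hw : w * w = 1 - p * p) by lra.
  assert (Ea : 2 * (m * m) - 1 + 2 * (m * c) * p = 2 * m * J - 1) by (rewrite HJ; ring).
  (* [H1] and [H2] are the real and imaginary parts of g^2 = 1 + 2 c J v. [F3] says |g^2| = 2 m J -
     1, and [F4] rewrites N1 |g|^2 as 2 m Re (conj (g^2) v g). *)
  set (H1 := 1 + 2 * c * J * p). set (H2 := 2 * c * J * w).
  assert (F1 : m * m + 2 * m * c * p + c * c * (p * p - w * w) = H1)
    by (unfold H1; rewrite Hw, HM, HJ; ring).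
  assert (F2 : 2 * m * c * w + c * c * (2 * (p * w)) = H2) by (unfold H2; rewrite HJ; ring).
  assert (F3 : H1 * H1 + H2 * H2 = (2 * m * J - 1) * (2 * m * J - 1)).
  { transitivity (1 + 4 * c * J * p + 4 * (c * c) * (J * J)).
    - unfold H1, H2. transitivity (1 + 4 * c * J * p + 4 * (c * c) * (J * J) * (p * p + w * w));
        [ring|rewrite Hw; ring].
    - transitivity (4 * (m * m) * (J * J) - 4 * m * J + 1); [|ring]. rewrite HM.
      replace m with (J - c * p) by (rewrite HJ; ring). ring. }
  assert (F4 : (2 * (c * m) + (2 + 2 * (c * c)) * p) * (2 * m * J - 1)
     = 2 * m * (H1 * (m * p + c * (p * p - w * w)) + H2 * (m * w + c * (2 * (p * w))))).
  { replace (2 + 2 * (c * c)) with (2 * (m * m)) by lra.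
    transitivity (2 * m * ((c + m * p) * (2 * m * J - 1))); [ring|]. f_equal.
    transitivity (H1 * (m * p + c * (2 * (p * p) - 1)) + 2 * c * J * (w * w) * (m + 2 * c * p)).
    - rewrite Hw. unfold H1.
      transitivity ((c + m * p) * (2 * (m * m) + 2 * m * c * p - 1)); [rewrite HJ; ring|].
      rewrite HM. rewrite HJ.
      transitivity (m * p + c * (2 * (p * p) - 1)
        + 2 * c * (m + c * p) * (m + c * p)); [|ring].
      transitivity (c + m * p + 2 * (c * c) * m * p + 2 * c * (c * c) + 2 * m * c * c * p
         + 2 * (m * m) * c * (p * p)); [ring|]. rewrite HM.
      transitivity (m * p + 2 * c * (p * p) - c + 2 * c * (m * m) + 4 * (c * c) * m * p
         + 2 * c * (c * c) * (p * p)); [|ring]. rewrite HM. ring.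
    - unfold H2. replace (p * p - w * w) with (2 * (p * p) - 1) by lra. ring. }
  assert (Hr : 2 * m * (H1 * (m * (H1 * r1 - H2 * r2)) + H2 * (m * (H1 * r2 + H2 * r1)))
     = 2 * (m * m) * ((H1 * H1 + H2 * H2) * r1)) by ring.
  rewrite Ea. rewrite <- F3 at 2.
  transitivity (2 * m * (H1 * (m * (H1 * r1 - H2 * r2)) + H2 * (m * (H1 * r2 + H2 * r1))));
    [|rewrite Hr; ring].
  assert (A1 : m * (H1 * r1 - H2 * r2) = - (d1 + m * J * y1)
      - 2 * s * (m * p + c * (p * p - w * w)) - k * H1).
  { rewrite <- F1 at 2. rewrite <- E1. rewrite <- F1, <- F2. ring. }
  assert (A2 : m * (H1 * r2 + H2 * r1) = - (d2 + m * J * y2)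
      - 2 * s * (m * w + c * (2 * (p * w))) - k * H2).
  { rewrite <- F2 at 2. rewrite <- E2. rewrite <- F1, <- F2. ring. }
  rewrite A1, A2.
  transitivity (2 * m * (H1 * (- (d1 + m * J * y1)) + H2 * (- (d2 + m * J * y2)))
    - 2 * s * (2 * m * (H1 * (m * p + c * (p * p - w * w)) + H2 * (m * w + c * (2 * (p * w)))))
    - 2 * m * k * (H1 * H1 + H2 * H2)); [|ring].
  rewrite <- F4, F3. unfold H1, H2. ring.
Qed.

Let N := m + s + c * (N1val + lval + n2val).
Let V := absg2 * absg2 + c * (lvval + v2val).
Let f00 := m + s.

(** Modulo the relations of the unperturbed wave, the two sides differ by c times the sum of linear
    part, [rem2] and G times [rem0], and this sum vanishes by the choice of r. *)
Lemma reduced_equation :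
  N * N = (f00 * f00 + 2 * G * f00 + c * bt - 2 * G * (f00 + c * e1val)) * V.
Proof.
  pose proof linear_part as HL. pose proof re_r as HR. rewrite re_rem2, re_rem0 in HR.
  rewrite <- HL in HR. clear HL.
  pose proof (mu_Cc a) as HM. fold m c in HM.
  assert (EN1 : c * N1val = m * absg2 - m).
  { unfold N1val, absg2. fold m c.
    transitivity (2 * (c * c) * m + 2 * (1 + c * c) * c * fst v); [ring|].
    rewrite <- HM. replace (c * c) with (m * m - 1) by lra. ring. }
  assert (EJ : absg2 = 2 * m * J - 1) by (unfold absg2, J; fold m c; ring).
  assert (EV : absg2 * absg2 = 1 + 2 * (J * (c * N1val))).
  { rewrite EN1, EJ. replace (1 + 2 * (J * (m * (2 * m * J - 1) - m)))
      with (4 * (m * m) * (J * J) - 4 * m * J + 1) by ring. ring. }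
  unfold N, V, f00. 
  set (g := absg2) in *. set (n1 := N1val) in *. set (l := lval) in *. set (n2 := n2val) in *.
  set (lv := lvval) in *. set (v2 := v2val) in *. set (e := e1val) in *.
  (* The unperturbed wave solves the equation for G = 0; a factor c is already divided out. *)
  assert (E0 : 2 * m * n1 + c * (n1 * n1) - m * m * (2 * (J * n1)) = 0).
  { transitivity (n1 * (2 * m + c * n1 - 2 * (m * m) * J)); [ring|]. rewrite EN1, EJ. ring. }
  assert (Hfin : c * (2 * (m + s) * (n1 + l + n2) + c * ((n1 + l + n2) * (n1 + l + n2))
     - (m + s) * (m + s) * (2 * (J * n1) + lv + v2)
     - (bt - 2 * G * e) * (g * g + c * (lv + v2))) = 0).
  { apply Rmult_eq_0_compat_l.
    transitivity ((2 * m * n1 + c * (n1 * n1) - m * m * (2 * (J * n1)))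
      + 2 * m * ((1 + 0) * (l + n2)) + 2 * (c * n1) * (l + n2) + 2 * s * (l + n2)
      + 2 * s * (n1 - m * (2 * (J * n1)))
      + c * ((l + n2) * (l + n2)) - m * m * (lv + v2) - 2 * m * s * (lv + v2)
      - s * s * (2 * (J * n1) + lv + v2) - (bt - 2 * G * e) * (g * g + c * (lv + v2))); [ring|].
    rewrite E0, EN1. replace (n1 - m * (2 * (J * n1))) with (- (n1 * g)) by (rewrite EJ; ring).
    lra. }
  rewrite EV in *. lra.
Qed.
End Pointwise.

(** * The boundary relations of the perturbed waves *)

Definition evr (w : nat -> R) (v : C) : R := Series (fun n => w n * pre v n).
Definition evi (w : nat -> R) (v : C) : R := Series (fun n => w n * pim v n).
Definition theta (w : nat -> R) (n : nat) : R := INR n * w n.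

Definition fseq (a s : R) (d : nat -> R) (n : nat) : R :=
  match n with O => mu a + s | 1%nat => 2 * Cc a | _ => Cc a * d n end.

(* The real part of f is the height above the level y = -1: [hh] has real part Y^2 / 2, and the last
   equation is Bernoulli's law, J being the boundary derivative of the disc automorphism. *)
Definition boundary_relations (a s : R) (d hh : nat -> R) (G b : R) : Prop :=
  forall v : C, sqmod v = 1 ->
    let f := fseq a s d in
    let Y := evr f v in
    let J := mu a + Cc a * fst v in
    evr hh v = Y * Y / 2 /\
    Y * evi (theta f) v - evi (theta hh) v = 0 /\
    (Y + J * (Y * evr (theta f) v - evr (theta hh) v)) ^ 2
    = (b - 2 * G * Y) * ((1 + J * evr (theta f) v) ^ 2 + (J * evi (theta f) v) ^ 2).

Lemma ap_bil_add_l (k : ker) (p p' q : W) (phi : nat -> R) : bnd phi ->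
  ap phi (bil k (wadd p p') q) = ap phi (bil k p q) + ap phi (bil k p' q).
Proof.
  intros H. rewrite !ap_bil_dser by auto. unfold dser. apply ap_add, dbnd_col, dbnd_ker, H.
Qed.
Lemma ap_bil_scal_l (k : ker) (c : R) (p q : W) (phi : nat -> R) : bnd phi ->
  ap phi (bil k (wscal c p) q) = c * ap phi (bil k p q).
Proof. intros H. rewrite !ap_bil_dser by auto. unfold dser. apply ap_scal. Qed.
Lemma ap_bil_add_r (k : ker) (p q q' : W) (phi : nat -> R) : bnd phi ->
  ap phi (bil k p (wadd q q')) = ap phi (bil k p q) + ap phi (bil k p q').
Proof.
  intros H. pose proof (dbnd_ker k phi H) as HB.
  rewrite !ap_bil_dser by auto. unfold dser. unfold ap at 1 3 5.
  rewrite <- Series_plus; try (apply ap_ex; now apply dbnd_col).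
  apply Series_ext; intros n. rewrite ap_add; [ring|]. apply (dbnd_row _ n HB).
Qed.
Lemma ap_bil_scal_r (k : ker) (c : R) (p q : W) (phi : nat -> R) : bnd phi ->
  ap phi (bil k p (wscal c q)) = c * ap phi (bil k p q).
Proof.
  intros H. rewrite !ap_bil_dser by auto. unfold dser. unfold ap at 1 3.
  rewrite <- Series_scal_l. apply Series_ext; intros n. rewrite ap_scal. ring.
Qed.

Section Wave.
Variables (v : C) (a : par) (G : R) (X : W).
Hypothesis Hv : sqmod v = 1.
Hypothesis HX : forall k, X k = Off a X k + Aw a (rw a (rem2 a X)) k + G * Aw a (rw a (rem0 a X)) k.

Definition fw : W :=
  wadd (sd (mu a + X 1%nat) 0) (wadd (sd (2 * Cc a) 1) (wscal (Cc a) (Dw a X))).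

Let bre : bnd (pre v). Proof. apply bnd_pre; lra. Qed.
Let bim : bnd (pim v). Proof. apply bnd_pim; lra. Qed.

Lemma fw_fseq (n : nat) : fw n = fseq a (X 1%nat) (Dw a X) n.
Proof.
  destruct n as [|[|n]]; simpl; rewrite ?frac_d_small by lia; ring.
Qed.

Lemma theta_fw (phi : nat -> R) : bnd (fun n => INR n * phi n) ->
  ap (fun n => INR n * phi n) fw = 2 * Cc a * phi 1%nat + Cc a * ap phi (Tw a X).
Proof.
  intros H. unfold fw, sd. rewrite !ap_add, !ap_scal, !ap_delta by auto.
  replace (ap (fun n => INR n * phi n) (Dw a X)) with (ap phi (Tw a X)).
  - simpl; ring.
  - apply Series_ext. intros [|[|n]].
    + simpl. rewrite frac_d_small by lia. unfold frac; simpl. unfold Rdiv; ring.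
    + simpl. rewrite frac_d_small by lia. unfold frac; simpl. unfold Rdiv; ring.
    + change (frac al_t a (S (S n)) * X (S (S n)) * phi (S (S n))
        = frac al_d a (S (S n)) * X (S (S n)) * (INR (S (S n)) * phi (S (S n)))).
      unfold frac, al_d, al_t, Rdiv. ring.
Qed.

Lemma qf_fw : ap (pre v) (bil kqf fw fw)
  = 2 * (Cc a * Cc a) + 2 * (Cc a * Cc a) * (fst v * ap (pre v) (Dw a X) + snd v * ap (pim v) (Dw a X))
    + Cc a * Cc a * ap (pre v) (bil kqf (Dw a X) (Dw a X)).
Proof.
  unfold fw, sd. rewrite !ap_bil_add_l, !ap_bil_scal_l by auto.
  rewrite !ap_bil_add_r, !ap_bil_scal_r by auto.
  rewrite !(ap_qf_delta0_l v Hv), !(ap_qf_delta0_r v Hv), !(ap_qf_delta1_l v Hv).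
  rewrite (ap_qf_sym v Hv (delta 1) (Dw a X)).
  2:{ exists 1%nat. intros n Hn. simpl. now rewrite (proj2 (Nat.eqb_neq n 1) Hn). }
  rewrite (ap_qf_delta1_l v Hv), (proj1 (ap_dn v Hv (Dw a X) (D0 a X))).
  replace (ap (pre v) (dn (delta 1))) with 1.
  - field.
  - rewrite <- (pre0 v), <- (ap_delta (pre v) 0). apply ap_ext. intros [|n]; reflexivity.
Qed.

(** The term 2 G (mu + s) cancels the mean value in 2 G Y. What is left of the gravity term is
    proportional to C, as the division by C requires. *)
Definition bern : R :=
  (mu a + X 1%nat) * (mu a + X 1%nat) + 2 * G * (mu a + X 1%nat) + Cc a * X 0%nat.

Lemma wave_equation :
  let Y := ap (pre v) fw in
  let J := mu a + Cc a * fst v in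
  let h1 := ap (fun n => INR n * pre v n) fw in
  let h2 := ap (fun n => INR n * pim v n) fw in
  (Y + J * ap (pre v) (bil kqf fw fw)) ^ 2
  = (bern - 2 * G * Y) * ((1 + J * h1) ^ 2 + (J * h2) ^ 2).
Proof.
  intros Y J h1 h2.
  pose proof (reduced_equation v Hv a G X HX) as E.
  assert (B1 : bnd (fun n => INR n * pre v n))
    by (apply bnd_INR; intros n; apply pow_le1_bounds; lra).
  assert (B2 : bnd (fun n => INR n * pim v n))
    by (apply bnd_INR; intros n; apply pow_le1_bounds; lra).
  unfold h1, h2. rewrite !theta_fw, qf_fw, pre1, pim1 by auto.
  assert (EY : Y = mu a + X 1%nat + Cc a * (2 * fst v + ap (pre v) (Dw a X))).
  { unfold Y, fw. rewrite !ap_add, !re_sd, ap_scal, pre0, pre1 by auto. ring. }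
  rewrite EY. clear Y h1 h2 EY.
  unfold e1val, lval, lvval, n2val, v2val, N1val, absg2 in E. fold J in E.
  set (d1 := ap (pre v) (Dw a X)) in *. set (d2 := ap (pim v) (Dw a X)) in *.
  set (t1 := ap (pre v) (Tw a X)) in *. set (t2 := ap (pim v) (Tw a X)) in *.
  set (q := ap (pre v) (bil kqf (Dw a X) (Dw a X))) in *.
  pose proof (mu_Cc a) as HM. unfold sqmod in Hv. unfold bern.
  set (m := mu a) in *. set (c := Cc a) in *. set (s := X 1%nat) in *. set (bt := X 0%nat) in *.
  set (p := fst v) in *. set (w := snd v) in *.
  assert (HJ : J = m + c * p) by reflexivity. clearbody J.
  assert (EN : m + s + c * (2 * p + d1) + J * (2 * (c * c) + 2 * (c * c) * (p * d1 + w * d2) + c * c * q)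
    = m + s + c * (2 * (c * m) + (2 + 2 * (c * c)) * p + (d1 + 2 * c * (J * (p * d1 + w * d2))) + c * (J * q)))
    by (rewrite HJ; ring).
  assert (EVo : (2 * (m * m) - 1 + 2 * (m * c) * p) * (2 * (m * m) - 1 + 2 * (m * c) * p)
     = 1 + 4 * c * J * p + 4 * (c * c) * (J * J)).
  { transitivity ((2 * m * J - 1) * (2 * m * J - 1)); [rewrite HJ; ring|].
    transitivity (4 * (m * m) * (J * J) - 4 * m * J + 1); [ring|]. rewrite HM.
    replace m with (J - c * p) by (rewrite HJ; ring). ring. }
  assert (EV : (1 + J * (2 * c * p + c * t1)) ^ 2 + (J * (2 * c * w + c * t2)) ^ 2
    = (2 * (m * m) - 1 + 2 * (m * c) * p) * (2 * (m * m) - 1 + 2 * (m * c) * p)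
      + c * (2 * (J * t1) + 4 * c * (J * (J * (p * t1 + w * t2))) + c * (J * (J * (t1 * t1 + t2 * t2))))).
  { rewrite EVo. replace (w * t2) with (w * t2) by ring.
    transitivity (1 + 4 * c * J * p + 4 * (c * c) * (J * J) * (p * p + w * w)
      + c * (2 * (J * t1) + 4 * c * (J * (J * (p * t1 + w * t2))) + c * (J * (J * (t1 * t1 + t2 * t2)))));
      [ring|]. rewrite Hv. ring. }
  rewrite EN, EV, <- E. ring.
Qed.
End Wave.

Lemma co_decay (w : W) (M : R) (n : nat) : nrm w <= M -> Rabs (w n) <= M * (5 / 6) ^ n.
Proof.
  intros H. pose proof (co_le_nrm w n) as H1. pose proof (rho_pow_pos n) as Hr.
  apply Rmult_le_reg_r with (rho ^ n); auto.
  rewrite Rmult_assoc, <- Rpow_mult_distr.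
  replace (5 / 6 * rho) with 1 by (unfold rho; field). rewrite pow1. lra.
Qed.

Lemma bil_const (k : ker) (p q : W) (n : nat) :
  (forall m, (1 <= m)%nat -> p m = 0) -> (forall m, (1 <= m)%nat -> q m = 0) ->
  (1 <= n)%nat -> bil k p q n = 0.
Proof.
  intros Hp Hq Hn. set (phi := fun i => if Nat.eqb i n then 1 else 0).
  pose proof (bnd_coord n) as Hb. fold phi in Hb.
  assert (E : ap phi (bil k p q) = bil k p q n).
  { unfold ap. rewrite (Series_single _ n).
    - unfold phi. rewrite Nat.eqb_refl; ring.
    - intros i Hi. unfold phi. rewrite (proj2 (Nat.eqb_neq i n) Hi); ring. }
  rewrite <- E, ap_bil_dser by auto. unfold dser, ap.
  rewrite (Series_single _ 0), (Series_single _ 0).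
  - unfold phi. simpl. destruct n; [lia|]. simpl. ring.
  - intros m Hm. rewrite Hq by lia. ring.
  - intros m Hm. rewrite Hp by lia. ring.
Qed.

(** This collects all that the geometric part uses. The geometric decay (5/6)^n, with constants
    uniform in the parameter, replaces the weighted norm from here on. *)
Theorem analytic_core (eta : R) : 0 < eta -> exists eps, 0 < eps /\ forall G, Rabs G < eps ->
  exists (s b : par -> R) (d : par -> nat -> R),
    slip s /\ slip b /\
    (exists L, 0 <= L /\ forall (a a' : par) n, Rabs (d a n - d a' n) <= L * Rabs (a - a') * (5 / 6) ^ n) /\
    forall a : par, Rabs (s a) <= eta /\ d a 0%nat = 0 /\ d a 1%nat = 0 /\
      (forall n, Rabs (d a n) <= eta * (5 / 6) ^ n) /\
      exists (hh : nat -> R) (M : R), (forall n, Rabs (hh n) <= M * (5 / 6) ^ n) /\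
      (pa a = 0 -> forall n, (1 <= n)%nat -> hh n = 0) /\
      boundary_relations a (s a) (d a) hh G (b a).
Proof.
  intros Heta. destruct ord_D as (K & HK & HD).
  (* The coefficients of D have norm at most K e, so e (K + 1) <= eta makes them and the mean height
     small. *)
  set (e := Rmin 1 (eta / (K + 1))).
  assert (He0 : 0 < eta / (K + 1)) by (apply Rdiv_lt_0_compat; lra).
  assert (He : 0 < e) by (unfold e; apply Rmin_glb_lt; lra).
  assert (He1 : e <= 1) by apply Rmin_l.
  assert (HeK : e * (K + 1) <= eta).
  { apply Rle_trans with (eta / (K + 1) * (K + 1)).
    - apply Rmult_le_compat_r; [lra|apply Rmin_r].
    - right; field; lra. }
  destruct (fixed_family e He) as (eps & Heps & HG).
  exists eps; split; auto. intros G HGe. destruct (HG G HGe) as (X & L & HL & HX).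
  assert (Hc : forall i a b, Rabs (X a i - X b i) <= L * Rabs (a - b)).
  { intros i a b. destruct (HX a b) as (_ & _ & H). rewrite <- wsub_co.
    pose proof (co_le_nrm (wsub (X a) (X b)) i). pose proof (rho_pow_ge1 i).
    pose proof (Rabs_pos (wsub (X a) (X b) i)). nra. }
  assert (Hb : forall i a, Rabs (X a i) <= e).
  { intros i a. destruct (HX a a) as (H & _ & _).
    pose proof (co_le_nrm (X a) i). pose proof (rho_pow_ge1 i).
    pose proof (Rabs_pos (X a i)). nra. }
  assert (Hs : forall i, slip (fun a => X a i)).
  { intros i. exists (1 + L). split; [lra|]. intros a b. specialize (Hb i a).
    specialize (Hc i a b). pose proof (Rabs_pos (a - b)). split; nra. }
  exists (fun a => X a 1%nat), (fun a => bern a G (X a)), (fun a => Dw a (X a)).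
  split; [apply Hs|]. split.
  { unfold bern. repeat first [apply slip_mu | apply slip_Cc | apply (Hs 0%nat) | apply (Hs 1%nat)
      | apply slip_const | apply slip_add | apply slip_mul]. }
  split.
  { exists (K * L + K). assert (0 <= K * L) by nra. split; [lra|]. intros a b n.
    rewrite <- wsub_co. apply co_decay.
    destruct (HX a b) as (H1 & _ & H2). destruct (HX b b) as (H3 & _ & _).
    eapply Rle_trans; [apply (nrm_sub_triang _ (Dw a (X b)))|].
    destruct (HD a b 1 (X a) (X b)) as (_ & H4 & _); try lra.
    destruct (HD a b 1 (X b) (X b)) as (_ & _ & H5); try lra.
    simpl in H4. assert (K * 1 * nrm (wsub (X a) (X b)) <= K * 1 * (L * Rabs (a - b)))
      by (apply Rmult_le_compat_l; lra). lra. }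
  intros a. destruct (HX a a) as (H1 & H2 & _).
  split; [specialize (Hb 1%nat a); nra|].
  split; [simpl; rewrite frac_d_small by lia; ring|].
  split; [simpl; rewrite frac_d_small by lia; ring|].
  split.
  { intros n. apply co_decay. destruct (HD a a e (X a) (X a)) as (H4 & _); [lra|lra|lra|].
    apply Rle_trans with (1 := H4). simpl. nra. }
  (* Half of the product of cosine series, not of power series: the real part on the circle has to
     be Y^2 / 2. *)
  set (fa := fw a (X a)). set (hw2 := wscal (/ 2) (bil kmul fa fa)).
  exists hw2, (nrm hw2). split; [intros n; apply co_decay; lra|].
  split.
  { intros E0 n Hn. assert (Hf : forall m, (1 <= m)%nat -> fa m = 0).
    { intros m Hm. unfold fa. rewrite fw_fseq. destruct m as [|[|m]]; [lia| |];
        simpl; unfold Cc; rewrite E0; unfold Rdiv; ring. }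
    change (hw2 n) with (/ 2 * bil kmul fa fa n). rewrite bil_const by auto. ring. }
  intros v Hv.
  assert (ef : forall phi, Series (fun n => fseq a (X a 1%nat) (Dw a (X a)) n * phi n) = ap phi fa).
  { intros phi. apply Series_ext; intros n. unfold fa. now rewrite fw_fseq. }
  assert (et : forall w phi, Series (fun n => theta w n * phi n)
     = Series (fun n => w n * (INR n * phi n))).
  { intros w phi. apply Series_ext; intros n. unfold theta; ring. }
  unfold evr, evi. rewrite !et, !ef. cbv zeta.
  change (Series (fun n => hw2 n * pre v n)) with (ap (pre v) hw2).
  change (Series (fun n => hw2 n * (INR n * pre v n))) with (ap (fun n => INR n * pre v n) hw2).
  change (Series (fun n => hw2 n * (INR n * pim v n))) with (ap (fun n => INR n * pim v n) hw2).
  unfold hw2. rewrite !ap_scal. destruct (qf_identity v Hv fa) as [Q1 Q2].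
  split; [rewrite ap_mul by auto; field|]. split; [lra|].
  rewrite Q1. apply (wave_equation v a G (X a) Hv H2).
Qed.

Lemma Cmod_le_abs (z : C) : Cmod z <= Rabs (fst z) + Rabs (snd z).
Proof.
  unfold Cmod. rewrite <- (sqrt_Rsqr (Rabs (fst z) + Rabs (snd z))).
  2:{ pose proof (Rabs_pos (fst z)); pose proof (Rabs_pos (snd z)); lra. }
  apply sqrt_le_1_alt. unfold Rsqr.
  pose proof (Rabs_pos (fst z)); pose proof (Rabs_pos (snd z)).
  replace (fst z ^ 2) with (Rabs (fst z) * Rabs (fst z)) by (rewrite <- Rabs_mult, Rabs_pos_eq; nra).
  replace (snd z ^ 2) with (Rabs (snd z) * Rabs (snd z)) by (rewrite <- Rabs_mult, Rabs_pos_eq; nra).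
  nra.
Qed.

Lemma re_le_Cmod (z : C) : Rabs (fst z) <= Cmod z.
Proof. eapply Rle_trans; [|apply Rmax_Cmod]. apply Rmax_l. Qed.
Lemma im_le_Cmod (z : C) : Rabs (snd z) <= Cmod z.
Proof. eapply Rle_trans; [|apply Rmax_Cmod]. apply Rmax_r. Qed.

Lemma Cmod_Ci : Cmod Ci = 1.
Proof.
  unfold Cmod, Ci; simpl. replace (0 * (0 * 1) + 1 * (1 * 1)) with 1 by ring. apply sqrt_1.
Qed.

Lemma Cmod_sqmod (z : C) : Cmod z * Cmod z = sqmod z.
Proof.
  unfold Cmod. rewrite sqrt_sqrt; [unfold sqmod; ring|nra].
Qed.

Lemma sqmod_le1 (z : C) : Cmod z <= 1 -> sqmod z <= 1.
Proof. intros H. rewrite <- Cmod_sqmod. pose proof (Cmod_ge_0 z). nra. Qed.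

(** * Power series and the conformal map *)

Definition cser (x : nat -> C) : C := (Series (fun n => fst (x n)), Series (fun n => snd (x n))).

Definition csum (x : nat -> C) : Prop := exists b, ex_series b /\ forall n, Cmod (x n) <= b n.

Lemma csum_re (x : nat -> C) : csum x -> ex_series (fun n => fst (x n)).
Proof.
  intros (b & Hb & H). apply ex_series_le_R with b; auto. intros n.
  eapply Rle_trans; [apply re_le_Cmod|auto].
Qed.
Lemma csum_im (x : nat -> C) : csum x -> ex_series (fun n => snd (x n)).
Proof.
  intros (b & Hb & H). apply ex_series_le_R with b; auto. intros n.
  eapply Rle_trans; [apply im_le_Cmod|auto].
Qed.

Lemma cser_bound (x : nat -> C) (b : nat -> R) :
  ex_series b -> (forall n, Cmod (x n) <= b n) -> Cmod (cser x) <= 2 * Series b.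
Proof.
  intros Hb H. eapply Rle_trans; [apply Cmod_le_abs|]. simpl.
  assert (Rabs (Series (fun n => fst (x n))) <= Series b).
  { apply Series_abs_le; auto. intros n; eapply Rle_trans; [apply re_le_Cmod|auto]. }
  assert (Rabs (Series (fun n => snd (x n))) <= Series b).
  { apply Series_abs_le; auto. intros n; eapply Rle_trans; [apply im_le_Cmod|auto]. }
  lra.
Qed.

Lemma cser_ext (x y : nat -> C) : (forall n, x n = y n) -> cser x = cser y.
Proof. intros H. unfold cser. f_equal; apply Series_ext; intros n; now rewrite H. Qed.

Lemma cser_add (x y : nat -> C) : csum x -> csum y ->
  cser (fun n => (x n + y n)%C) = (cser x + cser y)%C.
Proof.
  intros Hx Hy. unfold cser, Cplus; simpl.
  f_equal; apply Series_plus; auto using csum_re, csum_im.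
Qed.

Lemma cser_scal (c : C) (x : nat -> C) : csum x ->
  cser (fun n => (c * x n)%C) = (c * cser x)%C.
Proof.
  intros Hx. unfold cser, Cmult; simpl.
  pose proof (csum_re x Hx). pose proof (csum_im x Hx).
  f_equal; rewrite <- !Series_scal_l.
  - apply Series_minus; apply (ex_series_scal_l (V := R_NormedModule)); auto.
  - apply Series_plus; apply (ex_series_scal_l (V := R_NormedModule)); auto.
Qed.

Lemma csum_scal (c : C) (x : nat -> C) : csum x -> csum (fun n => (c * x n)%C).
Proof.
  intros (b & Hb & H). exists (fun n => Cmod c * b n). split.
  - apply (ex_series_scal_l (V := R_NormedModule)); auto.
  - intros n. rewrite Cmod_mult. apply Rmult_le_compat_l; auto using Cmod_ge_0.
Qed.

Lemma csum_add (x y : nat -> C) : csum x -> csum y -> csum (fun n => (x n + y n)%C).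
Proof.
  intros (b & Hb & H) (b' & Hb' & H'). exists (fun n => b n + b' n). split.
  - apply (ex_series_plus (V := R_NormedModule)); auto.
  - intros n. eapply Rle_trans; [apply Cmod_triangle|]. specialize (H n); specialize (H' n); lra.
Qed.

Definition dec (M q : R) (w : nat -> R) : Prop := forall n, Rabs (w n) <= M * q ^ n.

Definition ev (w : nat -> R) (v : C) : C := (evr w v, evi w v).

Lemma ev_cser (w : nat -> R) (v : C) : ev w v = cser (fun n => (w n * v ^ n)%C).
Proof.
  unfold ev, evr, evi, cser. f_equal; apply Series_ext; intros n; unfold pre, pim; simpl; ring.
Qed.

Lemma Cmod_pow_le1 (v : C) (n : nat) : Cmod v <= 1 -> Cmod (v ^ n)%C <= 1.
Proof.
  intros H. rewrite Cmod_pow. rewrite <- (pow1 n). apply pow_incr. split; auto using Cmod_ge_0.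
Qed.

Lemma dec_pos (M q : R) (w : nat -> R) : dec M q w -> 0 <= M.
Proof. intros H. specialize (H 0%nat). pose proof (Rabs_pos (w 0%nat)). simpl in H. lra. Qed.

Lemma dec_ex (M q : R) : 0 <= q < 1 -> ex_series (fun n => M * q ^ n).
Proof.
  intros H. apply (ex_series_scal_l (V := R_NormedModule)), ex_series_geom.
  rewrite Rabs_pos_eq; lra.
Qed.

Lemma term_bound (M q : R) (w : nat -> R) (v : C) (n : nat) :
  dec M q w -> Cmod v <= 1 -> Cmod (w n * v ^ n)%C <= M * q ^ n.
Proof.
  intros H Hv. rewrite Cmod_mult, Cmod_R. pose proof (Cmod_pow_le1 v n Hv).
  specialize (H n). pose proof (Rabs_pos (w n)). pose proof (Cmod_ge_0 (v ^ n)). nra.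
Qed.

Lemma ev_csum (M q : R) (w : nat -> R) (v : C) :
  0 <= q < 1 -> dec M q w -> Cmod v <= 1 -> csum (fun n => (w n * v ^ n)%C).
Proof.
  intros Hq H Hv. exists (fun n => M * q ^ n). split; [now apply dec_ex|].
  intros n; now apply term_bound.
Qed.

Lemma Series_dec (M q : R) : 0 <= q < 1 -> Series (fun n => M * q ^ n) = M / (1 - q).
Proof.
  intros H. rewrite Series_scal_l, Series_geom; [reflexivity|]. rewrite Rabs_pos_eq; lra.
Qed.

Lemma ev_bound (M q : R) (w : nat -> R) (v : C) :
  0 <= q < 1 -> dec M q w -> Cmod v <= 1 -> Cmod (ev w v) <= 2 * (M / (1 - q)).
Proof.
  intros Hq H Hv. rewrite ev_cser, <- Series_dec by auto. apply cser_bound; [now apply dec_ex|].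
  intros n; now apply term_bound.
Qed.

Lemma Im_pow (v : C) (n : nat) : Cmod v <= 1 -> Rabs (pim v n) <= INR n * Rabs (snd v).
Proof.
  intros Hv. induction n as [|n IH].
  - unfold pim; simpl. rewrite Rabs_R0; lra.
  - rewrite pim_S, S_INR. eapply Rle_trans; [apply Rabs_triang|]. rewrite !Rabs_mult.
    pose proof (re_le_Cmod v). destruct (pow_le1_bounds v n (sqmod_le1 v Hv)) as [H1 _].
    pose proof (Rabs_pos (fst v)). pose proof (Rabs_pos (snd v)). pose proof (Rabs_pos (pim v n)).
    assert (Rabs (fst v) * Rabs (pim v n) <= 1 * Rabs (pim v n)) by (apply Rmult_le_compat_r; lra).
    assert (Rabs (snd v) * Rabs (pre v n) <= Rabs (snd v) * 1) by (apply Rmult_le_compat_l; lra).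
    lra.
Qed.

(** Bernoulli's inequality for q' / q. Every derivative is paid for by a slightly slower decay
    rate. *)
Lemma n_geom (q q' : R) (n : nat) : 0 < q < q' -> INR n * q ^ n <= q / (q' - q) * q' ^ n.
Proof.
  intros H.
  assert (Hb : 1 + INR n * (q' / q - 1) <= (q' / q) ^ n).
  { replace (q' / q) with (1 + (q' / q - 1)) at 2 by ring. apply poly.
    assert (1 < q' / q); [|lra]. apply Rmult_lt_reg_r with q; [lra|].
    unfold Rdiv; rewrite Rmult_assoc, Rinv_l; lra. }
  assert (Hqn : 0 < q ^ n) by (apply pow_lt; lra).
  assert (E : q' ^ n = (q' / q) ^ n * q ^ n).
  { rewrite <- Rpow_mult_distr. f_equal; field; lra. }
  rewrite E. apply Rmult_le_reg_r with ((q' - q) / q); [apply Rdiv_lt_0_compat; lra|].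
  replace (q / (q' - q) * ((q' / q) ^ n * q ^ n) * ((q' - q) / q)) with ((q' / q) ^ n * q ^ n) by (field; lra).
  replace ((q' - q) / q) with (q' / q - 1) by (field; lra). nra.
Qed.

(** A series with real coefficients is real on the real axis, and |Im v^n| <= n |Im v| makes its
    imaginary part vanish there at a linear rate. Such relative bounds decide signs near the axes of
    symmetry, where Im v tends to 0. *)
Lemma evi_bound (M q q' : R) (w : nat -> R) (v : C) :
  0 < q < q' -> q' < 1 -> dec M q w -> Cmod v <= 1 ->
  Rabs (evi w v) <= M * (q / (q' - q)) / (1 - q') * Rabs (snd v).
Proof.
  intros Hq Hq' H Hv. unfold evi. pose proof (dec_pos _ _ _ H) as HM.
  apply Rle_trans with (Series (fun n => M * (q / (q' - q)) * Rabs (snd v) * q' ^ n)).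
  - apply Series_abs_le; [|apply dec_ex; lra].
    intros n. rewrite Rabs_mult. pose proof (Im_pow v n Hv). specialize (H n).
    pose proof (n_geom q q' n Hq). pose proof (Rabs_pos (snd v)). pose proof (pos_INR n).
    apply Rle_trans with (M * q ^ n * (INR n * Rabs (snd v))).
    + apply Rmult_le_compat; auto using Rabs_pos.
    + replace (M * q ^ n * (INR n * Rabs (snd v))) with ((M * Rabs (snd v)) * (INR n * q ^ n)) by ring.
      replace (M * (q / (q' - q)) * Rabs (snd v) * q' ^ n)
        with ((M * Rabs (snd v)) * (q / (q' - q) * q' ^ n)) by ring.
      apply Rmult_le_compat_l; auto. nra.
  - rewrite Series_dec by lra. right. unfold Rdiv; ring.
Qed.

Definition der (w : nat -> R) (n : nat) : R := INR (S n) * w (S n).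

Lemma dec_der (M q q' : R) (w : nat -> R) : 0 < q < q' -> q' < 1 -> dec M q w ->
  dec (M / (q' - q)) q' (der w).
Proof.
  intros Hq Hq' H n. unfold der. rewrite Rabs_mult, Rabs_pos_eq by apply pos_INR.
  pose proof (dec_pos _ _ _ H) as HM.
  pose proof (n_geom q q' (S n) Hq) as Hn. specialize (H (S n)).
  apply Rle_trans with (M * (INR (S n) * q ^ S n)).
  - pose proof (pos_INR (S n)). nra.
  - apply Rle_trans with (M * (q / (q' - q) * q' ^ S n)); [apply Rmult_le_compat_l; auto|].
    simpl. replace (M * (q / (q' - q) * (q' * q' ^ n))) with (M / (q' - q) * q' ^ n * (q * q')) by (field; lra).
    rewrite <- (Rmult_1_r (M / (q' - q) * q' ^ n)) at 2.
    apply Rmult_le_compat_l; [|nra]. apply Rmult_le_pos; [|apply pow_le; lra].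
    apply Rdiv_le_0_compat; lra.
Qed.

Definition rd (w : nat -> R) : Prop := exists M q, 0 < q < 1 /\ dec M q w.

Lemma rd_csum (w : nat -> R) (v : C) : rd w -> Cmod v <= 1 -> csum (fun n => (w n * v ^ n)%C).
Proof. intros (M & q & Hq & H) Hv. apply ev_csum with M q; auto. lra. Qed.

Lemma rd_der (w : nat -> R) : rd w -> rd (der w).
Proof.
  intros (M & q & Hq & H). exists (M / ((1 + q) / 2 - q)), ((1 + q) / 2).
  split; [lra|]. apply dec_der; auto; lra.
Qed.

Lemma dec_weaken (M M' q q' : R) (w : nat -> R) : 0 <= q <= q' -> M <= M' -> dec M q w -> dec M' q' w.
Proof.
  intros Hq HM H n. pose proof (dec_pos _ _ _ H). specialize (H n).
  assert (0 <= q ^ n <= q' ^ n) by (split; [apply pow_le; lra|apply pow_incr; lra]).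
  apply Rle_trans with (1 := H). apply Rmult_le_compat; lra.
Qed.

Lemma dec_add (M M' q : R) (w w' : nat -> R) : dec M q w -> dec M' q w' ->
  dec (M + M') q (fun n => w n + w' n).
Proof.
  intros H H' n. eapply Rle_trans; [apply Rabs_triang|]. specialize (H n); specialize (H' n). lra.
Qed.

Lemma dec_scal (c M q : R) (w : nat -> R) : dec M q w -> dec (Rabs c * M) q (fun n => c * w n).
Proof.
  intros H n. rewrite Rabs_mult, Rmult_assoc. apply Rmult_le_compat_l; auto using Rabs_pos.
Qed.

Lemma dec_up (M q : R) (w : nat -> R) : 0 < q -> dec M q w -> dec (M / q) q (up_fun w).
Proof.
  intros Hq H [|n]; simpl.
  - rewrite Rabs_R0. pose proof (dec_pos _ _ _ H). rewrite Rmult_1_r. apply Rdiv_le_0_compat; lra.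
  - eapply Rle_trans; [apply H|]. right; field; lra.
Qed.

Lemma rd_add (w w' : nat -> R) : rd w -> rd w' -> rd (fun n => w n + w' n).
Proof.
  intros (M & q & Hq & H) (M' & q' & Hq' & H').
  exists (M + M'), (Rmax q q'). split.
  - split; [apply Rlt_le_trans with q; [lra|apply Rmax_l]|apply Rmax_lub_lt; lra].
  - apply dec_add.
    + apply dec_weaken with M q; auto; [split; [lra|apply Rmax_l]|lra].
    + apply dec_weaken with M' q'; auto; [split; [lra|apply Rmax_r]|lra].
Qed.
Lemma rd_scal (c : R) (w : nat -> R) : rd w -> rd (fun n => c * w n).
Proof. intros (M & q & Hq & H). exists (Rabs c * M), q. split; auto. now apply dec_scal. Qed.
Lemma rd_up (w : nat -> R) : rd w -> rd (up_fun w).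
Proof. intros (M & q & Hq & H). exists (M / q), q. split; auto. apply dec_up; auto; lra. Qed.

Lemma ev_add (w w' : nat -> R) (v : C) : rd w -> rd w' -> Cmod v <= 1 ->
  ev (fun n => w n + w' n) v = (ev w v + ev w' v)%C.
Proof.
  intros H H' Hv. rewrite !ev_cser, <- cser_add by (auto using rd_csum).
  apply cser_ext; intros n. rewrite RtoC_plus; ring.
Qed.
Lemma ev_scal (c : R) (w : nat -> R) (v : C) : rd w -> Cmod v <= 1 ->
  ev (fun n => c * w n) v = (c * ev w v)%C.
Proof.
  intros H Hv. rewrite !ev_cser, <- cser_scal by (auto using rd_csum).
  apply cser_ext; intros n. rewrite RtoC_mult; ring.
Qed.
Lemma ev_up (w : nat -> R) (v : C) : rd w -> Cmod v <= 1 -> ev (up_fun w) v = (v * ev w v)%C.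
Proof.
  intros H Hv. rewrite !ev_cser, <- cser_scal by (auto using rd_csum). unfold cser.
  rewrite !(Series_incr_1_aux (fun n => _ (up_fun w n * v ^ n)%C)) by (simpl; ring).
  f_equal; apply Series_ext; intros n; simpl; ring.
Qed.
Lemma ev_theta (w : nat -> R) (v : C) : rd w -> Cmod v <= 1 -> ev (theta w) v = (v * ev (der w) v)%C.
Proof.
  intros H Hv. rewrite <- ev_up by (auto using rd_der).
  unfold ev, evr, evi; f_equal; apply Series_ext; intros [|n]; unfold theta, der; simpl; ring.
Qed.

Lemma pow_step (v v' : C) (n : nat) : Cmod v <= 1 -> Cmod v' <= 1 ->
  Cmod (v' ^ n - v ^ n)%C <= INR n * Cmod (v' - v).
Proof.
  intros H H'. induction n as [|n IH].
  - simpl. replace (1 - 1)%C with (RtoC 0) by ring. rewrite Cmod_0; lra.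
  - rewrite !Cpow_S, S_INR.
    replace (v' * v' ^ n - v * v ^ n)%C with (v' * (v' ^ n - v ^ n) + (v' - v) * v ^ n)%C by ring.
    eapply Rle_trans; [apply Cmod_triangle|]. rewrite !Cmod_mult.
    pose proof (Cmod_ge_0 (v' ^ n - v ^ n)). pose proof (Cmod_ge_0 (v' - v)).
    pose proof (Cmod_pow_le1 v n H). pose proof (Cmod_ge_0 (v ^ n)). pose proof (Cmod_ge_0 v'). nra.
Qed.

Lemma pow_remainder (v v' : C) (n : nat) : Cmod v <= 1 -> Cmod v' <= 1 ->
  Cmod (v' ^ S n - v ^ S n - (v' - v) * (INR (S n) * v ^ n))%C
  <= INR (S n) * INR (S n) * (Cmod (v' - v) * Cmod (v' - v)).
Proof.
  intros H H'. pose proof (Cmod_ge_0 (v' - v)) as Hd. induction n as [|n IH].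
  - replace (v' ^ 1 - v ^ 1 - (v' - v) * (INR 1 * v ^ 0))%C with (RtoC 0) by (simpl; ring).
    rewrite Cmod_0. simpl. nra.
  - replace (v' ^ S (S n) - v ^ S (S n) - (v' - v) * (INR (S (S n)) * v ^ S n))%C with
      (v * (v' ^ S n - v ^ S n - (v' - v) * (INR (S n) * v ^ n)) + (v' - v) * (v' ^ S n - v ^ S n))%C.
    2:{ rewrite !Cpow_S. rewrite (S_INR (S n)), RtoC_plus. ring. }
    eapply Rle_trans; [apply Cmod_triangle|]. rewrite !Cmod_mult.
    pose proof (pow_step v v' (S n) H H') as Hs.
    set (X := Cmod (v' ^ S n - v ^ S n - (v' - v) * (INR (S n) * v ^ n))%C) in *.
    set (Y := Cmod (v' ^ S n - v ^ S n)%C) in *. set (k := INR (S n)) in *.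
    assert (Hk : 0 <= k) by apply pos_INR.
    assert (0 <= X) by apply Cmod_ge_0. pose proof (Cmod_ge_0 v).
    rewrite (S_INR (S n)). fold k.
    assert (Cmod v * X <= 1 * X) by (apply Rmult_le_compat_r; auto).
    assert (Cmod (v' - v) * Y <= Cmod (v' - v) * (k * Cmod (v' - v))) by (apply Rmult_le_compat_l; auto).
    set (D := Cmod (v' - v)) in *. assert (0 <= D * D) by nra. nra.
Qed.

(** The remainder of v^n is at most n^2 |v' - v|^2, and the decay of the coefficients makes the sum
    converge on the closed disc, so differentiability extends to the boundary circle. *)
Lemma ev_remainder (w : nat -> R) : rd w -> exists K, 0 <= K /\ forall v v',
  Cmod v <= 1 -> Cmod v' <= 1 ->
  Cmod (ev w v' - ev w v - (v' - v) * ev (der w) v)%C <= K * (Cmod (v' - v) * Cmod (v' - v)).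
Proof.
  intros H. pose proof (rd_der _ H) as H1.
  assert (H2 : rd (fun n => INR (S n) * der w n)).
  { destruct (rd_der _ (rd_up _ H1)) as (M & q & Hq & Hd). exists M, q; split; [auto|exact Hd]. }
  destruct H2 as (M & q & Hq & Hd).
  exists (2 * (M / (1 - q))). split.
  { pose proof (dec_pos _ _ _ Hd). assert (0 <= M / (1 - q)) by (apply Rdiv_le_0_compat; lra). lra. }
  intros v v' Hv Hv'.
  assert (E : (ev w v' - ev w v - (v' - v) * ev (der w) v)%C
    = cser (fun n => (w (S n) * (v' ^ S n - v ^ S n - (v' - v) * (INR (S n) * v ^ n)))%C)).
  { assert (E0 : forall x, Cmod x <= 1 -> (ev w x = w 0%nat + cser (fun n => w (S n) * x ^ S n))%C).
    { intros x Hx. rewrite ev_cser. pose proof (rd_csum w x H Hx) as Hs. unfold cser.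
      rewrite (Series_incr_1 _ (csum_re _ Hs)), (Series_incr_1 _ (csum_im _ Hs)).
      unfold Cplus; simpl. f_equal; ring. }
    rewrite !E0 by auto. rewrite ev_cser, <- (cser_scal (v' - v)) by (auto using rd_csum).
    assert (Ss : forall x, Cmod x <= 1 -> csum (fun n => w (S n) * x ^ S n)%C).
    { intros x Hx. destruct H as (M0 & q0 & Hq0 & Hw). exists (fun n => M0 * q0 ^ S n). split.
      - apply (ex_series_incr_1 (fun n => M0 * q0 ^ n)), dec_ex; lra.
      - intros n; apply term_bound; auto. }
    transitivity (cser (fun n => w (S n) * v' ^ S n + (((-1) * (w (S n) * v ^ S n))
        + (-1) * ((v' - v) * (der w n * v ^ n)))))%C.
    - rewrite cser_add, cser_add, !cser_scal; auto using csum_scal, csum_add, rd_csum. ring.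
    - apply cser_ext; intros n. unfold der. rewrite RtoC_mult. ring. }
  rewrite E. set (D := Cmod (v' - v)).
  replace (2 * (M / (1 - q)) * (D * D)) with (2 * Series (fun n => (M * (D * D)) * q ^ n)).
  2:{ rewrite Series_dec by lra. unfold Rdiv; ring. }
  apply cser_bound; [apply dec_ex; lra|]. intros n. rewrite Cmod_mult, Cmod_R.
  pose proof (pow_remainder v v' n Hv Hv') as Hp. fold D in Hp. specialize (Hd n).
  unfold der in Hd. rewrite !Rabs_mult, (Rabs_pos_eq (INR (S n))) in Hd by apply pos_INR.
  assert (HD : 0 <= D) by apply Cmod_ge_0.
  apply Rle_trans with (Rabs (w (S n)) * (INR (S n) * INR (S n) * (D * D))).
  - apply Rmult_le_compat_l; auto using Rabs_pos.
  - replace (M * (D * D) * q ^ n) with ((M * q ^ n) * (D * D)) by ring. nra.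
Qed.

(** * Differentiation up to the boundary of the half-plane *)

Notation clh := closed_lower_half.

(* F' is the derivative of F on the closed lower half-plane, with a quadratic remainder
   that is uniform up to the boundary. *)
Definition tame (F F' : C -> C) : Prop :=
  exists K, 0 <= K /\ (forall z, clh z -> Cmod (F z) <= K /\ Cmod (F' z) <= K) /\
  forall z z', clh z -> clh z' ->
    Cmod (F z' - F z - (z' - z) * F' z)%C <= K * (Cmod (z' - z) * Cmod (z' - z)).

Lemma Cmod_minus (x y : C) : Cmod (x - y)%C <= Cmod x + Cmod y.
Proof.
  unfold Cminus. eapply Rle_trans; [apply Cmod_triangle|]. rewrite Cmod_opp. lra.
Qed.

Lemma tame_lip (F F' : C -> C) : tame F F' -> exists L, 0 <= L /\ forall z z', clh z -> clh z' ->
  Cmod (F z' - F z)%C <= L * Cmod (z' - z).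
Proof.
  intros (K & HK & HB & H). exists (2 * K). split; [lra|]. intros z z' Hz Hz'.
  pose proof (Cmod_ge_0 (z' - z)) as Hd. set (d := Cmod (z' - z)) in *.
  destruct (HB z Hz) as [B1 B2], (HB z' Hz') as [B1' _].
  destruct (Rle_dec d 1) as [L|L].
  - replace (F z' - F z)%C with ((F z' - F z - (z' - z) * F' z) + (z' - z) * F' z)%C by ring.
    eapply Rle_trans; [apply Cmod_triangle|]. rewrite Cmod_mult. fold d.
    specialize (H z z' Hz Hz'). fold d in H.
    assert (d * Cmod (F' z) <= d * K) by (apply Rmult_le_compat_l; auto).
    assert (K * (d * d) <= K * d) by (apply Rmult_le_compat_l; nra). lra.
  - eapply Rle_trans; [apply Cmod_minus|]. nra.
Qed.

Lemma tame_const (c : C) : tame (fun _ => c) (fun _ => 0%C).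
Proof.
  exists (Cmod c). split; [apply Cmod_ge_0|]. split.
  - intros z _. rewrite Cmod_0. split; [lra|apply Cmod_ge_0].
  - intros z z' _ _. replace (c - c - (z' - z) * 0)%C with (RtoC 0) by ring. rewrite Cmod_0.
    pose proof (Cmod_ge_0 c). pose proof (Cmod_ge_0 (z' - z)). nra.
Qed.

Lemma tame_ext (F G F' G' : C -> C) : (forall z, clh z -> F z = G z) ->
  (forall z, clh z -> F' z = G' z) -> tame F F' -> tame G G'.
Proof.
  intros E E' (K & HK & HB & H). exists K. split; auto. split.
  - intros z Hz. rewrite <- E, <- E' by auto. auto.
  - intros z z' Hz Hz'. rewrite <- !E, <- E' by auto. auto.
Qed.

Lemma tame_add (F F' G G' : C -> C) : tame F F' -> tame G G' ->
  tame (fun z => F z + G z)%C (fun z => F' z + G' z)%C.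
Proof.
  intros (K & HK & HB & H) (M & HM & HB' & H'). exists (K + M). split; [lra|]. split.
  - intros z Hz. destruct (HB z Hz), (HB' z Hz).
    split; (eapply Rle_trans; [apply Cmod_triangle|]; lra).
  - intros z z' Hz Hz'. specialize (H z z' Hz Hz'). specialize (H' z z' Hz Hz').
    replace (F z' + G z' - (F z + G z) - (z' - z) * (F' z + G' z))%C with
      ((F z' - F z - (z' - z) * F' z) + (G z' - G z - (z' - z) * G' z))%C by ring.
    eapply Rle_trans; [apply Cmod_triangle|]. lra.
Qed.

Lemma tame_mul (F F' G G' : C -> C) : tame F F' -> tame G G' ->
  tame (fun z => F z * G z)%C (fun z => F' z * G z + F z * G' z)%C.
Proof.
  intros TF TG. destruct (tame_lip _ _ TF) as (L & HL & HLip).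
  destruct (tame_lip _ _ TG) as (L' & HL' & HLip').
  destruct TF as (K & HK & HB & H), TG as (M & HM & HB' & H').
  assert (0 <= K * M) by nra. assert (0 <= L * L') by nra.
  exists (2 * (K * M) + L * L'). split; [lra|]. split.
  - intros z Hz. destruct (HB z Hz), (HB' z Hz).
    pose proof (Cmod_ge_0 (F z)); pose proof (Cmod_ge_0 (F' z)).
    pose proof (Cmod_ge_0 (G z)); pose proof (Cmod_ge_0 (G' z)). split.
    + rewrite Cmod_mult. assert (Cmod (F z) * Cmod (G z) <= K * M) by (apply Rmult_le_compat; auto). lra.
    + eapply Rle_trans; [apply Cmod_triangle|]. rewrite !Cmod_mult.
      assert (Cmod (F' z) * Cmod (G z) <= K * M) by (apply Rmult_le_compat; auto).
      assert (Cmod (F z) * Cmod (G' z) <= K * M) by (apply Rmult_le_compat; auto). lra.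
  - intros z z' Hz Hz'. specialize (H z z' Hz Hz'). specialize (H' z z' Hz Hz').
    specialize (HLip z z' Hz Hz'). specialize (HLip' z z' Hz Hz').
    destruct (HB z Hz) as [B1 _], (HB' z Hz) as [B2 _].
    set (d := Cmod (z' - z)) in *. assert (Hd : 0 <= d) by apply Cmod_ge_0.
    replace (F z' * G z' - F z * G z - (z' - z) * (F' z * G z + F z * G' z))%C with
      ((F z' - F z - (z' - z) * F' z) * G z + F z * (G z' - G z - (z' - z) * G' z)
       + (F z' - F z) * (G z' - G z))%C by ring.
    eapply Rle_trans; [apply Cmod_triangle|].
    eapply Rle_trans; [apply Rplus_le_compat_r, Cmod_triangle|]. rewrite !Cmod_mult.
    assert (Cmod (F z' - F z - (z' - z) * F' z) * Cmod (G z) <= (K * (d * d)) * M)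
      by (apply Rmult_le_compat; auto using Cmod_ge_0).
    assert (Cmod (F z) * Cmod (G z' - G z - (z' - z) * G' z) <= K * (M * (d * d)))
      by (apply Rmult_le_compat; auto using Cmod_ge_0).
    assert (Cmod (F z' - F z) * Cmod (G z' - G z) <= (L * d) * (L' * d))
      by (apply Rmult_le_compat; auto using Cmod_ge_0).
    lra.
Qed.

Lemma tame_inv (F F' : C -> C) (c : R) : 0 < c -> (forall z, clh z -> c <= Cmod (F z)) ->
  tame F F' -> tame (fun z => / F z)%C (fun z => - F' z * (/ F z * / F z))%C.
Proof.
  intros Hc Hlow TF. destruct (tame_lip _ _ TF) as (L & HL & HLip).
  destruct TF as (K & HK & HB & H).
  set (i := / c). assert (Hi : 0 < i) by (apply Rinv_0_lt_compat; auto).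
  assert (Hnz : forall z, clh z -> F z <> 0%C).
  { intros z Hz E. specialize (Hlow z Hz). rewrite E, Cmod_0 in Hlow. lra. }
  assert (Hinv : forall z, clh z -> Cmod (/ F z) <= i).
  { intros z Hz. rewrite Cmod_inv by (now apply Hnz). apply Rinv_le_contravar; auto. }
  assert (0 <= K * (i * i)) by (apply Rmult_le_pos; nra).
  assert (0 <= L * L * (i * i * i)) by (repeat apply Rmult_le_pos; lra).
  exists (i + K * (i * i) + L * L * (i * i * i)). split; [lra|]. split.
  - intros z Hz. specialize (Hinv z Hz). destruct (HB z Hz).
    pose proof (Cmod_ge_0 (/ F z)). split; [lra|].
    rewrite !Cmod_mult, Cmod_opp.
    assert (Cmod (F' z) * (Cmod (/ F z) * Cmod (/ F z)) <= K * (i * i)).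
    { apply Rmult_le_compat; auto using Cmod_ge_0; [nra|]. apply Rmult_le_compat; auto. }
    lra.
  - intros z z' Hz Hz'. pose proof (Hinv z Hz) as I1. pose proof (Hinv z' Hz') as I2.
    specialize (H z z' Hz Hz'). specialize (HLip z z' Hz Hz').
    set (d := Cmod (z' - z)) in *. assert (Hd : 0 <= d) by apply Cmod_ge_0.
    replace (/ F z' - / F z - (z' - z) * (- F' z * (/ F z * / F z)))%C with
      (- ((F z' - F z - (z' - z) * F' z) * (/ F z * / F z))
        + (F z' - F z) * (F z' - F z) * (/ F z * / F z * / F z'))%C
      by (field; split; apply Hnz; auto).
    eapply Rle_trans; [apply Cmod_triangle|]. rewrite Cmod_opp, !Cmod_mult.
    pose proof (Cmod_ge_0 (/ F z)). pose proof (Cmod_ge_0 (/ F z')).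
    assert (Cmod (/ F z) * Cmod (/ F z) <= i * i) by (apply Rmult_le_compat; auto).
    assert (Cmod (/ F z) * Cmod (/ F z) * Cmod (/ F z') <= i * i * i)
      by (apply Rmult_le_compat; auto; nra).
    assert (Cmod (F z' - F z) * Cmod (F z' - F z) <= (L * d) * (L * d))
      by (apply Rmult_le_compat; auto using Cmod_ge_0).
    assert (A1 : Cmod (F z' - F z - (z' - z) * F' z) * (Cmod (/ F z) * Cmod (/ F z)) <= (K * (d * d)) * (i * i))
      by (apply Rmult_le_compat; auto using Cmod_ge_0; nra).
    assert (A2 : Cmod (F z' - F z) * Cmod (F z' - F z) * (Cmod (/ F z) * Cmod (/ F z) * Cmod (/ F z'))
       <= (L * d) * (L * d) * (i * i * i)).
    { apply Rmult_le_compat; auto.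
      - apply Rmult_le_pos; apply Cmod_ge_0.
      - apply Rmult_le_pos; auto. apply Rmult_le_pos; auto. }
    assert (0 <= i * (d * d)) by (apply Rmult_le_pos; nra).
    lra.
Qed.

Lemma tame_ev (w : nat -> R) (F F' : C -> C) : rd w -> (forall z, clh z -> Cmod (F z) <= 1) ->
  tame F F' -> tame (fun z => ev w (F z)) (fun z => F' z * ev (der w) (F z))%C.
Proof.
  intros Hw HF TF. destruct (tame_lip _ _ TF) as (L & HL & HLip).
  destruct TF as (K & HK & HB & H).
  destruct (ev_remainder w Hw) as (R1 & HR1 & Hrem).
  destruct Hw as (M & q & Hq & Hd) eqn:E. clear E.
  destruct (rd_der w Hw) as (M' & q' & Hq' & Hd').
  set (B := 2 * (M / (1 - q))). set (B' := 2 * (M' / (1 - q'))).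
  assert (HB0 : 0 <= B) by (pose proof (dec_pos _ _ _ Hd); assert (0 <= M / (1 - q)) by (apply Rdiv_le_0_compat; lra); unfold B; lra).
  assert (HB0' : 0 <= B') by (pose proof (dec_pos _ _ _ Hd'); assert (0 <= M' / (1 - q')) by (apply Rdiv_le_0_compat; lra); unfold B'; lra).
  assert (Be : forall v, Cmod v <= 1 -> Cmod (ev w v) <= B) by (intros; apply (ev_bound M q); auto; lra).
  assert (Be' : forall v, Cmod v <= 1 -> Cmod (ev (der w) v) <= B') by (intros; apply (ev_bound M' q'); auto; lra).
  assert (0 <= K * B') by nra. assert (0 <= R1 * (L * L)) by (apply Rmult_le_pos; nra).
  exists (B + K * B' + R1 * (L * L)). split; [lra|]. split.
  - intros z Hz. split; [specialize (Be (F z) (HF z Hz)); lra|].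
    rewrite Cmod_mult. destruct (HB z Hz).
    assert (Cmod (F' z) * Cmod (ev (der w) (F z)) <= K * B')
      by (apply Rmult_le_compat; auto using Cmod_ge_0). lra.
  - intros z z' Hz Hz'. specialize (H z z' Hz Hz'). specialize (HLip z z' Hz Hz').
    specialize (Hrem (F z) (F z') (HF z Hz) (HF z' Hz')). specialize (Be' (F z) (HF z Hz)).
    set (d := Cmod (z' - z)) in *. assert (Hd0 : 0 <= d) by apply Cmod_ge_0.
    replace (ev w (F z') - ev w (F z) - (z' - z) * (F' z * ev (der w) (F z)))%C with
      ((ev w (F z') - ev w (F z) - (F z' - F z) * ev (der w) (F z))
        + (F z' - F z - (z' - z) * F' z) * ev (der w) (F z))%C by ring.
    eapply Rle_trans; [apply Cmod_triangle|]. rewrite Cmod_mult.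
    assert (Cmod (F z' - F z - (z' - z) * F' z) * Cmod (ev (der w) (F z)) <= (K * (d * d)) * B')
      by (apply Rmult_le_compat; auto using Cmod_ge_0).
    assert (Cmod (F z' - F z) * Cmod (F z' - F z) <= (L * d) * (L * d))
      by (apply Rmult_le_compat; auto using Cmod_ge_0).
    assert (R1 * (Cmod (F z' - F z) * Cmod (F z' - F z)) <= R1 * ((L * d) * (L * d)))
      by (apply Rmult_le_compat_l; auto).
    assert (0 <= B * (d * d)) by (apply Rmult_le_pos; nra).
    lra.
Qed.

(** * The exponential and the disc automorphism *)

Lemma mvt_simple (f f' : R -> R) (x : R) : (forall t, is_derive f t (f' t)) ->
  exists c, Rabs c <= Rabs x /\ f x - f 0 = f' c * x.
Proof.
  intros H. destruct (MVT_gen f 0 x f') as (c & Hc & E).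
  - intros; apply H.
  - intros t _. apply continuity_pt_filterlim. apply (ex_derive_continuous f). exists (f' t); apply H.
  - exists c. split; [|rewrite E; ring].
    revert Hc. unfold Rmin, Rmax. destruct (Rle_dec 0 x); intros Hc; unfold Rabs;
      destruct (Rcase_abs c), (Rcase_abs x); lra.
Qed.

Lemma sin_abs (x : R) : Rabs (sin x) <= Rabs x.
Proof.
  destruct (mvt_simple sin cos x) as (c & _ & E).
  { intros t. auto_derive; auto. ring. }
  rewrite sin_0, Rminus_0_r in E. rewrite E, Rabs_mult.
  pose proof (COS_bound c). assert (Rabs (cos c) <= 1) by (apply Rabs_le; lra).
  pose proof (Rabs_pos x). nra.
Qed.

Lemma cos_abs (x : R) : Rabs (cos x - 1) <= x * x.
Proof.
  destruct (mvt_simple cos (fun t => - sin t) x) as (c & Hc & E).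
  { intros t. auto_derive; auto. ring. }
  rewrite cos_0 in E. rewrite E, Rabs_mult, Rabs_Ropp.
  pose proof (sin_abs c). replace (x * x) with (Rabs x * Rabs x) by (rewrite <- Rabs_mult, Rabs_pos_eq; nra).
  apply Rmult_le_compat_r; [apply Rabs_pos|lra].
Qed.

Lemma sin_quad (x : R) : Rabs x <= 1 -> Rabs (sin x - x) <= x * x.
Proof.
  intros Hx. destruct (mvt_simple sin cos x) as (c & Hc & E).
  { intros t. auto_derive; auto. ring. }
  rewrite sin_0, Rminus_0_r in E. rewrite E. replace (cos c * x - x) with ((cos c - 1) * x) by ring.
  rewrite Rabs_mult. pose proof (cos_abs c) as H.
  replace (x * x) with (Rabs x * Rabs x) by (rewrite <- Rabs_mult, Rabs_pos_eq; nra).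
  apply Rmult_le_compat_r; [apply Rabs_pos|].
  replace (c * c) with (Rabs c * Rabs c) in H by (rewrite <- Rabs_mult, Rabs_pos_eq; nra).
  pose proof (Rabs_pos c). nra.
Qed.

Lemma exp_quad (y : R) : Rabs y <= 1 -> Rabs (exp y - 1 - y) <= 3 * (y * y).
Proof.
  intros Hy. destruct (mvt_simple exp exp y) as (c & Hc & E).
  { intros t. auto_derive; auto. ring. }
  destruct (mvt_simple exp exp c) as (c' & Hc' & E').
  { intros t. auto_derive; auto. ring. }
  rewrite exp_0 in E, E'. replace (exp y - 1 - y) with ((exp c - 1) * y) by lra.
  rewrite E', !Rabs_mult.
  assert (He : Rabs (exp c') <= 3).
  { rewrite Rabs_pos_eq by (left; apply exp_pos). apply Rle_trans with (exp 1); [|apply exp_le_3].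
    destruct (Rle_lt_or_eq_dec c' 1) as [L|L]; [|left; now apply exp_increasing|subst; lra].
    apply Rle_trans with (Rabs c'); [apply Rle_abs|lra]. }
  replace (y * y) with (Rabs y * Rabs y) by (rewrite <- Rabs_mult, Rabs_pos_eq; nra).
  pose proof (Rabs_pos c). pose proof (Rabs_pos y). pose proof (Rabs_pos (exp c')).
  assert (Rabs (exp c') * Rabs c <= 3 * Rabs y) by (apply Rmult_le_compat; auto). nra.
Qed.

Definition uu (z : C) : C := (exp (snd z) * cos (fst z), - (exp (snd z) * sin (fst z))).

Lemma Cmod_uu (z : C) : Cmod (uu z) = exp (snd z).
Proof.
  unfold Cmod, uu; simpl. pose proof (exp_pos (snd z)).
  pose proof (sin2_cos2 (fst z)) as E. unfold Rsqr in E.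
  rewrite <- (sqrt_square (exp (snd z))) at 5 by lra. f_equal.
  transitivity (exp (snd z) * exp (snd z) * (sin (fst z) * sin (fst z) + cos (fst z) * cos (fst z)));
    [ring|rewrite E; ring].
Qed.

Lemma uu_le1 (z : C) : clh z -> Cmod (uu z) <= 1.
Proof.
  intros H. rewrite Cmod_uu, <- exp_0.
  destruct (Rle_lt_or_eq_dec _ _ H) as [L|L]; [left; now apply exp_increasing|rewrite L; lra].
Qed.

Lemma uu_add (z h : C) : uu (z + h)%C = (uu z * uu h)%C.
Proof.
  unfold uu, Cmult, Cplus; simpl. rewrite exp_plus, cos_plus, sin_plus. f_equal; ring.
Qed.

Lemma uu_small (h : C) : Cmod h <= 1 -> Cmod (uu h - 1 + Ci * h)%C <= 12 * (Cmod h * Cmod h).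
Proof.
  intros Hh. eapply Rle_trans; [apply Cmod_le_abs|].
  pose proof (re_le_Cmod h) as Hx. pose proof (im_le_Cmod h) as Hy.
  destruct h as [x y]; simpl in *. set (d := Cmod (x, y)) in *.
  assert (Hx2 : x * x <= d * d).
  { replace (x * x) with (Rabs x * Rabs x) by (rewrite <- Rabs_mult, Rabs_pos_eq; nra).
    apply Rmult_le_compat; auto using Rabs_pos. }
  assert (Hy2 : y * y <= d * d).
  { replace (y * y) with (Rabs y * Rabs y) by (rewrite <- Rabs_mult, Rabs_pos_eq; nra).
    apply Rmult_le_compat; auto using Rabs_pos. }
  assert (Hxy : Rabs x * Rabs y <= d * d) by (apply Rmult_le_compat; auto using Rabs_pos).
  pose proof (exp_quad y ltac:(lra)) as E1. pose proof (cos_abs x) as E2.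
  pose proof (sin_quad x ltac:(lra)) as E3. pose proof (sin_abs x) as E4.
  assert (Ey : exp y <= 3).
  { apply Rle_trans with (exp 1); [|apply exp_le_3]. assert (y <= 1) by (pose proof (Rle_abs y); lra).
    destruct (Rle_lt_or_eq_dec y 1) as [L|L]; auto; [left; now apply exp_increasing|subst; lra]. }
  pose proof (exp_pos y).
  assert (Ey1 : Rabs (exp y - 1) <= 4 * Rabs y).
  { replace (exp y - 1) with ((exp y - 1 - y) + y) by ring.
    eapply Rle_trans; [apply Rabs_triang|].
    replace (y * y) with (Rabs y * Rabs y) in E1 by (rewrite <- Rabs_mult, Rabs_pos_eq; nra).
    pose proof (Rabs_pos y). nra. }
  replace (exp y * cos x + - (1) + (0 * x - 1 * y)) with
    ((exp y - 1 - y) + exp y * (cos x - 1)) by ring.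
  replace (- (exp y * sin x) + - 0 + (0 * y + 1 * x)) with
    (- (sin x - x) + - ((exp y - 1) * sin x)) by ring.
  pose proof (Rabs_triang (exp y - 1 - y) (exp y * (cos x - 1))) as T1.
  pose proof (Rabs_triang (- (sin x - x)) (- ((exp y - 1) * sin x))) as T2.
  rewrite Rabs_mult, (Rabs_pos_eq (exp y)) in T1 by lra. rewrite !Rabs_Ropp, Rabs_mult in T2.
  assert (exp y * Rabs (cos x - 1) <= 3 * (x * x)) by (apply Rmult_le_compat; auto using Rabs_pos; lra).
  assert (Rabs (exp y - 1) * Rabs (sin x) <= (4 * Rabs y) * Rabs x)
    by (apply Rmult_le_compat; auto using Rabs_pos).
  nra.
Qed.

Lemma tame_uu : tame uu (fun z => - Ci * uu z)%C.
Proof.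
  pose proof Cmod_Ci as HCi.
  exists 12. split; [lra|]. split.
  - intros z Hz. pose proof (uu_le1 z Hz). split; [lra|].
    rewrite Cmod_mult, Cmod_opp, HCi. lra.
  - intros z z' Hz Hz'. set (h := (z' - z)%C).
    assert (E : z' = (z + h)%C) by (unfold h; ring).
    pose proof (uu_le1 z Hz). pose proof (uu_le1 z' Hz') as Hu'. pose proof (Cmod_ge_0 h).
    pose proof (Cmod_ge_0 (uu z)).
    destruct (Rle_dec (Cmod h) 1) as [L|L].
    + rewrite E, uu_add.
      replace (uu z * uu h - uu z - h * (- Ci * uu z))%C with (uu z * (uu h - 1 + Ci * h))%C by ring.
      rewrite Cmod_mult. pose proof (uu_small h L). pose proof (Cmod_ge_0 (uu h - 1 + Ci * h)). nra.
    + replace (uu z' - uu z - h * (- Ci * uu z))%C with (uu z' - uu z + h * (Ci * uu z))%C by ring.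
      eapply Rle_trans; [apply Cmod_triangle|].
      pose proof (Cmod_minus (uu z') (uu z)). rewrite !Cmod_mult, HCi. nra.
Qed.

(* The disc automorphism u |-> (u - a) / (1 - a u), composed with zeta |-> exp (- i zeta) *)
Definition vv (a : R) (z : C) : C := ((uu z - a) * / (1 - a * uu z))%C.

Lemma den_low (a : par) (u : C) : Cmod u <= 1 -> 13 / 24 <= Cmod (1 - a * u)%C.
Proof.
  intros H. pose proof (Cmod_triangle (1 - a * u) (a * u)) as T.
  replace (1 - a * u + a * u)%C with (RtoC 1) in T by ring.
  rewrite Cmod_1, Cmod_mult, Cmod_R in T.
  destruct a as [a Ha]; simpl in *. rewrite Rabs_left1 in T by lra.
  pose proof (Cmod_ge_0 u). nra.
Qed.

Lemma den_nz (a : par) (u : C) : Cmod u <= 1 -> (1 - a * u)%C <> 0%C.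
Proof. intros H E. pose proof (den_low a u H). rewrite E, Cmod_0 in *. lra. Qed.

Lemma mob_sq (a : par) (u : C) :
  sqmod (1 - a * u)%C - sqmod (u - a)%C = (1 - a * a) * (1 - sqmod u).
Proof. unfold sqmod, Cminus, Cmult, Cplus, Copp, RtoC; simpl. ring. Qed.

Lemma sqmod_mult (x y : C) : sqmod (x * y)%C = sqmod x * sqmod y.
Proof. unfold sqmod, Cmult; simpl. ring. Qed.

Lemma sqmod_inv (x : C) : x <> 0%C -> sqmod (/ x)%C = / sqmod x.
Proof.
  intros H. rewrite <- !Cmod_sqmod, Cmod_inv by auto. rewrite Rinv_mult. reflexivity.
Qed.

Lemma sqmod_vv (a : par) (z : C) : clh z ->
  1 - sqmod (vv a z) = (1 - a * a) * (1 - sqmod (uu z)) / sqmod (1 - a * uu z)%C.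
Proof.
  intros Hz. pose proof (den_nz a _ (uu_le1 z Hz)) as Hn.
  unfold vv. rewrite sqmod_mult, sqmod_inv by auto.
  assert (0 < sqmod (1 - a * uu z)%C).
  { rewrite <- Cmod_sqmod. pose proof (den_low a _ (uu_le1 z Hz)). nra. }
  rewrite <- (mob_sq a (uu z)). field. lra.
Qed.

Lemma vv_le1 (a : par) (z : C) : clh z -> Cmod (vv a z) <= 1.
Proof.
  intros Hz. pose proof (sqmod_vv a z Hz) as E. pose proof (par_sq a).
  assert (0 < sqmod (1 - a * uu z)%C).
  { rewrite <- Cmod_sqmod. pose proof (den_low a _ (uu_le1 z Hz)). nra. }
  assert (0 <= 1 - sqmod (vv a z)).
  { rewrite E. apply Rdiv_le_0_compat; auto. pose proof (sqmod_le1 _ (uu_le1 z Hz)). nra. }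
  pose proof (Cmod_ge_0 (vv a z)). pose proof (Cmod_sqmod (vv a z)). nra.
Qed.

Lemma vv_circle (a : par) (x : R) : sqmod (vv a (x, 0)) = 1.
Proof.
  assert (Hz : clh (x, 0)) by (unfold closed_lower_half; simpl; lra).
  pose proof (sqmod_vv a _ Hz) as E.
  rewrite <- (Cmod_sqmod (uu (x, 0))), Cmod_uu in E. simpl in E. rewrite exp_0 in E.
  unfold Rdiv in E. lra.
Qed.

(** The derivative u dv/du expressed through v. It is a polynomial in v, so power series in v are
    closed under differentiation in zeta; on the circle it equals J v with J = mu + C Re v. *)
Definition kapv (a : R) (v : C) : C := (mu a * v + Cc a / 2 * (1 + v * v))%C.

Lemma kapv_vv (a : par) (z : C) : clh z ->
  kapv a (vv a z) = ((1 - a * a) * uu z * (/ (1 - a * uu z) * / (1 - a * uu z)))%C.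
Proof.
  intros Hz. pose proof (den_nz a _ (uu_le1 z Hz)) as Hn. pose proof (par_sq a) as Hp.
  assert (Hn2 : (1 - a * a)%C <> 0%C).
  { rewrite <- RtoC_mult, <- RtoC_minus. intros E. apply RtoC_inj in E. lra. }
  unfold kapv, vv, mu, Cc. unfold Rdiv.
  rewrite ?RtoC_mult, ?RtoC_inv, ?RtoC_plus, ?RtoC_minus, ?RtoC_mult by lra.
  field. repeat split; auto; try (intros E; apply RtoC_inj in E; lra).
Qed.

Lemma tame_vv (a : par) : tame (vv a) (fun z => - Ci * kapv a (vv a z))%C.
Proof.
  assert (T1 : tame (fun z => uu z - a)%C (fun z => - Ci * uu z)%C).
  { eapply tame_ext; [| |apply (tame_add _ _ _ _ tame_uu (tame_const (- a)%C))];
      intros z _; simpl; ring. }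
  assert (T2 : tame (fun z => 1 - a * uu z)%C (fun z => - a * (- Ci * uu z))%C).
  { eapply tame_ext; [| |apply (tame_add _ _ _ _ (tame_const 1%C)
      (tame_mul _ _ _ _ (tame_const (- a)%C) tame_uu))]; intros z _; simpl; ring. }
  assert (T3 := tame_inv _ _ (13 / 24) ltac:(lra) (fun z Hz => den_low a _ (uu_le1 z Hz)) T2).
  eapply tame_ext; [| |apply (tame_mul _ _ _ _ T1 T3)]; intros z Hz; [reflexivity|].
  simpl. rewrite kapv_vv by auto. pose proof (den_nz a _ (uu_le1 z Hz)) as Hn.
  field. auto.
Qed.

(** The operator i d/dzeta, acting on the coefficients of power series in v. *)
Definition Dop (a : R) (w : nat -> R) (n : nat) : R :=
  mu a * up_fun (der w) n + Cc a / 2 * (der w n + up_fun (up_fun (der w)) n).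

Lemma rd_Dop (a : R) (w : nat -> R) : rd w -> rd (Dop a w).
Proof.
  intros H. pose proof (rd_der _ H) as H1. apply rd_add; apply rd_scal.
  - now apply rd_up.
  - apply rd_add; auto. now apply rd_up, rd_up.
Qed.

Lemma ev_Dop (a : R) (w : nat -> R) (v : C) : rd w -> Cmod v <= 1 ->
  ev (Dop a w) v = (kapv a v * ev (der w) v)%C.
Proof.
  intros H Hv. pose proof (rd_der _ H) as H1. unfold Dop.
  rewrite (ev_add (fun n => mu a * up_fun (der w) n)
    (fun n => Cc a / 2 * (der w n + up_fun (up_fun (der w)) n))); auto;
    [|apply rd_scal, rd_up; auto|apply rd_scal, rd_add; auto; apply rd_up, rd_up; auto].
  rewrite (ev_scal (mu a)) by (auto using rd_up).
  rewrite (ev_scal (Cc a / 2) (fun n => der w n + up_fun (up_fun (der w)) n))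
    by (auto using rd_up, rd_add).
  rewrite ev_add by (auto using rd_up). rewrite !ev_up by (auto using rd_up).
  unfold kapv. rewrite RtoC_div by lra. ring.
Qed.

Definition EV (a : R) (w : nat -> R) (z : C) : C := ev w (vv a z).

Lemma tame_EV (a : par) (w : nat -> R) : rd w -> tame (EV a w) (fun z => - Ci * EV a (Dop a w) z)%C.
Proof.
  intros H. eapply tame_ext; [| |apply (tame_ev w _ _ H (fun z Hz => vv_le1 a z Hz) (tame_vv a))];
    intros z Hz; [reflexivity|]. simpl.
  unfold EV. rewrite ev_Dop by (auto using vv_le1). ring.
Qed.

(** * Waves given by a conformal map *)

Lemma ball_C (p q : C) (e : R) :
  ball p e q <-> Rabs (fst q - fst p) < e /\ Rabs (snd q - snd p) < e.
Proof. reflexivity. Qed.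

Lemma ball_Cmod (p q : C) (e : R) : ball p e q -> Cmod (q - p)%C < 2 * e.
Proof.
  intros H. destruct (proj1 (ball_C p q e) H) as [H1 H2].
  eapply Rle_lt_trans; [apply Cmod_le_abs|]. simpl. unfold Rminus in *. lra.
Qed.

Lemma Cmod_ball (p q : C) (e : R) : Cmod (q - p)%C < e -> ball p e q.
Proof.
  intros H. apply (proj2 (ball_C p q e)). pose proof (re_le_Cmod (q - p)%C) as H1.
  pose proof (im_le_Cmod (q - p)%C) as H2. simpl in H1, H2. unfold Rminus. lra.
Qed.

Lemma Cmod_0_eq (x y : C) : Cmod (x - y)%C = 0 -> x = y.
Proof.
  intros H. apply Cmod_eq_0 in H. replace x with ((x - y) + y)%C by ring. rewrite H. ring.
Qed.

Lemma is_derive_R_remainder (F : R -> R) (x l K del : R) : 0 < del -> 0 <= K ->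
  (forall y, Rabs (y - x) < del -> Rabs (F y - F x - (y - x) * l) <= K * (Rabs (y - x) * Rabs (y - x))) ->
  is_derive F x l.
Proof.
  intros Hd HK H. apply is_derive_Reals. intros eps Heps.
  assert (Hm : 0 < Rmin del (eps / (K + 1))).
  { apply Rmin_glb_lt; auto. apply Rdiv_lt_0_compat; lra. }
  exists (mkposreal _ Hm). simpl. intros h Hh Hlt.
  assert (H1 : Rabs h < del) by (eapply Rlt_le_trans; [exact Hlt|apply Rmin_l]).
  assert (H2 : Rabs h < eps / (K + 1)) by (eapply Rlt_le_trans; [exact Hlt|apply Rmin_r]).
  specialize (H (x + h)). replace (x + h - x) with h in H by ring. specialize (H H1).
  assert (Hp : 0 < Rabs h) by (apply Rabs_pos_lt; auto).
  replace ((F (x + h) - F x) / h - l) with ((F (x + h) - F x - h * l) / h) by (field; auto).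
  unfold Rdiv. rewrite Rabs_mult, Rabs_inv.
  apply Rmult_lt_reg_r with (Rabs h); auto. rewrite Rmult_assoc, Rinv_l, Rmult_1_r by lra.
  eapply Rle_lt_trans; [exact H|]. rewrite <- Rmult_assoc. apply Rmult_lt_compat_r; auto.
  apply Rle_lt_trans with ((K + 1) * Rabs h); [nra|].
  apply Rlt_le_trans with ((K + 1) * (eps / (K + 1))); [apply Rmult_lt_compat_l; lra|].
  right; field; lra.
Qed.

Lemma is_derive_C_remainder (F : C -> C) (x l : C) (K del : R) : 0 < del -> 0 <= K ->
  (forall y, Cmod (y - x)%C < del ->
    Cmod (F y - F x - (y - x) * l)%C <= K * (Cmod (y - x) * Cmod (y - x))) ->
  is_derive (K := C_AbsRing) (V := C_NormedModule) F x l.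
Proof.
  intros Hd HK H. split; [apply is_linear_scal_l|].
  intros x0 Hx0.
  apply (is_filter_lim_locally_unique (V := AbsRing_NormedModule C_AbsRing)) in Hx0. subst x0.
  intros eps.
  assert (Hm : 0 < Rmin del (eps / (K + 1))).
  { apply Rmin_glb_lt; auto. apply Rdiv_lt_0_compat; [apply cond_pos|lra]. }
  exists (mkposreal _ Hm). intros y Hy.
  change (Cmod (y - x)%C < Rmin del (eps / (K + 1))) in Hy.
  assert (H1 : Cmod (y - x)%C < del) by (eapply Rlt_le_trans; [exact Hy|apply Rmin_l]).
  assert (H2 : Cmod (y - x)%C < eps / (K + 1)) by (eapply Rlt_le_trans; [exact Hy|apply Rmin_r]).
  specialize (H y H1).
  change (Cmod (F y - F x - (y - x) * l)%C <= eps * Cmod (y - x)%C).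
  eapply Rle_trans; [exact H|]. pose proof (Cmod_ge_0 (y - x)%C) as Hp.
  rewrite <- Rmult_assoc. apply Rmult_le_compat_r; auto.
  apply Rle_trans with ((K + 1) * (eps / (K + 1))); [|right; field; lra].
  assert ((K + 1) * Cmod (y - x)%C <= (K + 1) * (eps / (K + 1))) by (apply Rmult_le_compat_l; lra).
  nra.
Qed.

Lemma is_derive_pair (F : R -> C) (x : R) (l : C) :
  is_derive (fun t => fst (F t)) x (fst l) -> is_derive (fun t => snd (F t)) x (snd l) ->
  is_derive (K := R_AbsRing) (V := C_R_NormedModule) F x l.
Proof.
  intros H1 H2.
  assert (H : filterdiff (K := R_AbsRing) (U := R_NormedModule) (V := C_R_NormedModule)
     (fun t => (fst (F t), snd (F t))) (locally x) (fun y : R => (scal y (fst l), scal y (snd l)))).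
  { apply (filterdiff_comp_2 (K := R_AbsRing) (T := R_NormedModule) (U := R_NormedModule)
      (V := R_NormedModule) (W := C_R_NormedModule)
      (fun t => fst (F t)) (fun t => snd (F t)) (fun u v => (u, v)) 
      (fun y => scal y (fst l)) (fun y => scal y (snd l)) (fun u v => (u, v))); auto.
    apply filterdiff_ext_lin with (fun p => p).
    - apply filterdiff_ext with (fun p => p); [intros [u w]; reflexivity|].
      apply filterdiff_id.
    - intros [u w]; reflexivity. }
  unfold is_derive. apply (filterdiff_ext_lin _ (fun y : R => (scal y (fst l), scal y (snd l)))).
  - apply filterdiff_ext with (2 := H). intros t. destruct (F t); reflexivity.
  - intros y. destruct l; reflexivity.
Qed.

(** The plane embedded as the span of the first two basis vectors, which makes the contraction
    principle available for maps of the plane. *)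
Definition C_to_W (h : C) : W := wadd (wscal (fst h) (delta 0)) (wscal (snd h) (delta 1)).
Definition W_to_C (w : W) : C := (w 0%nat, w 1%nat).

Lemma W_to_C_to_W (h : C) : W_to_C (C_to_W h) = h.
Proof. destruct h as [x y]. unfold W_to_C, C_to_W; simpl. f_equal; ring. Qed.

Lemma nrm_C_to_W (h : C) : nrm (C_to_W h) <= 11 / 5 * Cmod h.
Proof.
  eapply Rle_trans; [apply nrm_add|]. rewrite !nrm_scal, !nrm_delta. simpl.
  pose proof (re_le_Cmod h). pose proof (im_le_Cmod h). unfold rho. lra.
Qed.

Lemma Cmod_W_to_C (w : W) : Cmod (W_to_C w) <= nrm w.
Proof.
  eapply Rle_trans; [apply Cmod_le_abs|]. simpl.
  pose proof (sum_n_le_Series (fun n => Rabs (w n) * rho ^ n) 1 (term_pos w) (co_l1 w)) as H.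
  rewrite sum_Sn_R, sum_O in H. fold (nrm w) in H. simpl in H. unfold rho in H.
  pose proof (Rabs_pos (w 1%nat)). lra.
Qed.

(** The embedding costs a factor 1 + rho = 11/5, so that contraction by 1/3 becomes contraction by
    11/15 < 3/4. *)
Lemma C_fixed_point (T : C -> C) (t : R) : 0 < t ->
  (forall h, Cmod h <= t -> Cmod (T h) <= t / 3) ->
  (forall h h', Cmod h <= t -> Cmod h' <= t -> Cmod (T h - T h')%C <= Cmod (h - h')%C / 3) ->
  exists h, Cmod h <= t /\ T h = h.
Proof.
  intros Ht Hb Hl.
  destruct (fixed_point (fun w => C_to_W (T (W_to_C w))) t (3 / 4)) as (w & Hw & E); try lra.
  - intros w Hw. eapply Rle_trans; [apply nrm_C_to_W|].
    pose proof (Cmod_W_to_C w). specialize (Hb (W_to_C w) ltac:(lra)). lra.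
  - intros x y Hx Hy. pose proof (Cmod_W_to_C x). pose proof (Cmod_W_to_C y).
    specialize (Hl (W_to_C x) (W_to_C y) ltac:(lra) ltac:(lra)).
    apply Rle_trans with (nrm (C_to_W (T (W_to_C x) - T (W_to_C y))%C)).
    + right; apply nrm_ext. intros n. simpl. ring.
    + eapply Rle_trans; [apply nrm_C_to_W|].
      assert (Cmod (W_to_C x - W_to_C y)%C <= nrm (wsub x y)).
      { eapply Rle_trans; [|apply Cmod_W_to_C]. right. f_equal.
        unfold W_to_C, Cminus, Cplus, Copp; simpl. f_equal; ring. }
      pose proof (nrm_pos (wsub x y)). lra.
  - exists (W_to_C w). split; [eapply Rle_trans; [apply Cmod_W_to_C|auto]|].
    unfold W_to_C at 2. rewrite !E. change (T (W_to_C w) = W_to_C (C_to_W (T (W_to_C w)))).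
    now rewrite W_to_C_to_W.
Qed.

(** Along a Lipschitz path the supremum of the times up to which the path stays in U can be neither
    before 1 nor in V, unless U and V meet inside A. *)
Lemma path_connected (A : C -> Prop) :
  (forall p q, A p -> A q -> exists g : R -> C, g 0 = p /\ g 1 = q /\
     (forall t, 0 <= t <= 1 -> A (g t)) /\
     exists L, 0 <= L /\ forall t t', 0 <= t <= 1 -> 0 <= t' <= 1 ->
        Cmod (g t' - g t)%C <= L * Rabs (t' - t)) ->
  connected A.
Proof.
  intros HA U V HU HV Hc (p & Ap & Up) (q & Aq & Vq).
  apply NNPP; intros Hno.
  assert (Hdis : forall x, A x -> U x -> V x -> False) by (intros x H1 H2 H3; apply Hno; eauto).
  destruct (HA p q Ap Aq) as (g & G0 & G1 & GA & L & HL & GL).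
  assert (Hnb : forall (O : C -> Prop) t, open O -> 0 <= t <= 1 -> O (g t) ->
     exists del, 0 < del /\ forall t', 0 <= t' <= 1 -> Rabs (t' - t) < del -> O (g t')).
  { intros O t HO Ht Hg. destruct (HO _ Hg) as [e He].
    exists (e / (L + 1)). assert (0 < e / (L + 1)) by (apply Rdiv_lt_0_compat; [apply cond_pos|lra]).
    split; auto. intros t' Ht' Hlt. apply He, Cmod_ball.
    eapply Rle_lt_trans; [apply GL; auto|].
    apply Rle_lt_trans with ((L + 1) * Rabs (t' - t)); [pose proof (Rabs_pos (t' - t)); nra|].
    apply Rlt_le_trans with ((L + 1) * (e / (L + 1))); [apply Rmult_lt_compat_l; lra|].
    right; field; lra. }
  set (S := fun t => 0 <= t <= 1 /\ forall t', 0 <= t' <= t -> U (g t')).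
  assert (S0 : S 0).
  { split; [lra|]. intros t' Ht'. replace t' with 0 by lra. now rewrite G0. }
  destruct (completeness S) as [m [Hub Hlub]].
  { exists 1. intros t [Ht _]; lra. }
  { exists 0; auto. }
  assert (Hm : 0 <= m <= 1).
  { split; [apply Hub; auto|]. apply Hlub. intros t [Ht _]; lra. }
  assert (Hbelow : forall t, 0 <= t < m -> U (g t)).
  { intros t Ht. apply NNPP; intros Hn. assert (m <= t); [|lra].
    apply Hlub. intros t1 [H1 H2]. apply Rnot_lt_le; intros H3. apply Hn, H2. lra. }
  assert (Um : U (g m)).
  { destruct (Hc (g m) (GA m Hm)) as [H|H]; auto. exfalso.
    destruct (Hnb V m HV Hm H) as (del & Hdel & Hd).
    destruct (Req_dec m 0) as [E|E]; [rewrite E, G0 in H; now apply (Hdis p)|].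
    set (t := Rmax 0 (m - del / 2)).
    assert (Ht : 0 <= t < m).
    { unfold t. split; [apply Rmax_l|apply Rmax_lub_lt; lra]. }
    apply (Hdis (g t)); auto; [apply GA; lra|]. apply Hd; [lra|].
    rewrite Rabs_left by lra. pose proof (Rmax_r 0 (m - del / 2)). unfold t in *. lra. }
  destruct (Hnb U m HU Hm Um) as (del & Hdel & Hd).
  assert (S1 : forall t, 0 <= t <= 1 -> t < m + del -> U (g t)).
  { intros t Ht Hlt. destruct (Rlt_dec t m) as [H|H]; [apply Hbelow; lra|].
    apply Hd; auto. rewrite Rabs_pos_eq; lra. }
  destruct (Rlt_dec m 1) as [H|H].
  - set (t := Rmin 1 (m + del / 2)).
    assert (Ht : m < t <= 1) by (unfold t; split; [apply Rmin_glb_lt; lra|apply Rmin_l]).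
    assert (S t).
    { split; [lra|]. intros t' Ht'. apply S1; [lra|].
      pose proof (Rmin_r 1 (m + del / 2)). unfold t in *; lra. }
    pose proof (Hub t H0). lra.
  - apply (Hdis q); auto. rewrite <- G1. apply S1; lra.
Qed.

Definition tm (F : C -> C) : Prop := exists F', tame F F'.

Definition lips (F : C -> C) : Prop := exists L, 0 <= L /\ forall z z', clh z -> clh z' ->
  Cmod (F z' - F z)%C <= L * Cmod (z' - z).

Lemma tm_lips (F : C -> C) : tm F -> lips F.
Proof. intros [F' H]. apply (tame_lip F F' H). Qed.

Lemma lips_continuous_on (F : C -> C) : lips F -> continuous_on clh F.
Proof.
  intros (L & HL & H) z Hz P [e He].
  assert (Hd : 0 < e / (2 * (L + 1))) by (apply Rdiv_lt_0_compat; [apply cond_pos|lra]).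
  exists (mkposreal _ Hd). intros y Hy Hc. apply He, Cmod_ball.
  apply ball_Cmod in Hy. simpl in Hy. specialize (H z y Hz Hc).
  eapply Rle_lt_trans; [exact H|]. pose proof (Cmod_ge_0 (y - z)%C).
  apply Rle_lt_trans with ((L + 1) * Cmod (y - z)%C); [nra|].
  apply Rlt_le_trans with ((L + 1) * (2 * (e / (2 * (L + 1))))); [apply Rmult_lt_compat_l; lra|].
  right; field; lra.
Qed.

Lemma lower_clh (z : C) : lower_half z -> clh z.
Proof. unfold lower_half, closed_lower_half; lra. Qed.

Section Conformal.
Variables (zm dz : C -> C) (K0 M : R).
Hypothesis HK0 : 0 <= K0.
Hypothesis Hrem : forall z z', clh z -> clh z' ->
  Cmod (zm z' - zm z - (z' - z) * dz z)%C <= K0 * (Cmod (z' - z) * Cmod (z' - z)).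
Hypothesis Hdz : tm dz.
Hypothesis Hlow : exists c, 0 < c /\ forall z, clh z -> c <= Cmod (dz z).
Hypothesis Hbd : forall z, clh z -> Cmod (zm z - z)%C <= M.
Hypothesis Hinj : forall z1 z2, lower_half z1 -> clh z2 -> zm z1 = zm z2 -> z1 = z2.
Hypothesis Hper : forall z, clh z ->
  zm (fst z + 2 * PI, snd z) = (fst (zm z) + 2 * PI, snd (zm z)).

Lemma dz_nz (z : C) : clh z -> dz z <> 0%C.
Proof.
  intros Hz E. destruct Hlow as (c & Hc & H). specialize (H z Hz). rewrite E, Cmod_0 in H. lra.
Qed.

Lemma zm_lips : lips zm.
Proof.
  destruct Hdz as (F' & B & HB & HBd & _).
  assert (HM : 0 <= M).
  { assert (Hc : clh (0, 0)) by (unfold closed_lower_half; simpl; lra).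
    pose proof (Hbd _ Hc). pose proof (Cmod_ge_0 (zm (0, 0) - (0, 0))%C). lra. }
  exists (2 * M + 1 + K0 + B). split; [lra|]. intros z z' Hz Hz'.
  pose proof (Cmod_ge_0 (z' - z)) as Hd. set (d := Cmod (z' - z)) in *.
  destruct (Rle_dec d 1) as [L|L].
  - replace (zm z' - zm z)%C with ((zm z' - zm z - (z' - z) * dz z) + (z' - z) * dz z)%C by ring.
    eapply Rle_trans; [apply Cmod_triangle|]. rewrite Cmod_mult. fold d.
    pose proof (Hrem z z' Hz Hz') as H. fold d in H. destruct (HBd z Hz) as [B1 _].
    assert (d * Cmod (dz z) <= d * B) by (apply Rmult_le_compat_l; auto).
    assert (K0 * (d * d) <= K0 * d) by (apply Rmult_le_compat_l; nra). nra.
  - replace (zm z' - zm z)%C with ((zm z' - z') - (zm z - z) + (z' - z))%C by ring.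
    eapply Rle_trans; [apply Cmod_triangle|]. fold d.
    pose proof (Cmod_minus (zm z' - z') (zm z - z)).
    pose proof (Hbd z Hz). pose proof (Hbd z' Hz'). nra.
Qed.

(** Newton's iteration with the derivative frozen at z0 contracts on a small disc, by the quadratic
    remainder and the Lipschitz bound on [dz]. This gives openness of the image together with a
    Lipschitz estimate for the inverse. *)
Lemma local_inverse (z0 : C) : lower_half z0 -> exists del B, 0 < del /\ 0 <= B /\
  forall w, Cmod (w - zm z0)%C < del -> exists z, lower_half z /\ zm z = w /\
    Cmod (z - z0)%C <= B * Cmod (w - zm z0)%C.
Proof.
  intros Hz0. pose proof (lower_clh _ Hz0) as Cz0. unfold lower_half in Hz0.
  destruct Hlow as (m & Hm & Hml). destruct (tm_lips _ Hdz) as (L2 & HL2 & Hdl).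
  pose proof (Hml z0 Cz0) as Hm0. pose proof (dz_nz z0 Cz0) as Hnz.
  set (t0 := Rmin (- snd z0 / 2) (m / (6 * (2 * K0 + L2 + 1)))).
  assert (Hpos : 0 < 6 * (2 * K0 + L2 + 1)) by lra.
  assert (Ht0 : 0 < t0).
  { apply Rmin_glb_lt; [lra|]. apply Rdiv_lt_0_compat; lra. }
  assert (Ht1 : t0 <= - snd z0 / 2) by apply Rmin_l.
  assert (Ht2 : t0 * (6 * (2 * K0 + L2 + 1)) <= m).
  { apply Rle_trans with (m / (6 * (2 * K0 + L2 + 1)) * (6 * (2 * K0 + L2 + 1))).
    - apply Rmult_le_compat_r; [lra|apply Rmin_r].
    - right; field; lra. }
  exists (m * t0 / 6), (6 / m).
  split; [apply Rdiv_lt_0_compat; nra|]. split; [apply Rdiv_le_0_compat; lra|].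
  intros w Hw. set (e := Cmod (w - zm z0)%C) in *.
  destruct (Req_dec e 0) as [E0|E0].
  { exists z0. split; [exact Hz0|]. unfold e in E0. split; [symmetry; now apply Cmod_0_eq|].
    replace (z0 - z0)%C with (RtoC 0) by ring. rewrite Cmod_0. unfold e. rewrite E0. lra. }
  assert (He : 0 < e) by (pose proof (Cmod_ge_0 (w - zm z0)%C); unfold e in *; lra).
  (* The disc is taken proportional to the distance e, so that membership of the fixed point in it
     is already the Lipschitz bound. A positive radius needs e > 0; the case e = 0 is settled
     above. *)
  set (t := 6 / m * e).
  assert (Ht : 0 < t) by (unfold t; apply Rmult_lt_0_compat; [apply Rdiv_lt_0_compat; lra|auto]).
  assert (Htt : t <= t0).
  { unfold t. apply Rle_trans with (6 / m * (m * t0 / 6)); [|right; field; lra].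
    apply Rmult_le_compat_l; [apply Rdiv_le_0_compat; lra|lra]. }
  assert (Hin : forall h, Cmod h <= t -> lower_half (z0 + h)%C).
  { intros h Hh. unfold lower_half. simpl. pose proof (im_le_Cmod h). pose proof (Rle_abs (snd h)). lra. }
  set (T := fun h => (h - (zm (z0 + h) - w) * / dz z0)%C).
  destruct (C_fixed_point T t Ht) as (h & Hh & E).
  - intros h Hh. pose proof (lower_clh _ (Hin h Hh)) as Ch.
    replace (T h) with (((w - zm z0) - (zm (z0 + h) - zm z0 - (z0 + h - z0) * dz z0)) * / dz z0)%C
      by (unfold T; field; auto).
    rewrite Cmod_mult, Cmod_inv by auto.
    pose proof (Hrem z0 (z0 + h)%C Cz0 Ch) as H.
    replace (z0 + h - z0)%C with h in * by ring.
    pose proof (Cmod_minus (w - zm z0) (zm (z0 + h) - zm z0 - h * dz z0)%C) as H1. fold e in H1.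
    pose proof (Cmod_ge_0 h).
    assert (H2 : K0 * (Cmod h * Cmod h) <= K0 * (t * t)).
    { apply Rmult_le_compat_l; auto. apply Rmult_le_compat; auto. }
    assert (H3 : K0 * (t * t) <= m * t / 6).
    { assert (K0 * t <= m / 6) by nra. nra. }
    assert (H4 : e = m * t / 6) by (unfold t; field; lra).
    apply Rle_trans with ((m * t / 3) * / m); [|right; field; lra].
    apply Rmult_le_compat; try apply Cmod_ge_0; try lra.
    + left; apply Rinv_0_lt_compat; lra.
    + apply Rinv_le_contravar; auto.
  - intros h h' Hh Hh'. pose proof (lower_clh _ (Hin h Hh)) as Ch. pose proof (lower_clh _ (Hin h' Hh')) as Ch'.
    replace (T h - T h')%C with
      (- ((zm (z0 + h) - zm (z0 + h') - ((z0 + h) - (z0 + h')) * dz (z0 + h'))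
          + (h - h') * (dz (z0 + h') - dz z0)) * / dz z0)%C by (unfold T; field; auto).
    rewrite Cmod_mult, Cmod_opp, Cmod_inv by auto.
    pose proof (Hrem (z0 + h') (z0 + h) Ch' Ch) as H.
    pose proof (Hdl z0 (z0 + h')%C Cz0 Ch') as H'.
    replace (z0 + h - (z0 + h'))%C with (h - h')%C in * by ring.
    replace (z0 + h' - z0)%C with h' in * by ring.
    set (D := Cmod (h - h')%C) in *. assert (HD : 0 <= D) by apply Cmod_ge_0.
    assert (HD2 : D <= 2 * t) by (unfold D; pose proof (Cmod_minus h h'); lra).
    pose proof (Cmod_triangle (zm (z0 + h) - zm (z0 + h') - (h - h') * dz (z0 + h'))
       ((h - h') * (dz (z0 + h') - dz z0)))%C as H1.
    rewrite Cmod_mult in H1. fold D in H1.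
    assert (H2 : K0 * (D * D) <= D * (2 * K0 * t)).
    { replace (D * (2 * K0 * t)) with (K0 * (D * (2 * t))) by ring.
      apply Rmult_le_compat_l; auto. apply Rmult_le_compat_l; auto. }
    assert (H3 : D * Cmod (dz (z0 + h') - dz z0)%C <= D * (L2 * t)).
    { apply Rmult_le_compat_l; auto. eapply Rle_trans; [exact H'|]. apply Rmult_le_compat_l; auto. }
    apply Rle_trans with ((D * (m / 3)) * / m); [|right; field; lra].
    apply Rmult_le_compat; try apply Cmod_ge_0.
    + left; apply Rinv_0_lt_compat; lra.
    + assert (t * (2 * K0 + L2) <= m / 3) by nra.
      assert (D * (t * (2 * K0 + L2)) <= D * (m / 3)) by (apply Rmult_le_compat_l; auto). lra.
    + apply Rinv_le_contravar; auto.
  - exists (z0 + h)%C. split; [now apply Hin|]. split.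
    + apply Cmod_0_eq. unfold T in E.
      assert (E1 : ((zm (z0 + h) - w) * / dz z0)%C = 0%C).
      { transitivity (h - (h - (zm (z0 + h) - w) * / dz z0))%C; [ring|]. rewrite E. ring. }
      assert (E2 : (zm (z0 + h) - w)%C = 0%C).
      { transitivity ((zm (z0 + h) - w) * / dz z0 * dz z0)%C; [field; auto|]. rewrite E1. ring. }
      rewrite E2. apply Cmod_0.
    + replace (z0 + h - z0)%C with h by ring. exact Hh.
Qed.

Definition image (p : C) : Prop := exists zeta, lower_half zeta /\ zm zeta = p.

Lemma image_open : open image.
Proof.
  intros p (z0 & Hz0 & E). subst p.
  destruct (local_inverse z0 Hz0) as (del & B & Hd & HB & H).
  assert (Hd2 : 0 < del / 2) by lra. exists (mkposreal _ Hd2). intros w Hw.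
  apply ball_Cmod in Hw. simpl in Hw. destruct (H w ltac:(lra)) as (z & Hz & Ez & _).
  exists z; auto.
Qed.

Lemma image_connected : connected image.
Proof.
  apply path_connected. intros p q (z1 & Hz1 & E1) (z2 & Hz2 & E2). subst.
  assert (Hs : forall t, 0 <= t <= 1 -> lower_half (z1 + t * (z2 - z1))%C).
  { intros t Ht. unfold lower_half in *. simpl. destruct (Req_dec t 1) as [E|E]; [subst; lra|nra]. }
  exists (fun t => zm (z1 + t * (z2 - z1))%C). split; [f_equal; ring|]. split; [f_equal; ring|].
  split; [intros t Ht; exists (z1 + t * (z2 - z1))%C; auto|].
  destruct zm_lips as (L & HL & H). exists (L * Cmod (z2 - z1)%C).
  split; [pose proof (Cmod_ge_0 (z2 - z1)%C); nra|]. intros t t' Ht Ht'.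
  eapply Rle_trans; [apply H; apply lower_clh; auto|].
  replace (z1 + t' * (z2 - z1) - (z1 + t * (z2 - z1)))%C with ((t' - t)%R * (z2 - z1))%C
    by (rewrite RtoC_minus; ring).
  rewrite Cmod_mult, Cmod_R. right; ring.
Qed.

(** Points whose images are close to p lie in a fixed rectangle, because [zm] stays at bounded
    distance from the identity; there compactness applies. With an arbitrary [Q] the lemma treats
    all preimages of p at once, as a point of self-contact has two. *)
Lemma proper (p : C) (Q : C -> Prop) :
  (forall z, clh z -> zm z = p -> exists del, 0 < del /\
      forall z', clh z' -> Cmod (z' - z)%C < del -> Q z') ->
  exists eps, 0 < eps /\ forall z, clh z -> Cmod (zm z - p)%C < eps -> Q z.
Proof.
  intros H. destruct zm_lips as (L & HL & HLip).
  assert (Hx : forall z : C, exists del : posreal, clh z -> forall z', clh z' ->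
     Rabs (fst z' - fst z) < del -> Rabs (snd z' - snd z) < del ->
     (zm z = p /\ Q z') \/ del <= Cmod (zm z' - p)%C).
  { intros z. destruct (classic (clh z)) as [Hz|Hz].
    2:{ exists (mkposreal 1 Rlt_0_1). intros Hc; contradiction. }
    destruct (classic (zm z = p)) as [E|E].
    - destruct (H z Hz E) as (del & Hd & HQ).
      assert (Hd2 : 0 < del / 2) by lra. exists (mkposreal _ Hd2). simpl.
      intros _ z' Hz' H1 H2. left. split; auto. apply HQ; auto.
      eapply Rle_lt_trans; [apply Cmod_le_abs|]. simpl. unfold Rminus in *. lra.
    (* Away from the preimages of p the gauge is also a lower bound for the distance to p, so that
       the uniform gauge given by compactness bounds this distance from below. *)
    - set (r := Cmod (zm z - p)%C).
      assert (Hr : 0 < r).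
      { pose proof (Cmod_ge_0 (zm z - p)%C). destruct (Req_dec r 0) as [E0|E0]; [|unfold r in *; lra].
        exfalso; apply E, Cmod_0_eq, E0. }
      assert (Hd : 0 < r / (4 * (L + 1))) by (apply Rdiv_lt_0_compat; lra).
      assert (Hmin : 0 < Rmin (r / (4 * (L + 1))) (r / 2)) by (apply Rmin_glb_lt; lra).
      exists (mkposreal _ Hmin). simpl. intros _ z' Hz' H1 H2. right.
      assert (H3 : Cmod (z' - z)%C <= r / (2 * (L + 1))).
      { eapply Rle_trans; [apply Cmod_le_abs|]. simpl.
        pose proof (Rmin_l (r / (4 * (L + 1))) (r / 2)).
        replace (r / (2 * (L + 1))) with (r / (4 * (L + 1)) + r / (4 * (L + 1))) by (field; lra).
        unfold Rminus in *. lra. }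
      specialize (HLip z z' Hz Hz').
      assert (H4 : L * Cmod (z' - z)%C <= r / 2).
      { apply Rle_trans with ((L + 1) * (r / (2 * (L + 1)))); [|right; field; lra].
        pose proof (Cmod_ge_0 (z' - z)%C). apply Rmult_le_compat; lra. }
      pose proof (Cmod_triangle (zm z' - p) (- (zm z' - zm z)))%C as H5.
      replace (zm z' - p + - (zm z' - zm z))%C with (zm z - p)%C in H5 by ring.
      rewrite Cmod_opp in H5. fold r in H5. pose proof (Rmin_r (r / (4 * (L + 1))) (r / 2)). lra. }
  set (delta := fun x y => proj1_sig (constructive_indefinite_description _ (Hx (x, y)))).
  assert (Hdel : forall x y, clh (x, y) -> forall z', clh z' ->
     Rabs (fst z' - x) < delta x y -> Rabs (snd z' - y) < delta x y ->
     (zm (x, y) = p /\ Q z') \/ delta x y <= Cmod (zm z' - p)%C).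
  { intros x y. exact (proj2_sig (constructive_indefinite_description _ (Hx (x, y)))). }
  clearbody delta.
  destruct (compactness_value_2d (fst p - (M + 1)) (fst p + (M + 1)) (snd p - (M + 1)) 0 delta)
    as [d Hd].
  exists (Rmin d 1). split; [apply Rmin_glb_lt; [apply cond_pos|lra]|].
  intros z Hz Hzp.
  assert (H1 : Cmod (zm z - p)%C < d) by (eapply Rlt_le_trans; [exact Hzp|apply Rmin_l]).
  assert (H2 : Cmod (zm z - p)%C < 1) by (eapply Rlt_le_trans; [exact Hzp|apply Rmin_r]).
  assert (H3 : Cmod (z - p)%C < M + 1).
  { replace (z - p)%C with ((zm z - p) - (zm z - z))%C by ring.
    eapply Rle_lt_trans; [apply Cmod_minus|]. pose proof (Hbd z Hz). lra. }
  pose proof (re_le_Cmod (z - p)%C) as H4. pose proof (im_le_Cmod (z - p)%C) as H5.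
  simpl in H4, H5.
  apply NNPP. intros HnQ. apply (Hd (fst z) (snd z)).
  - assert (Rabs (fst z + - fst p) <= M + 1) as H6 by lra. apply Rabs_le_between in H6. lra.
  - assert (Rabs (snd z + - snd p) <= M + 1) as H6 by lra. apply Rabs_le_between in H6.
    unfold closed_lower_half in Hz. lra.
  - intros (u & v & Hu & Hv & Du & Dv & Hle).
    destruct (Hdel u v) with (z' := z) as [[_ HQ]|HQ]; auto.
    + unfold closed_lower_half; simpl; lra.
    + lra.
Qed.

Lemma surface_not_image (a : R) : ~ image (zm (a, 0)).
Proof.
  intros (z & Hz & E). apply Hinj in E; auto.
  - subst z. unfold lower_half in Hz; simpl in Hz; lra.
  - unfold closed_lower_half; simpl; lra.
Qed.

(** A point with no preimage in the closed half-plane has, by properness, a neighbourhood that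
    misses the image. So a frontier point outside the image can only come from the boundary line. *)
Lemma frontier_image (p : C) :
  (exists a, p = zm (a, 0)) <-> (frontier image p /\ ~ image p).
Proof.
  split.
  - intros (a & E). subst p. split; [|apply surface_not_image]. intros eps. split.
    + destruct zm_lips as (L & HL & H).
      assert (Hd : 0 < eps / (2 * (L + 1))) by (apply Rdiv_lt_0_compat; [apply cond_pos|lra]).
      set (z := (a, - (eps / (2 * (L + 1))))).
      exists (zm z). split; [|exists z; split; auto; unfold lower_half; simpl; lra].
      apply Cmod_ball.
      eapply Rle_lt_trans; [apply H; unfold closed_lower_half; simpl; lra|].
      assert (E : Cmod (z - (a, 0))%C <= eps / (2 * (L + 1))).
      { eapply Rle_trans; [apply Cmod_le_abs|]. unfold z; simpl.
        replace (a + - a) with 0 by ring. rewrite Rabs_R0, Rplus_0_l, Ropp_0, Rplus_0_r, Rabs_Ropp, Rabs_pos_eq; lra. }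
      apply Rle_lt_trans with (L * (eps / (2 * (L + 1)))); [apply Rmult_le_compat_l; auto|].
      apply Rlt_le_trans with ((2 * (L + 1)) * (eps / (2 * (L + 1)))); [apply Rmult_lt_compat_r; lra|].
      right; field; lra.
    + exists (zm (a, 0)). split; [apply ball_center|apply surface_not_image].
  - intros [Hf Hn]. apply NNPP; intros Hno.
    destruct (proper p (fun _ => False)) as (eps & He & H).
    + intros z Hz E. exfalso. destruct (Rlt_dec (snd z) 0) as [L|L].
      * apply Hn. exists z; auto.
      * apply Hno. exists (fst z). unfold closed_lower_half in Hz. rewrite <- E.
        destruct z as [x y]; simpl in *. do 2 f_equal. lra.
    + assert (He2 : 0 < eps / 2) by lra.
      destruct (Hf (mkposreal _ He2)) as [(q & Hb & z & Hz & Ez) _].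
      apply ball_Cmod in Hb. simpl in Hb. apply (H z (lower_clh _ Hz)). rewrite Ez. lra.
Qed.

Lemma image_periodic (p : C) : image (fst p + 2 * PI, snd p) <-> image p.
Proof.
  split; intros (z & Hz & E).
  - exists (fst z - 2 * PI, snd z).
    assert (Hz' : lower_half (fst z - 2 * PI, snd z)) by exact Hz. split; auto.
    pose proof (Hper _ (lower_clh _ Hz')) as H. simpl in H.
    replace (fst z - 2 * PI + 2 * PI) with (fst z) in H by ring.
    replace (fst z, snd z) with z in H by (destruct z; reflexivity).
    rewrite H in E. injection E as E1 E2.
    rewrite (surjective_pairing (zm _)), (surjective_pairing p). f_equal; [lra|auto].
  - exists (fst z + 2 * PI, snd z). split; [exact Hz|].
    rewrite Hper by (apply lower_clh; auto). now rewrite E.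
Qed.

Lemma image_below (m : R) : exists p, image p /\ snd p < m.
Proof.
  set (z := (0, - Rabs (m - M) - 1)).
  assert (Hz : lower_half z) by (unfold lower_half, z; simpl; pose proof (Rabs_pos (m - M)); lra).
  exists (zm z). split; [exists z; auto|].
  pose proof (Hbd z (lower_clh _ Hz)) as H. pose proof (im_le_Cmod (zm z - z)%C) as H1.
  simpl in H1. pose proof (Rle_abs (snd (zm z) + - (- Rabs (m - M) - 1))).
  pose proof (Rle_abs (- (m - M))) as H2. rewrite Rabs_Ropp in H2. lra.
Qed.

Lemma trace_derive (a : R) : is_derive (K := R_AbsRing) (V := C_R_NormedModule)
  (fun x => zm (x, 0)) a (dz (a, 0)).
Proof.
  assert (Hc : forall x, clh (x, 0)) by (intros; unfold closed_lower_half; simpl; lra).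
  assert (Hz : forall y, Cmod ((y, 0) - (a, 0))%C = Rabs (y - a)).
  { intros y. replace ((y, 0) - (a, 0))%C with (RtoC (y - a)); [apply Cmod_R|].
    unfold RtoC, Cminus, Cplus, Copp; simpl. f_equal; ring. }
  apply is_derive_pair; apply is_derive_R_remainder with K0 1; auto; try lra; intros y _.
  - pose proof (Hrem _ _ (Hc a) (Hc y)) as H. rewrite Hz in H. eapply Rle_trans; [|exact H].
    eapply Rle_trans; [|apply re_le_Cmod]. right; f_equal. simpl. ring.
  - pose proof (Hrem _ _ (Hc a) (Hc y)) as H. rewrite Hz in H. eapply Rle_trans; [|exact H].
    eapply Rle_trans; [|apply im_le_Cmod]. right; f_equal. simpl. ring.
Qed.

Lemma zm_derive (z : C) : lower_half z ->
  is_derive (K := C_AbsRing) (V := C_NormedModule) zm z (dz z).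
Proof.
  intros Hz. unfold lower_half in Hz.
  apply is_derive_C_remainder with K0 (- snd z); [lra|auto|].
  intros y Hy. apply Hrem; [unfold closed_lower_half; lra|].
  pose proof (im_le_Cmod (y - z)%C). simpl in H. pose proof (Rle_abs (snd y + - snd z)).
  unfold closed_lower_half; lra.
Qed.

(** The chain rule for F composed with the inverse of [zm], with derivative F' / z', in the form of
    a quadratic remainder. *)
Lemma comp_remainder (F F' : C -> C) (z0 : C) : tame F F' -> lower_half z0 ->
  exists del K, 0 < del /\ 0 <= K /\ forall w, Cmod (w - zm z0)%C < del ->
    exists z, lower_half z /\ zm z = w /\
    Cmod (F z - F z0 - (w - zm z0) * (F' z0 * / dz z0))%C
      <= K * (Cmod (w - zm z0)%C * Cmod (w - zm z0)%C).
Proof.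
  intros (KF & HKF & HBF & HF) Hz0. pose proof (lower_clh _ Hz0) as Cz0.
  destruct (local_inverse z0 Hz0) as (del & B & Hd & HB & H).
  set (Q := Cmod (F' z0 * / dz z0)%C). assert (HQ : 0 <= Q) by apply Cmod_ge_0.
  assert (Hc : 0 <= (KF + K0 * Q) * (B * B)) by (apply Rmult_le_pos; nra).
  exists del, ((KF + K0 * Q) * (B * B)). split; auto. split; auto.
  intros w Hw. destruct (H w Hw) as (z & Hz & E & Hb). exists z. split; auto. split; auto.
  pose proof (lower_clh _ Hz) as Cz. specialize (HF z0 z Cz0 Cz). pose proof (Hrem z0 z Cz0 Cz) as Hr.
  rewrite E in Hr. set (e := Cmod (w - zm z0)%C) in *. assert (He : 0 <= e) by apply Cmod_ge_0.
  set (d := Cmod (z - z0)%C) in *. assert (Hd0 : 0 <= d) by apply Cmod_ge_0.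
  pose proof (dz_nz z0 Cz0) as Hnz.
  replace (F z - F z0 - (w - zm z0) * (F' z0 * / dz z0))%C with
    ((F z - F z0 - (z - z0) * F' z0) - (w - zm z0 - (z - z0) * dz z0) * (F' z0 * / dz z0))%C
    by (field; auto).
  eapply Rle_trans; [apply Cmod_minus|]. rewrite Cmod_mult. fold Q.
  assert (d * d <= (B * B) * (e * e)).
  { apply Rle_trans with ((B * e) * (B * e)); [apply Rmult_le_compat; auto|right; ring]. }
  assert (Cmod (w - zm z0 - (z - z0) * dz z0) * Q <= K0 * (d * d) * Q) by (apply Rmult_le_compat_r; auto).
  assert ((KF + K0 * Q) * (d * d) <= (KF + K0 * Q) * ((B * B) * (e * e))).
  { apply Rmult_le_compat_l; auto. nra. }
  lra.
Qed.

(** The functions of the form q (y) + Re F are closed under both partial derivatives, with F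
    replaced by F' / z' and i F' / z'. Two applications yield all second derivatives of the stream
    function. *)
Lemma deriv_form (phi : C -> R) (q q' : R -> R) (F F' : C -> C) (z0 : C) :
  tame F F' -> (forall t, is_derive q t (q' t)) ->
  (forall z, lower_half z -> phi (zm z) = q (snd (zm z)) + fst (F z)) -> lower_half z0 ->
  is_derive (fun x => phi (x, snd (zm z0))) (fst (zm z0)) (fst (F' z0 * / dz z0)%C) /\
  is_derive (fun y => phi (fst (zm z0), y)) (snd (zm z0))
    (q' (snd (zm z0)) + fst (Ci * (F' z0 * / dz z0))%C).
Proof.
  intros TF Hq Hphi Hz0. destruct (comp_remainder F F' z0 TF Hz0) as (del & K & Hd & HK & H).
  set (D := (F' z0 * / dz z0)%C) in *. set (p := zm z0) in *.
  assert (Hrem1 : forall w, Cmod (w - p)%C < del ->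
     Rabs ((phi w - q (snd w)) - (phi p - q (snd p)) - fst ((w - p) * D)%C)
       <= K * (Cmod (w - p)%C * Cmod (w - p)%C)).
  { intros w Hw. destruct (H w Hw) as (z & Hz & E & Hb). rewrite <- E at 1 2.
    unfold p at 1 2. rewrite !Hphi by auto. eapply Rle_trans; [|exact Hb].
    eapply Rle_trans; [|apply re_le_Cmod]. right; f_equal.
    rewrite E. fold p. simpl. ring. }
  clear H. clearbody p D. destruct p as [p1 p2]. simpl fst in *. simpl snd in *.
  split.
  - assert (Hw : forall x, Cmod ((x, p2) - (p1, p2))%C = Rabs (x - p1)).
    { intros x. replace ((x, p2) - (p1, p2))%C with (RtoC (x - p1)); [apply Cmod_R|].
      unfold RtoC, Cminus, Cplus, Copp; simpl. f_equal; ring. }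
    apply is_derive_R_remainder with K del; auto. intros x Hx. rewrite <- Hw in Hx.
    specialize (Hrem1 _ Hx). rewrite Hw in Hrem1. eapply Rle_trans; [|exact Hrem1].
    right; f_equal. simpl. ring.
  - assert (Hw : forall y, Cmod ((p1, y) - (p1, p2))%C = Rabs (y - p2)).
    { intros y. replace ((p1, y) - (p1, p2))%C with (Ci * RtoC (y - p2))%C.
      - rewrite Cmod_mult, Cmod_R. replace (Cmod Ci) with 1; [ring|].
        symmetry; apply Cmod_Ci.
      - unfold RtoC, Ci, Cminus, Cplus, Copp, Cmult; simpl. f_equal; ring. }
    apply (is_derive_ext (fun y => q y + (phi (p1, y) - q y))); [intros; simpl; ring|].
    apply (is_derive_plus q (fun y => phi (p1, y) - q y)); [apply Hq|].
    apply is_derive_R_remainder with K del; auto. intros y Hy. rewrite <- Hw in Hy.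
    specialize (Hrem1 _ Hy). rewrite Hw in Hrem1. eapply Rle_trans; [|exact Hrem1].
    right; f_equal. simpl. ring.
Qed.

Lemma cont_form (phi : C -> R) (q : R -> R) (F : C -> C) (z0 : C) :
  lips F -> (forall t, continuous q t) ->
  (forall z, lower_half z -> phi (zm z) = q (snd (zm z)) + fst (F z)) -> lower_half z0 ->
  continuous phi (zm z0).
Proof.
  intros (L & HL & HF) Hq Hphi Hz0.
  destruct (local_inverse z0 Hz0) as (del & B & Hd & HB & H).
  intros P [e HP].
  assert (He2 : 0 < e / 2) by (destruct e; simpl; lra).
  destruct (Hq (snd (zm z0)) (fun y => ball (q (snd (zm z0))) (mkposreal _ He2) y)) as [d1 Hd1].
  { exists (mkposreal _ He2). auto. }
  assert (Hlb : 0 < e / (4 * (L * B + 1))).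
  { apply Rdiv_lt_0_compat; [apply cond_pos|]. assert (0 <= L * B) by nra. lra. }
  assert (Hm : 0 < Rmin d1 (Rmin (del / 2) (e / (4 * (L * B + 1))))).
  { apply Rmin_glb_lt; [apply cond_pos|]. apply Rmin_glb_lt; lra. }
  exists (mkposreal _ Hm). intros w Hw. apply HP.
  assert (Hw1 : Rabs (snd w - snd (zm z0)) < d1).
  { eapply Rlt_le_trans; [apply (proj2 (proj1 (ball_C _ _ _) Hw))|apply Rmin_l]. }
  apply ball_Cmod in Hw. simpl in Hw.
  pose proof (Rmin_r d1 (Rmin (del / 2) (e / (4 * (L * B + 1))))) as R1.
  pose proof (Rmin_l (del / 2) (e / (4 * (L * B + 1)))) as R2.
  pose proof (Rmin_r (del / 2) (e / (4 * (L * B + 1)))) as R3.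
  destruct (H w ltac:(lra)) as (z & Hz & E & Hb).
  change (Rabs (phi w - phi (zm z0)) < e). rewrite <- E, !Hphi by auto.
  specialize (HF z0 z (lower_clh _ Hz0) (lower_clh _ Hz)).
  specialize (Hd1 (snd w) Hw1). change (Rabs (q (snd w) - q (snd (zm z0))) < e / 2) in Hd1.
  rewrite E. replace (q (snd w) + fst (F z) - (q (snd (zm z0)) + fst (F z0))) with
    ((q (snd w) - q (snd (zm z0))) + (fst (F z - F z0)%C)) by (simpl; ring).
  eapply Rle_lt_trans; [apply Rabs_triang|].
  pose proof (re_le_Cmod (F z - F z0)%C) as H1.
  assert (H2 : Cmod (F z - F z0)%C <= L * B * Cmod (w - zm z0)%C).
  { eapply Rle_trans; [exact HF|]. rewrite Rmult_assoc. apply Rmult_le_compat_l; auto. }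
  assert (H3 : L * B * Cmod (w - zm z0)%C <= e / 2).
  { apply Rle_trans with ((L * B + 1) * (2 * (e / (4 * (L * B + 1))))).
    - assert (0 <= L * B) by nra. apply Rmult_le_compat; try lra. apply Cmod_ge_0.
    - right; field. assert (0 <= L * B) by nra. lra. }
  lra.
Qed.

(** * The stream function *)

Section Stream.
Variables (E E' H1 H1' H2 : C -> C).
Hypothesis TE : tame E E'.
Hypothesis TH1 : tame H1 H1'.
Hypothesis LH2 : lips H2.
Hypothesis EH1 : forall z, clh z -> H1 z = (E' z * / dz z)%C.
Hypothesis EH2 : forall z, clh z -> H2 z = (H1' z * / dz z)%C.

(** The first term carries the vorticity and the shear at infinite depth, whose velocity vanishes at
    y = -1; Re E is the harmonic correction that makes the boundary values 0. *)
Definition Psi (z : C) : R := - ((snd (zm z) + 1) * (snd (zm z) + 1)) / 2 + fst (E z).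
Hypothesis Psi0 : forall a, Psi (a, 0) = 0.

(** A preimage on the closed half-plane is chosen arbitrarily, since a surface point may have
    two. *)
Definition stream (p : C) : R :=
  Psi (epsilon (inhabits (RtoC 0)) (fun z => clh z /\ zm z = p)).

(** Two different preimages of one point both lie on the boundary line, where [Psi] vanishes, so the
    choice does not matter. *)
Lemma stream_zm (z : C) : clh z -> stream (zm z) = Psi z.
Proof.
  intros Hz. unfold stream.
  pose proof (epsilon_spec (inhabits (RtoC 0)) (fun y => clh y /\ zm y = zm z)
    (ex_intro _ z (conj Hz eq_refl))) as [H3 H4].
  set (y := epsilon _ _) in *. clearbody y.
  destruct (Rlt_dec (snd z) 0) as [L|L].
  - f_equal. symmetry. apply Hinj; auto.
  - destruct (Rlt_dec (snd y) 0) as [L'|L'].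
    + f_equal. apply Hinj; auto.
    + unfold closed_lower_half in *. destruct y as [y1 y2], z as [z1 z2]; simpl in *.
      replace y2 with 0 by lra. replace z2 with 0 by lra. now rewrite !Psi0.
Qed.

Lemma stream_form (z : C) : lower_half z ->
  stream (zm z) = (fun t => - ((t + 1) * (t + 1)) / 2) (snd (zm z)) + fst (E z).
Proof. intros Hz. rewrite stream_zm by (apply lower_clh; auto). reflexivity. Qed.

Lemma q_derive (t : R) : is_derive (fun t => - ((t + 1) * (t + 1)) / 2) t (- (t + 1)).
Proof. auto_derive; auto. field. Qed.

Lemma dx_stream (z : C) : lower_half z -> dx stream (zm z) = 0 + fst (H1 z).
Proof.
  intros Hz. unfold dx. apply is_derive_unique. rewrite EH1, Rplus_0_l by (apply lower_clh; auto).
  apply (deriv_form stream _ (fun t => - (t + 1)) E E' z TE q_derive stream_form Hz).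
Qed.

Lemma dy_stream (z : C) : lower_half z -> dy stream (zm z) = - (snd (zm z) + 1) + fst (Ci * H1 z)%C.
Proof.
  intros Hz. unfold dy. apply is_derive_unique. rewrite EH1 by (apply lower_clh; auto).
  apply (deriv_form stream _ (fun t => - (t + 1)) E E' z TE q_derive stream_form Hz).
Qed.

Lemma tame_CiH1 : tame (fun z => Ci * H1 z)%C (fun z => Ci * H1' z)%C.
Proof.
  eapply tame_ext; [| |apply (tame_mul _ _ _ _ (tame_const Ci) TH1)]; intros z _; simpl; ring.
Qed.

Lemma lips_Ci (F : C -> C) : lips F -> lips (fun z => Ci * F z)%C.
Proof.
  intros (L & HL & H). exists L; split; auto. intros z z' Hz Hz'.
  replace (Ci * F z' - Ci * F z)%C with (Ci * (F z' - F z))%C by ring.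
  rewrite Cmod_mult. replace (Cmod Ci) with 1; [rewrite Rmult_1_l; auto|].
  symmetry; apply Cmod_Ci.
Qed.

Lemma dxx (z : C) : lower_half z ->
  is_derive (fun x => dx stream (x, snd (zm z))) (fst (zm z)) (fst (H2 z)) /\
  is_derive (fun y => dx stream (fst (zm z), y)) (snd (zm z)) (0 + fst (Ci * H2 z)%C).
Proof.
  intros Hz. rewrite EH2 by (apply lower_clh; auto).
  apply (deriv_form (dx stream) (fun _ => 0) (fun _ => 0) H1 H1' z TH1); auto.
  - intros t. apply (is_derive_const (V := R_NormedModule) 0 t).
  - apply dx_stream.
Qed.

Lemma dyy (z : C) : lower_half z ->
  is_derive (fun x => dy stream (x, snd (zm z))) (fst (zm z)) (fst (Ci * H2 z)%C) /\
  is_derive (fun y => dy stream (fst (zm z), y)) (snd (zm z)) (-1 + fst (Ci * (Ci * H2 z))%C).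
Proof.
  intros Hz. rewrite EH2 by (apply lower_clh; auto).
  replace (Ci * (H1' z * / dz z))%C with ((Ci * H1' z) * / dz z)%C by ring.
  apply (deriv_form (dy stream) (fun t => - (t + 1)) (fun _ => -1) _ _ z tame_CiH1); auto.
  - intros t. auto_derive; [auto|lra].
  - apply dy_stream.
Qed.

Lemma stream_C2 : C2_on image stream.
Proof.
  assert (Cq : forall t, continuous (fun t => - (t + 1)) t).
  { intros t. apply (ex_derive_continuous (fun t => - (t + 1))). auto_derive; auto. }
  assert (Cc : forall (c t : R), continuous (fun _ : R => c) t) by (intros; apply continuous_const).
  assert (L1 : lips H1) by (apply tm_lips; exists H1'; auto).
  split; [|split]; intros p (z & Hz & Ep); subst p.
  - destruct (deriv_form stream _ (fun t => - (t + 1)) E E' z TE q_derive stream_form Hz) as [D1 D2].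
    split; [eexists; exact D1|]. split; [eexists; exact D2|]. split.
    + apply (cont_form (dx stream) (fun _ => 0) H1 z L1 (Cc 0) dx_stream Hz).
    + apply (cont_form (dy stream) (fun t => - (t + 1)) _ z (lips_Ci _ L1) Cq dy_stream Hz).
  - destruct (dxx z Hz) as [D1 D2].
    split; [eexists; exact D1|]. split; [eexists; exact D2|]. split.
    + apply (cont_form (dx (dx stream)) (fun _ => 0) H2 z LH2 (Cc 0)); auto.
      intros y Hy. rewrite Rplus_0_l. apply is_derive_unique, (dxx y Hy).
    + apply (cont_form (dy (dx stream)) (fun _ => 0) _ z (lips_Ci _ LH2) (Cc 0)); auto.
      intros y Hy. apply is_derive_unique, (dxx y Hy).
  - destruct (dyy z Hz) as [D1 D2].
    split; [eexists; exact D1|]. split; [eexists; exact D2|]. split.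
    + apply (cont_form (dx (dy stream)) (fun _ => 0) _ z (lips_Ci _ LH2) (Cc 0)); auto.
      intros y Hy. rewrite Rplus_0_l. apply is_derive_unique, (dyy y Hy).
    + apply (cont_form (dy (dy stream)) (fun _ => -1) _ z (lips_Ci _ (lips_Ci _ LH2)) (Cc (-1))); auto.
      intros y Hy. apply is_derive_unique, (dyy y Hy).
Qed.

Lemma stream_laplacian (p : C) : image p -> laplacian stream p = -1.
Proof.
  intros (z & Hz & Ep). subst p. unfold laplacian.
  replace (dx (dx stream) (zm z)) with (fst (H2 z)) by (symmetry; apply is_derive_unique, (dxx z Hz)).
  replace (dy (dy stream) (zm z)) with (-1 + fst (Ci * (Ci * H2 z))%C)
    by (symmetry; apply is_derive_unique, (dyy z Hz)).
  simpl. ring.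
Qed.

Lemma stream_grad (z : C) : lower_half z ->
  grad stream (zm z) = (fst (H1 z), - (snd (zm z) + 1) - snd (H1 z)).
Proof.
  intros Hz. unfold grad. rewrite dx_stream, dy_stream by auto. simpl. f_equal; ring.
Qed.

(** The quadratic shear profile is only locally Lipschitz; the factor 1 + |y| accounts for its
    growth with depth. *)
Lemma Psi_lips : exists L, 0 <= L /\ forall z z', clh z -> clh z' -> Cmod (z' - z)%C <= 1 ->
  Rabs (Psi z' - Psi z) <= L * (1 + Rabs (snd (zm z))) * Cmod (z' - z)%C.
Proof.
  destruct zm_lips as (L & HL & HLip). destruct (tame_lip _ _ TE) as (L' & HL' & HLip').
  exists (L * (1 + L) + L'). assert (0 <= L * L) by nra. split; [nra|]. intros z z' Hz Hz' Hd.
  specialize (HLip z z' Hz Hz'). specialize (HLip' z z' Hz Hz').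
  pose proof (Cmod_ge_0 (z' - z)%C) as H0. set (d := Cmod (z' - z)%C) in *.
  pose proof (im_le_Cmod (zm z' - zm z)%C) as I1. pose proof (re_le_Cmod (E z' - E z)%C) as I2.
  simpl in I1, I2. set (y := snd (zm z)) in *. set (dy0 := snd (zm z') + - y) in *.
  unfold Psi. fold y. replace (snd (zm z')) with (y + dy0) by (unfold dy0; ring).
  replace (- ((y + dy0 + 1) * (y + dy0 + 1)) / 2 + fst (E z') - (- ((y + 1) * (y + 1)) / 2 + fst (E z)))
    with (- dy0 * (y + 1 + dy0 / 2) + (fst (E z') + - fst (E z))) by field.
  eapply Rle_trans; [apply Rabs_triang|]. rewrite Rabs_mult, Rabs_Ropp.
  pose proof (Rabs_pos y) as Hy.
  assert (A1 : Rabs dy0 <= L * d) by lra.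
  assert (A2 : Rabs (y + 1 + dy0 / 2) <= (1 + Rabs y) * (1 + L)).
  { eapply Rle_trans; [apply Rabs_triang|].
    pose proof (Rabs_triang y 1) as T1. rewrite Rabs_R1 in T1.
    unfold Rdiv. rewrite Rabs_mult, (Rabs_pos_eq (/ 2)) by lra.
    assert (L * d <= L) by nra. nra. }
  assert (A3 : Rabs dy0 * Rabs (y + 1 + dy0 / 2) <= (L * d) * ((1 + Rabs y) * (1 + L)))
    by (apply Rmult_le_compat; auto using Rabs_pos).
  assert (0 <= L' * d * Rabs y) by (apply Rmult_le_pos; nra).
  lra.
Qed.

(** At a point of self-contact continuity has to be checked along both sheets; [proper] does this,
    as [Psi] has the same value at all preimages. *)
Lemma stream_continuous_on (D : C -> Prop) : (forall p, D p -> exists z, clh z /\ zm z = p) ->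
  continuous_on D stream.
Proof.
  intros HD p Dp P [e HP].
  destruct (HD p Dp) as (z0 & Hz0 & E0). destruct Psi_lips as (L & HL & HLip).
  destruct (proper p (fun z => Rabs (Psi z - Psi z0) < e)) as (eps & He & H).
  - intros z Hz Ez.
    assert (Eq : Psi z = Psi z0) by (rewrite <- !stream_zm by auto; congruence).
    set (K := L * (1 + Rabs (snd (zm z)))).
    assert (HK : 0 <= K) by (unfold K; pose proof (Rabs_pos (snd (zm z))); nra).
    exists (Rmin 1 (e / (K + 1))).
    assert (Hp : 0 < e / (K + 1)) by (apply Rdiv_lt_0_compat; [apply cond_pos|lra]).
    split; [apply Rmin_glb_lt; lra|]. intros z' Hz' Hlt. rewrite <- Eq.
    pose proof (Rmin_l 1 (e / (K + 1))). pose proof (Rmin_r 1 (e / (K + 1))).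
    eapply Rle_lt_trans; [apply HLip; auto; lra|]. fold K.
    pose proof (Cmod_ge_0 (z' - z)%C).
    apply Rle_lt_trans with ((K + 1) * Cmod (z' - z)%C); [nra|].
    apply Rlt_le_trans with ((K + 1) * (e / (K + 1))); [apply Rmult_lt_compat_l; lra|].
    right; field; lra.
  - assert (He2 : 0 < eps / 2) by lra. exists (mkposreal _ He2). intros w Hw Dw.
    apply ball_Cmod in Hw. simpl in Hw. destruct (HD w Dw) as (z & Hz & Ez).
    apply HP. change (Rabs (stream w - stream p) < e). rewrite <- Ez, <- E0, !stream_zm by auto.
    apply H; auto. rewrite Ez. lra.
Qed.
End Stream.
End Conformal.

(** Segments may end on the boundary of the half-plane, where only one-sided information exists.
    Clamping the argument to [0, 1] gives a continuous function on the line, to which the mean value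
    theorem applies. *)
Lemma seg_pos (F F' : R -> R) (K : R) : 0 <= K ->
  (forall t t', 0 <= t <= 1 -> 0 <= t' <= 1 ->
     Rabs (F t' - F t - (t' - t) * F' t) <= K * (Rabs (t' - t) * Rabs (t' - t))) ->
  (forall t, 0 < t < 1 -> 0 < F' t) -> F 0 < F 1.
Proof.
  intros HK H Hp.
  set (cl := fun t => Rmax 0 (Rmin 1 t)).
  assert (Hcl : forall t, 0 <= cl t <= 1).
  { intros t; unfold cl; split; [apply Rmax_l|apply Rmax_lub; [lra|apply Rmin_l]]. }
  assert (Hid : forall t, 0 <= t <= 1 -> cl t = t).
  { intros t Ht; unfold cl. rewrite Rmin_right, Rmax_right; lra. }
  assert (Hl : forall t t', Rabs (cl t' - cl t) <= Rabs (t' - t)).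
  { intros t t'. unfold cl, Rmax, Rmin.
    destruct (Rle_dec 1 t), (Rle_dec 1 t');
    repeat match goal with |- context [Rle_dec ?x ?y] => destruct (Rle_dec x y) end;
    unfold Rabs; repeat match goal with |- context [Rcase_abs ?x] => destruct (Rcase_abs x) end; lra. }
  (* MVT_gen only locates the intermediate point in the closed interval, so the derivative is
     replaced by 1 outside the open one. *)
  set (G := fun t => if Rlt_dec 0 t then if Rlt_dec t 1 then F' t else 1 else 1).
  assert (HG : forall t, 0 < G t).
  { intros t; unfold G. destruct (Rlt_dec 0 t); [destruct (Rlt_dec t 1)|]; auto; lra. }
  destruct (MVT_gen (fun t => F (cl t)) 0 1 G) as (c & Hc & E).
  - rewrite Rmin_left, Rmax_right by lra. intros t Ht.
    replace (G t) with (F' t) by (unfold G; destruct (Rlt_dec 0 t), (Rlt_dec t 1); lra).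
    apply is_derive_R_remainder with K (Rmin t (1 - t)); auto.
    + apply Rmin_glb_lt; lra.
    + intros y Hy. pose proof (Rmin_l t (1 - t)). pose proof (Rmin_r t (1 - t)).
      assert (0 <= y <= 1) by (apply Rabs_def2 in Hy; lra).
      rewrite !Hid by lra. apply H; lra.
  - rewrite Rmin_left, Rmax_right by lra. intros t Ht eps Heps.
    set (L := Rabs (F' (cl t)) + K + 1).
    assert (HL : 0 < L) by (unfold L; pose proof (Rabs_pos (F' (cl t))); lra).
    exists (eps / L). split; [apply Rdiv_lt_0_compat; lra|]. intros y [_ Hy].
    unfold R_dist in *. simpl in Hy. unfold R_dist in Hy. simpl. unfold R_dist.
    pose proof (H (cl t) (cl y) (Hcl t) (Hcl y)) as Hr. pose proof (Hl t y) as Hly.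
    set (D := Rabs (cl y - cl t)) in *. assert (HD : 0 <= D) by apply Rabs_pos.
    assert (D <= 1) by (unfold D; pose proof (Hcl t); pose proof (Hcl y); apply Rabs_le; lra).
    replace (F (cl y) - F (cl t)) with
      ((F (cl y) - F (cl t) - (cl y - cl t) * F' (cl t)) + (cl y - cl t) * F' (cl t)) by ring.
    eapply Rle_lt_trans; [apply Rabs_triang|]. rewrite Rabs_mult. fold D.
    pose proof (Rabs_pos (F' (cl t))).
    apply Rle_lt_trans with (L * D).
    { unfold L. assert (K * (D * D) <= K * D) by (apply Rmult_le_compat_l; nra). lra. }
    apply Rle_lt_trans with (L * Rabs (y - t)); [apply Rmult_le_compat_l; lra|].
    apply Rlt_le_trans with (L * (eps / L)); [apply Rmult_lt_compat_l; lra|right; field; lra].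
  - rewrite !Hid in E by lra. specialize (HG c). lra.
Qed.

Lemma dec_der_up (M q q' : R) (w : nat -> R) : 5 / 6 <= q -> q < q' -> q' < 1 -> dec M q w ->
  dec (6 / 5 * (M / (q' - q))) q' (up_fun (der w)) /\
  dec (61 / 25 * (M / (q' - q))) q' (fun n => der w n + up_fun (up_fun (der w)) n).
Proof.
  intros Hq Hqq Hq' H. assert (H1 : dec (M / (q' - q)) q' (der w)) by (apply dec_der; auto; lra).
  set (D := M / (q' - q)) in *. assert (HD : 0 <= D) by apply (dec_pos _ _ _ H1).
  pose proof (dec_up D q' (der w) ltac:(lra) H1) as H2.
  pose proof (dec_up _ q' _ ltac:(lra) H2) as H3.
  assert (Hi : / q' <= 6 / 5).
  { apply Rmult_le_reg_r with q'; [lra|]. rewrite Rinv_l; lra. }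
  assert (Hi0 : 0 < / q') by (apply Rinv_0_lt_compat; lra).
  assert (A2 : D / q' <= 6 / 5 * D) by (unfold Rdiv; nra).
  assert (A20 : 0 <= D / q') by (apply Rdiv_le_0_compat; lra).
  assert (A3 : D / q' / q' <= 36 / 25 * D) by (unfold Rdiv in *; nra).
  split.
  - apply dec_weaken with (D / q') q'; auto; lra.
  - apply dec_weaken with (D + D / q' / q') q'; [lra|lra|]. apply (dec_add D (D / q' / q')); auto.
Qed.

(** The 4 is a rounding of (6/5) mu + (61/25) |C| / 2, with mu <= 77/50 and |C| <= (528/697) mu. *)
Lemma dec_Dop (a : par) (M q q' : R) (w : nat -> R) : 5 / 6 <= q -> q < q' -> q' < 1 -> dec M q w ->
  dec (4 * (M / (q' - q))) q' (Dop a w).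
Proof.
  intros Hq Hqq Hq' H. destruct (dec_der_up M q q' w Hq Hqq Hq' H) as [H2 H3].
  assert (HD : 0 <= M / (q' - q)) by (apply Rdiv_le_0_compat; [apply (dec_pos _ _ _ H)|lra]).
  set (D := M / (q' - q)) in *.
  destruct (Cc_mu a) as [C0 C1]. pose proof (mu_Cc a). pose proof (mu_ge1 a).
  assert (Hm : mu a <= 77 / 50) by nra.
  apply dec_weaken with (Rabs (mu a) * (6 / 5 * D) + Rabs (Cc a / 2) * (61 / 25 * D)) q'; [lra| |].
  - rewrite (Rabs_pos_eq (mu a)), (Rabs_left1 (Cc a / 2)) by lra. nra.
  - apply (dec_add (Rabs (mu a) * (6 / 5 * D)) (Rabs (Cc a / 2) * (61 / 25 * D)));
      [apply (dec_scal (mu a) _ q' (up_fun (der w)))|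
       apply (dec_scal (Cc a / 2) _ q' (fun n => der w n + up_fun (up_fun (der w)) n))]; auto.
Qed.

Definition basis (i n : nat) : R := if Nat.eqb n i then 1 else 0.

Lemma rd_basis (i : nat) : rd (basis i).
Proof.
  exists (2 ^ i), (/ 2). split; [lra|]. intros n. unfold basis.
  assert (H : 0 < (/ 2) ^ n) by (apply pow_lt; lra).
  assert (H2 : 0 < 2 ^ i) by (apply pow_lt; lra).
  destruct (Nat.eqb_spec n i) as [E|E].
  - subst. rewrite Rabs_R1, <- Rpow_mult_distr. replace (2 * / 2) with 1 by field. rewrite pow1; lra.
  - rewrite Rabs_R0. nra.
Qed.

Lemma ev_basis (i : nat) (v : C) : ev (basis i) v = (v ^ i)%C.
Proof.
  unfold ev, evr, evi. rewrite !(Series_single _ i).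
  - unfold basis, pre, pim. rewrite Nat.eqb_refl, !Rmult_1_l. now destruct (v ^ i)%C.
  - intros n Hn. unfold basis. rewrite (proj2 (Nat.eqb_neq n i) Hn); ring.
  - intros n Hn. unfold basis. rewrite (proj2 (Nat.eqb_neq n i) Hn); ring.
Qed.

Lemma ev_ext (w w' : nat -> R) (v : C) : (forall n, w n = w' n) -> ev w v = ev w' v.
Proof. intros H. unfold ev, evr, evi. f_equal; apply Series_ext; intros n; now rewrite H. Qed.

Lemma pre_conj (v : C) (n : nat) : pre (Cconj v) n = pre v n /\ pim (Cconj v) n = - pim v n.
Proof. unfold pre, pim. rewrite <- Cpow_conj. split; reflexivity. Qed.

Lemma ev_conj (w : nat -> R) (v : C) : ev w (Cconj v) = Cconj (ev w v).
Proof.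
  assert (E1 : evr w (Cconj v) = evr w v).
  { apply Series_ext; intros n. now rewrite (proj1 (pre_conj v n)). }
  assert (E2 : evi w (Cconj v) = - evi w v).
  { unfold evi. rewrite <- Series_opp. apply Series_ext; intros n.
    rewrite (proj2 (pre_conj v n)). ring. }
  unfold ev. rewrite E1, E2. reflexivity.
Qed.

Lemma uu_conj (x y : R) : uu (- x, y) = Cconj (uu (x, y)).
Proof. unfold uu, Cconj; simpl. rewrite cos_neg, sin_neg. f_equal; ring. Qed.

Lemma vv_conj (a x y : R) : y <= 0 -> - 1 < a < 1 -> vv a (- x, y) = Cconj (vv a (x, y)).
Proof.
  intros Hy Ha. unfold vv. rewrite uu_conj. set (u := uu (x, y)).
  assert (Hd : (1 - a * u)%C <> 0%C).
  { intros E. assert (Cmod u <= 1) by (apply uu_le1; exact Hy).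
    assert (E1 : Cmod (a * u)%C = 1).
    { replace (a * u)%C with (1 - (1 - a * u))%C by ring. rewrite E.
      replace (1 - 0)%C with (RtoC 1) by ring. apply Cmod_1. }
    rewrite Cmod_mult, Cmod_R in E1. pose proof (Cmod_ge_0 u).
    assert (Rabs a < 1) by (apply Rabs_def1; lra). pose proof (Rabs_pos a). nra. }
  assert (Cj : forall z, Cconj z = (fst z, - snd z)) by reflexivity.
  assert (Hc : Cconj (1 - a * u)%C = (1 - a * Cconj u)%C).
  { unfold Cconj, Cminus, Cplus, Copp, Cmult, RtoC; simpl. f_equal; ring. }
  rewrite <- Hc. rewrite <- (Cinv_conj (1 - a * u)%C) by auto.
  unfold Cconj, Cminus, Cplus, Copp, Cmult, RtoC; simpl. f_equal; ring.
Qed.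

Lemma uu_period (x y : R) : uu (x + 2 * PI, y) = uu (x, y).
Proof.
  unfold uu; simpl. rewrite cos_plus, sin_plus, cos_2PI, sin_2PI. f_equal; ring.
Qed.

Lemma vv_period (a x y : R) : vv a (x + 2 * PI, y) = vv a (x, y).
Proof. unfold vv. now rewrite uu_period. Qed.

Lemma vv_im (a : par) (z : C) : clh z ->
  snd (vv a z) = (1 - a * a) * snd (uu z) / sqmod (1 - a * uu z)%C.
Proof.
  intros Hz. pose proof (den_nz a _ (uu_le1 z Hz)) as Hn.
  assert (Hs : 0 < sqmod (1 - a * uu z)%C).
  { rewrite <- Cmod_sqmod. pose proof (den_low a _ (uu_le1 z Hz)). nra. }
  assert (E : forall x : C, x <> 0%C -> (/ x)%C = (fst x / sqmod x, - snd x / sqmod x)).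
  { intros x Hx. unfold Cinv, sqmod. simpl. f_equal; f_equal; ring. }
  unfold vv. rewrite E by auto. set (S := sqmod _) in *. destruct (uu z) as [p q]. simpl.
  field. lra.
Qed.

(** Two applications of [Dop], with decay rates 5/6, 6/7 and 7/8, multiply a bound by 37632, and
    summation by another 16. One billionth keeps the result below [e0] = 1/1000. *)
Definition eta0 : R := / 1000000000.

Lemma clh_boundary (x : R) : clh (x, 0).
Proof. unfold closed_lower_half; simpl; lra. Qed.

(** * Geometry of the perturbed waves *)

Definition zmp (a s : R) (d : nat -> R) (z : C) : C :=
  (z + Ci * (EV a (fseq a s d) z - 1))%C.
Definition dzp (a s : R) (d : nat -> R) (z : C) : C :=
  (1 + EV a (Dop a (fseq a s d)) z)%C.

Lemma uu_eq (x y : R) : uu (x, y) = (exp y * cos x, - (exp y * sin x)).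
Proof. reflexivity. Qed.
Lemma EV_eq (a : R) (w : nat -> R) (z : C) : EV a w z = ev w (vv a z).
Proof. reflexivity. Qed.
Lemma zmp_eq (a s : R) (d : nat -> R) (z : C) :
  zmp a s d z = (z + Ci * (EV a (fseq a s d) z - 1))%C.
Proof. reflexivity. Qed.
Lemma dzp_eq (a s : R) (d : nat -> R) (z : C) : dzp a s d z = (1 + EV a (Dop a (fseq a s d)) z)%C.
Proof. reflexivity. Qed.
Lemma fst_ev (w : nat -> R) (v : C) : fst (ev w v) = evr w v.
Proof. reflexivity. Qed.
Lemma snd_ev (w : nat -> R) (v : C) : snd (ev w v) = evi w v.
Proof. reflexivity. Qed.
Section Geometry.
Local Opaque vv uu EV ev zmp dzp.
Variables (a : par) (s : R) (d : nat -> R).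
Hypothesis d0 : d 0%nat = 0.
Hypothesis d1 : d 1%nat = 0.
Hypothesis Hd : dec eta0 (5 / 6) d.

Notation f := (fseq a s d).
Notation zm := (zmp a s d).
Notation dz := (dzp a s d).

Lemma rd_d : rd d.
Proof. exists eta0, (5 / 6). split; [lra|auto]. Qed.

Lemma fseq_split (n : nat) : f n = ((mu a + s) * basis 0 n + 2 * Cc a * basis 1 n) + Cc a * d n.
Proof. destruct n as [|[|n]]; unfold basis; simpl; rewrite ?d0, ?d1; ring. Qed.

Lemma rd_ext (w w' : nat -> R) : (forall n, w n = w' n) -> rd w -> rd w'.
Proof. intros H (M & q & Hq & Hw). exists M, q; split; auto. intros n; rewrite <- H; auto. Qed.

Lemma rd_f : rd f.
Proof.
  eapply rd_ext; [intros n; symmetry; apply fseq_split|].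
  apply rd_add; [apply rd_add; apply rd_scal, rd_basis|apply rd_scal, rd_d].
Qed.

Lemma ev_f (v : C) : Cmod v <= 1 -> ev f v = (mu a + s + 2 * Cc a * v + Cc a * ev d v)%C.
Proof.
  intros Hv. rewrite (ev_ext _ _ v fseq_split).
  rewrite (ev_add (fun n => (mu a + s) * basis 0 n + 2 * Cc a * basis 1 n) (fun n => Cc a * d n));
    auto; [|apply rd_add; apply rd_scal, rd_basis|apply rd_scal, rd_d].
  rewrite (ev_add (fun n => (mu a + s) * basis 0 n) (fun n => 2 * Cc a * basis 1 n));
    auto; [|apply rd_scal, rd_basis|apply rd_scal, rd_basis].
  rewrite !ev_scal by (auto using rd_basis, rd_d). rewrite !ev_basis.
  rewrite RtoC_plus, RtoC_mult. simpl. ring.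
Qed.

Lemma ev_der_f (v : C) : Cmod v <= 1 -> ev (der f) v = (2 * Cc a + Cc a * ev (der d) v)%C.
Proof.
  intros Hv. pose proof (rd_der _ rd_d).
  rewrite (ev_ext _ (fun n => 2 * Cc a * basis 0 n + Cc a * der d n)).
  - rewrite (ev_add (fun n => 2 * Cc a * basis 0 n) (fun n => Cc a * der d n));
      auto; [|apply rd_scal, rd_basis|apply rd_scal; auto].
    rewrite !ev_scal by (auto using rd_basis). rewrite !ev_basis. rewrite RtoC_mult. simpl. ring.
  - intros [|n]; unfold der, basis; simpl; rewrite ?d1; ring.
Qed.

Definition P (z : C) : C := EV a (Dop a d) z.
Lemma P_eq (z : C) : P z = ev (Dop a d) (vv a z).
Proof. apply EV_eq. Qed.
Local Opaque P.

(** The relation mu^2 = 1 + C^2 completes the square in 1 + 2 C kapv (v). *)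
Lemma dz_eq (z : C) : clh z ->
  dz z = ((mu a + Cc a * vv a z) * (mu a + Cc a * vv a z) + Cc a * P z)%C.
Proof.
  intros Hz. rewrite dzp_eq, P_eq, EV_eq. pose proof (vv_le1 a z Hz) as Hv.
  rewrite !ev_Dop by (auto using rd_f, rd_d). rewrite ev_der_f by auto.
  pose proof (mu_Cc a) as E. apply (f_equal RtoC) in E.
  rewrite RtoC_plus, !RtoC_mult in E. unfold kapv. rewrite ?RtoC_div by lra.
  set (v := vv a z) in *. set (m := RtoC (mu a)) in *. set (c := RtoC (Cc a)) in *.
  replace (RtoC 1) with (m * m - c * c)%C at 1 by (rewrite E; ring).
  field.
Qed.

Definition e0 : R := / 1000.

Lemma dec_D1 : dec (168 * eta0) (6 / 7) (Dop a d).
Proof.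
  apply dec_weaken with (4 * (eta0 / (6 / 7 - 5 / 6))) (6 / 7); [lra|unfold eta0; lra|].
  apply dec_Dop; auto; lra.
Qed.
Lemma dec_D2 : dec (37632 * eta0) (7 / 8) (Dop a (Dop a d)).
Proof.
  apply dec_weaken with (4 * (168 * eta0 / (7 / 8 - 6 / 7))) (7 / 8); [lra|unfold eta0; lra|].
  apply dec_Dop; auto using dec_D1; lra.
Qed.

Lemma P_small (z : C) : clh z -> Cmod (P z) <= e0.
Proof.
  intros Hz. rewrite P_eq. eapply Rle_trans; [apply (ev_bound (168 * eta0) (6 / 7))|]; auto using dec_D1, vv_le1.
  - lra.
  - unfold eta0, e0; lra.
Qed.
Lemma P_im (z : C) : clh z -> Rabs (snd (P z)) <= e0 * Rabs (snd (vv a z)).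
Proof.
  intros Hz. rewrite P_eq, snd_ev. eapply Rle_trans; [apply (evi_bound (168 * eta0) (6 / 7) (7 / 8))|]; auto using dec_D1, vv_le1; try lra.
  apply Rmult_le_compat_r; [apply Rabs_pos|]. unfold eta0, e0; lra.
Qed.
Lemma d_im (z : C) : clh z -> Rabs (snd (EV a d z)) <= e0 * Rabs (snd (vv a z)).
Proof.
  intros Hz. rewrite EV_eq, snd_ev. eapply Rle_trans; [apply (evi_bound eta0 (5 / 6) (6 / 7))|]; auto using vv_le1; try lra.
  apply Rmult_le_compat_r; [apply Rabs_pos|]. unfold eta0, e0; lra.
Qed.
Lemma D2_small (z : C) : clh z -> Cmod (EV a (Dop a (Dop a d)) z) <= e0.
Proof.
  intros Hz. rewrite EV_eq. eapply Rle_trans; [apply (ev_bound (37632 * eta0) (7 / 8))|]; auto using dec_D2, vv_le1.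
  - lra.
  - unfold eta0, e0; lra.
Qed.

Lemma mu_Cc_bounds : 1 <= mu a <= 77 / 50 /\ - (59 / 50) <= Cc a <= 0 /\ 6 / 25 <= mu a + Cc a.
Proof.
  destruct (Cc_mu a) as [C0 C1]. pose proof (mu_Cc a). pose proof (mu_ge1 a).
  assert (mu a <= 77 / 50) by nra. repeat split; lra.
Qed.

Lemma vv_re (z : C) : clh z -> Rabs (fst (vv a z)) <= 1.
Proof. intros Hz. eapply Rle_trans; [apply re_le_Cmod|apply vv_le1; auto]. Qed.

Lemma g_re_low (z : C) : clh z -> 6 / 25 <= mu a + Cc a * fst (vv a z).
Proof.
  intros Hz. destruct mu_Cc_bounds as (Hm & Hc & Hmc).
  pose proof (vv_re z Hz) as H. apply Rabs_le_between in H. nra.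
Qed.

Lemma CP_small (z : C) : clh z -> Cmod (Cc a * P z)%C <= 59 / 50 * e0.
Proof.
  intros Hz. rewrite Cmod_mult, Cmod_R. destruct mu_Cc_bounds as (Hm & Hc & Hmc).
  pose proof (P_small z Hz). apply Rmult_le_compat; auto using Rabs_pos, Cmod_ge_0.
  rewrite Rabs_left1; lra.
Qed.

Lemma dz_low (z : C) : clh z -> / 20 <= Cmod (dz z).
Proof.
  intros Hz. rewrite dz_eq by auto.
  set (g := (mu a + Cc a * vv a z)%C).
  pose proof (CP_small z Hz) as Hp. pose proof (g_re_low z Hz) as Hg.
  assert (H1 : 6 / 25 <= Cmod g).
  { eapply Rle_trans; [|apply re_le_Cmod]. eapply Rle_trans; [|apply Rle_abs]. unfold g; simpl. lra. }
  pose proof (Cmod_triangle (g * g + Cc a * P z) (- (Cc a * P z)))%C as T.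
  replace (g * g + Cc a * P z + - (Cc a * P z))%C with (g * g)%C in T by ring.
  rewrite Cmod_opp, Cmod_mult in T. unfold e0 in *. nra.
Qed.

(** The imaginary part of g^2 is 2 C Im v Re g, positive as C and Im v are negative. Both it and the
    perturbation are proportional to Im v, so the sign persists up to the axes of symmetry. *)
Lemma dz_im (z : C) : clh z -> a < 0 -> snd (vv a z) < 0 -> 0 < snd (dz z).
Proof.
  intros Hz Ha Hv. rewrite dz_eq by auto. pose proof (g_re_low z Hz) as Hg.
  pose proof (P_im z Hz) as Hp. rewrite (Rabs_left (snd (vv a z))) in Hp by auto.
  apply Rabs_le_between in Hp.
  assert (HC : Cc a < 0).
  { unfold Cc. pose proof (par_sq a).
    replace (2 * a / (1 - a * a)) with (- (2 * (- a) / (1 - a * a))) by (field; lra).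
    assert (0 < 2 * (- a) / (1 - a * a)) by (apply Rdiv_lt_0_compat; lra). lra. }
  simpl. set (p := fst (vv a z)) in *. set (q := snd (vv a z)) in *.
  replace ((mu a + (Cc a * p - 0 * q)) * (0 + (Cc a * q + 0 * p))
     + (0 + (Cc a * q + 0 * p)) * (mu a + (Cc a * p - 0 * q)) + (Cc a * snd (P z) + 0 * fst (P z)))
    with (Cc a * (2 * q * (mu a + Cc a * p) + snd (P z))) by ring.
  assert (2 * q * (mu a + Cc a * p) + snd (P z) < 0) by (unfold e0 in *; nra). nra.
Qed.

Lemma dz_axis (z : C) : clh z -> snd (vv a z) = 0 -> / 20 <= fst (dz z).
Proof.
  intros Hz Hv. rewrite dz_eq by auto. pose proof (g_re_low z Hz) as Hg.
  pose proof (CP_small z Hz) as Hp. pose proof (re_le_Cmod (Cc a * P z)%C) as Hr.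
  assert (Hb : Rabs (fst (Cc a * P z)%C) <= 59 / 50 * e0) by lra.
  apply Rabs_le_between in Hb. simpl in *. rewrite Hv. unfold e0 in *. nra.
Qed.

Lemma rem_zm : exists K, 0 <= K /\ forall z z', clh z -> clh z' ->
  Cmod (zm z' - zm z - (z' - z) * dz z)%C <= K * (Cmod (z' - z) * Cmod (z' - z)).
Proof.
  destruct (tame_EV a f rd_f) as (K & HK & _ & H). exists K; split; auto.
  intros z z' Hz Hz'. specialize (H z z' Hz Hz').
  replace (zm z' - zm z - (z' - z) * dz z)%C with
    (Ci * (EV a f z' - EV a f z - (z' - z) * (- Ci * EV a (Dop a f) z)))%C.
  - rewrite Cmod_mult. replace (Cmod Ci) with 1; [lra|].
    symmetry; apply Cmod_Ci.
  - rewrite !zmp_eq, dzp_eq. set (X := EV a f z'). set (Y := EV a f z). set (W := EV a (Dop a f) z).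
    assert (Hi : (Ci * Ci)%C = (- 1)%C) by (unfold Ci, Cmult, Copp, RtoC; simpl; f_equal; ring).
    transitivity (Ci * (X - Y) + (Ci * Ci) * (z' - z) * W)%C; [ring|]. rewrite Hi. ring.
Qed.

Lemma tm_dz : tm dz.
Proof.
  exists (fun z => - Ci * EV a (Dop a (Dop a f)) z)%C.
  eapply tame_ext; [| |apply (tame_add _ _ _ _ (tame_const 1%C) (tame_EV a _ (rd_Dop a _ rd_f)))];
    intros z _; rewrite ?dzp_eq; simpl; ring.
Qed.

Lemma zm_bounded : exists M, forall z, clh z -> Cmod (zm z - z)%C <= M.
Proof.
  destruct (tame_EV a f rd_f) as (K & HK & HB & _). exists (K + 1). intros z Hz.
  replace (zm z - z)%C with (Ci * (EV a f z - 1))%C by (rewrite zmp_eq; ring).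
  rewrite Cmod_mult. replace (Cmod Ci) with 1.
  - rewrite Rmult_1_l. eapply Rle_trans; [apply Cmod_minus|]. rewrite Cmod_1.
    destruct (HB z Hz); lra.
  - symmetry; apply Cmod_Ci.
Qed.

Lemma zm_period (x y : R) : zm (x + 2 * PI, y) = (fst (zm (x, y)) + 2 * PI, snd (zm (x, y))).
Proof.
  rewrite !zmp_eq, !EV_eq, vv_period. unfold Cplus, Cmult, Cminus, Ci, RtoC; simpl. f_equal; ring.
Qed.

Lemma zm_period_Z (k : Z) (x y : R) :
  zm (x + 2 * PI * IZR k, y) = (fst (zm (x, y)) + 2 * PI * IZR k, snd (zm (x, y))).
Proof.
  assert (Hn : forall (n : nat) x, zm (x + 2 * PI * INR n, y) = (fst (zm (x, y)) + 2 * PI * INR n, snd (zm (x, y)))).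
  { induction n as [|n IH]; intros x0.
    - simpl. rewrite Rmult_0_r, !Rplus_0_r. apply surjective_pairing.
    - rewrite S_INR. replace (x0 + 2 * PI * (INR n + 1)) with ((x0 + 2 * PI * INR n) + 2 * PI) by ring.
      rewrite zm_period, IH. simpl. f_equal; ring. }
  destruct (Z.le_gt_cases 0 k) as [L|L].
  - rewrite <- (Z2Nat.id k L), <- INR_IZR_INZ. apply Hn.
  - specialize (Hn (Z.to_nat (- k)) (x + 2 * PI * IZR k)).
    rewrite INR_IZR_INZ, Z2Nat.id, opp_IZR in Hn by lia.
    replace (x + 2 * PI * IZR k + 2 * PI * - IZR k) with x in Hn by ring.
    rewrite (surjective_pairing (zm (x + 2 * PI * IZR k, y))). rewrite Hn. simpl. f_equal. ring.
Qed.

Lemma zm_conj (x y : R) : y <= 0 -> zm (- x, y) = (- fst (zm (x, y)), snd (zm (x, y))).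
Proof.
  intros Hy. rewrite !zmp_eq, !EV_eq, vv_conj, ev_conj; auto.
  - unfold Cconj, Cplus, Cmult, Cminus, Copp, Ci, RtoC; simpl. f_equal; ring.
  - destruct a as [a' Ha]; simpl; lra.
Qed.

Lemma zm_fst (z : C) : clh z -> fst (zm z) = fst z - Cc a * (2 * snd (vv a z) + snd (EV a d z)).
Proof.
  intros Hz. rewrite zmp_eq, !EV_eq, ev_f by (now apply vv_le1). simpl. ring.
Qed.

Lemma vv_im_neg (x y : R) : y <= 0 -> 0 < x < PI -> snd (vv a (x, y)) < 0.
Proof.
  intros Hy Hx. assert (Hz : clh (x, y)) by exact Hy. rewrite vv_im by auto.
  pose proof (par_sq a). pose proof (sin_gt_0 x (proj1 Hx) (proj2 Hx)). pose proof (exp_pos y).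
  assert (Hs : 0 < sqmod (1 - a * uu (x, y))%C).
  { rewrite <- Cmod_sqmod. pose proof (den_low a _ (uu_le1 _ Hz)). nra. }
  replace (snd (uu (x, y))) with (- (exp y * sin x)) by (rewrite uu_eq; reflexivity). apply Ropp_lt_cancel. rewrite Ropp_0.
  replace (- ((1 - a * a) * - (exp y * sin x) / sqmod (1 - a * uu (x, y))%C))
    with ((1 - a * a) * (exp y * sin x) / sqmod (1 - a * uu (x, y))%C) by (field; lra).
  apply Rdiv_lt_0_compat; auto. apply Rmult_lt_0_compat; [lra|]. apply Rmult_lt_0_compat; auto.
Qed.

Lemma vv_im_axis (x y : R) : y <= 0 -> sin x = 0 -> snd (vv a (x, y)) = 0.
Proof.
  intros Hy Hx. rewrite vv_im by exact Hy. replace (snd (uu (x, y))) with (- (exp y * sin x)) by (rewrite uu_eq; reflexivity). rewrite Hx. unfold Rdiv; ring.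
Qed.

(** The increment of [zm] is the integral of z' along the segment. The factor c selects the
    direction to be tested: the conjugate of the segment for its rotation, 1 for the height. *)
Lemma seg_snd (z1 z2 c : C) : clh z1 -> clh z2 ->
  (forall t, 0 < t < 1 -> 0 < snd ((z2 - z1) * dz (z1 + t * (z2 - z1)) * c)%C) ->
  0 < snd ((zm z2 - zm z1) * c)%C.
Proof.
  intros H1 H2 Hp. destruct rem_zm as (K & HK & Hrem). set (h := (z2 - z1)%C) in *.
  assert (Hc : forall t, 0 <= t <= 1 -> clh (z1 + t * h)%C).
  { intros t Ht. unfold closed_lower_half, h in *. simpl. nra. }
  pose proof (Cmod_ge_0 c) as Hcc. pose proof (Cmod_ge_0 h) as Hh.
  pose proof (seg_pos (fun t => snd ((zm (z1 + t * h) - zm z1) * c)%C)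
    (fun t => snd (h * dz (z1 + t * h) * c)%C) (K * (Cmod h * Cmod h) * Cmod c)) as S.
  cbv beta in S.
  replace (z1 + 0 * h)%C with z1 in S by ring. replace (z1 + 1 * h)%C with z2 in S by (unfold h; ring).
  replace ((zm z1 - zm z1) * c)%C with (RtoC 0) in S by ring. simpl snd at 3 in S.
  apply S; auto.
  - apply Rmult_le_pos; auto. apply Rmult_le_pos; auto. nra.
  - intros t t' Ht Ht'. specialize (Hrem _ _ (Hc t Ht) (Hc t' Ht')).
    replace (z1 + t' * h - (z1 + t * h))%C with ((t' - t)%R * h)%C in Hrem by (rewrite RtoC_minus; ring).
    rewrite Cmod_mult, Cmod_R in Hrem.
    apply Rle_trans with (Cmod ((zm (z1 + t' * h) - zm (z1 + t * h) - (t' - t)%R * h * dz (z1 + t * h)) * c)%C).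
    + eapply Rle_trans; [|apply im_le_Cmod]. right; f_equal. simpl. ring.
    + rewrite Cmod_mult.
      replace (K * (Cmod h * Cmod h) * Cmod c * (Rabs (t' - t) * Rabs (t' - t)))
        with (K * (Rabs (t' - t) * Cmod h * (Rabs (t' - t) * Cmod h)) * Cmod c) by ring.
      apply Rmult_le_compat_r; auto.
Qed.

(* Im z' > 0 inside the half-strip, so z turns every segment counterclockwise by less than pi. This one
   inequality yields injectivity, the monotonicity of the height, and [fst zm] decreasing towards the
   surface along curves of constant height, which keeps the fluid out of the bubble. *)
Lemma half_strip_mono (z1 z2 : C) : a < 0 -> clh z1 -> clh z2 ->
  0 <= fst z1 <= PI -> 0 <= fst z2 <= PI -> z1 <> z2 ->
  ~ (fst z1 = 0 /\ fst z2 = 0) -> ~ (fst z1 = PI /\ fst z2 = PI) ->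
  0 < snd ((zm z2 - zm z1) * Cconj (z2 - z1))%C.
Proof.
  intros Ha H1 H2 B1 B2 Hne N0 NP. apply seg_snd; auto. intros t Ht.
  set (h := (z2 - z1)%C). set (z := (z1 + t * h)%C).
  assert (Hz : clh z).
  { unfold z, h, closed_lower_half in *. simpl. nra. }
  assert (Hx : 0 < fst z < PI).
  { unfold z, h. simpl. replace (fst z1 + (t * (fst z2 + - fst z1) - 0 * (snd z2 + - snd z1)))
      with ((1 - t) * fst z1 + t * fst z2) by ring.
    split.
    - destruct (Req_dec (fst z1) 0), (Req_dec (fst z2) 0); try tauto; try nra.
    - destruct (Req_dec (fst z1) PI), (Req_dec (fst z2) PI); try tauto; try nra. }
  assert (Hi : 0 < snd (dz z)).
  { apply dz_im; auto. rewrite (surjective_pairing z). apply vv_im_neg; auto. }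
  assert (Hh : 0 < Cmod h).
  { apply Cmod_gt_0. intros E. apply Hne. unfold h in E.
    replace z2 with ((z2 - z1) + z1)%C by ring. rewrite E. ring. }
  replace (snd (h * dz z * Cconj h)%C) with (sqmod h * snd (dz z)).
  - rewrite <- Cmod_sqmod. apply Rmult_lt_0_compat; auto. nra.
  - unfold sqmod, Cconj. simpl. ring.
Qed.

(** On the axes of symmetry Im z' vanishes, but there z' is real and at least 1/20. *)
Lemma axis_mono (x y1 y2 : R) : sin x = 0 -> y1 < y2 -> y2 <= 0 ->
  snd (zm (x, y1)) < snd (zm (x, y2)).
Proof.
  intros Hx Hy H2.
  assert (H : 0 < snd ((zm (x, y2) - zm (x, y1)) * 1)%C).
  { apply seg_snd; [unfold closed_lower_half; simpl; lra|exact H2|]. intros t Ht.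
    set (z := ((x, y1) + t * ((x, y2) - (x, y1)))%C).
    assert (Ez : z = (x, y1 + t * (y2 - y1))).
    { unfold z, Cplus, Cmult, Cminus, Copp, RtoC; simpl. f_equal; ring. }
    assert (Hz : clh z) by (rewrite Ez; unfold closed_lower_half; simpl; nra).
    pose proof (dz_axis z Hz) as Hd'. rewrite Ez in Hd' at 1. rewrite vv_im_axis in Hd'; auto; [|nra].
    specialize (Hd' eq_refl). simpl. nra. }
  simpl in H. lra.
Qed.

Lemma x_lt_alpha (x y : R) : a < 0 -> y <= 0 -> 0 < x < PI -> fst (zm (x, y)) < x.
Proof.
  intros Ha Hy Hx. rewrite zm_fst by exact Hy. simpl.
  pose proof (vv_im_neg x y Hy Hx) as Hv. pose proof (d_im (x, y) Hy) as Hdi.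
  rewrite (Rabs_left (snd (vv a (x, y)))) in Hdi by auto. apply Rabs_le_between in Hdi.
  assert (HC : Cc a < 0).
  { unfold Cc. pose proof (par_sq a).
    replace (2 * a / (1 - a * a)) with (- (2 * (- a) / (1 - a * a))) by (field; lra).
    assert (0 < 2 * (- a) / (1 - a * a)) by (apply Rdiv_lt_0_compat; lra). lra. }
  assert (2 * snd (vv a (x, y)) + snd (EV a d (x, y)) < 0) by (unfold e0 in *; lra). nra.
Qed.

Lemma x_axis (x y : R) : y <= 0 -> sin x = 0 -> fst (zm (x, y)) = x.
Proof.
  intros Hy Hx. rewrite zm_fst by exact Hy. pose proof (d_im (x, y) Hy) as Hdi.
  rewrite vv_im_axis in * by auto. rewrite Rabs_R0, Rmult_0_r in Hdi.
  assert (E : snd (EV a d (x, y)) = 0).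
  { pose proof (Rabs_pos (snd (EV a d (x, y)))). apply Rabs_eq_0. lra. }
  rewrite E. simpl. ring.
Qed.

Lemma x_deep (x y : R) : a < 0 -> y < 0 -> 0 < x < PI -> fst (zm (x, 0)) < fst (zm (x, y)).
Proof.
  intros Ha Hy Hx.
  assert (H : 0 < snd ((zm (x, 0) - zm (x, y)) * Cconj ((x, 0) - (x, y)))%C).
  { apply half_strip_mono; auto; simpl; try lra.
    - unfold closed_lower_half; simpl; lra.
    - apply clh_boundary.
    - intros E; injection E; lra. }
  simpl in H. nra.
Qed.

Lemma y_mono (x1 x2 : R) : a < 0 -> 0 <= x1 -> x1 < x2 -> x2 <= PI ->
  snd (zm (x1, 0)) < snd (zm (x2, 0)).
Proof.
  intros Ha H0 H1 H2.
  assert (H : 0 < snd ((zm (x2, 0) - zm (x1, 0)) * Cconj ((x2, 0) - (x1, 0)))%C).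
  { apply half_strip_mono; auto using clh_boundary; simpl; try lra.
    intros E; injection E; lra. }
  simpl in H. nra.
Qed.

Hypothesis Xpos : forall x, 0 <= x <= PI -> 0 <= fst (zm (x, 0)).

Lemma strip_x (x y : R) : a < 0 -> y <= 0 -> 0 < x < PI ->
  0 <= fst (zm (x, y)) < PI /\ (y < 0 -> 0 < fst (zm (x, y))).
Proof.
  intros Ha Hy Hx. pose proof (x_lt_alpha x y Ha Hy Hx). pose proof (Xpos x ltac:(lra)).
  destruct (Req_dec y 0) as [E|E]; [subst; lra|].
  pose proof (x_deep x y Ha ltac:(lra) Hx). lra.
Qed.

Lemma reduce_period (x : R) : exists (k : Z) x', x = x' + 2 * PI * IZR k /\ - PI < x' <= PI.
Proof.
  pose proof PI_RGT_0. set (r := (x - PI) / (2 * PI)).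
  (* [up r] is r + 1 exactly for integral r, when x lies on a crest line and its representative has
     to be PI rather than -PI. *)
  destruct (archimed r) as [H1 H2]. exists (Rdefinitions.up r - 1 + (if Req_EM_T (IZR (Rdefinitions.up r)) (r + 1) then 0 else 1))%Z.
  assert (Er : x = PI + r * (2 * PI)) by (unfold r; field; lra).
  destruct (Req_EM_T (IZR (Rdefinitions.up r)) (r + 1)) as [E|E].
  - exists (x - 2 * PI * r). rewrite Z.add_0_r, minus_IZR, E. split; [ring|]. rewrite Er. lra.
  - exists (x - 2 * PI * IZR (Rdefinitions.up r)). rewrite plus_IZR, minus_IZR. split; [ring|].
    rewrite Er. assert (IZR (Rdefinitions.up r) < r + 1) by lra. nra.
Qed.

Lemma zm_half_inj (z1 z2 : C) : a < 0 -> clh z1 -> clh z2 ->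
  0 <= fst z1 <= PI -> 0 <= fst z2 <= PI -> zm z1 = zm z2 -> z1 = z2.
Proof.
  intros Ha H1 H2 B1 B2 E. apply NNPP; intros Hne.
  assert (Hax : forall x, sin x = 0 -> fst z1 = x -> fst z2 = x -> False).
  { intros x Hx E1 E2. destruct z1 as [x1 y1], z2 as [x2 y2]; simpl in *. subst.
    unfold closed_lower_half in *; simpl in *.
    destruct (Rtotal_order y1 y2) as [L|[L|L]].
    - pose proof (axis_mono _ _ _ Hx L H2). rewrite E in *. lra.
    - subst. now apply Hne.
    - pose proof (axis_mono _ _ _ Hx L H1). rewrite E in *. lra. }
  pose proof (half_strip_mono z1 z2 Ha H1 H2 B1 B2 Hne) as H.
  rewrite E in H. replace ((zm z2 - zm z2) * Cconj (z2 - z1))%C with (RtoC 0) in H by ring.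
  simpl in H. apply (Rlt_irrefl 0), H.
  - intros [E1 E2]. apply (Hax 0); auto using sin_0.
  - intros [E1 E2]. apply (Hax PI); auto using sin_PI.
Qed.

(** Each half-period stays on its side of the trough line and is mapped injectively. So a
    coincidence needs abscissa 0 on both halves, and below the boundary the abscissa is strictly
    inside. *)
Lemma zm_coincide (z1 z2 : C) : a < 0 -> clh z1 -> clh z2 -> zm z1 = zm z2 ->
  z1 = z2 \/ exists (k : Z) (tau : R), 0 < tau < PI /\ fst (zm (tau, 0)) = 0 /\
    ((z1 = (- tau + 2 * PI * IZR k, 0) /\ z2 = (tau + 2 * PI * IZR k, 0)) \/
     (z1 = (tau + 2 * PI * IZR k, 0) /\ z2 = (- tau + 2 * PI * IZR k, 0))).
Proof.
  intros Ha H1 H2 E. pose proof PI_RGT_0 as HPI.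
  destruct z1 as [x1 y1], z2 as [x2 y2]. unfold closed_lower_half in H1, H2; simpl in H1, H2.
  destruct (reduce_period x1) as (k1 & u1 & E1 & B1). destruct (reduce_period x2) as (k2 & u2 & E2 & B2).
  subst x1 x2. rewrite !zm_period_Z in E. injection E as Ex Ey.
  assert (Loc : forall u y, - PI < u <= PI -> y <= 0 ->
     (u < 0 -> - PI < fst (zm (u, y)) <= 0 /\ (y < 0 -> fst (zm (u, y)) < 0)) /\
     (u = 0 -> fst (zm (u, y)) = 0) /\ (u = PI -> fst (zm (u, y)) = PI) /\
     (0 < u < PI -> 0 <= fst (zm (u, y)) < PI /\ (y < 0 -> 0 < fst (zm (u, y))))).
  { intros u y Hu Hy. split; [|split; [|split]].
    - intros Hn. replace u with (- - u) by ring. rewrite zm_conj by auto. simpl.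
      destruct (strip_x (- u) y Ha Hy) as [S1 S2]; [lra|]. split; [lra|]. intros L; specialize (S2 L); lra.
    - intros; subst; apply x_axis; auto using sin_0.
    - intros; subst; apply x_axis; auto using sin_PI.
    - intros; now apply strip_x. }
  assert (Bx : forall u y, - PI < u <= PI -> y <= 0 -> - PI < fst (zm (u, y)) <= PI).
  { intros u y Hu Hy. destruct (Loc u y Hu Hy) as (L1 & L2 & L3 & L4).
    destruct (Rtotal_order u 0) as [L|[L|L]]; [specialize (L1 L); lra|specialize (L2 L); lra|].
    destruct (Req_dec u PI) as [LP|LP]; [specialize (L3 LP); lra|specialize (L4 ltac:(lra)); lra]. }
  pose proof (Bx u1 y1 B1 H1) as X1. pose proof (Bx u2 y2 B2 H2) as X2.
  (* Both reduced abscissae lie in the half-open interval (-PI, PI], so equal abscissae force equal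
     period indices. *)
  assert (Ek : k1 = k2).
  { assert (Hk : -1 < IZR (k1 - k2) < 1).
    { rewrite minus_IZR. split; apply Rmult_lt_reg_l with (2 * PI); lra. }
    destruct Hk as [Hk1 Hk2]. apply lt_IZR in Hk1. apply lt_IZR in Hk2. lia. }
  subst k2. assert (Exx : fst (zm (u1, y1)) = fst (zm (u2, y2))) by lra. clear Ex.
  assert (Half : forall v1 v2, 0 <= v1 <= PI -> 0 <= v2 <= PI ->
     fst (zm (v1, y1)) = fst (zm (v2, y2)) -> snd (zm (v1, y1)) = snd (zm (v2, y2)) ->
     v1 = v2 /\ y1 = y2).
  { intros v1 v2 V1 V2 F1 F2.
    assert (Eq : (v1, y1) = (v2, y2)).
    { apply zm_half_inj; auto. rewrite (surjective_pairing (zm (v1, y1))), F1, F2.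
      symmetry; apply surjective_pairing. }
    injection Eq; auto. }
  destruct (Loc u1 y1 B1 H1) as (L1 & L2 & L3 & L4). destruct (Loc u2 y2 B2 H2) as (R1 & R2 & R3 & R4).
  assert (Cj : forall u y, y <= 0 -> fst (zm (- u, y)) = - fst (zm (u, y)) /\ snd (zm (- u, y)) = snd (zm (u, y))).
  { intros u y Hy. rewrite zm_conj by auto. split; reflexivity. }
  destruct (Cj u1 y1 H1) as [C1 C2]. destruct (Cj u2 y2 H2) as [C3 C4].
  destruct (Rlt_dec u1 0) as [N1|N1]; destruct (Rlt_dec u2 0) as [N2|N2].
  - destruct (Half (- u1) (- u2)) as [F1 F2]; try lra.
    left. f_equal; [|auto]. replace u1 with u2 by lra. reflexivity.
  - right. specialize (L1 N1).
    assert (X20 : 0 <= fst (zm (u2, y2))).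
    { destruct (Req_dec u2 0) as [Z|Z]; [rewrite R2; auto; lra|].
      destruct (Req_dec u2 PI) as [Z'|Z']; [rewrite R3; auto; lra|]. apply R4; lra. }
    assert (Y1 : y1 = 0).
    { apply NNPP; intros Hy. destruct L1 as [_ L1]. specialize (L1 ltac:(lra)). lra. }
    destruct (Half (- u1) u2) as [F1 F2]; try lra.
    subst y1 y2 u2. exists k1, (- u1). repeat split; try lra.
    left. split; f_equal; ring.
  - right. specialize (R1 N2).
    assert (X20 : 0 <= fst (zm (u1, y1))).
    { destruct (Req_dec u1 0) as [Z|Z]; [rewrite L2; auto; lra|].
      destruct (Req_dec u1 PI) as [Z'|Z']; [rewrite L3; auto; lra|]. apply L4; lra. }
    assert (Y2 : y2 = 0).
    { apply NNPP; intros Hy. destruct R1 as [_ R1]. specialize (R1 ltac:(lra)). lra. }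
    destruct (Half u1 (- u2)) as [F1 F2]; try lra.
    subst y2 y1 u1. exists k1, (- u2). repeat split; try lra.
    right. split; f_equal; ring.
  - left. destruct (Half u1 u2) as [F1 F2]; try lra. now subst.
Qed.
End Geometry.

Lemma tm_mul (F G : C -> C) : tm F -> tm G -> tm (fun z => F z * G z)%C.
Proof. intros [F' H] [G' H']. eexists. apply (tame_mul _ _ _ _ H H'). Qed.
Lemma tm_add (F G : C -> C) : tm F -> tm G -> tm (fun z => F z + G z)%C.
Proof. intros [F' H] [G' H']. eexists. apply (tame_add _ _ _ _ H H'). Qed.
Lemma tm_const (c : C) : tm (fun _ => c).
Proof. eexists. apply (tame_const c). Qed.
Lemma tm_EV (a : par) (w : nat -> R) : rd w -> tm (EV a w).
Proof. intros H. eexists. apply (tame_EV a w H). Qed.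

Lemma ev_Dop_circle (a : par) (w : nat -> R) (v : C) : rd w -> sqmod v = 1 ->
  ev (Dop a w) v = ((mu a + Cc a * fst v)%R * ev (theta w) v)%C.
Proof.
  intros H Hv.
  assert (Hv1 : Cmod v <= 1).
  { pose proof (Cmod_sqmod v). pose proof (Cmod_ge_0 v). nra. }
  rewrite ev_Dop, ev_theta by auto.
  assert (E : kapv a v = ((mu a + Cc a * fst v)%R * v)%C).
  { unfold sqmod in Hv. unfold kapv. destruct v as [p q].
    unfold Cmult, Cplus, Cdiv, Cmult, Cinv, RtoC; simpl in *. f_equal; [|field].
    replace (q * q) with (1 - p * p) by lra. field. }
  rewrite E. ring.
Qed.

(** * From the boundary relations to a solution *)

Section Solution.
Local Opaque vv uu EV ev zmp dzp.
Variables (a : par) (s : R) (d : nat -> R) (G b M : R) (hh : nat -> R).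
Hypothesis d0 : d 0%nat = 0.
Hypothesis d1 : d 1%nat = 0.
Hypothesis Hd : dec eta0 (5 / 6) d.
Hypothesis Hhh : dec M (5 / 6) hh.
Notation f := (fseq a s d).
Notation zm := (zmp a s d).
Notation dz := (dzp a s d).
Hypothesis Heq : boundary_relations a s d hh G b.
Hypothesis Hinj : forall z1 z2, lower_half z1 -> clh z2 -> zm z1 = zm z2 -> z1 = z2.

Let rdf : rd f. Proof. apply rd_f; auto. Qed.
Let rdh : rd hh. Proof. exists M, (5 / 6). split; [lra|auto]. Qed.
Let dnz (z : C) : clh z -> dz z <> 0%C.
Proof.
  intros Hz E. pose proof (dz_low a s d d0 d1 Hd z Hz) as H. rewrite E, Cmod_0 in H. lra.
Qed.
Let low : exists c, 0 < c /\ forall z, clh z -> c <= Cmod (dz z).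
Proof. exists (/ 20). split; [lra|]. apply dz_low; auto. Qed.
Let tmdz : tm dz. Proof. apply tm_dz; auto. Qed.

Definition dz' (z : C) : C := (- Ci * EV a (Dop a (Dop a f)) z)%C.
Let tdz : tame dz dz'.
Proof.
  eapply tame_ext; [| |apply (tame_add _ _ _ _ (tame_const 1%C) (tame_EV a _ (rd_Dop a _ rdf)))];
    intros z _; unfold dz'; rewrite ?dzp_eq; simpl; ring.
Qed.
Definition iz' (z : C) : C := (- dz' z * (/ dz z * / dz z))%C.
Let tiz : tame (fun z => / dz z)%C iz'.
Proof. apply (tame_inv dz dz' (/ 20)); auto; [lra|]. apply dz_low; auto. Qed.
Definition F0 (z : C) : C := (- Ci * EV a (Dop a hh) z)%C.
Definition F0' (z : C) : C := (- Ci * (- Ci * EV a (Dop a (Dop a hh)) z))%C.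
Let tF0 : tame F0 F0'.
Proof.
  eapply tame_ext; [| |apply (tame_mul _ _ _ _ (tame_const (- Ci)%C) (tame_EV a _ (rd_Dop a _ rdh)))];
    intros z _; unfold F0, F0'; simpl; ring.
Qed.
(** [F0] is the derivative of E in zeta, so [H1] and [H2] are the first and second derivatives of E
    with respect to the physical variable z, pulled back to the half-plane. *)
Definition H1 (z : C) : C := (F0 z * / dz z)%C.
Definition H1' (z : C) : C := (F0' z * / dz z + F0 z * iz' z)%C.
Definition H2 (z : C) : C := (H1' z * / dz z)%C.
Let tH1 : tame H1 H1'. Proof. apply (tame_mul _ _ _ _ tF0 tiz). Qed.
Let lH2 : lips H2.
Proof.
  apply tm_lips.
  assert (t1 : tm (fun z => / dz z)%C) by (eexists; apply tiz).
  assert (t2 : tm (fun z => - dz' z)%C).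
  { destruct (tm_mul _ _ (tm_const Ci) (tm_EV a _ (rd_Dop a _ (rd_Dop a _ rdf)))) as [F' HF].
    exists F'. eapply tame_ext; [| |exact HF]; intros z _; unfold dz'; ring. }
  assert (t3 : tm F0) by (eexists; apply tF0).
  assert (t4 : tm F0').
  { apply (tm_mul (fun _ => - Ci)%C); [apply tm_const|].
    apply (tm_mul (fun _ => - Ci)%C); [apply tm_const|]. apply tm_EV, rd_Dop, rd_Dop; auto. }
  apply tm_mul; auto. apply tm_add; [apply tm_mul; auto|].
  apply tm_mul; auto. apply tm_mul; auto. apply tm_mul; auto.
Qed.

Definition EE : C -> C := EV a hh.
Let tE : tame EE F0. Proof. apply (tame_EV a hh rdh). Qed.

Lemma snd_trace (x : R) : snd (zm (x, 0)) = evr f (vv a (x, 0)) - 1.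
Proof.
  rewrite zmp_eq, EV_eq, <- fst_ev. simpl. ring.
Qed.

Let psi0 (x : R) : Psi zm EE (x, 0) = 0.
Proof.
  unfold Psi. rewrite snd_trace. destruct (Heq (vv a (x, 0)) (vv_circle a x)) as (E & _ & _).
  unfold EE. rewrite EV_eq, fst_ev, E. field.
Qed.

Let strm := stream zm EE.

Definition solution_wave : wave := Wave 1 (b / 2 - G) (image zm) strm zm.

Lemma solution_conformal : conformal_C1 solution_wave.
Proof.
  destruct (rem_zm a s d d0 d1 Hd) as (K & HK & Hrem).
  destruct (zm_bounded a s d d0 d1 Hd) as (B & HB).
  split; [intros p; reflexivity|]. split.
  { intros z1 z2 L1 L2. apply Hinj; auto using lower_clh. }
  exists dz. split; [apply (zm_derive zm dz K HK Hrem)|].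
  split; [apply (trace_derive zm dz K HK Hrem)|]. split; [|split].
  - apply lips_continuous_on, (zm_lips zm dz K B); auto.
  - apply lips_continuous_on, tm_lips, tmdz.
  - intros z Hz. apply dnz; auto.
Qed.

Lemma solution_periodic : periodic_param solution_wave.
Proof.
  split.
  - intros z Hz. simpl. rewrite zm_period. now rewrite <- surjective_pairing.
  - destruct (zm_bounded a s d d0 d1 Hd) as (B & HB). exists B. intros z Hz. simpl.
    specialize (HB z Hz). pose proof (re_le_Cmod (zm z - z)%C). pose proof (im_le_Cmod (zm z - z)%C).
    cbn [fst snd Cminus Cplus Copp] in *. unfold Rminus. lra.
Qed.

Lemma solution_domain : fluid_domain solution_wave.
Proof.
  destruct (rem_zm a s d d0 d1 Hd) as (K & HK & Hrem).
  destruct (zm_bounded a s d d0 d1 Hd) as (B & HB).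
  assert (Hper : forall z, clh z -> zm (fst z + 2 * PI, snd z) = (fst (zm z) + 2 * PI, snd (zm z))).
  { intros z Hz. rewrite zm_period. now rewrite <- surjective_pairing. }
  split; [|split; [|split]].
  - split; [apply (image_open zm dz K HK Hrem tmdz low)|].
    split; [apply (image_connected zm dz K B HK Hrem tmdz HB)|].
    exists (zm (0, -1)). exists (0, -1). split; auto. unfold lower_half; simpl; lra.
  - apply (image_periodic zm Hper).
  - apply (image_below zm B HB).
  - intros p. apply (frontier_image zm dz K B HK Hrem tmdz HB Hinj p).
Qed.

Lemma solution_preimage (p : C) : fluid_or_surface solution_wave p -> exists z, clh z /\ zm z = p.
Proof.
  intros [(z & Hz & E)|(x & E)].
  - exists z; split; auto using lower_clh.
  - exists (x, 0). split; [apply clh_boundary|auto].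
Qed.

Lemma solution_stream (z : C) : clh z -> strm (zm z) = Psi zm EE z.
Proof. apply (stream_zm zm Hinj EE psi0). Qed.

Lemma Psi_reflect (x y : R) : y <= 0 -> Psi zm EE (- x, y) = Psi zm EE (x, y).
Proof.
  intros Hy. unfold Psi, EE. rewrite zm_conj, !EV_eq, vv_conj, ev_conj; auto.
  destruct a as [a' Ha]; simpl; lra.
Qed.

Lemma Psi_period (k : Z) (x y : R) : Psi zm EE (x + 2 * PI * IZR k, y) = Psi zm EE (x, y).
Proof.
  unfold Psi, EE. rewrite zm_period_Z. rewrite !EV_eq. simpl snd.
  assert (E : vv a (x + 2 * PI * IZR k, y) = vv a (x, y)).
  { assert (Hn : forall (n : nat) x, vv a (x + 2 * PI * INR n, y) = vv a (x, y)).
    { induction n as [|n IH]; intros x0.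
      - simpl. now rewrite Rmult_0_r, Rplus_0_r.
      - rewrite S_INR. replace (x0 + 2 * PI * (INR n + 1)) with ((x0 + 2 * PI * INR n) + 2 * PI) by ring.
        now rewrite vv_period. }
    destruct (Z.le_gt_cases 0 k) as [L|L].
    - rewrite <- (Z2Nat.id k L), <- INR_IZR_INZ. apply Hn.
    - specialize (Hn (Z.to_nat (- k)) (x + 2 * PI * IZR k)).
      rewrite INR_IZR_INZ, Z2Nat.id, opp_IZR in Hn by lia. rewrite <- Hn. f_equal. f_equal. ring. }
  now rewrite E.
Qed.

(** Conjugation of v combined with a translation by periods reflects the parameter half-plane, and
    [zm] and [Psi] commute with this reflection. *)
Lemma solution_axis (k : Z) (c : C) : fst c = PI * IZR k -> symmetric_about solution_wave c.
Proof.
  intros Hc.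
  assert (Hr : forall z, clh z -> zm (- fst z + 2 * PI * IZR k, snd z) = reflect c (zm z)).
  { intros z Hz. rewrite zm_period_Z, zm_conj by exact Hz. rewrite <- surjective_pairing.
    unfold reflect. rewrite Hc. simpl. f_equal. ring. }
  assert (Hrr : forall p, reflect c (reflect c p) = p).
  { intros [p q]. unfold reflect; simpl. f_equal; ring. }
  assert (Hi : forall p, image zm p -> image zm (reflect c p)).
  { intros p (z & Hz & E). exists (- fst z + 2 * PI * IZR k, snd z). split; [exact Hz|].
    rewrite Hr by (apply lower_clh; auto). now rewrite E. }
  split.
  - intros p. split; intros H; [|now apply Hi]. rewrite <- Hrr. now apply Hi.
  - intros p Hp. destruct (solution_preimage p Hp) as (z & Hz & E). simpl. rewrite <- E, <- Hr by auto.
    rewrite !solution_stream by auto. rewrite Psi_period, Psi_reflect by exact Hz.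
    now rewrite <- surjective_pairing.
Qed.

Lemma dz_circle (x : R) : let v := vv a (x, 0) in let J := mu a + Cc a * fst v in
  dz (x, 0) = (1 + J * evr (theta f) v, J * evi (theta f) v).
Proof.
  intros v J. rewrite dzp_eq, EV_eq, ev_Dop_circle by (auto using vv_circle). fold v J.
  rewrite (surjective_pairing (ev (theta f) v)), fst_ev, snd_ev.
  unfold Cmult, Cplus, RtoC; simpl. f_equal; ring.
Qed.

(** On the boundary (H1 + i Y) z' is purely imaginary, by the second boundary relation, and its
    imaginary part is the quantity squared in the third. The factor |z'|^2 then cancels. *)
Lemma bernoulli_identity (x : R) :
  let h := H1 (x, 0) in
  let Y := snd (zm (x, 0)) + 1 in
  fst h ^ 2 + (- Y - snd h) ^ 2 = b - 2 * G * Y.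
Proof.
  intros h Y. set (v := vv a (x, 0)). destruct (Heq v (vv_circle a x)) as (_ & E1 & E2).
  assert (EY : Y = evr f v) by (unfold Y; rewrite snd_trace; fold v; ring).
  rewrite <- EY in E1, E2. set (J := mu a + Cc a * fst v) in *.
  pose proof (dz_circle x) as Edz. cbv zeta in Edz. fold v J in Edz.
  pose proof (dnz (x, 0) (clh_boundary x)) as Hn.
  assert (Eh : (h * dz (x, 0))%C = (- Ci * (J * ev (theta hh) v))%C).
  { unfold h, H1, F0. rewrite EV_eq, ev_Dop_circle by (auto using vv_circle). fold v J. field; auto. }
  assert (Sd : 0 < sqmod (dz (x, 0))).
  { rewrite <- Cmod_sqmod. pose proof (dz_low a s d d0 d1 Hd (x, 0) (clh_boundary x)). nra. }
  assert (Key : sqmod ((h + Ci * Y) * dz (x, 0))%C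
     = (Y + J * (Y * evr (theta f) v - evr (theta hh) v)) ^ 2).
  { replace ((h + Ci * Y) * dz (x, 0))%C with (h * dz (x, 0) + Ci * Y * dz (x, 0))%C by ring.
    rewrite Eh, Edz, (surjective_pairing (ev (theta hh) v)), fst_ev, snd_ev. unfold sqmod, Cmult, Cplus, Copp, Ci, RtoC; simpl.
    replace (evi (theta hh) v) with (Y * evi (theta f) v) by lra. ring. }
  rewrite sqmod_mult in Key. rewrite E2 in Key. rewrite Edz in Key at 1.
  assert (Es : sqmod (1 + J * evr (theta f) v, J * evi (theta f) v)
     = (1 + J * evr (theta f) v) ^ 2 + (J * evi (theta f) v) ^ 2) by (unfold sqmod; simpl; ring).
  rewrite Edz, Es in Sd. rewrite Es in Key.
  apply Rmult_eq_reg_r in Key; [|lra]. rewrite <- Key. unfold sqmod, Ci; simpl. ring.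
Qed.

(** The derivative of E carries the factor kapv (v) = (1 - a^2) u / (1 - a u)^2, and |u| = exp
    (beta). *)
Lemma far_decay : exists K, 0 <= K /\ forall z, clh z -> Cmod (H1 z) <= K * exp (snd z).
Proof.
  destruct (rd_der _ rdh) as (N & q & Hq & Hder).
  set (B := 2 * (N / (1 - q))).
  assert (HB : 0 <= B).
  { pose proof (dec_pos _ _ _ Hder). assert (0 <= N / (1 - q)) by (apply Rdiv_le_0_compat; lra). unfold B; lra. }
  exists (80 * B). split; [lra|]. intros z Hz. unfold H1, F0.
  rewrite !Cmod_mult, Cmod_opp, Cmod_Ci, Rmult_1_l, Cmod_inv by auto.
  pose proof (dz_low a s d d0 d1 Hd z Hz) as Hl.
  assert (Hi : / Cmod (dz z) <= 20).
  { replace 20 with (/ / 20) by field. apply Rinv_le_contravar; lra. }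
  assert (Hi0 : 0 <= / Cmod (dz z)) by (left; apply Rinv_0_lt_compat; lra).
  rewrite EV_eq, ev_Dop by (auto using vv_le1). rewrite kapv_vv, !Cmod_mult by auto.
  rewrite Cmod_uu, Cmod_inv by (apply den_nz, uu_le1; auto).
  pose proof (den_low a _ (uu_le1 z Hz)) as Hden.
  set (D := Cmod (1 - a * uu z)) in *.
  assert (HD : / D <= 2) by (replace 2 with (/ / 2) by field; apply Rinv_le_contravar; lra).
  assert (HD0 : 0 < / D) by (apply Rinv_0_lt_compat; lra).
  assert (Hev : Cmod (ev (der hh) (vv a z)) <= B) by (apply (ev_bound N q); auto using vv_le1; lra).
  assert (Ha : Cmod (1 - a * a)%C <= 1).
  { rewrite <- RtoC_mult, <- RtoC_minus, Cmod_R. pose proof (par_sq a). rewrite Rabs_pos_eq; nra. }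
  pose proof (exp_pos (snd z)) as He. pose proof (Cmod_ge_0 (1 - a * a)).
  pose proof (Cmod_ge_0 (ev (der hh) (vv a z))).
  assert (A1 : / D * / D <= 4) by nra.
  assert (A2 : Cmod (1 - a * a) * exp (snd z) <= 1 * exp (snd z)) by (apply Rmult_le_compat_r; lra).
  assert (A3 : Cmod (1 - a * a) * exp (snd z) * (/ D * / D) <= 1 * exp (snd z) * 4).
  { apply Rmult_le_compat; auto; nra. }
  assert (A30 : 0 <= Cmod (1 - a * a) * exp (snd z) * (/ D * / D)) by (repeat apply Rmult_le_pos; lra).
  assert (A4 : Cmod (1 - a * a) * exp (snd z) * (/ D * / D) * Cmod (ev (der hh) (vv a z))
     <= 1 * exp (snd z) * 4 * B) by (apply Rmult_le_compat; auto).
  apply Rle_trans with (1 * exp (snd z) * 4 * B * 20); [|right; ring].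
  apply Rmult_le_compat; auto. apply Rmult_le_pos; auto.
Qed.

Lemma solution_equations : water_wave_equations G solution_wave.
Proof.
  destruct (rem_zm a s d d0 d1 Hd) as (K & HK & Hrem).
  destruct (zm_bounded a s d d0 d1 Hd) as (B & HB).
  assert (EH1 : forall z, clh z -> H1 z = (F0 z * / dz z)%C) by reflexivity.
  assert (EH2 : forall z, clh z -> H2 z = (H1' z * / dz z)%C) by reflexivity.
  pose proof (stream_grad zm dz K HK Hrem tmdz low Hinj EE F0 H1 tE EH1 psi0) as Hgrad.
  split; [|split; [|split; [|split; [|split; [|split]]]]].
  - apply (stream_C2 zm dz K HK Hrem tmdz low Hinj EE F0 H1 H1' H2 tE tH1 lH2 EH1 EH2 psi0).
  - apply (stream_continuous_on zm dz K B HK Hrem tmdz HB Hinj EE F0 tE psi0).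
    apply solution_preimage.
  - intros p Hp. destruct (solution_preimage p Hp) as (z & Hz & E). simpl. rewrite <- E.
    pose proof (zm_period a s d (fst z) (snd z)) as Hp2. rewrite <- surjective_pairing in Hp2.
    rewrite <- Hp2. rewrite !solution_stream by auto.
    replace (fst z + 2 * PI) with (fst z + 2 * PI * IZR 1) by (simpl; ring).
    rewrite Psi_period. now rewrite <- surjective_pairing.
  - intros p Hp. simpl.
    apply (stream_laplacian zm dz K HK Hrem tmdz low Hinj EE F0 H1 H1' H2 tE tH1 EH1 EH2 psi0 p Hp).
  - intros p (x & E). subst p. change (strm (zm (x, 0)) = 0).
    rewrite solution_stream by apply clh_boundary. apply psi0.
  - intros x.
    exists (fst (H1 (x, 0)), - (snd (zm (x, 0)) + 1) - snd (H1 (x, 0))). split.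
    + destruct (zm_lips zm dz K B HK Hrem tmdz HB) as (L & HL & Hl).
      destruct (tame_lip _ _ tH1) as (L' & HL' & Hl').
      intros Q [e He].
      assert (Hd0 : 0 < e / (2 * (L + L' + 1))) by (apply Rdiv_lt_0_compat; [apply cond_pos|lra]).
      exists (mkposreal _ Hd0). intros z Hz Lz. apply He.
      change (psi solution_wave) with strm. change (zmap solution_wave z) with (zm z).
      rewrite Hgrad by auto. apply ball_Cmod in Hz. simpl in Hz.
      specialize (Hl _ _ (clh_boundary x) (lower_clh _ Lz)).
      specialize (Hl' _ _ (clh_boundary x) (lower_clh _ Lz)).
      pose proof (Cmod_ge_0 (z - (x, 0))%C) as Hd1. set (dd := Cmod (z - (x, 0))%C) in *.
      assert (Hlt : (L + L' + 1) * dd < e).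
      { apply Rlt_le_trans with ((L + L' + 1) * (2 * (e / (2 * (L + L' + 1))))).
        - apply Rmult_lt_compat_l; lra.
        - right; field; lra. }
      pose proof (re_le_Cmod (H1 z - H1 (x, 0))%C) as R1. pose proof (im_le_Cmod (H1 z - H1 (x, 0))%C) as R2.
      pose proof (im_le_Cmod (zm z - zm (x, 0))%C) as R3. cbn [fst snd Cminus Cplus Copp] in R1, R2, R3.
      apply (proj2 (ball_C _ _ _)). cbn [fst snd]. unfold Rminus. split; [nra|].
      replace (- (snd (zm z) + 1) + - snd (H1 z) + - (- (snd (zm (x, 0)) + 1) + - snd (H1 (x, 0))))
        with (- (snd (zm z) + - snd (zm (x, 0))) + - (snd (H1 z) + - snd (H1 (x, 0)))) by ring.
      eapply Rle_lt_trans; [apply Rabs_triang|]. rewrite !Rabs_Ropp. nra.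
    + cbn [fst snd]. pose proof (bernoulli_identity x) as Hb. cbv zeta in Hb. rewrite Hb.
      change (snd (trace solution_wave x)) with (snd (zm (x, 0))). simpl. field.
  - intros eps Heps. destruct far_decay as (Kf & HKf & Hf).
    exists (ln (eps / (Kf + 1)) - B). intros p (z & Hz & Ep) Hlt. rewrite <- Ep in *.
    change (psi solution_wave) with strm. rewrite Hgrad by auto.
    apply Rle_lt_trans with (Cmod (H1 z)).
    + right. rewrite <- (Cmod_conj (H1 z)). f_equal.
      unfold Cconj, Cminus, Cplus, Copp; simpl. f_equal; ring.
    + eapply Rle_lt_trans; [apply Hf, lower_clh; auto|].
      pose proof (HB z (lower_clh _ Hz)) as HBz. pose proof (im_le_Cmod (zm z - z)%C) as Hi.
      cbn [fst snd Cminus Cplus Copp] in Hi.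
      assert (Hs : Rabs (snd (zm z) + - snd z) <= B) by lra. apply Rabs_le_between in Hs.
      assert (Hx : snd z < ln (eps / (Kf + 1))) by lra.
      apply exp_increasing in Hx. rewrite exp_ln in Hx by (apply Rdiv_lt_0_compat; lra).
      pose proof (exp_pos (snd z)).
      apply Rle_lt_trans with ((Kf + 1) * exp (snd z)); [nra|].
      apply Rlt_le_trans with ((Kf + 1) * (eps / (Kf + 1))); [apply Rmult_lt_compat_l; lra|].
      right; field; lra.
Qed.

Lemma solution_is_solution :
  injective_trace solution_wave \/ touching solution_wave -> symmetric_wave solution_wave ->
  is_solution G solution_wave.
Proof.
  intros H S. split; [apply solution_domain|]. split; [apply solution_conformal|].
  split; [apply solution_periodic|]. split; [exact H|]. split; [exact S|]. apply solution_equations.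
Qed.
End Solution.

(** * Trigonometric inequalities for the unperturbed profile *)

Lemma PI_bounds : 314 / 100 < PI < 3143 / 1000.
Proof.
  pose proof (PI_2_3_7_ineq 1) as H. unfold sum_f_R0, tg_alt, PI_2_3_7_tg, Ratan_seq in H. simpl in H.
  replace (1 + 1 + 1 + 1 + 1 + 1 + 1) with 7 in H by ring.
  replace (1 + 1 + 1 + 1 + 1) with 5 in H by ring. replace (1 + 1 + 1) with 3 in H by ring. lra.
Qed.

Lemma increasing_0 (f f' : R -> R) (x : R) : 0 <= x ->
  (forall t, is_derive f t (f' t)) -> (forall t, 0 <= t <= x -> 0 <= f' t) -> f 0 <= f x.
Proof.
  intros Hx Hd Hp. destruct (MVT_gen f 0 x f') as (c & Hc & E).
  - intros; apply Hd.
  - intros t _. apply continuity_pt_filterlim. apply (ex_derive_continuous f t). now exists (f' t).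
  - rewrite Rmin_left, Rmax_right in Hc by lra. specialize (Hp c Hc). nra.
Qed.

(** The classical inequality of Cusa and Huygens, by three successive monotonicity arguments. *)
Lemma cusa (x : R) : 0 <= x <= PI -> 3 * sin x <= x * (2 + cos x).
Proof.
  intros Hx.
  assert (H1 : forall t, 0 <= t <= PI -> 0 <= sin t - t * cos t).
  { intros t Ht. pose proof (increasing_0 (fun t => sin t - t * cos t) (fun t => t * sin t) t ltac:(lra)) as H.
    cbv beta in H. rewrite sin_0 in H. replace 0 with (0 - 0 * cos 0) by ring. apply H.
    - intros y. auto_derive; auto. ring.
    - intros y Hy. apply Rmult_le_pos; [lra|]. apply sin_ge_0; lra. }
  assert (H2 : forall t, 0 <= t <= PI -> 0 <= 2 - 2 * cos t - t * sin t).
  { intros t Ht. pose proof (increasing_0 (fun t => 2 - 2 * cos t - t * sin t) (fun t => sin t - t * cos t) t ltac:(lra)) as H.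
    cbv beta in H. rewrite sin_0, cos_0 in H. replace 0 with (2 - 2 * 1 - 0 * 0) by ring. apply H.
    - intros y. auto_derive; auto. ring.
    - intros y Hy. apply H1; lra. }
  pose proof (increasing_0 (fun t => t * (2 + cos t) - 3 * sin t) (fun t => 2 - 2 * cos t - t * sin t) x ltac:(lra)) as H.
  cbv beta in H. rewrite sin_0 in H. apply Rminus_le. apply Ropp_le_cancel. 
  replace (- (3 * sin x - x * (2 + cos x))) with (x * (2 + cos x) - 3 * sin x) by ring.
  replace (- 0) with (0 * (2 + cos 0) - 3 * 0) by ring. apply H.
  - intros y. auto_derive; auto. ring.
  - intros y Hy. apply H2; lra.
Qed.

Lemma sin_cubic (x : R) : 0 <= x -> x - x * x * x / 6 <= sin x.
Proof.
  intros Hx.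
  assert (H1 : forall t, 0 <= t -> 0 <= cos t - 1 + t * t / 2).
  { intros t Ht. pose proof (increasing_0 (fun t => cos t - 1 + t * t / 2) (fun t => t - sin t) t Ht) as H.
    cbv beta in H. rewrite cos_0 in H. replace 0 with (1 - 1 + 0 * 0 / 2) by field. apply H.
    - intros y. auto_derive; auto. field.
    - intros y Hy. pose proof (sin_abs y) as Hs. rewrite (Rabs_pos_eq y) in Hs by lra.
      apply Rabs_le_between in Hs. lra. }
  pose proof (increasing_0 (fun t => sin t - t + t * t * t / 6) (fun t => cos t - 1 + t * t / 2) x Hx) as H.
  cbv beta in H. rewrite sin_0 in H.
  assert (0 - 0 + 0 * 0 * 0 / 6 <= sin x - x + x * x * x / 6); [|lra]. apply H.
  - intros y. auto_derive; auto. field.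
  - intros y Hy. apply H1; lra.
Qed.

(* With kappa = (1 + a^2) / (2 |a|), the abscissa of the unperturbed surface is
   x - 2 sin x / (kappa + cos x); the weakened coefficient absorbs the perturbation. *)
Lemma overhang_bound (k x : R) : 132 / 100 <= k -> 0 < x < PI -> - (1 / 10) <= cos x ->
  (2 + / 1000) * sin x < x * (k + cos x).
Proof.
  intros Hk Hx Hc. pose proof PI_bounds as HPI.
  pose proof (sin_gt_0 x (proj1 Hx) (proj2 Hx)) as Hs. pose proof (SIN_bound x) as Hs1.
  assert (Hm : x * (132 / 100 + cos x) <= x * (k + cos x)) by (apply Rmult_le_compat_l; lra).
  apply Rlt_le_trans with (2 := Hm).
  (* For cos x >= 0.043 the bound of [cusa] suffices, as (2 + 1/1000) (2 + c) < 3 (1.32 + c) holds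
     for c > 0.0421. In the remaining narrow range around PI / 2 the factor sin x is replaced by
     1. *)
  destruct (Rle_lt_dec (43 / 1000) (cos x)) as [C1|C1].
  { pose proof (cusa x ltac:(lra)) as HC. pose proof (COS_bound x) as Hcb.
    assert (E : 3 * sin x * (132 / 100 + cos x) <= x * (2 + cos x) * (132 / 100 + cos x))
      by (apply Rmult_le_compat_r; lra).
    apply Rmult_lt_reg_r with (2 + cos x); [lra|]. nra. }
  apply Rle_lt_trans with (2 + / 1000); [nra|].
  set (y := PI / 2 - x). assert (Ec : cos x = sin y) by (unfold y; now rewrite sin_shift).
  assert (Ex : x = PI / 2 - y) by (unfold y; ring). clearbody y.
  destruct (Rle_lt_dec 0 y) as [Y|Y].
  - assert (Hy : y <= 1 / 20).
    { apply Rnot_lt_le; intros L.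
      assert (sin (1 / 20) < sin y) by (apply sin_increasing_1; lra).
      pose proof (sin_cubic (1 / 20) ltac:(lra)). lra. }
    pose proof (sin_cubic y Y) as H3. rewrite Ec.
    assert (y * 99 / 100 <= sin y) by nra.
    apply Rlt_le_trans with ((157 / 100 - y) * (132 / 100 + y * 99 / 100)); [nra|].
    apply Rmult_le_compat; lra.
  - pose proof (sin_abs y) as Ha. rewrite (Rabs_left y) in Ha by lra. apply Rabs_le_between in Ha.
    rewrite Ec in *.
    apply Rlt_le_trans with ((157 / 100 - sin y) * (132 / 100 + sin y)); [nra|].
    apply Rmult_le_compat_r; lra.
Qed.

(** This fixes the end of the parameter interval: 697/528 is the value of kappa at a = -11/24, and
    at 2 PI / 3 the unperturbed abscissa is already negative, with room for the perturbation. *)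
Lemma overhang_example : 2 * PI / 3 < (2 - / 1000) * sin (2 * PI / 3) / (697 / 528 + cos (2 * PI / 3)).
Proof.
  pose proof PI_bounds. replace (2 * PI / 3) with (2 * (PI / 3)) at 2 3 by field.
  rewrite sin_2PI3, cos_2PI3.
  assert (H3 : 1732 / 1000 < sqrt 3).
  { apply Rsqr_incrst_0; [|lra|apply sqrt_pos]. rewrite Rsqr_sqrt by lra. unfold Rsqr; lra. }
  replace (697 / 528 + -1 / 2) with (433 / 528) by field. 
  apply Rmult_lt_reg_r with (433 / 528); [lra|].
  replace ((2 - / 1000) * (sqrt 3 / 2) / (433 / 528) * (433 / 528)) with ((2 - / 1000) * (sqrt 3 / 2)) by field.
  lra.
Qed.

Lemma vv_boundary (a : par) (x : R) :
  let N := 1 - 2 * a * cos x + a * a in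
  vv a (x, 0) = (((1 + a * a) * cos x - 2 * a) / N, - ((1 - a * a) * sin x) / N).
Proof.
  intros N. pose proof (sin2_cos2 x) as E. unfold Rsqr in E. pose proof (COS_bound x).
  assert (HN : 0 < N) by (destruct a as [a' Ha]; unfold N; simpl; nra).
  assert (EN : N = (1 - a * cos x) * (1 - a * cos x) + a * sin x * (a * sin x)).
  { unfold N. replace 1 with (sin x * sin x + cos x * cos x) at 1 by lra.
    replace (sin x * sin x) with (1 - cos x * cos x) by lra.
    transitivity (1 - 2 * a * cos x + a * a * (sin x * sin x + cos x * cos x)); [rewrite E; ring|ring]. }
  unfold vv, uu. cbn [fst snd]. rewrite exp_0, !Rmult_1_l.
  unfold Cmult, Cminus, Cplus, Copp, Cinv, RtoC. cbn [fst snd]. simpl pow.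
  replace ((1 + - (a * cos x - 0 * - sin x)) * ((1 + - (a * cos x - 0 * - sin x)) * 1) +
    (0 + - (a * - sin x + 0 * cos x)) * ((0 + - (a * - sin x + 0 * cos x)) * 1)) with N by (rewrite EN; ring).
  f_equal.
  - transitivity (((cos x - a) * (1 - a * cos x) - a * (sin x * sin x)) / N); [field; lra|].
    replace (sin x * sin x) with (1 - cos x * cos x) by lra. field. lra.
  - field. lra.
Qed.

Lemma trace_parts (F F' : C -> C) (K : R) : 0 <= K ->
  (forall z z', clh z -> clh z' -> Cmod (F z' - F z - (z' - z) * F' z)%C <= K * (Cmod (z' - z) * Cmod (z' - z))) ->
  forall x, is_derive (fun t => fst (F (t, 0))) x (fst (F' (x, 0))) /\
            is_derive (fun t => snd (F (t, 0))) x (snd (F' (x, 0))).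
Proof.
  intros HK H x.
  assert (Hz : forall y, Cmod ((y, 0) - (x, 0))%C = Rabs (y - x)).
  { intros y. replace ((y, 0) - (x, 0))%C with (RtoC (y - x)); [apply Cmod_R|].
    unfold RtoC, Cminus, Cplus, Copp; simpl. f_equal; ring. }
  split; apply is_derive_R_remainder with K 1; auto; try lra; intros y _;
    specialize (H _ _ (clh_boundary x) (clh_boundary y)); rewrite Hz in H;
    (eapply Rle_trans; [|exact H]).
  - eapply Rle_trans; [|apply re_le_Cmod]. right; f_equal. simpl. ring.
  - eapply Rle_trans; [|apply im_le_Cmod]. right; f_equal. simpl. ring.
Qed.

(** * Contacts of the profile with the trough axis *)

Section Boundary.
Local Opaque vv uu EV ev zmp dzp P.
Variables (a : par) (s : R) (d : nat -> R).
Hypothesis d0 : d 0%nat = 0.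
Hypothesis d1 : d 1%nat = 0.
Hypothesis Hd : dec eta0 (5 / 6) d.
Notation zm := (zmp a s d).
Notation dz := (dzp a s d).
Let N (x : R) := 1 - 2 * a * cos x + a * a.

Lemma N_bounds (x : R) : 29 / 100 <= N x <= 213 / 100.
Proof.
  pose proof (COS_bound x). destruct a as [a' Ha]; unfold N; simpl. split; [|nra].
  assert (a' * cos x <= - a') by nra. nra.
Qed.

(** The error is again proportional to sin x, which keeps the comparison meaningful near the trough,
    where the abscissa itself tends to 0. *)
Lemma x_approx (x : R) : 0 <= x <= PI ->
  Rabs (fst (zm (x, 0)) - (x + 4 * a * sin x / N x)) <= e0 * (- 2 * a * sin x / N x).
Proof.
  intros Hx. pose proof (sin_ge_0 x ltac:(lra) ltac:(lra)) as Hs. pose proof (N_bounds x) as HN.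
  pose proof (par_sq a) as Hq.
  assert (Ha : a <= 0) by (destruct a as [a' Ha]; simpl; lra).
  rewrite zm_fst by (auto using clh_boundary). pose proof (d_im a d Hd (x, 0) (clh_boundary x)) as Hi.
  pose proof (vv_boundary a x) as V. cbv zeta in V. fold (N x) in V. rewrite V in *. cbn [fst snd] in *.
  replace (x - Cc a * (2 * (- ((1 - a * a) * sin x) / N x) + snd (EV a d (x, 0))) - (x + 4 * a * sin x / N x))
    with (- (Cc a * snd (EV a d (x, 0)))) by (unfold Cc; field; lra).
  assert (HC : 0 <= - Cc a) by apply Cc_mu.
  rewrite Rabs_Ropp, Rabs_mult, (Rabs_left1 (Cc a)) by lra.
  eapply Rle_trans; [apply Rmult_le_compat_l; [lra|exact Hi]|].
  replace (- ((1 - a * a) * sin x) / N x) with (- ((1 - a * a) * sin x / N x)) by (field; lra).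
  rewrite Rabs_Ropp, Rabs_pos_eq.
  - right. unfold Cc. field. lra.
  - apply Rdiv_le_0_compat; [|lra]. apply Rmult_le_pos; lra.
Qed.

(** On the part of the profile before cos x = -1/10 the worst value of kappa on the parameter
    interval, 697/528, still excludes contact. The flat case a = 0, where kappa is infinite, is
    separate. *)
Lemma x_pos_front (x : R) : 0 < x < PI -> - (1 / 10) <= cos x -> 0 < fst (zm (x, 0)).
Proof.
  intros Hx Hc. pose proof (x_approx x ltac:(lra)) as H. apply Rabs_le_between in H.
  pose proof (N_bounds x) as HN.
  assert (Ha : - (11 / 24) <= a <= 0) by (destruct a as [a' Ha]; exact Ha).
  destruct (Req_dec a 0) as [E|E].
  { replace (4 * a * sin x / N x) with 0 in H by (rewrite E; field; lra).
    replace (-2 * a * sin x / N x) with 0 in H by (rewrite E; field; lra). lra. }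
  pose proof (overhang_bound ((1 + a * a) / (- 2 * a)) x) as O.
  assert (Hk : 132 / 100 <= (1 + a * a) / (- 2 * a)).
  { apply Rmult_le_reg_r with (- 2 * a); [lra|].
    replace ((1 + a * a) / (- 2 * a) * (- 2 * a)) with (1 + a * a) by (field; lra). nra. }
  specialize (O Hk Hx Hc).
  assert (E1 : (1 + a * a) / (- 2 * a) + cos x = N x / (- 2 * a)) by (unfold N; field; lra).
  rewrite E1 in O.
  assert (E2 : (2 + / 1000) * sin x * (- 2 * a / N x) < x).
  { apply Rmult_lt_compat_r with (r := - 2 * a / N x) in O; [|apply Rdiv_lt_0_compat; lra].
    replace (x * (N x / (-2 * a)) * (-2 * a / N x)) with x in O by (field; lra). exact O. }
  replace ((2 + / 1000) * sin x * (-2 * a / N x))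
    with (- (4 * a * sin x / N x) + / 1000 * (- 2 * a * sin x / N x)) in E2 by (field; lra).
  unfold e0 in H. lra.
Qed.

Lemma x_overhang : pa a = - (11 / 24) -> fst (zm (2 * PI / 3, 0)) < 0.
Proof.
  intros Ea. pose proof PI_RGT_0 as HPI. set (x := 2 * PI / 3). pose proof (x_approx x ltac:(unfold x; lra)) as H.
  apply Rabs_le_between in H. pose proof overhang_example as O. fold x in O.
  pose proof (N_bounds x) as HN.
  assert (E1 : 697 / 528 + cos x = N x * (12 / 11)) by (unfold N; rewrite Ea; field).
  rewrite E1 in O.
  replace ((2 - / 1000) * sin x / (N x * (12 / 11))) with
    (- (4 * a * sin x / N x) - / 1000 * (- 2 * a * sin x / N x)) in O by (rewrite Ea; field; lra).
  unfold e0 in H. lra.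
Qed.

(** On the boundary g = (1 - a^2 - 2 i a sin x) / N, whose square has this real part; multiplication
    by N^2 removes the denominators. *)
Lemma dz_re (x : R) : N x * N x * fst (dz (x, 0)) =
  (1 - a * a) * (1 - a * a) - 4 * (a * a) * (sin x * sin x) + Cc a * (N x * N x * fst (P a d (x, 0))).
Proof.
  pose proof (N_bounds x) as HN. pose proof (par_sq a).
  rewrite dz_eq by (auto using clh_boundary). pose proof (vv_boundary a x) as V. cbv zeta in V. fold (N x) in V.
  assert (E : (mu a + Cc a * vv a (x, 0))%C = ((1 - a * a) / N x, - (2 * a * sin x) / N x)).
  { rewrite V. unfold Cplus, Cmult, RtoC. cbn [fst snd]. f_equal.
    - unfold mu, Cc, N in *. field. split; lra.
    - unfold Cc. field. lra. }
  rewrite E. unfold Cplus, Cmult, RtoC. cbn [fst snd]. field. lra.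
Qed.

Lemma zm_boundary_derive (x : R) :
  is_derive (fun t => fst (zm (t, 0))) x (fst (dz (x, 0))) /\
  is_derive (fun t => snd (zm (t, 0))) x (snd (dz (x, 0))).
Proof. destruct (rem_zm a s d d0 d1 Hd) as (K & HK & Hr). exact (trace_parts _ _ K HK Hr x). Qed.

Lemma P_boundary_derive (x : R) : exists l, Rabs l <= e0 /\ is_derive (fun t => fst (P a d (t, 0))) x l.
Proof.
  assert (rD : rd (Dop a d)) by (apply rd_Dop; exists eta0, (5 / 6); split; [lra|auto]).
  destruct (tame_EV a _ rD) as (K & HK & _ & H).
  exists (fst (- Ci * EV a (Dop a (Dop a d)) (x, 0))%C). split.
  - eapply Rle_trans; [apply re_le_Cmod|]. rewrite Cmod_mult, Cmod_opp, Cmod_Ci, Rmult_1_l.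
    apply D2_small; auto using clh_boundary.
  - apply (trace_parts (EV a (Dop a d)) _ K HK H x).
Qed.

Hypothesis Hneg : a < 0.
Hypothesis Xpos : forall x, 0 <= x <= PI -> 0 <= fst (zm (x, 0)).

(** A contact is an interior minimum of the nonnegative abscissa. *)
Lemma contact_vertical (t : R) : 0 < t < PI -> fst (zm (t, 0)) = 0 -> fst (dz (t, 0)) = 0.
Proof.
  intros Ht E. destruct (zm_boundary_derive t) as [H _]. apply is_derive_Reals in H.
  pose proof (deriv_minimum (fun t => fst (zm (t, 0))) 0 PI t (exist _ _ H)) as M.
  simpl in M. apply M; try lra. intros y Hy1 Hy2. rewrite E. apply Xpos; lra.
Qed.

(** At a contact Re z' = 0, so 4 a^2 sin^2 t equals (1 - a^2)^2 up to 0.0055. As a^2 <= 121/576, the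
    right side is at least 0.618; this bounds sin t and |a| from below. *)
Lemma contact_region (t : R) : 0 < t < PI -> fst (zm (t, 0)) = 0 ->
  PI / 2 < t /\ cos t < - (1 / 10) /\ 8 / 10 <= sin t /\ 39 / 100 <= - a.
Proof.
  intros Ht E.
  assert (Hc : cos t < - (1 / 10)).
  { apply Rnot_le_lt; intros L. pose proof (x_pos_front t Ht L). lra. }
  pose proof (dz_re t) as D. rewrite (contact_vertical t Ht E), Rmult_0_r in D.
  pose proof (N_bounds t) as HN. pose proof (P_small a d Hd (t, 0) (clh_boundary t)) as HP.
  pose proof (re_le_Cmod (P a d (t, 0))) as HP2. destruct (mu_Cc_bounds a) as (_ & HC & _).
  assert (HP3 : - e0 <= fst (P a d (t, 0)) <= e0) by (apply Rabs_le_between; lra).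
  assert (HNN : 0 <= N t * N t <= 454 / 100) by nra.
  assert (Hb : - (55 / 10000) <= Cc a * (N t * N t * fst (P a d (t, 0))) <= 55 / 10000).
  { assert (Rabs (N t * N t * fst (P a d (t, 0))) <= 454 / 100 * e0).
    { rewrite Rabs_mult, Rabs_pos_eq by lra. apply Rmult_le_compat; auto using Rabs_pos; lra. }
    apply Rabs_le_between in H. unfold e0 in *. nra. }
  pose proof (sin_gt_0 t (proj1 Ht) (proj2 Ht)) as Hs. pose proof (SIN_bound t).
  assert (Ha : - (11 / 24) <= a) by (destruct a as [a' Ha]; simpl; lra).
  assert (Ha2 : 0 < a * a <= 121 / 576) by nra.
  assert (H1 : 618 / 1000 <= 4 * (a * a) * (sin t * sin t)) by nra.
  split; [|split; [exact Hc|split]].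
  - apply Rnot_le_lt; intros L. pose proof (cos_ge_0 t ltac:(lra) L). lra.
  - assert (618 / 1000 <= 4 * (121 / 576) * (sin t * sin t)) by nra. nra.
  - assert (618 / 1000 <= 4 * (a * a)) by nra. nra.
Qed.

(* At a contact z' is imaginary, and N^2 Re z' is strictly increasing where cos < -1/10. *)
Lemma contact_unique_lt (t1 t2 : R) : 0 < t1 -> t1 < t2 -> t2 < PI ->
  fst (zm (t1, 0)) = 0 -> fst (zm (t2, 0)) = 0 -> False.
Proof.
  intros H0 H12 HP E1 E2.
  destruct (contact_region t1 ltac:(lra) E1) as (R1 & C1 & S1 & A1).
  destruct (contact_region t2 ltac:(lra) E2) as (R2 & C2 & S2 & _).
  destruct (functional_choice _ _ _ P_boundary_derive) as [p' Hp'].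
  set (p := fun t => fst (P a d (t, 0))) in *.
  set (Z := fun x => (1 - a * a) * (1 - a * a) - 4 * (a * a) * (sin x * sin x) + Cc a * (N x * N x * p x)).
  set (Z' := fun x => - 8 * (a * a) * (sin x * cos x)
     + Cc a * (4 * a * sin x * N x * p x + N x * N x * p' x)).
  assert (DZ : forall x, is_derive Z x (Z' x)).
  { intros x. destruct (Hp' x) as [_ Dp]. unfold Z, Z', N. auto_derive.
    - now exists (p' x).
    - replace (Derive (fun t => p t) x) with (p' x) by (symmetry; apply is_derive_unique; exact Dp). ring. }
  destruct (MVT_gen Z t1 t2 Z') as (c & Hc & E).
  - intros; apply DZ.
  - intros x _. apply continuity_pt_filterlim, (ex_derive_continuous Z). now exists (Z' x).
  - rewrite Rmin_left, Rmax_right in Hc by lra.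
    assert (Z1 : Z t1 = 0).
    { unfold Z, p. rewrite <- dz_re, contact_vertical by (auto; lra). ring. }
    assert (Z2 : Z t2 = 0).
    { unfold Z, p. rewrite <- dz_re, contact_vertical by (auto; lra). ring. }
    rewrite Z1, Z2, Rminus_0_r in E.
    assert (Zc : Z' c = 0) by (apply Rmult_eq_reg_r with (t2 - t1); lra).
    assert (Cc1 : cos c <= cos t1).
    { destruct (Req_dec c t1) as [->|]; [lra|]. left. apply cos_decreasing_1; lra. }
    assert (Sc : sin t2 <= sin c).
    { destruct (Req_dec c t2) as [->|]; [lra|]. left. apply sin_decreasing_1; lra. }
    pose proof (N_bounds c) as HN. destruct (Hp' c) as [Bp' _]. pose proof (SIN_bound c) as Sb.
    assert (Bp : Rabs (p c) <= e0).
    { eapply Rle_trans; [apply re_le_Cmod|]. apply P_small; auto using clh_boundary. }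
    destruct (mu_Cc_bounds a) as (_ & HC & _).
    assert (Ha : - (11 / 24) <= a) by (destruct a as [a' Ha]; simpl; lra).
    assert (B1 : Rabs (4 * a * sin c * N c * p c) <= 4 * e0).
    { rewrite Rabs_mult. apply Rmult_le_compat; auto using Rabs_pos.
      assert (Hm : 0 <= - a * sin c <= 11 / 24) by nra.
      replace (4 * a * sin c * N c) with (- (4 * (- a * sin c) * N c)) by ring.
      rewrite Rabs_Ropp, Rabs_pos_eq by nra. nra. }
    assert (B2 : Rabs (N c * N c * p' c) <= 5 * e0).
    { rewrite Rabs_mult. apply Rmult_le_compat; auto using Rabs_pos.
      rewrite Rabs_pos_eq by nra. nra. }
    apply Rabs_le_between in B1. apply Rabs_le_between in B2.
    assert (B3 : - (11 / 1000) <= Cc a * (4 * a * sin c * N c * p c + N c * N c * p' c) <= 11 / 1000)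
      by (unfold e0 in *; nra).
    assert (B4 : 8 / 100 <= - (sin c * cos c)) by nra.
    assert (B5 : 15 / 100 <= a * a) by nra.
    assert (B6 : 8 * (15 / 100 * (8 / 100)) <= - 8 * (a * a) * (sin c * cos c)) by nra.
    unfold Z' in Zc. lra.
Qed.

Lemma contact_unique (t1 t2 : R) : 0 < t1 < PI -> 0 < t2 < PI ->
  fst (zm (t1, 0)) = 0 -> fst (zm (t2, 0)) = 0 -> t1 = t2.
Proof.
  intros H1 H2 E1 E2. destruct (Rtotal_order t1 t2) as [L|[L|L]]; auto; exfalso.
  - apply (contact_unique_lt t1 t2); auto; lra.
  - apply (contact_unique_lt t2 t1); auto; lra.
Qed.
End Boundary.

Lemma segment_between (l u x1 x2 t : R) : l < x1 < u -> l < x2 < u -> 0 <= t <= 1 ->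
  l < x1 + t * (x2 - x1) < u.
Proof.
  intros H1 H2 Ht. destruct (Rle_dec x1 x2) as [H|H].
  - assert (0 <= t * (x2 - x1) <= x2 - x1) by nra. lra.
  - assert (0 <= t * (x1 - x2) <= x1 - x2) by nra. lra.
Qed.

(** * The region enclosed by a symmetric profile *)

Section Bubble.
Variables (X Y : R -> R) (T T' L : R).
Hypothesis HL : 0 <= L.
Hypothesis HX : forall x x', Rabs (X x' - X x) <= L * Rabs (x' - x).
Hypothesis HY : forall x x', Rabs (Y x' - Y x) <= L * Rabs (x' - x).
Hypothesis HT : 0 < T < T'.
Hypothesis Hinc : forall x x', 0 <= x -> x < x' -> x' <= T' -> Y x < Y x'.
Hypothesis X0 : X 0 = 0.
Hypothesis XT : X T = 0.
Hypothesis Xp : forall x, 0 < x < T -> 0 < X x.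

(** Because the height increases along the half profile, the enclosed region is swept out by one
    horizontal open segment for each height. *)
Definition bubble (p : C) : Prop := exists x, 0 < x < T /\ snd p = Y x /\ Rabs (fst p) < X x.

Lemma lipschitz_continuity (F : R -> R) :
  (forall x x', Rabs (F x' - F x) <= L * Rabs (x' - x)) -> continuity F.
Proof.
  intros H x e He. exists (e / (L + 1)). split; [apply Rdiv_lt_0_compat; lra|].
  intros y [_ Hy]. simpl in *. unfold R_dist in *. eapply Rle_lt_trans; [apply H|].
  pose proof (Rabs_pos (y - x)).
  apply Rle_lt_trans with ((L + 1) * Rabs (y - x)); [nra|].
  apply Rlt_le_trans with ((L + 1) * (e / (L + 1))); [apply Rmult_lt_compat_l; lra|right; field; lra].
Qed.

(** Continuity of the inverse of the height function, in the form needed up to both ends of the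
    interval. *)
Lemma height_inv (x eta : R) : 0 <= x <= T -> 0 < eta -> exists e, 0 < e /\
  (forall x', 0 <= x' <= T -> Rabs (Y x' - Y x) < e -> Rabs (x' - x) < eta).
Proof.
  intros Hx He.
  assert (H1 : exists e, 0 < e /\ forall x', 0 <= x' <= T -> Y x - e < Y x' -> x - eta < x').
  { destruct (Rlt_dec (x - eta) 0) as [N|N].
    - exists 1. split; [lra|]. intros; lra.
    - exists (Y x - Y (x - eta)). pose proof (Hinc (x - eta) x ltac:(lra) ltac:(lra) ltac:(lra)).
      split; [lra|]. intros x' Hx' Hy. apply Rnot_le_lt; intros Hle.
      destruct (Req_dec x' (x - eta)) as [E|E]; [subst; lra|].
      pose proof (Hinc x' (x - eta) ltac:(lra) ltac:(lra) ltac:(lra)). lra. }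
  assert (H2 : exists e, 0 < e /\ forall x', 0 <= x' <= T -> Y x' < Y x + e -> x' < x + eta).
  { destruct (Rlt_dec T (x + eta)) as [N|N].
    - exists 1. split; [lra|]. intros; lra.
    - exists (Y (x + eta) - Y x). pose proof (Hinc x (x + eta) ltac:(lra) ltac:(lra) ltac:(lra)).
      split; [lra|]. intros x' Hx' Hy. apply Rnot_le_lt; intros Hle.
      destruct (Req_dec x' (x + eta)) as [E|E]; [subst; lra|].
      pose proof (Hinc (x + eta) x' ltac:(lra) ltac:(lra) ltac:(lra)). lra. }
  destruct H1 as (e1 & E1 & H1), H2 as (e2 & E2 & H2).
  exists (Rmin e1 e2). split; [apply Rmin_glb_lt; auto|]. intros x' Hx' Hy.
  pose proof (Rmin_l e1 e2). pose proof (Rmin_r e1 e2). apply Rabs_def2 in Hy.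
  specialize (H1 x' Hx' ltac:(lra)). specialize (H2 x' Hx' ltac:(lra)). apply Rabs_def1; lra.
Qed.

Lemma height_ivt (x1 x2 y : R) : 0 <= x1 -> x1 <= x2 -> x2 <= T -> Y x1 <= y <= Y x2 ->
  exists x, x1 <= x <= x2 /\ Y x = y.
Proof.
  intros H1 H2 H3 Hy. destruct (IVT_gen Y x1 x2 y) as (x & Hx & E).
  - now apply lipschitz_continuity.
  - rewrite Rmin_left, Rmax_right; lra.
  - rewrite Rmin_left, Rmax_right in Hx by lra. eauto.
Qed.

Lemma Y_inj (x x' : R) : 0 <= x <= T -> 0 <= x' <= T -> Y x = Y x' -> x = x'.
Proof.
  intros Hx Hx' E. destruct (Rtotal_order x x') as [H|[H|H]]; auto.
  - pose proof (Hinc x x' ltac:(lra) H ltac:(lra)). lra.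
  - pose proof (Hinc x' x ltac:(lra) H ltac:(lra)). lra.
Qed.

Lemma bubble_open : open bubble.
Proof.
  intros p (x & Hx & Ey & Hp). set (g := X x - Rabs (fst p)).
  assert (Hg : 0 < g) by (unfold g; lra).
  set (del := Rmin (g / (4 * (L + 1))) (Rmin (x / 2) ((T - x) / 2))).
  assert (Hd : 0 < del).
  { repeat apply Rmin_glb_lt; try lra. apply Rdiv_lt_0_compat; lra. }
  assert (D1 : del <= g / (4 * (L + 1))) by apply Rmin_l.
  assert (D2 : del <= x / 2) by (eapply Rle_trans; [apply Rmin_r|apply Rmin_l]).
  assert (D3 : del <= (T - x) / 2) by (eapply Rle_trans; [apply Rmin_r|apply Rmin_r]).
  pose proof (Hinc (x - del) x ltac:(lra) ltac:(lra) ltac:(lra)) as I1.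
  pose proof (Hinc x (x + del) ltac:(lra) ltac:(lra) ltac:(lra)) as I2.
  set (e := Rmin (g / 2) (Rmin (Y x - Y (x - del)) (Y (x + del) - Y x))).
  assert (He : 0 < e) by (repeat apply Rmin_glb_lt; lra).
  assert (E1 : e <= g / 2) by apply Rmin_l.
  assert (E2 : e <= Y x - Y (x - del)) by (eapply Rle_trans; [apply Rmin_r|apply Rmin_l]).
  assert (E3 : e <= Y (x + del) - Y x) by (eapply Rle_trans; [apply Rmin_r|apply Rmin_r]).
  exists (mkposreal e He). intros q Hq. destruct (proj1 (ball_C p q e) Hq) as [Q1 Q2].
  apply Rabs_def2 in Q2. destruct (height_ivt (x - del) (x + del) (snd q)) as (x' & Hx' & Ey'); try lra. 
  exists x'. split; [lra|]. split; [auto|].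
  pose proof (HX x x') as Hl.
  assert (Hxx : Rabs (x' - x) <= del) by (apply Rabs_le; lra).
  assert (Hd2 : L * Rabs (x' - x) <= g / 4).
  { apply Rle_trans with (L * (g / (4 * (L + 1)))); [apply Rmult_le_compat_l; lra|].
    apply Rle_trans with ((L + 1) * (g / (4 * (L + 1)))); [|right; field; lra].
    apply Rmult_le_compat_r; [apply Rdiv_le_0_compat|]; lra. }
  assert (Hl2 : Rabs (X x' - X x) <= g / 4) by lra. apply Rabs_le_between in Hl2.
  assert (Rabs (fst q) <= Rabs (fst p) + Rabs (fst q - fst p)).
  { replace (fst q) with (fst p + (fst q - fst p)) at 1 by ring. apply Rabs_triang. }
  unfold g in *. lra.
Qed.

Lemma XY_bound (x : R) : 0 <= x <= T -> Rabs (X x) <= L * T /\ Rabs (Y x) <= Rabs (Y 0) + L * T.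
Proof.
  intros Hx. pose proof (HX 0 x) as H1. pose proof (HY 0 x) as H2.
  rewrite X0 in H1. rewrite !Rminus_0_r in *. rewrite (Rabs_pos_eq x) in * by lra.
  assert (L * x <= L * T) by (apply Rmult_le_compat_l; lra). split; [lra|].
  replace (Y x) with (Y 0 + (Y x - Y 0)) by ring. eapply Rle_trans; [apply Rabs_triang|]. lra.
Qed.

Lemma bubble_bounded : bounded bubble.
Proof.
  exists (L * T + (Rabs (Y 0) + L * T)). intros p (x & Hx & Ey & Hp).
  eapply Rle_trans; [apply Cmod_le_abs|]. destruct (XY_bound x) as [B1 B2]; [lra|].
  pose proof (Rle_abs (X x)). rewrite Ey. lra.
Qed.

(** In the coordinates (x, r), with r the abscissa divided by [X x], the region is the convex
    rectangle (0, T) x (-1, 1); straight segments there give Lipschitz paths. *)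
Lemma bubble_connected : connected bubble.
Proof.
  apply path_connected. intros p q (x1 & Hx1 & Ep & Hp) (x2 & Hx2 & Eq & Hq).
  pose proof (Xp x1 Hx1) as P1. pose proof (Xp x2 Hx2) as P2.
  set (r1 := fst p / X x1). set (r2 := fst q / X x2).
  assert (Hr : forall u z, 0 < z -> Rabs u < z -> Rabs (u / z) < 1).
  { intros u z Hz Hu. unfold Rdiv. rewrite Rabs_mult, (Rabs_pos_eq (/ z)) by (left; apply Rinv_0_lt_compat; auto).
    apply Rmult_lt_reg_r with z; [auto|]. rewrite Rmult_assoc, Rinv_l by lra. lra. }
  pose proof (Hr _ _ P1 Hp) as R1. pose proof (Hr _ _ P2 Hq) as R2. fold r1 in R1. fold r2 in R2.
  apply Rabs_def2 in R1. apply Rabs_def2 in R2.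
  set (xx := fun t => x1 + t * (x2 - x1)). set (rr := fun t => r1 + t * (r2 - r1)).
  assert (Hxx : forall t, 0 <= t <= 1 -> 0 < xx t < T).
  { intros t Ht. apply segment_between; auto. }
  assert (Hrr : forall t, 0 <= t <= 1 -> Rabs (rr t) < 1).
  { intros t Ht. destruct (segment_between (-1) 1 r1 r2 t) as [S1 S2]; try lra. apply Rabs_def1; unfold rr; lra. }
  exists (fun t => (rr t * X (xx t), Y (xx t))). split; [|split; [|split]].
  - unfold rr, xx. rewrite !Rmult_0_l, !Rplus_0_r. rewrite <- Ep. unfold r1.
    rewrite (surjective_pairing p) at 3. f_equal. field. lra.
  - unfold rr, xx. rewrite !Rmult_1_l.
    replace (x1 + (x2 - x1)) with x2 by ring. replace (r1 + (r2 - r1)) with r2 by ring. rewrite <- Eq. unfold r2.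
    rewrite (surjective_pairing q) at 3. f_equal. field. lra.
  - intros t Ht. exists (xx t). cbn [fst snd]. repeat split; try apply Hxx; auto.
    rewrite Rabs_mult. pose proof (Xp _ (Hxx t Ht)). rewrite (Rabs_pos_eq (X _)) by lra.
    specialize (Hrr t Ht). nra.
  - exists (2 * (L * T) + (L * T + L * T)). split; [assert (0 <= L * T) by (apply Rmult_le_pos; lra); lra|].
    intros t t' Ht Ht'. eapply Rle_trans; [apply Cmod_le_abs|]. cbn [fst snd Cminus Cplus Copp].
    assert (Exx : Rabs (xx t' - xx t) <= T * Rabs (t' - t)).
    { unfold xx. replace (x1 + t' * (x2 - x1) - (x1 + t * (x2 - x1))) with ((x2 - x1) * (t' - t)) by ring.
      rewrite Rabs_mult. apply Rmult_le_compat_r; [apply Rabs_pos|]. apply Rabs_le; lra. }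
    assert (Err : Rabs (rr t' - rr t) <= 2 * Rabs (t' - t)).
    { unfold rr. replace (r1 + t' * (r2 - r1) - (r1 + t * (r2 - r1))) with ((r2 - r1) * (t' - t)) by ring.
      rewrite Rabs_mult. apply Rmult_le_compat_r; [apply Rabs_pos|]. apply Rabs_le; lra. }
    assert (A : L * Rabs (xx t' - xx t) <= L * (T * Rabs (t' - t))) by (apply Rmult_le_compat_l; auto).
    pose proof (HX (xx t) (xx t')) as A1. pose proof (HY (xx t) (xx t')) as A2.
    pose proof (Hxx t Ht). pose proof (Hrr t' Ht').
    destruct (XY_bound (xx t)) as [B1 _]; [lra|].
    replace (rr t' * X (xx t') + - (rr t * X (xx t))) with
      (rr t' * (X (xx t') - X (xx t)) + (rr t' - rr t) * X (xx t)) by ring.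
    pose proof (Rabs_triang (rr t' * (X (xx t') - X (xx t))) ((rr t' - rr t) * X (xx t))) as Tr.
    rewrite !Rabs_mult in Tr.
    assert (C1 : Rabs (rr t') * Rabs (X (xx t') - X (xx t)) <= 1 * (L * (T * Rabs (t' - t))))
      by (apply Rmult_le_compat; auto using Rabs_pos; lra).
    assert (C2 : Rabs (rr t' - rr t) * Rabs (X (xx t)) <= 2 * Rabs (t' - t) * (L * T))
      by (apply Rmult_le_compat; auto using Rabs_pos).
    change (Y (xx t') + - Y (xx t)) with (Y (xx t') - Y (xx t)). lra.
Qed.

Lemma bubble_domain : domain bubble.
Proof.
  split; [apply bubble_open|]. split; [apply bubble_connected|].
  exists (0, Y (T / 2)). exists (T / 2). cbn [fst snd]. split; [lra|]. split; auto.
  rewrite Rabs_R0. apply Xp. lra.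
Qed.

Lemma bubble_frontier (p : C) : (frontier bubble p /\ ~ bubble p) <->
  exists x, 0 <= x <= T /\ snd p = Y x /\ Rabs (fst p) = X x.
Proof.
  split.
  - intros [Hf Hn].
    assert (Near : forall e, 0 < e -> exists q x, 0 < x < T /\ snd q = Y x /\ Rabs (fst q) < X x /\
      Rabs (fst q - fst p) < e /\ Rabs (snd q - snd p) < e).
    { intros e He. destruct (proj1 (Hf (mkposreal e He))) as (q & Hb & x & Hx & Eq & Hq).
      destruct (proj1 (ball_C p q e) Hb) as [Q1 Q2]. exists q, x. tauto. }
    assert (Hy : Y 0 <= snd p <= Y T).
    { split; apply Rnot_lt_le; intros Hlt.
      - destruct (Near (Y 0 - snd p) ltac:(lra)) as (q & x & Hx & Eq & _ & _ & Hb).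
        pose proof (Hinc 0 x ltac:(lra) ltac:(lra) ltac:(lra)). apply Rabs_def2 in Hb. lra.
      - destruct (Near (snd p - Y T) ltac:(lra)) as (q & x & Hx & Eq & _ & _ & Hb).
        pose proof (Hinc x T ltac:(lra) ltac:(lra) ltac:(lra)). apply Rabs_def2 in Hb. lra. }
    destruct (height_ivt 0 T (snd p)) as (x & Hx & Ex); try lra.
    (* Points of the bubble near p have nearly the height of p, hence nearly its profile parameter,
       and so their abscissae are bounded by nearly [X x]. *)
    assert (Hle : Rabs (fst p) <= X x).
    { apply Rnot_lt_le; intros Hlt. set (g := Rabs (fst p) - X x) in *.
      destruct (height_inv x (g / (2 * (L + 1))) Hx) as (e & He & Hinv).
      { apply Rdiv_lt_0_compat; unfold g; lra. }
      destruct (Near (Rmin e (g / 2))) as (q & x' & Hx' & Eq & Hq & Hb1 & Hb2).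
      { apply Rmin_glb_lt; unfold g; lra. }
      pose proof (Rmin_l e (g / 2)). pose proof (Rmin_r e (g / 2)).
      assert (Hc : Rabs (x' - x) < g / (2 * (L + 1))).
      { apply Hinv; [lra|]. rewrite Ex, <- Eq. lra. }
      pose proof (HX x x') as Hl. pose proof (Rle_abs (X x' - X x)).
      assert (L * Rabs (x' - x) <= g / 2).
      { apply Rle_trans with ((L + 1) * (g / (2 * (L + 1)))); [|right; field; lra].
        apply Rmult_le_compat; try lra. apply Rabs_pos. }
      assert (Rabs (fst p) <= Rabs (fst q) + Rabs (fst q - fst p)).
      { replace (fst p) with (fst q + - (fst q - fst p)) at 1 by ring.
        eapply Rle_trans; [apply Rabs_triang|]. rewrite Rabs_Ropp. lra. }
      unfold g in *. lra. }
    exists x. split; [auto|]. split; [auto|].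
    destruct (Rle_lt_or_eq_dec _ _ Hle) as [Hlt|E]; auto. exfalso.
    pose proof (Rabs_pos (fst p)).
    assert (x <> 0) by (intros ->; lra). assert (x <> T) by (intros ->; lra).
    apply Hn. exists x. repeat split; auto; lra.
  - intros (x & Hx & Ey & Ex).
    assert (Hn : ~ bubble p).
    { intros (x' & Hx' & Ey' & Hlt). assert (x = x') by (apply Y_inj; lra). subst x'. lra. }
    split; auto. intros [e He]. split; [|exists p; split; auto; apply ball_center].
    set (B := L * T + L * T + 1). assert (HLT : 0 <= L * T) by (apply Rmult_le_pos; lra).
    set (k := Rmin (/ 2) (e / (2 * B))).
    assert (Hk : 0 < k). { apply Rmin_glb_lt; [lra|]. apply Rdiv_lt_0_compat; unfold B; lra. }
    assert (K1 : k <= / 2) by apply Rmin_l. assert (K2 : k <= e / (2 * B)) by apply Rmin_r.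
    (* Moving the parameter towards T / 2 and shrinking the abscissa by 1 - k makes both defining
       inequalities strict, also at the two ends of the profile. *)
    set (x' := x + k * (T / 2 - x)).
    assert (Hx' : 0 < x' < T) by (unfold x'; split; nra).
    assert (Hxx : Rabs (x' - x) <= k * T).
    { unfold x'. replace (x + k * (T / 2 - x) - x) with (k * (T / 2 - x)) by ring.
      rewrite Rabs_mult, (Rabs_pos_eq k) by lra. apply Rmult_le_compat_l; [lra|]. apply Rabs_le; lra. }
    assert (HkB : k * B < e).
    { apply Rle_lt_trans with (e / (2 * B) * B); [apply Rmult_le_compat_r; unfold B in *; lra|].
      replace (e / (2 * B) * B) with (e / 2) by (field; unfold B; lra). lra. }
    assert (HLx : L * Rabs (x' - x) <= L * (k * T)) by (apply Rmult_le_compat_l; auto).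
    pose proof (HX x x') as A1. pose proof (HY x x') as A2. pose proof (Xp x' Hx') as Px.
    destruct (XY_bound x') as [B1 _]; [lra|]. rewrite Rabs_pos_eq in B1 by lra.
    assert (Sg : exists sg, (sg = 1 \/ sg = -1) /\ fst p = sg * X x).
    { destruct (Rle_dec 0 (fst p)) as [S|S].
      - exists 1. split; auto. rewrite <- Ex, Rabs_pos_eq; lra.
      - exists (-1). split; auto. rewrite <- Ex, Rabs_left; lra. }
    destruct Sg as (sg & Hs & Ep).
    assert (As : Rabs sg = 1).
    { destruct Hs; subst; [apply Rabs_R1|]. rewrite Rabs_left; lra. }
    exists (sg * ((1 - k) * X x'), Y x'). split.
    + apply (proj2 (ball_C _ _ _)). cbn [fst snd]. split.
      * rewrite Ep. replace (sg * ((1 - k) * X x') - sg * X x) with (sg * ((X x' - X x) - k * X x')) by ring.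
        rewrite Rabs_mult, As, Rmult_1_l. eapply Rle_lt_trans; [apply Rabs_triang|].
        rewrite Rabs_Ropp, Rabs_mult, (Rabs_pos_eq k), (Rabs_pos_eq (X x')) by lra.
        assert (k * X x' <= k * (L * T)) by (apply Rmult_le_compat_l; lra).
        simpl. unfold B in HkB. lra.
      * rewrite Ey. simpl. unfold B in HkB. nra.
    + exists x'. cbn [fst snd]. split; auto. split; auto.
      rewrite Rabs_mult, As, Rmult_1_l, Rabs_pos_eq by nra. nra.
Qed.
End Bubble.

(** * The touching wave *)

Lemma is_derive_parts (F : R -> C) (x : R) (l : C) :
  is_derive (K := R_AbsRing) (V := C_R_NormedModule) F x l ->
  is_derive (fun t => fst (F t)) x (fst l) /\ is_derive (fun t => snd (F t)) x (snd l).
Proof.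
  intros H. split.
  - apply (filterdiff_comp' (K := R_AbsRing) (U := R_NormedModule) (V := C_R_NormedModule)
      (W := R_NormedModule) F (fun p => fst p) x _ (fun p => fst p) H).
    apply filterdiff_linear, (is_linear_fst (K := R_AbsRing) (U := R_NormedModule) (V := R_NormedModule)).
  - apply (filterdiff_comp' (K := R_AbsRing) (U := R_NormedModule) (V := C_R_NormedModule)
      (W := R_NormedModule) F (fun p => snd p) x _ (fun p => snd p) H).
    apply filterdiff_linear, (is_linear_snd (K := R_AbsRing) (U := R_NormedModule) (V := R_NormedModule)).
Qed.

Lemma vertical_tangent (w : wave) (a m : R) (p : C) : m <> 0 ->
  is_derive (K := R_AbsRing) (V := C_R_NormedModule) (trace w) a (0, m) ->
  tangent_line w a p <-> fst p = fst (trace w a).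
Proof.
  intros Hm H. destruct (is_derive_parts _ _ _ H) as [H1 H2]. split.
  - intros (v & t & Hv & E). destruct (is_derive_parts _ _ _ Hv) as [V1 V2].
    assert (E1 : fst v = 0).
    { rewrite <- (is_derive_unique _ _ _ V1). apply (is_derive_unique _ _ _ H1). }
    rewrite E, E1. cbn [fst]. ring.
  - intros E. exists (0, m), ((snd p - snd (trace w a)) / m). split; auto.
    rewrite <- E. cbn [fst snd]. rewrite (surjective_pairing p) at 1. f_equal; [ring|field; auto].
Qed.

Section Touching.
Local Opaque vv uu EV ev zmp dzp.
Variables (a : par) (s : R) (d : nat -> R).
Hypothesis d0 : d 0%nat = 0.
Hypothesis d1 : d 1%nat = 0.
Hypothesis Hd : dec eta0 (5 / 6) d.
Notation zm := (zmp a s d).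
Notation dz := (dzp a s d).

Lemma boundary_lipschitz : exists L, 0 <= L /\ forall x x',
  Rabs (fst (zm (x', 0)) - fst (zm (x, 0))) <= L * Rabs (x' - x) /\
  Rabs (snd (zm (x', 0)) - snd (zm (x, 0))) <= L * Rabs (x' - x).
Proof.
  destruct (rem_zm a s d d0 d1 Hd) as (K & HK & Hrem).
  destruct (zm_bounded a s d d0 d1 Hd) as (B & HB).
  destruct (zm_lips zm dz K B HK Hrem (tm_dz a s d d0 d1 Hd) HB) as (L & HL & H).
  exists L. split; auto. intros x x'. specialize (H _ _ (clh_boundary x) (clh_boundary x')).
  replace ((x', 0) - (x, 0))%C with (RtoC (x' - x)) in H
    by (unfold RtoC, Cminus, Cplus, Copp; simpl; f_equal; ring).
  rewrite Cmod_R in H. split; (eapply Rle_trans; [|exact H]).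
  - apply (re_le_Cmod (zm (x', 0) - zm (x, 0))%C).
  - apply (im_le_Cmod (zm (x', 0) - zm (x, 0))%C).
Qed.

Hypothesis Hneg : a < 0.

Lemma dz_conj (x : R) : dz (- x, 0) = Cconj (dz (x, 0)).
Proof.
  rewrite !dzp_eq, !EV_eq, vv_conj, ev_conj; [|lra|destruct a as [a' Ha]; simpl in *; lra].
  unfold Cconj, Cplus, RtoC; simpl. f_equal; ring.
Qed.

Lemma height_abs (x : R) : snd (zm (Rabs x, 0)) = snd (zm (x, 0)) /\
  (0 <= x -> fst (zm (Rabs x, 0)) = fst (zm (x, 0))) /\ (x <= 0 -> fst (zm (Rabs x, 0)) = - fst (zm (x, 0))).
Proof.
  destruct (Rle_dec 0 x) as [H|H].
  - rewrite Rabs_pos_eq by auto. split; auto. split; auto. intros. assert (x = 0) by lra. subst.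
    rewrite x_axis by (auto using sin_0; lra). ring.
  - rewrite Rabs_left by lra. rewrite zm_conj by lra. repeat split; auto; intros; lra.
Qed.

(** The height is strictly increasing in |alpha| on each period, so troughs and crests occur only at
    alpha in PI Z, where abscissa and parameter agree. *)
Lemma extremal_axis (G b : R) (hh : nat -> R) (c : C) :
  crest (solution_wave a s d G b hh) c \/ trough (solution_wave a s d G b hh) c ->
  exists k : Z, fst c = PI * IZR k.
Proof.
  pose proof PI_RGT_0 as HPI.
  assert (Red : forall x, exists (k : Z) u, -PI < u <= PI /\ zm (x, 0) = (fst (zm (u, 0)) + 2 * PI * IZR k, snd (zm (u, 0)))).
  { intros x. destruct (reduce_period x) as (k & u & -> & Hu). exists k, u. split; auto. apply zm_period_Z. }
  assert (Ab : forall u, - PI < u <= PI -> 0 <= Rabs u <= PI).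
  { intros u Hu. split; [apply Rabs_pos|]. apply Rabs_le; lra. }
  intros [[(x & E) Hmax]|[(x & E) Hmin]]; change (c = zm (x, 0)) in E;
    destruct (Red x) as (k & u & Hu & Ez); specialize (Ab u Hu);
    destruct (height_abs u) as (Es & _ & _).
  - assert (Hp : Rabs u = PI).
    { apply NNPP; intros Hne. pose proof (y_mono a s d d0 d1 Hd (Rabs u) PI Hneg ltac:(lra) ltac:(lra) ltac:(lra)) as Hy.
      specialize (Hmax (zm (PI, 0)) ltac:(exists PI; reflexivity)). rewrite E, Ez in Hmax. cbn [snd] in Hmax. lra. }
    assert (u = PI). { unfold Rabs in Hp. destruct (Rcase_abs u); lra. } subst u.
    exists (1 + 2 * k)%Z. rewrite E, Ez. cbn [fst]. rewrite x_axis by (auto using sin_PI; lra).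
    rewrite plus_IZR, mult_IZR. ring.
  - assert (Hp : Rabs u = 0).
    { apply NNPP; intros Hne. pose proof (y_mono a s d d0 d1 Hd 0 (Rabs u) Hneg ltac:(lra) ltac:(lra) ltac:(lra)) as Hy.
      specialize (Hmin (zm (0, 0)) ltac:(exists 0; reflexivity)). rewrite E, Ez in Hmin. cbn [snd] in Hmin. lra. }
    apply Rabs_eq_0 in Hp. subst u. exists (2 * k)%Z. rewrite E, Ez. cbn [fst].
    rewrite x_axis by (auto using sin_0; lra). rewrite mult_IZR. ring.
Qed.

Hypothesis Xpos : forall x, 0 <= x <= PI -> 0 <= fst (zm (x, 0)).

Lemma zm_lower_inj (z1 z2 : C) : lower_half z1 -> clh z2 -> zm z1 = zm z2 -> z1 = z2.
Proof.
  intros H1 H2 E. destruct (zm_coincide a s d d0 d1 Hd Xpos z1 z2 Hneg (lower_clh _ H1) H2 E)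
    as [|(k & t & _ & _ & [[E1 _]|[E1 _]])]; auto; unfold lower_half in H1; rewrite E1 in H1; simpl in H1; lra.
Qed.

Lemma trace_injective : (forall x, 0 < x < PI -> 0 < fst (zm (x, 0))) ->
  forall x1 x2, zm (x1, 0) = zm (x2, 0) -> x1 = x2.
Proof.
  intros Hp x1 x2 E. destruct (zm_coincide a s d d0 d1 Hd Xpos _ _ Hneg (clh_boundary x1) (clh_boundary x2) E)
    as [E1|(k & t & Ht & E1 & _)]; [now injection E1|]. specialize (Hp t Ht). lra.
Qed.

Variable t : R.
Hypothesis Ht : 0 < t < PI.
Hypothesis Xt : fst (zm (t, 0)) = 0.

Let X (x : R) := fst (zm (x, 0)).
Let Y (x : R) := snd (zm (x, 0)).

(** An earlier zero of the abscissa would be a second contact. *)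
Lemma bubble_profile (x : R) : 0 < x < t -> 0 < X x.
Proof.
  intros Hx. destruct (Xpos x ltac:(lra)) as [H|H]; [exact H|].
  pose proof (contact_unique a s d d0 d1 Hd Hneg Xpos x t ltac:(lra) Ht (eq_sym H) Xt). lra.
Qed.

(** Between points of equal height, one on the profile and one in the fluid at depth beta, the
    rotation inequality reduces to (x difference) times (- beta) > 0. So the fluid lies beyond the
    profile on each side, and the horizontal segments of the bubble contain none of it. *)
Lemma bubble_outside_fluid (p : C) : bubble X Y t p -> ~ image zm p.
Proof.
  intros (x & Hx & Ey & Hp) (z & Hz & Ez). pose proof PI_RGT_0 as HPI.
  destruct z as [al be]. unfold lower_half in Hz; simpl in Hz.
  destruct (reduce_period al) as (k & u & -> & Hu). rewrite zm_period_Z in Ez.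
  pose proof (x_lt_alpha a s d d0 d1 Hd x 0 Hneg ltac:(lra) ltac:(lra)) as Hxl. fold (X x) in Hxl.
  assert (Bw : forall w, 0 <= w <= PI -> 0 <= fst (zm (w, be)) <= PI).
  { intros w Hw. destruct (Req_dec w 0) as [->|]; [rewrite x_axis by (auto using sin_0; lra); lra|].
    destruct (Req_dec w PI) as [->|]; [rewrite x_axis by (auto using sin_PI; lra); lra|].
    pose proof (strip_x a s d d0 d1 Hd Xpos w be Hneg ltac:(lra) ltac:(lra)). lra. }
  assert (Sep : forall w, 0 <= w <= PI -> snd (zm (w, be)) = Y x -> X x < fst (zm (w, be))).
  { intros w Hw Es.
    pose proof (half_strip_mono a s d d0 d1 Hd (x, 0) (w, be) Hneg (clh_boundary x)) as M.
    cbn [fst snd] in M.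
    assert (H0 : 0 < snd ((zm (w, be) - zm (x, 0)) * Cconj ((w, be) - (x, 0)))%C).
    { apply M; try lra; [unfold closed_lower_half; simpl; lra|]. intros E; injection E; lra. }
    unfold Y in Es. unfold X.
    replace (snd ((zm (w, be) - zm (x, 0)) * Cconj ((w, be) - (x, 0)))%C) with
      ((fst (zm (w, be)) - fst (zm (x, 0))) * - be) in H0.
    - nra.
    - unfold Cconj. cbn [Cmult Cminus Cplus Copp fst snd]. rewrite Es. ring. }
  assert (Rf : forall y, fst (zm (- y, be)) = - fst (zm (y, be)) /\ snd (zm (- y, be)) = snd (zm (y, be))).
  { intros y. rewrite zm_conj by lra. split; reflexivity. }
  rewrite <- Ez in Ey, Hp. cbn [fst snd] in Ey, Hp.
  assert (Hu2 : - PI <= fst (zm (u, be)) <= PI).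
  { destruct (Rle_dec 0 u) as [P|P]; [specialize (Bw u ltac:(lra)); lra|].
    specialize (Bw (- u) ltac:(lra)). destruct (Rf u) as [R1 _]. lra. }
  assert (Hk : k = 0%Z).
  { apply Rabs_def2 in Hp. assert (-1 < IZR k < 1).
    { split; apply Rmult_lt_reg_l with (2 * PI); lra. }
    destruct H as [K1 K2]. apply lt_IZR in K1. apply lt_IZR in K2. lia. }
  subst k. rewrite Rmult_0_r, Rplus_0_r in Hp. apply Rabs_def2 in Hp.
  destruct (Rle_dec 0 u) as [P|P].
  - specialize (Sep u ltac:(lra) Ey). lra.
  - destruct (Rf u) as [R1 R2]. specialize (Sep (- u) ltac:(lra) ltac:(lra)). lra.
Qed.

(** By symmetry the parameters -t and t give the same point. There z' is imaginary and not zero, so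
    both tangent lines are vertical. Uniqueness of the contact leaves one pair modulo the period. *)
Lemma solution_touching (G b : R) (hh : nat -> R) : touching (solution_wave a s d G b hh).
Proof.
  set (w := solution_wave a s d G b hh). pose proof PI_RGT_0 as HPI.
  assert (Tr : forall x, trace w x = zm (x, 0)) by reflexivity.
  destruct boundary_lipschitz as (L & HL & HLip).
  assert (Sym : zm (- t, 0) = zm (t, 0)).
  { rewrite zm_conj by lra. rewrite Xt, (surjective_pairing (zm (t, 0))), Xt. cbn [snd]. f_equal. ring. }
  destruct (rem_zm a s d d0 d1 Hd) as (K & HK & Hrem).
  pose proof (trace_derive zm dz K HK Hrem) as Htd.
  pose proof (contact_vertical a s d d0 d1 Hd Xpos t Ht Xt) as Hv.
  assert (Hm : 0 < snd (dz (t, 0))).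
  { apply dz_im; auto using clh_boundary. apply vv_im_neg; auto; lra. }
  exists (- t), t. split; [lra|]. split; [rewrite !Tr; exact Sym|]. split; [|split].
  - intros b1 b2 Hb E. rewrite !Tr in E.
    destruct (zm_coincide a s d d0 d1 Hd Xpos _ _ Hneg (clh_boundary b1) (clh_boundary b2) E)
      as [E1|(k & t' & Ht' & E1 & Hc)]; [injection E1; lra|].
    assert (t' = t) by (apply (contact_unique a s d d0 d1 Hd Hneg Xpos); auto). subst t'.
    destruct Hc as [[E2 E3]|[E2 E3]]; injection E2 as E2; injection E3 as E3; [|lra].
    exists k. split; auto.
  - intros p.
    assert (D1 : is_derive (K := R_AbsRing) (V := C_R_NormedModule) (trace w) t (0, snd (dz (t, 0)))).
    { replace (0, snd (dz (t, 0))) with (dz (t, 0)); [apply Htd|].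
      rewrite (surjective_pairing (dz (t, 0))) at 1. now rewrite Hv. }
    assert (D2 : is_derive (K := R_AbsRing) (V := C_R_NormedModule) (trace w) (- t) (0, - snd (dz (t, 0)))).
    { replace (0, - snd (dz (t, 0))) with (dz (- t, 0)); [apply Htd|].
      rewrite dz_conj. unfold Cconj. now rewrite Hv. }
    rewrite (vertical_tangent _ _ _ p (Rgt_not_eq _ _ Hm) D1).
    rewrite (vertical_tangent _ _ (- snd (dz (t, 0))) p ltac:(lra) D2). rewrite !Tr, Sym. reflexivity.
  - assert (HX : forall x x', Rabs (X x' - X x) <= L * Rabs (x' - x)) by (intros; apply HLip).
    assert (HY : forall x x', Rabs (Y x' - Y x) <= L * Rabs (x' - x)) by (intros; apply HLip).
    assert (Hinc : forall x x', 0 <= x -> x < x' -> x' <= PI -> Y x < Y x') by (intros; apply y_mono; auto).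
    assert (X0 : X 0 = 0) by (apply x_axis; auto using sin_0; lra).
    exists (bubble X Y t). split; [|split; [|split]].
    + apply (bubble_domain X Y t PI L); auto using bubble_profile.
    + apply (bubble_bounded X Y t L); auto using bubble_profile.
    + intros p. assert (Hf : (frontier (bubble X Y t) p /\ ~ bubble X Y t p) <->
        exists x, 0 <= x <= t /\ snd p = Y x /\ Rabs (fst p) = X x).
      { apply (bubble_frontier X Y t PI L); auto using bubble_profile. }
      rewrite Hf. clear Hf. split.
      * intros (x & Hx & Ey & Ex). destruct (Rle_dec 0 (fst p)) as [S|S].
        -- exists x. split; [lra|]. rewrite Tr, (surjective_pairing p), (surjective_pairing (zm (x, 0))).
           rewrite Ey, <- (Rabs_pos_eq (fst p)), Ex by auto. reflexivity.
        -- exists (- x). split; [lra|]. rewrite Tr, zm_conj by lra. rewrite (surjective_pairing p).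
           rewrite Ey. f_equal. rewrite Rabs_left in Ex by lra. unfold X in Ex. lra.
      * intros (x & Hx & E). rewrite Tr in E. subst p.
        assert (Ha : 0 <= Rabs x <= t) by (split; [apply Rabs_pos|apply Rabs_le; lra]).
        destruct (height_abs x) as (E1 & E2 & E3). exists (Rabs x). split; auto. split; [auto|].
        pose proof (Xpos (Rabs x) ltac:(lra)) as Hp. unfold X.
        destruct (Rle_dec 0 x) as [P|P].
        -- rewrite <- E2 by auto. apply Rabs_pos_eq; auto.
        -- rewrite E3 by lra. rewrite E3 in Hp by lra. rewrite <- Rabs_Ropp. apply Rabs_pos_eq; auto.
    + intros p Hp. apply (bubble_outside_fluid p Hp).
Qed.
End Touching.

(** * Dependence on the parameter *)

Definition par_lipschitz (q : R) (w : par -> nat -> R) : Prop :=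
  exists M, 0 <= M /\ forall a a' : par,
    dec M q (w a) /\ dec (M * Rabs (a - a')) q (fun n => w a n - w a' n).

(** The difference is (a - a') (u^2 - 1) divided by the product of the two denominators, each of
    modulus above 1/2. *)
Lemma vv_par_lipschitz (a a' : par) (z : C) : clh z ->
  Cmod (vv a z - vv a' z)%C <= 8 * Rabs (a - a').
Proof.
  intros Hz. pose proof (den_nz a _ (uu_le1 z Hz)) as N1. pose proof (den_nz a' _ (uu_le1 z Hz)) as N2.
  pose proof (den_low a _ (uu_le1 z Hz)) as D1. pose proof (den_low a' _ (uu_le1 z Hz)) as D2.
  pose proof (uu_le1 z Hz) as Hu.
  assert (E : (vv a z - vv a' z)%C =
    ((a - a')%R * (uu z * uu z - 1) * (/ (1 - a * uu z) * / (1 - a' * uu z)))%C).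
  { unfold vv. rewrite RtoC_minus. field. auto. }
  rewrite E, !Cmod_mult, !Cmod_inv, Cmod_R by auto.
  assert (H1 : Cmod (uu z * uu z - 1)%C <= 2).
  { eapply Rle_trans; [apply Cmod_minus|]. rewrite Cmod_mult, Cmod_1. pose proof (Cmod_ge_0 (uu z)). nra. }
  assert (I1 : / Cmod (1 - a * uu z)%C <= 2) by (replace 2 with (/ / 2) by field; apply Rinv_le_contravar; lra).
  assert (I2 : / Cmod (1 - a' * uu z)%C <= 2) by (replace 2 with (/ / 2) by field; apply Rinv_le_contravar; lra).
  assert (P1 : 0 < / Cmod (1 - a * uu z)%C) by (apply Rinv_0_lt_compat; lra).
  assert (P2 : 0 < / Cmod (1 - a' * uu z)%C) by (apply Rinv_0_lt_compat; lra).
  pose proof (Rabs_pos (a - a')). pose proof (Cmod_ge_0 (uu z * uu z - 1)%C).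
  replace (8 * Rabs (a - a')) with (Rabs (a - a') * 2 * (2 * 2)) by ring.
  apply Rmult_le_compat; nra.
Qed.

Lemma ev_lipschitz (M q q' : R) (w : nat -> R) : 0 < q < q' -> q' < 1 -> dec M q w ->
  exists K, 0 <= K /\ forall w, dec M q w -> forall v v', Cmod v <= 1 -> Cmod v' <= 1 ->
    Cmod (ev w v' - ev w v)%C <= K * Cmod (v' - v).
Proof.
  intros Hq Hq' Hw. pose proof (dec_pos _ _ _ Hw) as HM. set (D := M * (q / (q' - q))).
  assert (HD : 0 <= D) by (apply Rmult_le_pos; [auto|apply Rdiv_le_0_compat; lra]).
  exists (2 * (D / (1 - q'))). split.
  { assert (0 <= D / (1 - q')) by (apply Rdiv_le_0_compat; lra). lra. }
  clear w Hw. intros w Hw v v' Hv Hv'. pose proof (Cmod_ge_0 (v' - v)) as Hd.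
  assert (C1 : forall u, Cmod u <= 1 -> csum (fun n => (w n * u ^ n)%C)).
  { intros u Hu. apply (ev_csum M q); auto; lra. }
  assert (Em : RtoC (-1) = Copp (RtoC 1)) by (apply injective_projections; simpl; ring).
  replace (ev w v' - ev w v)%C with (cser (fun n => (w n * v' ^ n + (-1)%R * (w n * v ^ n))%C)).
  - replace (2 * (D / (1 - q')) * Cmod (v' - v)) with (2 * (D * Cmod (v' - v) / (1 - q'))) by (field; lra).
    rewrite <- Series_dec by lra. apply cser_bound; [apply dec_ex; lra|]. intros n.
    replace (w n * v' ^ n + (-1)%R * (w n * v ^ n))%C with (w n * (v' ^ n - v ^ n))%C.
    + rewrite Cmod_mult, Cmod_R. pose proof (pow_step v v' n Hv Hv') as Hp.
      pose proof (n_geom q q' n Hq) as Hn. specialize (Hw n). pose proof (pos_INR n).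
      apply Rle_trans with (M * q ^ n * (INR n * Cmod (v' - v))).
      * apply Rmult_le_compat; auto using Rabs_pos, Cmod_ge_0.
      * replace (M * q ^ n * (INR n * Cmod (v' - v))) with (M * Cmod (v' - v) * (INR n * q ^ n)) by ring.
        replace (D * Cmod (v' - v) * q' ^ n) with (M * Cmod (v' - v) * (q / (q' - q) * q' ^ n))
          by (unfold D; ring).
        apply Rmult_le_compat_l; auto. apply Rmult_le_pos; auto.
    + rewrite Em. ring.
  - rewrite cser_add by (auto using csum_scal). rewrite cser_scal by auto. rewrite !ev_cser.
    rewrite Em. ring.
Qed.

Lemma EV_par_lipschitz (q : R) (w : par -> nat -> R) : 0 < q < 1 -> par_lipschitz q w ->
  exists K, 0 <= K /\ forall (a a' : par) z, clh z ->
    Cmod (EV a (w a) z) <= K /\ Cmod (EV a (w a) z - EV a' (w a') z)%C <= K * Rabs (a - a').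
Proof.
  intros Hq (M & HM & H).
  assert (p0 : par) by (exists 0; lra).
  destruct (ev_lipschitz M q ((1 + q) / 2) (w p0)) as (K & HK & HL); try lra; [apply (H p0 p0)|].
  set (B := 2 * (M / (1 - q))).
  assert (HB : 0 <= B) by (assert (0 <= M / (1 - q)) by (apply Rdiv_le_0_compat; lra); unfold B; lra).
  exists (B + 8 * K). split; [lra|]. intros a a' z Hz. destruct (H a a') as [H1 H2].
  destruct (H a' a) as [H3 _].
  split.
  - apply Rle_trans with B; [|lra]. apply (ev_bound M q); auto using vv_le1; lra.
  - unfold EV.
    assert (E : ev (w a) (vv a z) = (ev (fun n => w a n - w a' n)%R (vv a z) + ev (w a') (vv a z))%C).
    { rewrite <- ev_add; auto using vv_le1.
      - apply ev_ext; intros n; ring.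
      - exists (M * Rabs (a - a')), q; auto.
      - exists M, q; auto. }
    rewrite E.
    replace (ev (fun n => w a n - w a' n)%R (vv a z) + ev (w a') (vv a z) - ev (w a') (vv a' z))%C with
      (ev (fun n => w a n - w a' n)%R (vv a z) + (ev (w a') (vv a z) - ev (w a') (vv a' z)))%C by ring.
    eapply Rle_trans; [apply Cmod_triangle|].
    pose proof (ev_bound _ q _ (vv a z) ltac:(lra) H2 (vv_le1 a z Hz)) as B1.
    pose proof (HL _ H3 (vv a' z) (vv a z) (vv_le1 a' z Hz) (vv_le1 a z Hz)) as B2.
    pose proof (vv_par_lipschitz a a' z Hz) as B3.
    replace (2 * (M * Rabs (a - a') / (1 - q))) with (B * Rabs (a - a')) in B1 by (unfold B; field; lra).
    assert (K * Cmod (vv a z - vv a' z) <= K * (8 * Rabs (a - a'))) by (apply Rmult_le_compat_l; auto).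
    lra.
Qed.

(** The parameter enters twice: through the coefficients, where [Dop] is applied to their
    difference, and through mu and C in [Dop] itself. *)
Lemma par_lipschitz_Dop (q q' : R) (w : par -> nat -> R) : 5 / 6 <= q -> q < q' -> q' < 1 ->
  par_lipschitz q w -> par_lipschitz q' (fun a => Dop a (w a)).
Proof.
  intros Hq Hqq Hq' (M & HM & H).
  destruct slip_mu as (Km & HKm & Lm). destruct slip_Cc as (Kc & HKc & Lc).
  set (D := M / (q' - q)). assert (HD : 0 <= D) by (apply Rdiv_le_0_compat; lra).
  assert (HP : 0 <= Km * D /\ 0 <= Kc * D) by (split; apply Rmult_le_pos; auto). destruct HP as [HP1 HP2].
  set (K := 4 * D + 6 / 5 * (Km * D) + 61 / 25 * (Kc * D)).
  exists K. split; [unfold K; lra|]. intros a a'. destruct (H a a') as [H1 H2]. destruct (H a' a) as [H3 _].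
  split.
  - apply dec_weaken with (4 * D) q'; [lra|unfold K; lra|]. now apply dec_Dop.
  - pose proof (dec_Dop a _ q q' _ Hq Hqq Hq' H2) as B1.
    destruct (dec_der_up M q q' (w a') Hq Hqq Hq' H3) as [B2 B3]. fold D in B2, B3.
    intros n. specialize (B1 n). specialize (B2 n). specialize (B3 n). simpl in B3.
    assert (Hqn : 0 <= q' ^ n) by (apply pow_le; lra).
    set (A := Rabs (a - a')) in *. assert (HA : 0 <= A) by apply Rabs_pos.
    assert (Ed : forall i, der (fun n => w a n - w a' n) i = der (w a) i - der (w a') i)
      by (intros i; unfold der; ring).
    assert (E : Dop a (w a) n - Dop a' (w a') n = Dop a (fun n => w a n - w a' n) n
      + (mu a - mu a') * up_fun (der (w a')) n
      + (Cc a - Cc a') / 2 * (der (w a') n + up_fun (up_fun (der (w a'))) n)).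
    { unfold Dop. rewrite Ed. destruct n as [|[|n]]; simpl; rewrite ?Ed; field. }
    rewrite E. eapply Rle_trans; [apply Rabs_triang|].
    apply Rle_trans with (4 * D * A * q' ^ n + Km * A * (6 / 5 * D * q' ^ n) + Kc * A * (61 / 25 * D * q' ^ n)).
    + apply Rplus_le_compat.
      * eapply Rle_trans; [apply Rabs_triang|]. apply Rplus_le_compat.
        -- eapply Rle_trans; [exact B1|]. right. unfold D. field. lra.
        -- rewrite Rabs_mult. apply Rmult_le_compat; auto using Rabs_pos. apply Lm.
      * rewrite Rabs_mult. apply Rmult_le_compat; auto using Rabs_pos.
        destruct (Lc a a') as [_ L]. fold A in L. unfold Rdiv. rewrite Rabs_mult, (Rabs_pos_eq (/ 2)) by lra.
        pose proof (Rabs_pos (Cc a - Cc a')). lra.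
    + right. unfold K. ring.
Qed.

Lemma par_lipschitz_fseq (s : par -> R) (d : par -> nat -> R) (L : R) : slip s -> 0 <= L ->
  (forall a : par, dec eta0 (5 / 6) (d a)) ->
  (forall (a a' : par) n, Rabs (d a n - d a' n) <= L * Rabs (a - a') * (5 / 6) ^ n) ->
  par_lipschitz (5 / 6) (fun a => fseq a (s a) (d a)).
Proof.
  intros (Ks & HKs & Ls) HL Hd HdL.
  destruct slip_mu as (Km & HKm & Lm). destruct slip_Cc as (Kc & HKc & Lc).
  set (K := Km + Ks + 3 * Kc + Kc * (1 + L)).
  assert (HKL : 0 <= Kc * (1 + L)) by (apply Rmult_le_pos; lra).
  assert (HK : Km + Ks <= K /\ 2 * Kc <= K * (5 / 6) /\ Kc * (1 + L) <= K) by (unfold K; lra).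
  exists K. split; [unfold K; lra|]. intros a a'.
  destruct (Ls a a') as [S1 S2], (Lm a a') as [M1 M2], (Lc a a') as [C1 C2].
  set (A := Rabs (a - a')) in *. assert (HA : 0 <= A) by apply Rabs_pos.
  assert (Hq : forall n, 0 <= (5 / 6) ^ n) by (intros; apply pow_le; lra).
  split; intros [|[|n]].
  - simpl. eapply Rle_trans; [apply Rabs_triang|]. lra.
  - simpl. rewrite Rabs_mult, (Rabs_pos_eq 2) by lra. lra.
  - change (Rabs (Cc a * d a (S (S n))) <= K * (5 / 6) ^ S (S n)). rewrite Rabs_mult.
    apply Rle_trans with (Kc * (1 + L) * (5 / 6) ^ S (S n)); [|apply Rmult_le_compat_r; auto; lra].
    rewrite Rmult_assoc. apply Rmult_le_compat; auto using Rabs_pos.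
    eapply Rle_trans; [apply Hd|]. apply Rmult_le_compat_r; auto. unfold eta0; lra.
  - simpl. replace (mu a + s a - (mu a' + s a')) with ((mu a - mu a') + (s a - s a')) by ring.
    eapply Rle_trans; [apply Rabs_triang|]. assert ((Km + Ks) * A <= K * A) by (apply Rmult_le_compat_r; lra). lra.
  - simpl. rewrite <- Rmult_minus_distr_l, Rabs_mult, (Rabs_pos_eq 2) by lra.
    assert (2 * Kc * A <= K * (5 / 6) * A) by (apply Rmult_le_compat_r; lra). lra.
  - change (Rabs (Cc a * d a (S (S n)) - Cc a' * d a' (S (S n))) <= K * A * (5 / 6) ^ S (S n)).
    set (m := S (S n)). replace (Cc a * d a m - Cc a' * d a' m) with
      (Cc a * (d a m - d a' m) + (Cc a - Cc a') * d a' m) by ring.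
    eapply Rle_trans; [apply Rabs_triang|]. rewrite !Rabs_mult.
    apply Rle_trans with (Kc * (L * A * (5 / 6) ^ m) + Kc * A * (1 * (5 / 6) ^ m)).
    + assert (D1 : Rabs (d a m - d a' m) <= L * A * (5 / 6) ^ m) by apply HdL.
      assert (D2 : Rabs (d a' m) <= 1 * (5 / 6) ^ m).
      { eapply Rle_trans; [apply Hd|]. apply Rmult_le_compat_r; auto. unfold eta0; lra. }
      apply Rplus_le_compat; apply Rmult_le_compat; auto using Rabs_pos.
    + assert (Kc * (1 + L) * (A * (5 / 6) ^ m) <= K * (A * (5 / 6) ^ m)); [|lra].
      apply Rmult_le_compat_r; [apply Rmult_le_pos; auto|lra].
Qed.

Fixpoint Dopn (j : nat) (a : R) (w : nat -> R) : nat -> R :=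
  match j with O => w | S j => Dop a (Dopn j a w) end.

(** Each derivative moves the decay rate halfway to 1, which is harmless for finitely many of
    them. *)
Lemma par_lipschitz_Dopn (j : nat) (w : par -> nat -> R) : par_lipschitz (5 / 6) w ->
  exists q, 5 / 6 <= q < 1 /\ par_lipschitz q (fun a => Dopn j a (w a)).
Proof.
  intros H. induction j as [|j (q & Hq & IH)].
  - exists (5 / 6). split; [lra|exact H].
  - exists ((1 + q) / 2). split; [lra|]. apply (par_lipschitz_Dop q _ (fun a => Dopn j a (w a))); auto; lra.
Qed.

Lemma Lub_bounded (E : R -> Prop) (B : R) : (exists r, E r) -> (forall r, E r -> 0 <= r <= B) ->
  0 <= real (Lub_Rbar E) <= B.
Proof.
  intros (r & Hr) HE. destruct (Lub_Rbar_correct E) as [H1 H2].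
  specialize (H2 (Finite B)). assert (H3 : Rbar_le (Lub_Rbar E) B).
  { apply H2. intros x Hx. apply HE; auto. }
  specialize (H1 r Hr). specialize (HE r Hr). destruct (Lub_Rbar E) as [l| |]; simpl in *; try tauto. lra.
Qed.

Lemma Derive_n_chain (F : nat -> R -> R) (k : nat) :
  (forall j x, is_derive (F j) x (F (S j) x)) -> forall x, Derive_n (F 0%nat) k x = F k x.
Proof.
  intros H. induction k as [|k IH]; intros x; [reflexivity|]. simpl.
  rewrite (Derive_ext _ _ x IH). apply is_derive_unique, H.
Qed.

Lemma ex_derive_n_chain (F : nat -> R -> R) (k : nat) (x : R) :
  (forall j x, is_derive (F j) x (F (S j) x)) -> ex_derive_n (F 0%nat) k x.
Proof.
  intros H. destruct k as [|k]; simpl; auto.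
  apply (ex_derive_ext (F k)); [intros t; symmetry; now apply Derive_n_chain|]. eexists; apply H.
Qed.

(** For distances h >= 1 the supremum of f suffices; for h < 1 the mean value theorem does, as h <=
    h^theta. *)
Lemma holder_quotient_bound (th B : R) (f f' : R -> R) (r : R) : 0 < th < 1 ->
  (forall x, is_derive f x (f' x)) -> (forall x, Rabs (f x) <= B /\ Rabs (f' x) <= B) ->
  holder_quotient th f r -> 0 <= r <= 2 * B.
Proof.
  intros Hth Hd HB (x & y & Hne & ->). set (h := Rabs (x - y)).
  assert (Hh : 0 < h) by (apply Rabs_pos_lt; lra).
  assert (HP : 0 < Rpower h th) by apply exp_pos.
  assert (HB0 : 0 <= B) by (pose proof (Rabs_pos (f 0)); destruct (HB 0); lra).
  split; [apply Rdiv_le_0_compat; auto using Rabs_pos|].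
  apply Rmult_le_reg_r with (Rpower h th); auto. unfold Rdiv. rewrite Rmult_assoc, Rinv_l, Rmult_1_r by lra.
  destruct (Rle_dec 1 h) as [L|L].
  - assert (1 <= Rpower h th).
    { rewrite <- (Rpower_O h) by auto. apply Rle_Rpower; lra. }
    replace (f x - f y) with (f x + - f y) by ring. eapply Rle_trans; [apply Rabs_triang|]. rewrite Rabs_Ropp.
    destruct (HB x), (HB y). nra.
  - assert (Hp : h <= Rpower h th).
    { rewrite <- (Rpower_1 h) at 1 by auto. unfold Rpower. apply Rnot_lt_le; intros Hlt.
      apply exp_lt_inv in Hlt. assert (ln h < 0) by (rewrite <- ln_1; apply ln_increasing; lra). nra. }
    destruct (MVT_gen f y x f') as (c & _ & E).
    + intros; apply Hd.
    + intros t _. apply continuity_pt_filterlim, (ex_derive_continuous f). now exists (f' t).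
    + rewrite E, Rabs_mult. fold h. destruct (HB c) as [_ Hc]. pose proof (Rabs_pos (f' c)). nra.
Qed.

(** Four suprema and one Hölder quotient, the latter at most 2 B, make up 6 B. The fourth derivative
    enters only through this quotient. *)
Lemma holder_chain (th B : R) (F : nat -> R -> R) : 0 < th < 1 ->
  (forall j x, is_derive (F j) x (F (S j) x)) -> (forall x, F 0%nat (x + 2 * PI) = F 0%nat x) ->
  (forall j x, (j <= 4)%nat -> Rabs (F j x) <= B) ->
  holder_space 3 th (F 0%nat) /\ 0 <= holder_norm 3 th (F 0%nat) <= 6 * B.
Proof.
  intros Hth Hd Hp HB.
  assert (Hq : forall r, holder_quotient th (Derive_n (F 0%nat) 3) r -> 0 <= r <= 2 * B).
  { intros r (x & y & Hne & E). rewrite !Derive_n_chain in E by auto.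
    apply (holder_quotient_bound th B (F 3%nat) (F 4%nat)); auto.
    exists x, y; auto. }
  split.
  - split; [exact Hp|]. split; [intros; now apply ex_derive_n_chain|].
    exists (2 * B). intros r Hr. now apply Hq.
  - assert (S : forall j, (j <= 4)%nat -> 0 <= sup_norm (Derive_n (F 0%nat) j) <= B).
    { intros j Hj. apply Lub_bounded; [exists (Rabs (Derive_n (F 0%nat) j 0)), 0; reflexivity|].
      intros r (x & ->). rewrite Derive_n_chain by auto. split; [apply Rabs_pos|auto]. }
    assert (H : 0 <= real (Lub_Rbar (holder_quotient th (Derive_n (F 0%nat) 3))) <= 2 * B).
    { apply Lub_bounded; auto. eexists. exists 1, 0. split; [lra|reflexivity]. }
    unfold holder_norm. rewrite !sum_Sn_R, sum_O.
    pose proof (S 0%nat ltac:(lia)). pose proof (S 1%nat ltac:(lia)).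
    pose proof (S 2%nat ltac:(lia)). pose proof (S 3%nat ltac:(lia)). lra.
Qed.

(** The j-th derivative along the boundary of the height above y = -1; the powers of -i convert
    [Dop] into d/dzeta. *)
Definition surf (j : nat) (a : R) (w : nat -> R) (x : R) : R :=
  fst ((- Ci) ^ j * EV a (Dopn j a w) (x, 0))%C.

Lemma rd_Dopn (j : nat) (a : R) (w : nat -> R) : rd w -> rd (Dopn j a w).
Proof. intros H. induction j; simpl; auto using rd_Dop. Qed.

Lemma surf_derive (j : nat) (a : par) (w : nat -> R) (x : R) : rd w ->
  is_derive (surf j a w) x (surf (S j) a w x).
Proof.
  intros H. pose proof (tame_mul _ _ _ _ (tame_const ((- Ci) ^ j)%C) (tame_EV a _ (rd_Dopn j a w H))) as (K & HK & _ & Hr).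
  destruct (trace_parts _ _ K HK Hr x) as [D _].
  replace (surf (S j) a w x) with
    (fst (0 * EV a (Dopn j a w) (x, 0) + (- Ci) ^ j * (- Ci * EV a (Dop a (Dopn j a w)) (x, 0))))%C.
  - exact D.
  - unfold surf. simpl Dopn. f_equal. simpl Cpow. ring.
Qed.

Lemma surf_bound (j : nat) (z z' : C) :
  Rabs (fst ((- Ci) ^ j * z)%C - fst ((- Ci) ^ j * z')%C) <= Cmod (z - z')%C.
Proof.
  replace (fst ((- Ci) ^ j * z)%C - fst ((- Ci) ^ j * z')%C) with (fst ((- Ci) ^ j * (z - z'))%C) by (simpl; ring).
  eapply Rle_trans; [apply re_le_Cmod|]. rewrite Cmod_mult, Cmod_pow, Cmod_opp, Cmod_Ci, pow1. lra.
Qed.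

Section Family.
Variable w : par -> nat -> R.
Hypothesis Hw : par_lipschitz (5 / 6) w.

Lemma surf_par_lipschitz : exists K, 0 <= K /\ forall (a a' : par) j x, (j <= 4)%nat ->
  Rabs (surf j a (w a) x) <= K /\ Rabs (surf j a (w a) x - surf j a' (w a') x) <= K * Rabs (a - a').
Proof.
  assert (H : forall m, exists K, 0 <= K /\ forall (a a' : par) j x, (j < m)%nat ->
    Rabs (surf j a (w a) x) <= K /\ Rabs (surf j a (w a) x - surf j a' (w a') x) <= K * Rabs (a - a')).
  { induction m as [|m (K & HK & IH)].
    - exists 0. split; [lra|]. intros; lia.
    - destruct (par_lipschitz_Dopn m w Hw) as (q & Hq & Hm).
      destruct (EV_par_lipschitz q _ ltac:(lra) Hm) as (K' & HK' & H).
      exists (K + K'). split; [lra|]. intros a a' j x Hj. pose proof (Rabs_pos (a - a')).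
      destruct (Nat.eq_dec j m) as [->|Hne].
      + destruct (H a a' (x, 0) (clh_boundary x)) as [B1 B2]. split.
        * eapply Rle_trans; [apply re_le_Cmod|]. rewrite Cmod_mult, Cmod_pow, Cmod_opp, Cmod_Ci, pow1. lra.
        * eapply Rle_trans; [apply surf_bound|]. nra.
      + destruct (IH a a' j x ltac:(lia)) as [B1 B2]. split; [lra|nra]. }
  destruct (H 5%nat) as (K & HK & H5). exists K. split; auto. intros. apply H5. lia.
Qed.

Lemma rd_family (a : par) : rd (w a).
Proof. destruct Hw as (M & _ & H). exists M, (5 / 6). split; [lra|]. apply (H a a). Qed.

Lemma surf_period (a : R) (u : nat -> R) (x : R) : surf 0 a u (x + 2 * PI) = surf 0 a u x.
Proof. unfold surf. rewrite !EV_eq, vv_period. reflexivity. Qed.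

Lemma surf_holder_space (th c : R) (a : par) : 0 < th < 1 ->
  holder_space 3 th (fun x => surf 0 a (w a) x - c).
Proof.
  intros Hth. destruct surf_par_lipschitz as (K & HK & H).
  set (F := fun j x => match j with O => surf 0 a (w a) x - c | _ => surf j a (w a) x end).
  apply (holder_chain th (K + Rabs c) F); auto.
  - intros j x. destruct j as [|j]; simpl.
    + replace (surf 1 a (w a) x) with (minus (surf 1 a (w a) x) 0) by (unfold minus, plus, opp; simpl; ring).
      apply (is_derive_minus (fun x => surf 0 a (w a) x) (fun _ => c)).
      * apply surf_derive, rd_family.
      * apply (is_derive_const (K := R_AbsRing) (V := R_NormedModule)).
    + apply surf_derive, rd_family.
  - intros x. simpl. now rewrite surf_period.
  - intros j x Hj. destruct (H a a j x Hj) as [B _]. pose proof (Rabs_pos c). destruct j; simpl; [|lra].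
    unfold Rminus. eapply Rle_trans; [apply Rabs_triang|]. rewrite Rabs_Ropp. lra.
Qed.

Lemma surf_holder_lipschitz (th : R) : 0 < th < 1 -> exists K, 0 <= K /\ forall (a a' : par) f,
  (forall x, f x = surf 0 a (w a) x - surf 0 a' (w a') x) ->
  0 <= holder_norm 3 th f <= K * Rabs (a - a').
Proof.
  intros Hth. destruct surf_par_lipschitz as (K & HK & H). exists (6 * K). split; [lra|].
  intros a a' f Hf. set (F := fun j x => surf j a (w a) x - surf j a' (w a') x).
  replace f with (F 0%nat).
  - rewrite Rmult_assoc. apply (holder_chain th (K * Rabs (a - a')) F); auto.
    + intros j x. apply (is_derive_minus (fun x => surf j a (w a) x) (fun x => surf j a' (w a') x));
        apply surf_derive, rd_family.
    + intros x. unfold F. now rewrite !surf_period.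
    + intros j x Hj. now apply H.
  - apply FunctionalExtensionality.functional_extensionality. intros x. symmetry; apply Hf.
Qed.
End Family.

(** * The first contact and the end of the curve *)

Lemma first_point (P : R -> Prop) (M : R) : 0 <= M -> P M ->
  (forall x, 0 <= x <= M -> ~ P x ->
     exists del, 0 < del /\ forall y, 0 <= y <= M -> Rabs (y - x) < del -> ~ P y) ->
  exists m, 0 <= m <= M /\ P m /\ forall x, 0 <= x < m -> ~ P x.
Proof.
  intros HM PM Hopen.
  set (E := fun x => 0 <= x <= M /\ forall y, 0 <= y < x -> ~ P y).
  destruct (completeness E) as (m & Hub & Hlub).
  - exists M. intros x [Hx _]. lra.
  - exists 0. split; [lra|]. intros; lra.
  - assert (Hm : 0 <= m <= M).
    { split; [apply Hub; split; [lra|intros; lra]|]. apply Hlub. intros x [Hx _]. lra. }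
    assert (Hlt : forall x, 0 <= x < m -> ~ P x).
    { intros x Hx Px. apply (Rlt_not_le m x); [lra|]. apply Hlub. intros z [Hz Hn].
      apply Rnot_lt_le; intros L. apply (Hn x); auto; lra. }
    exists m. split; auto. split; auto. apply NNPP; intros Hn.
    destruct (Hopen m Hm Hn) as (del & Hd & H).
    destruct (Req_dec m M) as [->|Hne]; [auto|].
    assert (HE : E (Rmin M (m + del / 2))).
    { pose proof (Rmin_l M (m + del / 2)). pose proof (Rmin_r M (m + del / 2)).
      split; [split; auto; apply Rmin_glb; lra|]. intros y Hy.
      destruct (Rlt_dec y m); [apply Hlt; lra|]. apply H; [lra|]. apply Rabs_def1; lra. }
    apply Hub in HE. assert (m < Rmin M (m + del / 2)) by (apply Rmin_glb_lt; lra). lra.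
Qed.

Lemma within_lipschitz (F : R -> R) (K l t0 : R) : 0 <= K ->
  (forall t, unit_interval t -> Rabs (F t - l) <= K * Rabs (t - t0)) ->
  filterlim F (within unit_interval (locally t0)) (locally l).
Proof.
  intros HK H Q [e He]. assert (Hd : 0 < e / (K + 1)) by (apply Rdiv_lt_0_compat; [apply cond_pos|lra]).
  exists (mkposreal _ Hd). intros t Ht Hu. apply He. change (Rabs (F t - l) < e).
  change (Rabs (t - t0) < e / (K + 1)) in Ht. eapply Rle_lt_trans; [apply H; auto|].
  pose proof (Rabs_pos (t - t0)).
  apply Rle_lt_trans with ((K + 1) * Rabs (t - t0)); [nra|].
  apply Rlt_le_trans with ((K + 1) * (e / (K + 1))); [apply Rmult_lt_compat_l; lra|right; field; lra].
Qed.

Lemma clamp_range (t : R) : - (11 / 24) <= - Rmax 0 (Rmin (11 / 24) t) <= 0.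
Proof.
  pose proof (Rmax_l 0 (Rmin (11 / 24) t)).
  assert (Rmax 0 (Rmin (11 / 24) t) <= 11 / 24) by (apply Rmax_lub; [lra|apply Rmin_l]). lra.
Qed.
(** The clamp makes the parameter a total function of t; on [0, 11/24] it is -t. *)
Definition par_at (t : R) : par := mkpar _ (clamp_range t).
Lemma par_at_val (t : R) : 0 <= t <= 11 / 24 -> pa (par_at t) = - t.
Proof. intros Ht. simpl. rewrite Rmin_right, Rmax_right; lra. Qed.

Section Curve.
Local Opaque vv uu EV ev zmp dzp par_at.
Variables (G : R) (s b : par -> R) (d hh : par -> nat -> R).
Hypothesis Hs : slip s.
Hypothesis Hb : slip b.
Hypothesis d0 : forall a, d a 0%nat = 0.
Hypothesis d1 : forall a, d a 1%nat = 0.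
Hypothesis Hd : forall a, dec eta0 (5 / 6) (d a).
Hypothesis HdL : exists L, 0 <= L /\
  forall (a a' : par) n, Rabs (d a n - d a' n) <= L * Rabs (a - a') * (5 / 6) ^ n.
Hypothesis Hhh : forall a, exists M, dec M (5 / 6) (hh a).
Hypothesis Hh0 : forall a : par, pa a = 0 -> forall n, (1 <= n)%nat -> hh a n = 0.
Hypothesis Heq : forall a : par, boundary_relations a (s a) (d a) (hh a) G (b a).

Notation zm a := (zmp a (s a) (d a)).
Definition wave_at (a : par) : wave := solution_wave a (s a) (d a) G (b a) (hh a).
Definition abscissa (a : par) (x : R) : R := fst (zm a (x, 0)).

Lemma fseq_par_lipschitz : par_lipschitz (5 / 6) (fun a => fseq a (s a) (d a)).
Proof. destruct HdL as (L & HL & H). apply (par_lipschitz_fseq s d L); auto. Qed.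

Lemma abscissa_par_lipschitz : exists K, 0 <= K /\ forall (a a' : par) x,
  Rabs (abscissa a x - abscissa a' x) <= K * Rabs (a - a').
Proof.
  destruct (EV_par_lipschitz (5 / 6) _ ltac:(lra) fseq_par_lipschitz) as (K & HK & H).
  exists K. split; auto. intros a a' x. destruct (H a a' (x, 0) (clh_boundary x)) as [_ B].
  eapply Rle_trans; [|exact B]. eapply Rle_trans; [|apply im_le_Cmod].
  rewrite <- Rabs_Ropp. right; f_equal. unfold abscissa. rewrite !zmp_eq. simpl. ring.
Qed.

Lemma abscissa_continuity (a : par) : continuity (abscissa a).
Proof.
  destruct (boundary_lipschitz a (s a) (d a) (d0 a) (d1 a) (Hd a)) as (L & HL & H).
  apply (lipschitz_continuity L HL). intros x x'. apply H.
Qed.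

Lemma abscissa_axis (a : par) : abscissa a 0 = 0 /\ abscissa a PI = PI.
Proof. split; apply x_axis; auto using sin_0, sin_PI; lra. Qed.

Lemma abscissa_flat (a : par) (x : R) : pa a = 0 -> abscissa a x = x.
Proof.
  intros E. unfold abscissa. rewrite zm_fst by (auto using clh_boundary).
  unfold Cc. rewrite E. cbn [fst]. unfold Rdiv. ring.
Qed.

(** With the weak inequality these t form a closed set containing 11/24, even though the abscissa is
    negative there; equality at the first of them is a consequence of minimality. *)
Definition contact_at (t : R) : Prop := exists x, 0 < x < PI /\ abscissa (par_at t) x <= 0.

Lemma first_contact : exists T, 0 < T <= 11 / 24 /\ contact_at T /\ forall t, 0 <= t < T -> ~ contact_at t.
Proof.
  pose proof PI_RGT_0 as HPI. destruct abscissa_par_lipschitz as (K & HK & HL).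
  destruct (first_point contact_at (11 / 24)) as (T & HT & C & N); [lra| | |].
  - exists (2 * PI / 3). split; [lra|]. left. apply x_overhang; auto. apply par_at_val. lra.
  - intros t Ht Hn.
    (* On all of (0, PI) the abscissa comes arbitrarily close to 0 at the trough, so no positive
       lower bound exists. On [PI / 2, PI], outside which contact is impossible, the minimum is
       attained and positive, and Lipschitz dependence preserves it nearby. *)
    destruct (continuity_ab_min (abscissa (par_at t)) (PI / 2) PI) as (x & Hmin & Hx); [lra|
      intros; apply abscissa_continuity|].
    set (m := abscissa (par_at t) x) in *.
    assert (Hm : 0 < m).
    { destruct (Req_dec x PI) as [->|Hne]; [unfold m; rewrite (proj2 (abscissa_axis _)); lra|].
      apply Rnot_le_lt; intros L. apply Hn. exists x. split; [lra|exact L]. }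
    exists (m / (K + 1)). split; [apply Rdiv_lt_0_compat; lra|]. intros y Hy Hyt (x' & Hx' & C).
    assert (Hc : PI / 2 <= x').
    { apply Rnot_lt_le; intros L. pose proof (cos_ge_0 x' ltac:(lra) ltac:(lra)).
      set (ay := par_at y) in *.
      pose proof (x_pos_front ay (s ay) (d ay) (d0 ay) (d1 ay) (Hd ay) x' Hx' ltac:(lra)) as Hp.
      fold (abscissa ay x') in Hp. lra. }
    specialize (Hmin x' ltac:(lra)). specialize (HL (par_at t) (par_at y) x').
    rewrite !par_at_val in HL by lra. replace (- t - - y) with (y - t) in HL by ring.
    pose proof (Rabs_pos (y - t)).
    assert (K * Rabs (y - t) < m).
    { apply Rle_lt_trans with ((K + 1) * Rabs (y - t)); [nra|].
      apply Rlt_le_trans with ((K + 1) * (m / (K + 1))); [apply Rmult_lt_compat_l; lra|right; field; lra]. }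
    apply Rabs_le_between in HL. lra.
  - exists T. split; [|split; auto]. split; [|lra]. destruct HT as [[HT|HT] _]; auto. subst T.
    destruct C as (x & Hx & Hle). rewrite abscissa_flat in Hle; [lra|]. rewrite par_at_val; lra.
Qed.

(** A negative abscissa at t would persist at a slightly smaller parameter, or occur at 0 itself,
    and so give a contact before the first one. *)
Lemma contact_nonneg (T : R) : 0 < T <= 11 / 24 -> (forall t, 0 <= t < T -> ~ contact_at t) ->
  forall t x, 0 <= t <= T -> 0 <= x <= PI -> 0 <= abscissa (par_at t) x.
Proof.
  intros HT HN t x Ht Hx. destruct (abscissa_axis (par_at t)) as [A0 A1].
  destruct (Req_dec x 0) as [->|X0]; [lra|]. destruct (Req_dec x PI) as [->|X1]; [lra|].
  destruct abscissa_par_lipschitz as (K & HK & HL).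
  apply Rnot_lt_le; intros Hneg. set (v := - abscissa (par_at t) x). assert (Hv : 0 < v) by (unfold v; lra).
  set (t' := Rmax 0 (t - v / (K + 1))).
  assert (Hvk : 0 < v / (K + 1)) by (apply Rdiv_lt_0_compat; lra).
  assert (Hc : contact_at t'); [|apply (HN t'); auto].
  - exists x. split; [lra|]. specialize (HL (par_at t') (par_at t) x).
    assert (B1 : 0 <= t') by apply Rmax_l. assert (B2 : t - v / (K + 1) <= t') by apply Rmax_r.
    assert (B3 : t' <= t) by (apply Rmax_lub; lra).
    rewrite !par_at_val in HL by lra. rewrite (Rabs_pos_eq (- t' - - t)) in HL by lra.
    apply Rabs_le_between in HL.
    assert (K * (- t' - - t) <= v).
    { apply Rle_trans with ((K + 1) * (v / (K + 1))); [|right; field; lra]. apply Rmult_le_compat; lra. }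
    unfold v in *. lra.
  - split; [apply Rmax_l|].
    destruct (Req_dec t 0) as [->|T0].
    + unfold t'. rewrite Rmax_left; lra.
    + unfold t'. apply Rmax_lub_lt; lra.
Qed.

Lemma curve_symmetric (a : par) : pa a < 0 ->
  (forall x, 0 <= x <= PI -> 0 <= abscissa a x) -> symmetric_wave (wave_at a).
Proof.
  intros Ha HX c Hc. apply extremal_axis in Hc; auto. destruct Hc as (k & Hk).
  apply (solution_axis a (s a) (d a) G (b a) (hh a)) with k; auto.
  intros z1 z2. apply zm_lower_inj; auto.
Qed.

Lemma curve_solution (a : par) : pa a < 0 -> (forall x, 0 <= x <= PI -> 0 <= abscissa a x) ->
  (forall x, 0 < x < PI -> 0 < abscissa a x) \/ touching (wave_at a) -> is_solution G (wave_at a).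
Proof.
  intros Ha HX Hc. destruct (Hhh a) as (M & HM).
  apply (solution_is_solution a (s a) (d a) G (b a) M (hh a)); auto.
  - intros z1 z2. apply zm_lower_inj; auto.
  - destruct Hc as [Hc|Hc]; [left|right; exact Hc].
    intros x1 x2. apply trace_injective; auto.
  - now apply curve_symmetric.
Qed.

(** * The laminar flow *)

Section Flat.
Variable a : par.
Hypothesis Ha : pa a = 0.
Let c := mu a + s a - 1.

(** At a = 0 the constant C vanishes and z' = 1, so the strict inequality Im z' > 0 behind
    injectivity and symmetry degenerates. The map is a vertical translation, for which all
    properties are checked directly. *)
Lemma flat_zm (z : C) : clh z -> zm a z = (fst z, snd z + c).
Proof.
  intros Hz. rewrite zmp_eq, EV_eq, ev_f by (auto using vv_le1).
  assert (E : Cc a = 0) by (unfold Cc; rewrite Ha; field). rewrite E. unfold c.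
  apply injective_projections; simpl; ring.
Qed.

Lemma flat_inj (z1 z2 : C) : lower_half z1 -> clh z2 -> zm a z1 = zm a z2 -> z1 = z2.
Proof.
  intros H1 H2. rewrite !flat_zm by (auto using lower_clh). intros E. injection E as E1 E2.
  apply injective_projections; lra.
Qed.

Lemma flat_surface (p : C) : surface (wave_at a) p <-> snd p = c.
Proof.
  split.
  - intros (x & ->). change (snd (zm a (x, 0)) = c). rewrite flat_zm by apply clh_boundary. simpl. ring.
  - intros E. exists (fst p). change (p = zm a (fst p, 0)). rewrite flat_zm by apply clh_boundary.
    apply injective_projections; simpl; lra.
Qed.

Lemma flat_fluid (p : C) : fluid (wave_at a) p <-> snd p < c.
Proof.
  split.
  - intros (z & Hz & <-). rewrite flat_zm by (now apply lower_clh). unfold lower_half in Hz. simpl. lra.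
  - intros L. assert (Hz : lower_half (fst p, snd p - c)) by (unfold lower_half; simpl; lra).
    exists (fst p, snd p - c). split; auto. change (zm a (fst p, snd p - c) = p).
    rewrite flat_zm by (now apply lower_clh). apply injective_projections; simpl; ring.
Qed.

(** The power series E reduces to its constant term, so only the shear profile remains. *)
Lemma flat_psi (p : C) : fluid_or_surface (wave_at a) p ->
  psi (wave_at a) p = - ((snd p + 1) * (snd p + 1)) / 2 + hh a 0%nat.
Proof.
  intros Hp. assert (Hle : snd p - c <= 0).
  { destruct Hp as [Hp|Hp]; [apply flat_fluid in Hp|apply flat_surface in Hp]; lra. }
  assert (Ep : p = zm a (fst p, snd p - c)).
  { rewrite flat_zm by exact Hle. apply injective_projections; simpl; ring. }
  rewrite Ep at 1. change (stream (zm a) (EE a (hh a)) (zm a (fst p, snd p - c))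
    = - ((snd p + 1) * (snd p + 1)) / 2 + hh a 0%nat).
  rewrite (solution_stream a (s a) (d a) G (b a) (hh a)); auto using flat_inj.
  unfold Psi. rewrite <- Ep. f_equal. unfold EE.
  rewrite EV_eq, (ev_ext _ (fun n => hh a 0%nat * basis 0 n)).
  - rewrite ev_scal by (auto using rd_basis, vv_le1). rewrite ev_basis. simpl. ring.
  - intros [|n]; unfold basis; simpl; [ring|]. rewrite (Hh0 a Ha) by lia. ring.
Qed.

Lemma flat_solution : is_solution G (wave_at a).
Proof.
  destruct (Hhh a) as (M & HM).
  apply (solution_is_solution a (s a) (d a) G (b a) M (hh a)); auto using flat_inj.
  - left. intros x1 x2 E. change (zm a (x1, 0) = zm a (x2, 0)) in E.
    rewrite !flat_zm in E by apply clh_boundary. now injection E.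
  - intros q _. fold (wave_at a). assert (Hr : forall p, fluid (wave_at a) (reflect q p) <-> fluid (wave_at a) p).
    { intros p. rewrite !flat_fluid. reflexivity. }
    split; auto. intros p Hp. rewrite !flat_psi; auto.
    destruct Hp as [Hp|Hp]; [left; now apply Hr|right]. apply flat_surface in Hp. now apply flat_surface.
Qed.

Lemma flat_laminar : laminar (wave_at a).
Proof.
  split.
  - exists c. intros p. apply flat_surface.
  - exists (fun y => - ((y + 1) * (y + 1)) / 2 + hh a 0%nat). intros p Hp. now rewrite flat_psi.
Qed.
End Flat.

Lemma wave_height (a : par) (x : R) : height (wave_at a) x = surf 0 a (fseq a (s a) (d a)) x - 1.
Proof.
  change (snd (zm a (x, 0)) = surf 0 a (fseq a (s a) (d a)) x - 1).
  unfold surf. rewrite zmp_eq. simpl. ring.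
Qed.

Lemma curve_exists (th : R) : 0 < th < 1 -> exists w : R -> wave,
  continuous_curve_of_solutions th G w /\ laminar (w 0) /\ touching (w 1).
Proof.
  intros Hth. destruct first_contact as (T & HT & (x & Hx & Hc) & HN).
  pose proof (contact_nonneg T HT HN) as HX.
  assert (Hval : forall t, unit_interval t -> pa (par_at (t * T)) = - (t * T) /\ 0 <= t * T <= T).
  { intros t [H1 H2]. assert (0 <= t * T <= T) by nra. split; auto. apply par_at_val. lra. }
  (* At T the nonpositive abscissa provided by the contact is also nonnegative, hence 0, which makes
     [x] a genuine contact parameter. *)
  assert (Htouch : touching (wave_at (par_at (1 * T)))).
  { destruct (Hval 1) as [V1 V2]; [split; lra|]. rewrite Rmult_1_l in *.
    set (aT := par_at T) in *.
    apply (solution_touching aT (s aT) (d aT) (d0 aT) (d1 aT) (Hd aT)) with x; auto.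
    - lra.
    - intros y Hy. apply (HX T y); lra.
    - pose proof (HX T x ltac:(lra) ltac:(lra)) as Hp. fold aT in Hp.
      change (abscissa aT x = 0). lra. }
  exists (fun t => wave_at (par_at (t * T))). split; [|split; [|exact Htouch]].
  2:{ apply flat_laminar. destruct (Hval 0) as [V1 _]; [split; lra|]. rewrite V1. ring. }
  assert (HT11 : 0 <= T) by lra.
  assert (Lip : forall t t0, unit_interval t -> unit_interval t0 ->
    Rabs (par_at (t * T) - par_at (t0 * T)) = T * Rabs (t - t0)).
  { intros t t0 H H0. destruct (Hval t H) as [-> _], (Hval t0 H0) as [-> _].
    replace (- (t * T) - - (t0 * T)) with (- (T * (t - t0))) by ring.
    rewrite Rabs_Ropp, Rabs_mult, (Rabs_pos_eq T); auto. }
  split; [|split; [|split; [|split]]].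
  - intros t Ht. destruct (Hval t Ht) as [V1 V2]. destruct (Req_dec (t * T) 0) as [E|E].
    (* Along the curve three regimes occur: the flat start, waves with positive abscissa before the
       first contact, and the touching wave at the end. *)
    { apply flat_solution. lra. }
    apply curve_solution; [lra|intros y Hy; apply HX; lra|].
    destruct (Req_dec (t * T) T) as [E1|E1].
    + right. assert (t = 1) by nra. subst t. exact Htouch.
    + left. intros y Hy. apply Rnot_le_lt; intros L. apply (HN (t * T)); [lra|].
      exists y. auto.
  - intros t0 Ht0. apply (within_lipschitz _ 0); [lra|]. intros t Ht. simpl.
    rewrite Rminus_diag_eq by reflexivity. rewrite Rabs_R0. lra.
  - intros t0 Ht0. destruct Hb as (K & HK & HL). assert (HKT : 0 <= K * T) by (apply Rmult_le_pos; auto).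
    apply (within_lipschitz _ (K * T)); auto. intros t Ht. simpl.
    destruct (HL (par_at (t * T)) (par_at (t0 * T))) as [_ B]. rewrite Lip in B by auto.
    replace (b (par_at (t * T)) / 2 - G - (b (par_at (t0 * T)) / 2 - G)) with
      (/ 2 * (b (par_at (t * T)) - b (par_at (t0 * T)))) by field.
    rewrite Rabs_mult, (Rabs_pos_eq (/ 2)) by lra. pose proof (Rabs_pos (b (par_at (t * T)) - b (par_at (t0 * T)))).
    lra.
  - intros t Ht. set (a := par_at (t * T)).
    replace (height (wave_at a)) with (fun x => surf 0 a (fseq a (s a) (d a)) x - 1).
    + apply (surf_holder_space (fun a => fseq a (s a) (d a)) fseq_par_lipschitz); auto.
    + apply functional_extensionality. intros y. symmetry. apply wave_height.
  - intros t0 Ht0.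
    destruct (surf_holder_lipschitz (fun a => fseq a (s a) (d a)) fseq_par_lipschitz th Hth) as (K & HK & HL).
    apply (within_lipschitz _ (K * T)); [apply Rmult_le_pos; auto|]. intros t Ht.
    specialize (HL (par_at (t * T)) (par_at (t0 * T))
      (fun x => height (wave_at (par_at (t * T))) x - height (wave_at (par_at (t0 * T))) x)).
    rewrite Lip in HL by auto. rewrite Rminus_0_r.
    assert (B := HL ltac:(intros y; rewrite !wave_height; ring)).
    rewrite Rabs_pos_eq; lra.
Qed.
End Curve.

Theorem theorem7 :
  forall theta : R, 0 < theta < 1 ->
  exists epsilon : R, 0 < epsilon /\
    forall G : R, - epsilon < G < epsilon ->
    exists w : R -> wave,
      continuous_curve_of_solutions theta G w /\
      laminar (w 0) /\
      touching (w 1).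
Proof.
  intros th Hth. destruct (analytic_core eta0) as (eps & Heps & H); [unfold eta0; lra|].
  exists eps. split; auto. intros G HG.
  destruct (H G) as (s & b & d & Hs & Hb & HdL & Ha); [apply Rabs_def1; lra|].
  assert (Hh : forall a : par, exists h : nat -> R,
    (exists M, dec M (5 / 6) h) /\ (pa a = 0 -> forall n, (1 <= n)%nat -> h n = 0) /\
    boundary_relations a (s a) (d a) h G (b a)).
  { intros a. destruct (Ha a) as (_ & _ & _ & _ & h & M & H1 & H2 & H3).
    exists h. split; [exists M; exact H1|]. split; [exact H2|exact H3]. }
  destruct (functional_choice _ _ _ Hh) as (hh & Hhh).
  apply (curve_exists G s b d hh); auto; intros a;
    first [apply (Hhh a) | destruct (Ha a) as (_ & H0 & H1 & H2 & _); assumption].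
Qed.
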